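(* In the setting of the context (Neimark--Sacker bifurcation of a $2\pi$-periodically forced system, with $\omega^\star\notin\{\frac13,\frac14\}$, and with normal form coefficients and the $M=3$ Fourier $\phi$-mode approximation as defined there), the Lyapunov coefficients satisfy, as $\varepsilon\to0$, $$\beta_R(\lambda^\star)=-\dot\alpha_R(\lambda^\star)\frac{\lambda^F(\varepsilon)-\lambda^\star}{\varepsilon^2}+O(\varepsilon^2),$$ $$\beta_I(\lambda^\star)=\frac{\omega^F(\varepsilon)-\omega^\star}{\varepsilon^2}-\dot\alpha_I(\lambda^\star)\frac{\lambda^F(\varepsilon)-\lambda^\star}{\varepsilon^2}+O(\varepsilon^2),$$ and the coefficients of the normal form transformation polynomials $\widehat{\boldsymbol h}(\cdot;\theta,\lambda^\star)$, $\widetilde{\boldsymbol h}(\cdot;\theta,\lambda^\star)$ satisfy $$\widehat{\boldsymbol a}_m(\theta,\lambda^\star)=\tfrac1\varepsilon\widehat{\boldsymbol a}_m^F(\theta,\varepsilon)+O(\varepsilon^2),\qquad\widetilde{\boldsymbol a}_m(\theta,\lambda^\star)=\tfrac1\varepsilon\widetilde{\boldsymbol a}_m^F(\theta,\varepsilon)+O(\varepsilon^2)\qquad(m=0,2),$$ $$\widehat{\boldsymbol b}_m(\theta,\lambda^\star)=\tfrac1\varepsilon\widehat{\boldsymbol b}_m^F(\theta,\varepsilon)+O(\varepsilon^2),\qquad\widetilde{\boldsymbol b}_m(\theta,\lambda^\star)=\tfrac1\varepsilon\widetilde{\boldsymbol b}_m^F(\theta,\varepsilon)+O(\varepsilon^2)\qquad(m=2),$$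 $$\widehat{\boldsymbol a}_m(\theta,\lambda^\star)=\tfrac1{\varepsilon^2}\widehat{\boldsymbol a}_m^F(\theta,\varepsilon)+O(\varepsilon^2),\qquad\widehat{\boldsymbol b}_m(\theta,\lambda^\star)=\tfrac1{\varepsilon^2}\widehat{\boldsymbol b}_m^F(\theta,\varepsilon)+O(\varepsilon^2)\qquad(m=1,3).$$
   Context: Setting (periodically forced Neimark--Sacker bifurcation). $\mathbb S^1=\mathbb R/2\pi\mathbb Z$; $\boldsymbol F:\mathbb R^n\times\mathbb S^1\times\mathbb R\to\mathbb R^n$ is smooth; the system is $\frac{d\boldsymbol v}{d\theta}(\theta)=\boldsymbol F(\boldsymbol v,\theta,\lambda)$; $\mathsf J(\boldsymbol v,\theta,\lambda)$ is the Jacobian matrix of $\boldsymbol F$ with respect to $\boldsymbol v$. Assume: (1) $\boldsymbol v^\star:\mathbb S^1\to\mathbb R^n$ satisfies $\boldsymbol F(\boldsymbol v^\star(\theta),\theta,\lambda^\star)-\frac{d}{d\theta}\boldsymbol v^\star(\theta)=\boldsymbol 0$ for all $\theta$. (2) There are $\mathsf E^\star\in\mathbb R^{n\times n}$ and $\mathsf P^\star:\mathbb S^1\to\mathbb R^{n\times n}$ with $\mathsf P^\star(\theta)$ non-singular for all $\theta$ (so all Floquet vectors are taken $2\pi$-periodic) such that $\mathsf J(\boldsymbol v^\star(\theta),\theta,\lambda^\star)\mathsf P^\star(\theta)-\dot{\mathsf P}^\star(\theta)=\mathsf P^\star(\theta)\mathsf E^\star$, $\mathsf E^\star=\mathrm{diag}(\widehat{\mathsf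 E}^\star,\widetilde{\mathsf E}^\star)$, $\widehat{\mathsf E}^\star=\begin{pmatrix}0&-\omega^\star\\ \omega^\star&0\end{pmatrix}$, $\omega^\star>0$, and $\widetilde{\mathsf E}^\star\in\mathbb R^{(n-2)\times(n-2)}$ with no eigenvalues on the imaginary axis. The imaginary parts of the eigenvalues of $\mathsf E^\star$ (Floquet exponents) are taken in $(-\frac12,\frac12)$, so that $0<\omega^\star<\frac12$. Consequently, for $\lambda$ near $\lambda^\star$ there are smooth continuations $\boldsymbol v^\star(\theta;\lambda)$, $\mathsf P(\theta;\lambda)$ (non-singular, $2\pi$-periodic in $\theta$), $\mathsf E(\lambda)$ of $\boldsymbol v^\star,\mathsf P^\star,\mathsf E^\star$ with $\boldsymbol F(\boldsymbol v^\star(\theta;\lambda),\theta,\lambda)=\frac{d}{d\theta}\boldsymbol v^\star(\theta;\lambda)$, $\mathsf J(\boldsymbol v^\star(\theta;\lambda),\theta,\lambda)\mathsf P(\theta;\lambda)-\dot{\mathsf P}(\theta;\lambda)=\mathsf P(\theta;\lambda)\mathsf E(\lambda)$ (here $\dot{\mathsf P}=\partial\mathsf P/\partial\theta$), $\mathsf E(\lambda)=\mathrm{diag}(\widehat{\mathsf E}(\lambda),\widetilde{\mathsf E}(\lambda))$, $\widehat{\mathsf E}(\lambda)=\begin{pmatrix}\alpha_R(\lambda)&-\alpha_I(\lambda)\\ \alpha_I(\lambda)&\alpha_R(\lambda)\end{pmatrix}$. (3) Transversality: $\dot\alpha_R(\lambda^\star)\neq0$ (dot on $\alpha_R,\alpha_I$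 denotes $d/d\lambda$). (4) No strong resonance: $\omega^\star\notin\{\frac13,\frac14\}$. Notation. $\boldsymbol a^\star(\phi)=(\cos\phi,\sin\phi,0,\dots,0)^T$, $\dot{\boldsymbol a}^\star(\phi)=(-\sin\phi,\cos\phi,0,\dots,0)^T\in\mathbb R^n$; $\widehat{\boldsymbol e}_1=(1,0)^T$, $\widehat{\boldsymbol e}_2=(0,1)^T$. $\langle w_1,w_2\rangle=\frac1{2\pi}\int_0^{2\pi}w_1(\theta)\cdot w_2(\theta)\,d\theta$; $\langle\langle w_1,w_2\rangle\rangle=\frac1{(2\pi)^2}\int_0^{2\pi}\int_0^{2\pi}w_1\cdot w_2\,d\theta\,d\phi$. For $\boldsymbol z:\mathbb S^1\times\mathbb S^1\to\mathbb R^n$, $\boldsymbol\gamma(\boldsymbol z)=(\langle\langle\boldsymbol z,\boldsymbol a^\star(\phi)\rangle\rangle,\langle\langle\boldsymbol z,\dot{\boldsymbol a}^\star(\phi)\rangle\rangle)^T$, and $$\boldsymbol G(\boldsymbol z,\lambda,\theta;\varepsilon)=\tfrac1\varepsilon\mathsf P(\theta;\lambda)^{-1}\Big\{\boldsymbol F\big(\boldsymbol v^\star(\theta;\lambda)+\varepsilon\mathsf P(\theta;\lambda)\boldsymbol z,\theta,\lambda\big)-\boldsymbol F\big(\boldsymbol v^\star(\theta;\lambda),\theta,\lambda\big)-\varepsilon\dot{\mathsf P}(\theta;\lambda)\boldsymbol z\Big\}$$ (with $\boldsymbol G=\mathsf E(\lambda)\boldsymbol z$ at $\varepsilon=0$).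 Write $\boldsymbol z=(\widehat{\boldsymbol z},\widetilde{\boldsymbol z})\in\mathbb R^2\times\mathbb R^{n-2}$, $\boldsymbol G=(\widehat{\boldsymbol G},\widetilde{\boldsymbol G})$. $M=3$ Fourier $\phi$-mode approximation. $\mathsf S_{\infty,3}$ truncates double Fourier series to $\phi$-modes $0,\dots,3$ (all $\theta$-modes kept). For $|\varepsilon|$ small, $\lambda^F(\varepsilon),\omega^F(\varepsilon)$ and $\boldsymbol z^F(\theta,\phi;\varepsilon)=\boldsymbol a^\star(\phi)+\boldsymbol a_0^F(\theta,\varepsilon)+\sum_{m=1}^3\{\boldsymbol a_m^F(\theta,\varepsilon)\cos m\phi+\boldsymbol b_m^F(\theta,\varepsilon)\sin m\phi\}$ is the locally unique solution near $(\lambda^\star,\omega^\star,\boldsymbol a^\star)$, with $\boldsymbol z_3$ having only $\phi$-modes $0,\dots,3$, of $\mathsf S_{\infty,3}\boldsymbol G(\boldsymbol z_3,\lambda,\theta;\varepsilon)-\partial_\theta\boldsymbol z_3-\omega\partial_\phi\boldsymbol z_3=\boldsymbol 0$, $\boldsymbol\gamma(\boldsymbol z_3)=\widehat{\boldsymbol e}_1$. Write $\boldsymbol a_m^F=(\widehat{\boldsymbol a}_m^F,\widetilde{\boldsymbol a}_m^F)$, $\boldsymbol b_m^F=(\widehat{\boldsymbol b}_m^F,\widetilde{\boldsymbol b}_m^F)$ for the splitting in $\mathbb R^2\times\mathbb R^{n-2}$. Normal form. For $\lambda$ near $\lambda^\star$, consider near-identity transformations $(\widehat{\boldsymbol y},\widetilde{\boldsymbol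 y})\mapsto(\widehat{\boldsymbol z},\widetilde{\boldsymbol z})$, with $\widehat{\boldsymbol y}=(\hat y_1,\hat y_2)$ and coefficients depending smoothly on $(\theta,\lambda)$ ($2\pi$-periodic in $\theta$), $$\widehat{\boldsymbol z}=\widehat{\boldsymbol y}+\tfrac1\varepsilon\widehat{\boldsymbol h}(\varepsilon\widehat{\boldsymbol y};\theta,\lambda)=\widehat{\boldsymbol y}+\varepsilon\{[\hat y_1^2+\hat y_2^2]\widehat{\boldsymbol a}_0+[\hat y_1^2-\hat y_2^2]\widehat{\boldsymbol a}_2+2\hat y_1\hat y_2\widehat{\boldsymbol b}_2\}$$ $$+\varepsilon^2\{\hat y_1[\hat y_1^2+\hat y_2^2]\widehat{\boldsymbol a}_1+\hat y_2[\hat y_1^2+\hat y_2^2]\widehat{\boldsymbol b}_1+\hat y_1[\hat y_1^2-3\hat y_2^2]\widehat{\boldsymbol a}_3+\hat y_2[3\hat y_1^2-\hat y_2^2]\widehat{\boldsymbol b}_3\},$$ $$\widetilde{\boldsymbol z}=\widetilde{\boldsymbol y}+\tfrac1\varepsilon\widetilde{\boldsymbol h}(\varepsilon\widehat{\boldsymbol y};\theta,\lambda)=\widetilde{\boldsymbol y}+\varepsilon\{[\hat y_1^2+\hat y_2^2]\widetilde{\boldsymbol a}_0+[\hat y_1^2-\hat y_2^2]\widetilde{\boldsymbol a}_2+2\hat y_1\hat y_2\widetilde{\boldsymbol b}_2\},$$ subject to $\langle\widehat{\boldsymbol a}_1(\theta,\lambda),\widehat{\boldsymbol e}_1\rangle+\langle\widehat{\boldsymbol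 b}_1(\theta,\lambda),\widehat{\boldsymbol e}_2\rangle=0=\langle\widehat{\boldsymbol a}_1(\theta,\lambda),\widehat{\boldsymbol e}_2\rangle-\langle\widehat{\boldsymbol b}_1(\theta,\lambda),\widehat{\boldsymbol e}_1\rangle$. Under them the equation $\boldsymbol G-[\partial_\theta+\omega\partial_\phi]\boldsymbol z=\boldsymbol 0$ becomes $\widehat{\boldsymbol G}^\dagger-[\partial_\theta+\omega\partial_\phi]\widehat{\boldsymbol y}=\boldsymbol 0$, $\widetilde{\boldsymbol G}^\dagger-[\partial_\theta+\omega\partial_\phi]\widetilde{\boldsymbol y}=\boldsymbol 0$, where, with $D$ the derivative in the $\mathbb R^2$ argument and $\partial_\theta\widehat{\boldsymbol h},\partial_\theta\widetilde{\boldsymbol h}$ the derivatives in the explicit $\theta$ argument, $$\widehat{\boldsymbol G}^\dagger=(\mathsf I+D\widehat{\boldsymbol h}(\varepsilon\widehat{\boldsymbol y};\theta,\lambda))^{-1}[\widehat{\boldsymbol G}-\tfrac1\varepsilon\partial_\theta\widehat{\boldsymbol h}(\varepsilon\widehat{\boldsymbol y};\theta,\lambda)],\qquad\widetilde{\boldsymbol G}^\dagger=\widetilde{\boldsymbol G}-\tfrac1\varepsilon\partial_\theta\widetilde{\boldsymbol h}(\varepsilon\widehat{\boldsymbol y};\theta,\lambda)-D\widetilde{\boldsymbol h}(\varepsilon\widehat{\boldsymbol y};\theta,\lambda)\widehat{\boldsymbol G}^\dagger,$$ with expansions $\widehat{\boldsymbol G}^\dagger=\widehat{\mathsf E}(\lambda)\widehat{\boldsymbol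 y}+\sum_{p\ge2}\varepsilon^{p-1}\widehat{\boldsymbol G}^\dagger_p(\widehat{\boldsymbol y},\widetilde{\boldsymbol y};\lambda,\theta)$, $\widetilde{\boldsymbol G}^\dagger=\widetilde{\mathsf E}(\lambda)\widetilde{\boldsymbol y}+\sum_{p\ge2}\varepsilon^{p-1}\widetilde{\boldsymbol G}^\dagger_p(\widehat{\boldsymbol y},\widetilde{\boldsymbol y};\lambda,\theta)$, the $p$-th terms being homogeneous polynomials of degree $p$ in $(\widehat{\boldsymbol y},\widetilde{\boldsymbol y})$. $\widehat{\boldsymbol h},\widetilde{\boldsymbol h}$ are chosen so that: the quadratic terms in $\widehat{\boldsymbol y}$ of $\widetilde{\boldsymbol G}_2^\dagger$ vanish; the quadratic terms in $\widehat{\boldsymbol y}$ of $\widehat{\boldsymbol G}_2^\dagger$ vanish; and the cubic terms in $\widehat{\boldsymbol y}$ of $\widehat{\boldsymbol G}_3^\dagger$ have the form $[\hat y_1^2+\hat y_2^2]\begin{pmatrix}\beta_R(\lambda)&-\beta_I(\lambda)\\ \beta_I(\lambda)&\beta_R(\lambda)\end{pmatrix}\widehat{\boldsymbol y}$ (with $\beta_R,\beta_I$ independent of $\theta$). The numbers $\beta_R(\lambda),\beta_I(\lambda)$ are the Lyapunov coefficients. *)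

(* Defs.v *)
From mathcomp Require Import all_boot all_order all_algebra complex.
From mathcomp Require Import all_classical all_reals all_analysis.
Set Implicit Arguments.
Unset Strict Implicit.
Unset Printing Implicit Defensive.
Import Order.TTheory GRing.Theory Num.Theory.
Import numFieldNormedType.Exports.
Local Open Scope classical_set_scope.
Local Open Scope ring_scope.

(* Functions on S^1 = R/2piZ are 2pi-periodic functions on R.  The dimension n
   is written 2 + m, so that column vectors and square matrices split into
   blocks of sizes 2 and m = n - 2; a dot over a symbol is derive1.  The angle
   arguments theta, phi are named t, p; lambda is l and epsilon is e. *)

(* C^k on an open set of a finite-dimensional space: f is differentiable there
   and all its directional derivatives are C^(k-1). *)
Fixpoint Ck_on (R : realType) (V W : normedModType R) (k : nat) (A : set V)
    (f : V -> W) : Prop :=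
  match k with
  | 0 => forall x, A x -> {for x, continuous f}
  | k'.+1 => (forall x, A x -> differentiable f x) /\
             (forall u : V, Ck_on k' A (fun x => 'D_u f x))
  end.

Definition smooth_on (R : realType) (V W : normedModType R) (A : set V)
    (f : V -> W) : Prop := forall k, Ck_on k A f.

Definition smooth_periodic (R : realType) (W : normedModType R) (U : set R)
    (f : R -> R -> W) : Prop :=
  smooth_on (setT `*` U) (fun x : R * R => f x.1 x.2) /\
  (forall t l, U l -> f (t + 2 * pi) l = f t l).

Definition jac (R : realType) (p q : nat) (f : 'cV[R]_q -> 'cV[R]_p)
    (x : 'cV[R]_q) : 'M[R]_(p, q) :=
  \matrix_(i, j) ('D_(delta_mx j 0) f x) i 0.

Definition dot (R : realType) (q : nat) (u w : 'cV[R]_q) : R :=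
  \sum_i u i 0 * w i 0.

Definition period_int (R : realType) (f : R -> R) : R :=
  (\int[lebesgue_measure]_(x in `[0%R, (2 * pi)%R]) f x)%R.

(* <w1, w2> *)
Definition ip1 (R : realType) (q : nat) (w1 w2 : R -> 'cV[R]_q) : R :=
  (2 * pi)^-1 * period_int (fun t => dot (w1 t) (w2 t)).

(* <<w1, w2>> *)
Definition ip2 (R : realType) (q : nat) (w1 w2 : R -> R -> 'cV[R]_q) : R :=
  (2 * pi) ^- 2 *
  period_int (fun p => period_int (fun t => dot (w1 t p) (w2 t p))).

Definition rot_scale (R : realType) (x y : R) : 'M[R]_2 :=
  \matrix_(i, j) if i == j then x else if i == 0 then - y else y.

Definition e1 (R : realType) : 'cV[R]_2 := delta_mx 0 0.
Definition e2 (R : realType) : 'cV[R]_2 := delta_mx 1 0.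

Definition astar (R : realType) (m : nat) (p : R) : 'cV[R]_(2 + m) :=
  col_mx (cos p *: e1 R + sin p *: e2 R) 0.

Definition dastar (R : realType) (m : nat) (p : R) : 'cV[R]_(2 + m) :=
  col_mx (- sin p *: e1 R + cos p *: e2 R) 0.

Definition gamma (R : realType) (m : nat) (z : R -> R -> 'cV[R]_(2 + m)) :
    'cV[R]_2 :=
  ip2 z (fun _ p => astar m p) *: e1 R + ip2 z (fun _ p => dastar m p) *: e2 R.

Definition vector_field (R : realType) (m : nat) : Type :=
  'cV[R]_(2 + m) -> R -> R -> 'cV[R]_(2 + m).

Definition smooth_field (R : realType) (m : nat) (F : vector_field R m) : Prop :=
  smooth_on setT (fun x : 'cV[R]_(2 + m) * R * R => F x.1.1 x.1.2 x.2) /\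
  (forall v t l, F v (t + 2 * pi) l = F v t l).

Definition J (R : realType) (m : nat) (F : vector_field R m)
    (v : 'cV[R]_(2 + m)) (t l : R) : 'M[R]_(2 + m) :=
  jac (fun u => F u t l) v.

Definition is_periodic_solution (R : realType) (m : nat)
    (F : vector_field R m) (l : R) (v : R -> 'cV[R]_(2 + m)) : Prop :=
  (forall t, v (t + 2 * pi) = v t) /\
  (forall t, derivable v t 1 /\ F (v t) t l - derive1 v t = 0).

Definition is_floquet (R : realType) (m : nat) (F : vector_field R m) (l : R)
    (v : R -> 'cV[R]_(2 + m)) (P : R -> 'M[R]_(2 + m)) (E : 'M[R]_(2 + m)) :
    Prop :=
  (forall t, P (t + 2 * pi) = P t) /\
  (forall t, P t \in unitmx) /\
  (forall t, derivable P t 1 /\ J F (v t) t l *m P t - derive1 P t = P t *m E).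

Definition complex_eigenvalue (R : realType) (q : nat) (A : 'M[R]_q)
    (mu : R[i]) : Prop :=
  eigenvalue (map_mx (@real_complex R) A) mu.

Definition Estar (R : realType) (m : nat) (os : R) (Ets : 'M[R]_m) :
    'M[R]_(2 + m) :=
  block_mx (rot_scale 0 os) 0 0 Ets.

Record NS_point (R : realType) (m : nat) (F : vector_field R m) (ls os : R)
    (vs : R -> 'cV[R]_(2 + m)) (Ps : R -> 'M[R]_(2 + m)) (Ets : 'M[R]_m) :
    Prop := {
  NS_solution : is_periodic_solution F ls vs ;
  NS_floquet : is_floquet F ls vs Ps (Estar os Ets) ;
  NS_omega_gt0 : 0 < os ;
  NS_hyperbolic : forall mu, complex_eigenvalue Ets mu -> complex.Re mu != 0 ;
  NS_exponents : forall mu, complex_eigenvalue (Estar os Ets) mu ->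
    - 2^-1 < complex.Im mu < 2^-1 ;
  NS_no_resonance : os != 3^-1 /\ os != 4^-1 }.

(* The continuations v*(theta; lambda), P(theta; lambda), E(lambda) *)
Record continuation (R : realType) (m : nat) := Continuation {
  cv : R -> R -> 'cV[R]_(2 + m) ;
  cP : R -> R -> 'M[R]_(2 + m) ;
  alphaR : R -> R ;
  alphaI : R -> R ;
  cEt : R -> 'M[R]_m }.

Definition cE (R : realType) (m : nat) (C : continuation R m) (l : R) :
    'M[R]_(2 + m) :=
  block_mx (rot_scale (alphaR C l) (alphaI C l)) 0 0 (cEt C l).

Record is_continuation (R : realType) (m : nat) (F : vector_field R m)
    (ls os : R) (vs : R -> 'cV[R]_(2 + m)) (Ps : R -> 'M[R]_(2 + m))
    (Ets : 'M[R]_m) (U : set R) (C : continuation R m) : Prop := {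
  cont_smooth_v : smooth_periodic U (cv C) ;
  cont_smooth_P : smooth_periodic U (cP C) ;
  cont_smooth_aR : smooth_on U (alphaR C) ;
  cont_smooth_aI : smooth_on U (alphaI C) ;
  cont_smooth_Et : smooth_on U (cEt C) ;
  cont_v0 : forall t, cv C t ls = vs t ;
  cont_P0 : forall t, cP C t ls = Ps t ;
  cont_E0 : cE C ls = Estar os Ets ;
  cont_solution : forall l, U l -> is_periodic_solution F l (cv C ^~ l) ;
  cont_floquet : forall l, U l ->
    is_floquet F l (cv C ^~ l) (cP C ^~ l) (cE C l) }.

Definition G (R : realType) (m : nat) (F : vector_field R m)
    (C : continuation R m) (z : 'cV[R]_(2 + m)) (l t e : R) : 'cV[R]_(2 + m) :=
  if e == 0 then cE C l *m z
  else e^-1 *: (invmx (cP C t l) *m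
         (F (cv C t l + e *: (cP C t l *m z)) t l - F (cv C t l) t l
          - e *: (derive1 (cP C ^~ l) t *m z))).

Definition cos_coef (R : realType) (q k : nat) (f : R -> 'cV[R]_q) : 'cV[R]_q :=
  \col_i ((if k == 0%N then 2 * pi else pi)^-1 *
          period_int (fun x => f x i 0 * cos (k%:R * x))).

Definition sin_coef (R : realType) (q k : nat) (f : R -> 'cV[R]_q) : 'cV[R]_q :=
  \col_i (pi^-1 * period_int (fun x => f x i 0 * sin (k%:R * x))).

(* a_0(theta) + sum_(1 <= k <= M) a_k(theta) cos(k phi) + b_k(theta) sin(k phi) *)
Definition phi_series (R : realType) (q M : nat) (a b : nat -> R -> 'cV[R]_q)
    (t p : R) : 'cV[R]_q :=
  a 0 t + \sum_(1 <= k < M.+1) (cos (k%:R * p) *: a k t + sin (k%:R * p) *: b k t).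

(* S_{oo,M}: all theta-modes are kept, so only phi is projected. *)
Definition phi_trunc (R : realType) (q M : nat) (f : R -> R -> 'cV[R]_q) :
    R -> R -> 'cV[R]_q :=
  phi_series M (fun k t => cos_coef k (f t)) (fun k t => sin_coef k (f t)).

(* The unknowns of the approximation, as functions of epsilon: lambda^F(e),
   omega^F(e), and a_k^F(theta, e) = aF k theta e, likewise b_k^F. *)
Record fourier_family (R : realType) (m : nat) := FourierFamily {
  lambdaF : R -> R ;
  omegaF : R -> R ;
  aF : nat -> R -> R -> 'cV[R]_(2 + m) ;
  bF : nat -> R -> R -> 'cV[R]_(2 + m) }.

Definition zF (R : realType) (m : nat) (X : fourier_family R m) (t p e : R) :
    'cV[R]_(2 + m) :=
  astar m p + phi_series 3 (fun k t => aF X k t e) (fun k t => bF X k t e) t p.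

Record fourier_solution (R : realType) (m : nat) (F : vector_field R m)
    (C : continuation R m) (X : fourier_family R m) (e : R) : Prop := {
  four_a : forall k, (k <= 3)%N -> forall t,
    derivable (fun t => aF X k t e) t 1 /\ aF X k (t + 2 * pi) e = aF X k t e ;
  four_b : forall k, (1 <= k <= 3)%N -> forall t,
    derivable (fun t => bF X k t e) t 1 /\ bF X k (t + 2 * pi) e = bF X k t e ;
  four_eq : forall t p,
    phi_trunc 3 (fun t p => G F C (zF X t p e) (lambdaF X e) t e) t p
    - derive1 (fun t => zF X t p e) t
    - omegaF X e *: derive1 (fun p => zF X t p e) p = 0 ;
  four_gamma : gamma (fun t p => zF X t p e) = e1 R }.

(* The locally unique solution near (lambda*, omega*, a* ) is given as a family
   of solutions tending to that triple as epsilon -> 0, with the sup norm over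
   (theta, phi) for the last component. *)
Record is_fourier_approx (R : realType) (m : nat) (F : vector_field R m)
    (ls os : R) (C : continuation R m) (X : fourier_family R m) : Prop := {
  approx_solution : \forall e \near (0 : R), fourier_solution F C X e ;
  approx_lambda : lambdaF X e @[e --> (0 : R)] --> ls ;
  approx_omega : omegaF X e @[e --> (0 : R)] --> os ;
  approx_z : forall r : R, 0 < r ->
    \forall e \near (0 : R), forall t p, `|zF X t p e - astar m p| < r }.

(* Coefficients as functions of (theta, lambda).  Only the following indices
   are used: ah 0..3, bh 1..3, at_ 0 and 2, bt 2. *)
Record nf_coeffs (R : realType) (m : nat) := NfCoeffs {
  ah : nat -> R -> R -> 'cV[R]_2 ;
  bh : nat -> R -> R -> 'cV[R]_2 ;
  at_ : nat -> R -> R -> 'cV[R]_m ;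
  bt : nat -> R -> R -> 'cV[R]_m ;
  betaR : R -> R ;
  betaI : R -> R }.

Definition hhat (R : realType) (m : nat) (N : nf_coeffs R m) (y : 'cV[R]_2)
    (t l : R) : 'cV[R]_2 :=
  let y1 := y 0 0 in let y2 := y 1 0 in
  (y1 ^+ 2 + y2 ^+ 2) *: ah N 0 t l + (y1 ^+ 2 - y2 ^+ 2) *: ah N 2 t l
  + (2 * y1 * y2) *: bh N 2 t l
  + (y1 * (y1 ^+ 2 + y2 ^+ 2)) *: ah N 1 t l
  + (y2 * (y1 ^+ 2 + y2 ^+ 2)) *: bh N 1 t l
  + (y1 * (y1 ^+ 2 - 3 * y2 ^+ 2)) *: ah N 3 t l
  + (y2 * (3 * y1 ^+ 2 - y2 ^+ 2)) *: bh N 3 t l.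

Definition htilde (R : realType) (m : nat) (N : nf_coeffs R m) (y : 'cV[R]_2)
    (t l : R) : 'cV[R]_m :=
  let y1 := y 0 0 in let y2 := y 1 0 in
  (y1 ^+ 2 + y2 ^+ 2) *: at_ N 0 t l + (y1 ^+ 2 - y2 ^+ 2) *: at_ N 2 t l
  + (2 * y1 * y2) *: bt N 2 t l.

(* (yhat, ytilde) |-> z; at e = 0 this is the identity since 0^-1 = 0 *)
Definition nf_map (R : realType) (m : nat) (N : nf_coeffs R m) (yh : 'cV[R]_2)
    (yt : 'cV[R]_m) (l t e : R) : 'cV[R]_(2 + m) :=
  col_mx (yh + e^-1 *: hhat N (e *: yh) t l)
         (yt + e^-1 *: htilde N (e *: yh) t l).

Definition Ghat_dag (R : realType) (m : nat) (F : vector_field R m)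
    (C : continuation R m) (N : nf_coeffs R m) (yh : 'cV[R]_2) (yt : 'cV[R]_m)
    (l t e : R) : 'cV[R]_2 :=
  invmx (1%:M + jac (fun x => hhat N x t l) (e *: yh)) *m
  (usubmx (G F C (nf_map N yh yt l t e) l t e)
   - e^-1 *: derive1 (fun t => hhat N (e *: yh) t l) t).

Definition Gtilde_dag (R : realType) (m : nat) (F : vector_field R m)
    (C : continuation R m) (N : nf_coeffs R m) (yh : 'cV[R]_2) (yt : 'cV[R]_m)
    (l t e : R) : 'cV[R]_m :=
  dsubmx (G F C (nf_map N yh yt l t e) l t e)
  - e^-1 *: derive1 (fun t => htilde N (e *: yh) t l) t
  - jac (fun x => htilde N x t l) (e *: yh) *m Ghat_dag F C N yh yt l t e.

(* Coefficient of e^(p-1) in the expansion of g in powers of e *)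
Definition expansion_term (R : realType) (q p : nat) (g : R -> 'cV[R]_q) :
    'cV[R]_q :=
  (p.-1)`!%:R^-1 *: derive1n p.-1 g 0.

Definition Ghat_dag_term (R : realType) (m : nat) (F : vector_field R m)
    (C : continuation R m) (N : nf_coeffs R m) (p : nat) (yh : 'cV[R]_2)
    (yt : 'cV[R]_m) (l t : R) : 'cV[R]_2 :=
  expansion_term p (fun e => Ghat_dag F C N yh yt l t e).

Definition Gtilde_dag_term (R : realType) (m : nat) (F : vector_field R m)
    (C : continuation R m) (N : nf_coeffs R m) (p : nat) (yh : 'cV[R]_2)
    (yt : 'cV[R]_m) (l t : R) : 'cV[R]_m :=
  expansion_term p (fun e => Gtilde_dag F C N yh yt l t e).

(* The p-th term is a homogeneous polynomial of degree p in (yhat, ytilde); its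
   part of degree p in yhat alone is its value at ytilde = 0. *)
Record is_normal_form (R : realType) (m : nat) (F : vector_field R m)
    (U : set R) (C : continuation R m) (N : nf_coeffs R m) : Prop := {
  nf_ah : forall k, (k <= 3)%N -> smooth_periodic U (ah N k) ;
  nf_bh : forall k, (1 <= k <= 3)%N -> smooth_periodic U (bh N k) ;
  nf_at0 : smooth_periodic U (at_ N 0) ;
  nf_at2 : smooth_periodic U (at_ N 2) ;
  nf_bt2 : smooth_periodic U (bt N 2) ;
  nf_norm1 : forall l, U l ->
    ip1 (ah N 1 ^~ l) (fun=> e1 R) + ip1 (bh N 1 ^~ l) (fun=> e2 R) = 0 ;
  nf_norm2 : forall l, U l ->
    ip1 (ah N 1 ^~ l) (fun=> e2 R) - ip1 (bh N 1 ^~ l) (fun=> e1 R) = 0 ;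
  nf_quadratic_tilde : forall l, U l -> forall t yh,
    Gtilde_dag_term F C N 2 yh 0 l t = 0 ;
  nf_quadratic_hat : forall l, U l -> forall t yh,
    Ghat_dag_term F C N 2 yh 0 l t = 0 ;
  nf_cubic_hat : forall l, U l -> forall t yh,
    Ghat_dag_term F C N 3 yh 0 l t =
    (yh 0 0 ^+ 2 + yh 1 0 ^+ 2) *: (rot_scale (betaR N l) (betaI N l) *m yh) }.

(* f(theta) = g(theta, e) + O(e^2) as e -> 0, uniformly in theta *)
Definition eq_O2 (R : realType) (W : normedModType R) (f : R -> W)
    (g : R -> R -> W) : Prop :=
  exists K : R, \forall e \near (0 : R)^',
    forall t, `|f t - g t e| <= K * e ^+ 2.

(* Main.v *)
(** Let z^F be the M = 3 approximation and z^N the image, under the normal form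
    transformation at lambda*, of the circle yhat = (cos phi, sin phi),
    ytilde = 0.  By the normal form conditions z^N solves the equation at
    lambda* up to the drift e^2 beta yhat and a residual which is O(e^3) in the
    hat and O(e^2) in the tilde components; since G(-z; -e) = -G(z; e), its
    leading coefficients have a parity under phi |-> phi + pi.

    Each phi-mode of the defect z^F - z^N then satisfies a linear ODE in theta
    with constant coefficients, forced by the detuning of lambda^F and
    omega^F, the residual and the difference of the nonlinear terms.
    Hyperbolicity, the absence of resonances and, for the critical mode, the
    normalizations of z^F and of the normal form bound the defect by the
    forcing.  The means of the critical equation bound the drifts
    alpha_R(lambda^F) + e^2 beta_R and
    alpha_I(lambda^F) - omega^F + e^2 beta_I as well, and by transversality the
    drifts control the detuning.  So defect, drifts and detuning are O(e^2) by
    absorption; feeding this back gives O(e^3) for the even modes and, because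
    the parities remove the next order, O(e^4) for the hat components of the
    odd modes and for the drifts, which is the claim. *)

Require Import Defs.
From mathcomp Require Import all_boot all_order all_algebra complex.
From mathcomp Require Import all_classical all_reals all_analysis.
From mathcomp Require Import ring lra.
Set Implicit Arguments.
Unset Strict Implicit.
Unset Printing Implicit Defensive.
Import Order.TTheory GRing.Theory Num.Theory.
Import numFieldNormedType.Exports.
Local Open Scope classical_set_scope.
Local Open Scope ring_scope.

(** * Periodic linear differential equations *)

(** The Fourier solution is only known to converge as epsilon tends to 0: there is no rate and no
    smoothness in epsilon, so its coefficients cannot be expanded. Every estimate therefore concerns
    a difference with a normal form quantity, and the absorption starts from the mere smallness of
    the coefficients of $z^F - a^\star$, which is the factor in front of the detuning.

    The normal form conditions are derivatives in epsilon at 0 for fixed theta and phi, hence give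
    pointwise little-o statements only. Uniformity in the angles has a separate source: the residual
    has a Taylor expansion in epsilon with uniformly bounded coefficients, and the pointwise
    statements make the low coefficients vanish.

    On the unit circle the quadratic and cubic transformation polynomials are trigonometric
    polynomials with phi-modes 0 to 3. So z^N lies in the same space as z^F, and the truncation is
    harmless because only the Fourier coefficients of these modes are ever compared.

    The transformation has no cubic tilde terms, so the tilde residual is O(e^2) in odd modes. The
    tilde components of the odd modes of the defect accordingly remain at O(e^2); the claim does not
    concern them. *)

Section derivative_rules.
Variables (R : realType) (V : normedModType R).
Implicit Types (f g : V -> R) (x u : V) (df dg c : R).

Lemma der_cst c x u : is_derive x u (fun=> c) 0.
Proof. exact: is_derive_cst. Qed.

Lemma derD f g x u df dg : is_derive x u f df -> is_derive x u g dg ->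
  is_derive x u (fun y => f y + g y) (df + dg).
Proof. exact: is_deriveD. Qed.

Lemma derN f x u df : is_derive x u f df -> is_derive x u (fun y => - f y) (- df).
Proof. exact: is_deriveN. Qed.

Lemma derB f g x u df dg : is_derive x u f df -> is_derive x u g dg ->
  is_derive x u (fun y => f y - g y) (df - dg).
Proof. exact: is_deriveB. Qed.

Lemma derM f g x u df dg : is_derive x u f df -> is_derive x u g dg ->
  is_derive x u (fun y => f y * g y) (f x * dg + df * g x).
Proof. by move=> hf hg; apply: is_derive_eq (is_deriveM hf hg) _; rewrite [X in _ + X]mulrC. Qed.

Lemma derZ c f x u df : is_derive x u f df ->
  is_derive x u (fun y => c * f y) (c * df).
Proof. exact: is_deriveZ. Qed.

Lemma der_sum n (h : 'I_n -> V -> R) x u (dh : 'I_n -> R) :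
  (forall i, is_derive x u (h i) (dh i)) ->
  is_derive x u (fun y => \sum_(i < n) h i y) (\sum_(i < n) dh i).
Proof.
move=> hh; rewrite (_ : (fun y => _) = \sum_(i < n) h i); first exact: is_derive_sum.
by apply/funext => y; rewrite fct_sumE.
Qed.

End derivative_rules.

Section real_line.
Variable R : realType.
Implicit Types (f g df : R -> R) (a b x t M : R).

Lemma der_comp f g x (df dg : R) : is_derive x 1 f df -> is_derive (f x) 1 g dg ->
  is_derive x 1 (fun y => g (f y)) (dg * df).
Proof.
move=> [df1 df2] [dg1 dg2]; apply: DeriveDef.
  exact/derivable1_diffP/(differentiable_comp ((derivable1_diffP _ _).1 df1)
    ((derivable1_diffP _ _).1 dg1)).
have := derive1_comp df1 dg1; rewrite !derive1E df2 dg2; exact.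
Qed.

Lemma der_derive1 f x (dfx : R) : derivable f x 1 -> derive1 f x = dfx -> is_derive x 1 f dfx.
Proof. by move=> d1 <-; rewrite derive1E; exact: derivableP. Qed.

Lemma der_id x : is_derive x 1 (fun y : R => y) 1.
Proof. exact: is_derive_id. Qed.

Lemma derX k x : is_derive x 1 (fun y : R => y ^+ k) (k%:R * x ^+ k.-1).
Proof.
elim: k => [|k IH]; first by rewrite mul0r; exact: der_cst.
rewrite (_ : (fun y => _) = fun y : R => y * y ^+ k); last by apply/funext => y; rewrite exprS.
apply: is_derive_eq (derM (der_id x) IH) _; rewrite mul1r -natr1 mulrDl mul1r.
by case: k {IH} => [|k]; rewrite ?mul0r ?mulr0// mulrCA -exprS.
Qed.

Lemma der_cosM c x : is_derive x 1 (fun y => cos (c * y)) (- (c * sin (c * x))).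
Proof.
have h : is_derive x 1 (fun y => c * y) (c * 1) := derZ c (is_derive_id x 1).
apply: is_derive_eq (der_comp h (is_derive_cos (c * x))) _.
by rewrite mulr1 mulNr mulrC.
Qed.

Lemma der_sinM c x : is_derive x 1 (fun y => sin (c * y)) (c * cos (c * x)).
Proof.
have h : is_derive x 1 (fun y => c * y) (c * 1) := derZ c (is_derive_id x 1).
apply: is_derive_eq (der_comp h (is_derive_sin (c * x))) _.
by rewrite mulr1 mulrC.
Qed.

Lemma der_cont f x (dfx : R) : is_derive x 1 f dfx -> {for x, continuous f}.
Proof. by move=> [hf _]; apply/differentiable_continuous/derivable1_diffP. Qed.

(** The segment is described by min and max because epsilon and [l - ls] take both signs. *)
Lemma der_bound f df a b M :
  (forall x, Num.min a b <= x <= Num.max a b -> is_derive x 1 f (df x)) ->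
  (forall x, Num.min a b <= x <= Num.max a b -> `|df x| <= M) ->
  `|f b - f a| <= M * `|b - a|.
Proof.
wlog ab : a b / a <= b => [hw|] hd hM.
  have [ab|/ltW ab] := leP a b; first exact: hw.
  by rewrite distrC (distrC b); apply: hw => // x; rewrite minC maxC; [exact: hd|exact: hM].
have mE : Num.min a b = a by exact/min_idPl.
have ME : Num.max a b = b by exact/max_idPr.
rewrite mE ME in hd hM.
have [||c hc ->] := @MVT_segment R f df a b ab.
- by move=> x /itvP hx; apply: hd; rewrite !hx.
- apply: derivable_within_continuous => x /itvP hx.
  by have [] := hd x _; rewrite ?hx.
- by rewrite normrM ler_wpM2r//; apply: hM; rewrite !(itvP hc).
Qed.

Lemma period_reduce t : exists n : int, 0 <= t + n%:~R * (2 * pi) <= 2 * pi.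
Proof.
have pi0 : 0 < 2 * pi :> R by rewrite mulr_gt0// pi_gt0.
exists (- Num.floor (t / (2 * pi))).
have /andP[h1 h2] := floor_itv (t / (2 * pi)).
rewrite rmorphN mulNr subr_ge0 lerBlDr -ler_pdivlMr// h1/=.
by move/ltW: h2; rewrite intrD ler_pdivrMr// mulrDl mul1r addrC.
Qed.

Lemma periodic_int f (T := 2 * pi) : (forall t, f (t + T) = f t) ->
  forall (n : int) t, f (t + n%:~R * T) = f t.
Proof.
move=> hf.
have hn (n : nat) t : f (t + n%:R * T) = f t.
  elim: n t => [|n IH] t; first by rewrite mul0r addr0.
  by rewrite -natr1 mulrDl mul1r addrA hf.
case=> n t; first exact: hn.
by rewrite NegzE rmorphN mulNr -[LHS](hn n.+1) subrK.
Qed.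

Lemma periodic_reduce f : (forall t, f (t + 2 * pi) = f t) ->
  forall t, exists2 s, 0 <= s <= 2 * pi & f t = f s.
Proof.
move=> hf t; have [n hn] := period_reduce t; exists (t + n%:~R * (2 * pi)) => //.
by rewrite periodic_int.
Qed.

End real_line.

Section periodic_linear_ode.
Variable R : realType.
Implicit Types (p q f g : R -> R) (nu M t : R).

(** In the frame rotating with frequency nu around the time [t0] only the forcing drives the
    solution. Over one period the solution returns to its value while the frame turns by 2 pi nu,
    which leaves a linear system for (p, q) at [t0], invertible unless nu is an integer. *)
Lemma rotation_ode_bound nu : cos (2 * pi * nu) != 1 ->
  exists2 K : R, 0 <= K & forall p q f g M,
    (forall t, p (t + 2 * pi) = p t) -> (forall t, q (t + 2 * pi) = q t) ->
    (forall t, is_derive t 1 p (- nu * q t + f t)) ->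
    (forall t, is_derive t 1 q (nu * p t + g t)) ->
    (forall t, `|f t| <= M) -> (forall t, `|g t| <= M) ->
    forall t, `|p t| <= K * M /\ `|q t| <= K * M.
Proof.
move=> nu1; pose c : R := cos (2 * pi * nu) - 1; pose s : R := sin (2 * pi * nu).
have cs : c ^+ 2 + s ^+ 2 = - 2 * c.
  by have := cos2Dsin2 (2 * pi * nu); rewrite /c /s => h; lra.
have c0 : c < 0.
  by rewrite subr_lt0 lt_neqAle nu1 cos_le1.
(* [- 2 * c] equals c^2 + s^2, the determinant of the system for (p, q) at [t0]. Its coefficients
   are at most 2 and its right-hand sides at most 2 M times the period; 12 is a generous upper bound
   for the resulting 8. *)
pose K : R := 12 * (2 * pi) / (- 2 * c).
have pi0 := pi_gt0 R.
exists K; first by rewrite divr_ge0 //; nra.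
move=> p q f g M pper qper dp dq hf hg t0.
have M0 : 0 <= M by exact: le_trans (normr_ge0 _) (hf 0).
pose u t := cos (nu * (t - t0)) * p t + sin (nu * (t - t0)) * q t.
pose v t := cos (nu * (t - t0)) * q t - sin (nu * (t - t0)) * p t.
have dsh t : is_derive t 1 (fun y => nu * (y - t0)) nu.
  by apply: is_derive_eq (derZ nu (derB (der_id t) (der_cst t0 _ _))) _; rewrite subr0 mulr1.
have dcos t := der_comp (dsh t) (is_derive_cos (nu * (t - t0))).
have dsin t := der_comp (dsh t) (is_derive_sin (nu * (t - t0))).
have du t : is_derive t 1 u (cos (nu * (t - t0)) * f t + sin (nu * (t - t0)) * g t).
  by apply: is_derive_eq (derD (derM (dcos t) (dp t)) (derM (dsin t) (dq t))) _; ring.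
have dv t : is_derive t 1 v (cos (nu * (t - t0)) * g t - sin (nu * (t - t0)) * f t).
  by apply: is_derive_eq (derB (derM (dcos t) (dq t)) (derM (dsin t) (dp t))) _; ring.
have hcs (x y : R) t : `|x| <= M -> `|y| <= M ->
    `|cos (nu * (t - t0)) * x + sin (nu * (t - t0)) * y| <= 2 * M.
  move=> hx hy; apply: le_trans (ler_normD _ _) _; rewrite !normrM mulrDl mul1r.
  by apply: lerD; rewrite -[leRHS]mul1r; apply: ler_pM => //; rewrite ?cos_max ?sin_max.
have hu := @der_bound R u _ t0 (t0 + 2 * pi) (2 * M) (fun t _ => du t)
  (fun t _ => hcs _ _ t (hf t) (hg t)).
have hv : `|v (t0 + 2 * pi) - v t0| <= 2 * M * `|t0 + 2 * pi - t0|.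
  apply: (@der_bound R v _ t0 (t0 + 2 * pi) (2 * M) (fun t _ => dv t)) => t _.
  by rewrite -mulrN; apply: hcs => //; rewrite normrN.
have pi2 : `|t0 + 2 * pi - t0| = 2 * pi.
  by rewrite [t0 + _]addrC addrK ger0_norm //; nra.
rewrite pi2 in hu hv.
have uE : u (t0 + 2 * pi) - u t0 = c * p t0 + s * q t0.
  rewrite /u [t0 + _ - _]addrAC subrr add0r mulr0 cos0 sin0 pper qper mulrC /c /s.
  rewrite (mulrC nu); ring.
have vE : v (t0 + 2 * pi) - v t0 = c * q t0 - s * p t0.
  rewrite /v [t0 + _ - _]addrAC subrr add0r mulr0 cos0 sin0 pper qper mulrC /c /s.
  rewrite (mulrC nu); ring.
rewrite uE in hu; rewrite vE in hv.
have cn : `|c| <= 2.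
  have /andP[h1 h2] : -1 <= cos (2 * pi * nu) <= 1 by rewrite cos_geN1 cos_le1.
  by rewrite ler_norml /c; lra.
have sn : `|s| <= 2 by apply: le_trans (sin_max _) _; rewrite ler1n.
have key (a b x y : R) : `|a| <= 2 -> `|b| <= 2 -> `|x| <= 2 * M * (2 * pi) ->
    `|y| <= 2 * M * (2 * pi) -> `|a * x + b * y| <= 12 * (2 * pi) * M.
  move=> ha hb hx hy; apply: le_trans (ler_normD _ _) _; rewrite !normrM.
  have := ler_pM (normr_ge0 _) (normr_ge0 _) ha hx.
  have := ler_pM (normr_ge0 _) (normr_ge0 _) hb hy.
  have : 0 <= M * pi by rewrite mulr_ge0// ltW.
  lra.
have c2 : 0 < - 2 * c by lra.
split.
- rewrite /K mulrAC ler_pdivlMr// -(gtr0_norm c2) -normrM.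
  have := key c (- s) _ _ cn _ hu hv; rewrite normrN => /(_ sn).
  suff -> : c * (c * p t0 + s * q t0) + - s * (c * q t0 - s * p t0) = p t0 * (- 2 * c) by [].
  rewrite -cs; ring.
- rewrite /K mulrAC ler_pdivlMr// -(gtr0_norm c2) -normrM.
  have := key s c _ _ sn cn hu hv.
  suff -> : s * (c * p t0 + s * q t0) + c * (c * q t0 - s * p t0) = q t0 * (- 2 * c) by [].
  rewrite -cs; ring.
Qed.

Lemma periodic_max f : (forall t, f (t + 2 * pi) = f t) ->
  (forall t, derivable f t 1) -> exists2 c : R, is_derive c 1 f 0 & forall t, f t <= f c.
Proof.
move=> fper df.
have pi0 : 0 < 2 * pi :> R by rewrite mulr_gt0// pi_gt0.
have [|c hc hmax] := @EVT_max R f 0 (2 * pi) (ltW pi0).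
  by apply: derivable_within_continuous => x _.
have cmax t : f t <= f c.
  by have [s hs ->] := periodic_reduce fper t; apply: hmax.
exists c => //; apply: (@derive1_at_max R f (c - 1) (c + 1) c) => //; first lra.
by rewrite in_itv/=; lra.
Qed.

(* At a maximum of p^2 + q^2 the rotation term drops out. *)
Lemma hyperbolic_ode_bound (al be : R) : al != 0 ->
  forall p q f g M,
    (forall t, p (t + 2 * pi) = p t) -> (forall t, q (t + 2 * pi) = q t) ->
    (forall t, is_derive t 1 p (al * p t - be * q t + f t)) ->
    (forall t, is_derive t 1 q (be * p t + al * q t + g t)) ->
    (forall t, `|f t| <= M) -> (forall t, `|g t| <= M) ->
    forall t, `|p t| <= 2 / `|al| * M /\ `|q t| <= 2 / `|al| * M.
Proof.
move=> al0 p q f g M pper qper dp dq hf hg.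
have M0 : 0 <= M by exact: le_trans (normr_ge0 _) (hf 0).
pose r t := p t * p t + q t * q t.
have dr t := derD (derM (dp t) (dp t)) (derM (dq t) (dq t)).
have [||c dc hc] := @periodic_max r.
- by move=> t; rewrite /r pper qper.
- by move=> t; have [] := dr t.
have c0 : al * r c = - (p c * f c + q c * g c).
  have [_] := dc; have [_ ->] := dr c; rewrite /r => h.
  have : 2 * (al * (p c * p c + q c * q c) + (p c * f c + q c * g c)) = 0.
    by rewrite -[RHS]h; ring.
  by move/eqP; rewrite mulf_eq0 pnatr_eq0/= => /eqP; lra.
have f2 (x : R) : `|x| <= M -> x ^+ 2 <= M ^+ 2.
  by move=> hx; rewrite -[x ^+ 2]real_normK ?num_real// lerXn2r// nnegrE.
have r0 t : 0 <= r t by rewrite /r -!expr2 addr_ge0// sqr_ge0.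
have hr : al ^+ 2 * r c <= 2 * M ^+ 2.
  have [->|rc0] := eqVneq (r c) 0; first by rewrite mulr0 mulr_ge0// sqr_ge0.
  have rc : 0 < r c by rewrite lt_def rc0 r0.
  rewrite -(ler_pM2r rc).
  have -> : al ^+ 2 * r c * r c = (p c * f c + q c * g c) ^+ 2.
    by rewrite -[_ + _]opprK -c0; ring.
  have := f2 _ (hf c); have := f2 _ (hg c) => h1 h2.
  (* Lagrange's identity: (p f + q g)^2 is (p^2 + q^2)(f^2 + g^2) minus this square. *)
  have : 0 <= (p c * g c - q c * f c) ^+ 2 by exact: sqr_ge0.
  have h3 : (f c ^+ 2 + g c ^+ 2) * r c <= 2 * M ^+ 2 * r c.
    by rewrite ler_wpM2r//; lra.
  move=> h4; apply: le_trans h3; rewrite /r -subr_ge0; apply: le_trans h4 _.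
  by rewrite le_eqVlt; apply/orP; left; apply/eqP; ring.
have key (x : R) t : x ^+ 2 <= r t -> `|x| <= 2 / `|al| * M.
  move=> hx; have an : 0 < `|al| by rewrite normr_gt0.
  rewrite mulrAC ler_pdivlMr// -normrM.
  rewrite -(@ler_pXn2r _ 2)// ?nnegrE ?mulr_ge0// real_normK ?num_real//.
  rewrite exprMn exprMn mulrC.
  have : al ^+ 2 * x ^+ 2 <= al ^+ 2 * r c.
    by rewrite ler_wpM2l ?sqr_ge0//; exact: le_trans hx (hc t).
  have := sqr_ge0 M; lra.
by move=> t; split; apply: (key _ t); rewrite /r -!expr2 ?lerDl ?lerDr sqr_ge0.
Qed.

Section hyperbolic_system.
Variables (m : nat) (A : 'M[R]_m) (ka : R).
Implicit Types (mu : R[i]) (a b : 'cV[R]_m).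

(* Real and imaginary parts of (A - mu) (a + i b). *)
Let shift_re mu a b : 'cV[R]_m := A *m a - complex.Re mu *: a + complex.Im mu *: b.
Let shift_im mu a b : 'cV[R]_m := A *m b - complex.Re mu *: b - complex.Im mu *: a.

Let cplx a b : 'cV[R[i]]_m := \col_i (a i 0 +i* b i 0)%C.

Let cplx_shift mu a b :
  cplx (shift_re mu a b) (shift_im mu a b) =
  (map_mx (@real_complex R) A - mu%:M) *m cplx a b.
Proof.
apply/colP => i; rewrite mulmxBl mul_scalar_mx !mxE.
have -> : \sum_j map_mx (@real_complex R) A i j * cplx a b j 0 =
    ((\sum_j A i j * a j 0) +i* (\sum_j A i j * b j 0))%C.
  elim/big_rec3 : _ => [//|j x y z _ ->]; rewrite !mxE.
  by apply/eqP; rewrite eq_complex/=; apply/andP; split; apply/eqP; ring.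
by case: mu => al be; apply/eqP; rewrite eq_complex/=; apply/andP; split; apply/eqP; ring.
Qed.

(** Induction on the list. The pair (A - mu)(a + i b) satisfies the same system with forcing (A -
    mu)(f + i g) and is annihilated by the shorter product, so it is already bounded. As a known
    term it turns the equation of each entry of a + i b into a scalar one, with growth rate Re mu
    and frequency Im mu + ka. *)
Let hyp_annihilated (rs : seq R[i]) : (forall mu, mu \in rs -> complex.Re mu != 0) ->
  exists2 K : R, 0 <= K & forall (a b f g : R -> 'cV[R]_m) (M : R),
    (forall t, a (t + 2 * pi) = a t) -> (forall t, b (t + 2 * pi) = b t) ->
    (forall t i, is_derive t 1 (fun t => a t i 0) ((A *m a t - ka *: b t + f t) i 0)) ->
    (forall t i, is_derive t 1 (fun t => b t i 0) ((A *m b t + ka *: a t + g t) i 0)) ->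
    (forall t i, `|f t i 0| <= M) -> (forall t i, `|g t i 0| <= M) ->
    (forall t, foldr (fun mu X => X *m (map_mx (@real_complex R) A - mu%:M)) 1%:M rs
        *m cplx (a t) (b t) = 0) ->
    forall t i, `|a t i 0| <= K * M /\ `|b t i 0| <= K * M.
Proof.
elim: rs => [_|mu rs IH hrs].
  exists 0 => // a b f g M _ _ _ _ _ _ h0 t i.
  have := h0 t; rewrite /= mul1mx => /colP/(_ i); rewrite !mxE => -[-> ->].
  by rewrite normr0 mul0r.
have [|K K0 hK] := IH; first by move=> z hz; apply: hrs; rewrite inE hz orbT.
have mu0 : complex.Re mu != 0 by apply: hrs; rewrite mem_head.
(* A bound for the operator A - mu, hence [cA * M] for the forcing of the shifted system. *)
pose cA : R := \sum_i \sum_j `|A i j| + `|complex.Re mu| + `|complex.Im mu|.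
have cA0 : 0 <= cA.
  by rewrite !addr_ge0// sumr_ge0// => i _; rewrite sumr_ge0.
pose K' : R := 2 / `|complex.Re mu| * (K * cA + 1).
exists K'; first by rewrite mulr_ge0// ?divr_ge0// addr_ge0// mulr_ge0.
move=> a b f g M pa pb da db hf hg h0.
have bnd (x y : 'cV[R]_m) i (s : R) : `|s| = 1 -> (forall i, `|x i 0| <= M) ->
  (forall i, `|y i 0| <= M) ->
    `|(A *m x) i 0 - complex.Re mu * x i 0 + s * (complex.Im mu * y i 0)| <= cA * M.
  move=> hs hx hy; rewrite /cA !mulrDl.
  apply: le_trans (ler_normD _ _) _; apply: lerD; last first.
    by rewrite 2!normrM hs mul1r ler_wpM2l.
  apply: le_trans (ler_normB _ _) _; apply: lerD; last by rewrite normrM ler_wpM2l.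
  rewrite mxE; apply: le_trans (ler_norm_sum _ _ _) _.
  rewrite [X in _ <= X * M](bigD1 i)//= mulrDl mulr_suml; apply: ler_wpDr.
    rewrite mulr_ge0//; first by apply: sumr_ge0 => j _; apply: sumr_ge0.
    exact: le_trans (normr_ge0 _) (hx i).
  by apply: ler_sum => j _; rewrite normrM ler_wpM2l.
pose a1 t := shift_re mu (a t) (b t); pose b1 t := shift_im mu (a t) (b t).
pose f1 t := shift_re mu (f t) (g t); pose g1 t := shift_im mu (f t) (g t).
have dmul (x : R -> 'cV[R]_m) (y : 'cV[R]_m) t i : (forall i, is_derive t 1 (fun t =>
  x t i 0) (y i 0)) ->
    is_derive t 1 (fun t => (A *m x t) i 0) ((A *m y) i 0).
  move=> dx; rewrite (_ : (fun t => _) = fun t => \sum_j A i j * x t j 0); last first.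
    by apply/funext => s; rewrite mxE.
  by rewrite mxE; apply: der_sum => j; apply: derZ.
have h1 t i : `|a1 t i 0| <= K * (cA * M) /\ `|b1 t i 0| <= K * (cA * M).
  apply: (hK a1 b1 f1 g1 (cA * M)) t i.
  - by move=> t; rewrite /a1 pa pb.
  - by move=> t; rewrite /b1 pa pb.
  - move=> t i; rewrite (_ : (fun t => _) = fun t => (A *m a t) i 0 - complex.Re mu * a t i 0
        + complex.Im mu * b t i 0); last by apply/funext => s; rewrite /a1 /shift_re !mxE.
    apply: is_derive_eq (derD (derB (dmul _ _ _ _ (da t)) (derZ _ (da t i))) (derZ _ (db t i))) _.
    rewrite /a1 /b1 /f1 /shift_re /shift_im !(mulmxDr, mulmxN) -!scalemxAr !mxE; ring.
  - move=> t i; rewrite (_ : (fun t => _) = fun t => (A *m b t) i 0 - complex.Re mu * b t i 0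
        - complex.Im mu * a t i 0); last by apply/funext => s; rewrite /b1 /shift_im !mxE.
    apply: is_derive_eq (derB (derB (dmul _ _ _ _ (db t)) (derZ _ (db t i))) (derZ _ (da t i))) _.
    rewrite /a1 /b1 /g1 /shift_re /shift_im !(mulmxDr, mulmxN) -!scalemxAr !mxE; ring.
  - move=> t i; have := bnd (f t) (g t) i 1 (normr1 _) (hf t) (hg t).
    by rewrite /f1 /shift_re !mxE mul1r.
  - move=> t i; have := bnd (g t) (f t) i (-1) (normrN1 _) (hg t) (hf t).
    by rewrite /g1 /shift_im !mxE mulN1r.
  - by move=> t; rewrite /a1 /b1 cplx_shift mulmxA; exact: h0.
move=> t i.
have h2 x : `|a1 x i 0 + f x i 0| <= (K * cA + 1) * M /\ `|b1 x i 0 + g x i 0| <= (K * cA + 1) * M.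
  by rewrite mulrDl mul1r -mulrA; have [u v] := h1 x i; split;
    apply: le_trans (ler_normD _ _) _; apply: lerD.
have -> : K' * M = 2 / `|complex.Re mu| * ((K * cA + 1) * M) by rewrite /K' mulrA.
apply: (@hyperbolic_ode_bound _ (complex.Im mu + ka) mu0 (fun t => a t i 0) (fun t => b t i 0)
  (fun t => a1 t i 0 + f t i 0) (fun t => b1 t i 0 + g t i 0)).
- by move=> s; rewrite pa.
- by move=> s; rewrite pb.
- by move=> s; apply: is_derive_eq (da s i) _; rewrite /a1 /shift_re !mxE; ring.
- by move=> s; apply: is_derive_eq (db s i) _; rewrite /b1 /shift_im !mxE; ring.
- by move=> s; have [] := h2 s.
- by move=> s; have [] := h2 s.
Qed.

(* Cayley-Hamilton reduces the system to a chain of scalar complex equations, one for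
   each eigenvalue, solved from the last one upwards. *)
Lemma hyperbolic_system_bound : (forall mu, complex_eigenvalue A mu -> complex.Re mu != 0) ->
  exists2 K : R, 0 <= K & forall (a b f g : R -> 'cV[R]_m) (M : R),
    (forall t, a (t + 2 * pi) = a t) -> (forall t, b (t + 2 * pi) = b t) ->
    (forall t i, is_derive t 1 (fun t => a t i 0) ((A *m a t - ka *: b t + f t) i 0)) ->
    (forall t i, is_derive t 1 (fun t => b t i 0) ((A *m b t + ka *: a t + g t) i 0)) ->
    (forall t i, `|f t i 0| <= M) -> (forall t i, `|g t i 0| <= M) ->
    forall t i, `|a t i 0| <= K * M /\ `|b t i 0| <= K * M.
Proof.
move=> hA; have [rs hrs] := closed_field_poly_normal (char_poly (map_mx (@real_complex R) A)).
rewrite (monicP (char_poly_monic _)) scale1r in hrs.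
have [|K K0 hK] := @hyp_annihilated rs.
  by move=> mu hmu; apply: hA; rewrite /complex_eigenvalue eigenvalue_root_char hrs root_prod_XsubC.
exists K => // a b f g M pa pb da db hf hg; apply: (hK a b f g M) => // t.
suff -> : foldr (fun mu X => X *m (map_mx (@real_complex R) A - mu%:M)) 1%:M rs =
  0 by rewrite mul0mx.
move: (map_mx _ A) hrs => B; case: m B => [|n] B hrs; first by apply/matrixP => -[].
rewrite -(Cayley_Hamilton B) hrs; elim: rs {hrs hK} => [|mu rs IH] /=.
  by rewrite big_nil -polyC1 horner_mx_C.
by rewrite IH big_cons mulrC rmorphM/= rmorphB/= horner_mx_X horner_mx_C.
Qed.

End hyperbolic_system.
End periodic_linear_ode.

(** * Fourier coefficients *)

Section period_integral.
Variable R : realType.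
Implicit Types (f g h Gm : R -> R) (M x : R).

Let pi0 : 0 < pi :> R := pi_gt0 R.

(** The base point -1 makes the derivative two-sided on all of [0, 2 pi], endpoints included, and
    the half-line leaves room for shifts by pi and 2 pi. *)
Lemma antiderivative_exists f : continuous f ->
  exists Gm, forall x, -1 < x -> is_derive x 1 Gm (f x).
Proof.
move=> cf; exists (fun x => (\int[lebesgue_measure]_(t in `[-1, x]) f t)%R) => x x1.
have [||||d1 d2] := @continuous_FTC1_closed R f (-1) x (x + 1).
- by rewrite ltrDl.
- by apply: continuous_compact_integrable; [exact: segment_compact|exact: continuous_subspaceT].
- exact: x1.
- exact: cf.
- exact: der_derive1 d1 d2.
Qed.

Lemma period_intE f Gm : continuous f -> (forall x, -1 < x -> is_derive x 1 Gm (f x)) ->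
  period_int f = Gm (2 * pi) - Gm 0.
Proof.
move=> cf dG; rewrite /period_int /Rintegral (@continuous_FTC2 R f Gm 0 (2 * pi)) //.
- by rewrite mulr_gt0.
- exact: continuous_subspaceT.
- split.
  + by move=> x /itvP hx; have [] // := dG x; rewrite (lt_trans _ (_ : 0 < x)) ?hx ?ltrN10.
  + by apply: cvg_at_right_filter; apply: der_cont (dG _ _); rewrite ltrN10.
  + by apply: cvg_at_left_filter; apply: der_cont (dG _ _);
    rewrite (@lt_trans _ _ 0) ?ltrN10 ?mulr_gt0.
- move=> x /itvP hx; rewrite derive1E.
  by have [] // := dG x; rewrite (lt_trans _ (_ : 0 < x)) ?hx ?ltrN10.
Qed.

Lemma period_intD f g : continuous f -> continuous g ->
  period_int (fun x => f x + g x) = period_int f + period_int g.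
Proof.
move=> cf cg; have [F dF] := antiderivative_exists cf; have [G dG] := antiderivative_exists cg.
have cfg : continuous (fun x => f x + g x).
  by move=> x; apply: continuousD; [exact: cf|exact: cg].
rewrite (period_intE cf dF) (period_intE cg dG).
have dFG x (x1 : -1 < x) : is_derive x 1 (fun x => F x + G x) (f x + g x) :=
  derD (dF x x1) (dG x x1).
by rewrite (period_intE cfg dFG); ring.
Qed.

Lemma period_intZ (c : R) f : continuous f ->
  period_int (fun x => c * f x) = c * period_int f.
Proof.
move=> cf; have [F dF] := antiderivative_exists cf.
have ccf : continuous (fun x => c * f x).
  by move=> x; apply: continuousM; [exact: cvg_cst|exact: cf].
rewrite (period_intE cf dF).
have dcF x (x1 : -1 < x) : is_derive x 1 (fun x => c * F x) (c * f x) := derZ c (dF x x1).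
by rewrite (period_intE ccf dcF); ring.
Qed.

Lemma period_int_cst (c : R) : period_int (fun=> c) = 2 * pi * c.
Proof.
have dG x : -1 < x -> is_derive x 1 (fun x => c * x) c.
  by move=> _; apply: is_derive_eq (derZ _ (der_id x)) _; rewrite mulr1.
by rewrite (period_intE _ dG) ?mulr0 ?subr0 1?mulrC//; exact: cst_continuous.
Qed.

Lemma period_int_bound f M : continuous f -> (forall x, `|f x| <= M) ->
  `|period_int f| <= 2 * pi * M.
Proof.
move=> cf hM; have [F dF] := antiderivative_exists cf; rewrite (period_intE cf dF).
have h2 : 0 <= 2 * pi :> R by rewrite mulr_ge0// ltW.
apply: le_trans (@der_bound R F f 0 (2 * pi) M _ _) _; first move=> x.
- rewrite (min_idPl h2) => /andP[x0 _]; apply: dF; exact: lt_le_trans (ltrN10 R) x0.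
- by move=> x _; exact: hM.
- by rewrite subr0 ger0_norm// mulrC.
Qed.

Lemma period_int_mean f : continuous f -> exists x, period_int f = 2 * pi * f x.
Proof.
move=> cf; have [F dF] := antiderivative_exists cf; rewrite (period_intE cf dF).
have [|||c _ ->] := @MVT_segment R F f 0 (2 * pi); first by rewrite mulr_ge0// ltW.
- by move=> x /itvP hx; apply: dF; rewrite (@lt_trans _ _ 0)// ?ltrN10// hx.
- by apply: derivable_within_continuous => x /itvP hx; have [] // := dF x;
  rewrite (@lt_le_trans _ _ 0)// ?ltrN10// hx.
- by exists c; rewrite subr0 mulrC.
Qed.

Lemma period_int_shift f : continuous f -> (forall x, f (x + 2 * pi) = f x) ->
  period_int (fun x => f (x + pi)) = period_int f.
Proof.
move=> cf pf; have [F dF] := antiderivative_exists cf; rewrite (period_intE cf dF).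
have dsh c x : 0 <= c -> -1 < x -> is_derive x 1 (fun y => F (y + c)) (f (x + c)).
  move=> c0 x1; have h : is_derive x 1 (fun y => y + c) (1 + 0) := derD (der_id x) (der_cst c _ _).
  by apply: is_derive_eq (der_comp h (dF (x + c) _)) _; [lra|rewrite addr0 mulr1].
have cfs : continuous (fun x => f (x + pi)).
  move=> x; apply: (@continuous_comp _ _ _ (fun x => x + pi) f); last exact: cf.
  by apply: cvgD => //; exact: cvg_cst.
have dFs x : -1 < x -> is_derive x 1 (fun x => F (x + pi)) (f (x + pi)) := dsh _ x (ltW pi0).
rewrite (period_intE cfs dFs).
(* F(x + 2 pi) - F(x) is constant because f is periodic; its values at pi and at 0 agree. *)
suff : F (pi + 2 * pi) - F (0 + 2 * pi) = F pi - F 0.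
  by rewrite !add0r (addrC pi); move=> h; lra.
  apply/eqP; rewrite -subr_eq0 -normr_le0.
  have -> : F (pi + 2 * pi) - F (0 + 2 * pi) - (F pi - F 0) =
     (F (pi + 2 * pi) - F pi) - (F (0 + 2 * pi) - F 0) by ring.
  have := @der_bound R (fun x => F (x + 2 * pi) - F x) (fun=> 0) 0 pi 0.
  rewrite mul0r; apply; last by move=> x _; rewrite normr0.
  move=> x; rewrite (min_idPl (ltW pi0)) => /andP[x0 _].
  have x1 : -1 < x by lra.
  have c0 : 0 <= 2 * pi :> R by rewrite mulr_ge0// ltW.
  apply: is_derive_eq (derB (dsh _ x c0 x1) (dF x x1)) _.
  by rewrite pf subrr.
Qed.

Lemma period_int_ext f g : f =1 g -> period_int f = period_int g.
Proof. by move=> h; congr period_int; exact/funext. Qed.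

(** The two hypotheses express that nu is an integer; the real frequency may be a negative
    difference j - k. *)
Lemma period_int_cos (nu : R) : cos (2 * pi * nu) = 1 -> sin (2 * pi * nu) = 0 ->
  period_int (fun x => cos (nu * x)) = if nu == 0 then 2 * pi else 0.
Proof.
move=> hc hs; have [->|nu0] := eqVneq nu 0.
  rewrite -[RHS]mulr1 -(period_int_cst 1); apply: period_int_ext => x.
  by rewrite mul0r cos0.
have cf : continuous (fun x => cos (nu * x)) by move=> x; apply: der_cont (der_cosM nu x).
have dG x : -1 < x -> is_derive x 1 (fun x => nu^-1 * sin (nu * x)) (cos (nu * x)).
  by move=> _; apply: is_derive_eq (derZ _ (der_sinM nu x)) _; rewrite mulKf.
by rewrite (period_intE cf dG) (mulrC nu) hs !mulr0 sin0 mulr0 subr0.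
Qed.

Lemma period_int_sin (nu : R) : cos (2 * pi * nu) = 1 -> sin (2 * pi * nu) = 0 ->
  period_int (fun x => sin (nu * x)) = 0.
Proof.
move=> hc hs; have [->|nu0] := eqVneq nu 0.
  rewrite -[RHS](mulr0 (2 * pi)) -(period_int_cst 0); apply: period_int_ext => x.
  by rewrite mul0r sin0.
have cf : continuous (fun x => sin (nu * x)) by move=> x; apply: der_cont (der_sinM nu x).
have dG x : -1 < x -> is_derive x 1 (fun x => - nu^-1 * cos (nu * x)) (sin (nu * x)).
  by move=> _; apply: is_derive_eq (derZ _ (der_cosM nu x)) _; rewrite mulrNN mulKf.
by rewrite (period_intE cf dG) (mulrC nu) hc mulr0 cos0 subrr.
Qed.

(** By Rolle's theorem over one period the derivative vanishes somewhere, and there c = - f. *)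
Lemma periodic_drift_bound (s f : R -> R) (c M : R) :
  (forall t : R, s (t + 2 * pi) = s t) -> (forall t : R, is_derive t 1 s (c + f t)) ->
  (forall t, `|f t| <= M) -> `|c| <= M.
Proof.
move=> ps ds hf; have h2 : 0 < 2 * pi :> R by rewrite mulr_gt0.
have [|x _] := @MVT R s (fun t => c + f t) 0 (2 * pi) h2.
  by apply: derivable_within_continuous => x _; have [] := ds x.
rewrite -{1}[2 * pi]add0r ps subrr subr0 => /esym/eqP.
rewrite mulf_eq0 (gt_eqF h2) orbF addr_eq0 => /eqP ->.
by rewrite normrN.
Qed.

(** A zero mean yields a zero of s. That zero and the given point are brought into one period and
    joined by the bound on the derivative. *)
Lemma periodic_zero_mean_bound (s ds : R -> R) (M : R) :
  (forall t : R, s (t + 2 * pi) = s t) -> (forall t : R, is_derive t 1 s (ds t)) ->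
  (forall t, `|ds t| <= M) -> period_int s = 0 -> forall t, `|s t| <= 4 * pi * M.
Proof.
move=> ps hs hM s0 t.
have M0 : 0 <= M by exact: le_trans (normr_ge0 _) (hM 0).
have cs : continuous s by move=> x; exact: der_cont (hs x).
have [x] := period_int_mean cs; rewrite s0 => /esym/eqP.
rewrite mulf_eq0 gt_eqF ?mulr_gt0//= => /eqP sx.
have [[u hu ->] [v hv sv]] := (periodic_reduce ps t, periodic_reduce ps x).
rewrite -[s u]subr0 -sx sv.
apply: le_trans (@der_bound R s ds v u M (fun t _ => hs t) (fun t _ => hM t)) _.
rewrite mulrC ler_wpM2r// ler_norml; have := pi0; lra.
Qed.

End period_integral.

Section fourier_coefficients.
Variable R : realType.
Implicit Types (f g : R -> R) (b : bool) (k j : nat) (M c x : R).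

Definition trig b k x : R := if b then sin (k%:R * x) else cos (k%:R * x).

(** A single indexing for [cos_coef] and [sin_coef]. The index (true, 0) belongs to the zero
    function, so it has to be excluded wherever a coefficient is recovered from a series. *)
Definition fourier b k f : R :=
  (if k == 0%N then 2 * pi else pi)^-1 * period_int (fun x => f x * trig b k x).

Definition trig_deriv b k x : R := if b then k%:R * cos (k%:R * x) else - (k%:R * sin (k%:R * x)).

Lemma der_trig b k x : is_derive x 1 (trig b k) (trig_deriv b k x).
Proof. by case: b; [exact: der_sinM|exact: der_cosM]. Qed.

Lemma trig_cont b k : continuous (trig b k).
Proof. by move=> x; exact: der_cont (der_trig b k x). Qed.

Lemma trig_le1 b k x : `|trig b k x| <= 1.
Proof. by case: b; [exact: sin_max|exact: cos_max]. Qed.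

Lemma trig_pi b k x : trig b k (x + pi) = (-1) ^+ k * trig b k x.
Proof.
have h : sin (k%:R * x + k%:R * pi) = (-1) ^+ k * sin (k%:R * x) /\
         cos (k%:R * x + k%:R * pi) = (-1) ^+ k * cos (k%:R * x).
  move: (k%:R * x) => y; elim: k => [|k [IHs IHc]].
    by rewrite mul0r addr0 !mul1r.
  by rewrite -natr1 mulrDl mul1r addrA sinDpi cosDpi IHs IHc exprS !mulN1r !mulNr.
by rewrite /trig mulrDr; case: h => -> ->; case: b.
Qed.

Lemma trig_2pi b k x : trig b k (x + 2 * pi) = trig b k x.
Proof.
by rewrite mulrDl mul1r addrA !trig_pi mulrA -exprMn mulrNN mulr1 expr1n mul1r.
Qed.

Lemma contZ c f : continuous f -> continuous (fun x => c * f x).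
Proof. by move=> cf x; apply: continuousM; [exact: cvg_cst|exact: cf]. Qed.

Lemma contD f g : continuous f -> continuous g -> continuous (fun x => f x + g x).
Proof. by move=> cf cg x; apply: continuousD; [exact: cf|exact: cg]. Qed.

Let sgn2 k : (-1) ^+ k * (-1) ^+ k = 1 :> R.
Proof. by rewrite -exprMn mulrNN mulr1 expr1n. Qed.

Let cprod f b k : continuous f -> continuous (fun x => f x * trig b k x).
Proof. by move=> cf x; apply: continuousM; [exact: cf|exact: trig_cont]. Qed.

Lemma fourierD b k f g : continuous f -> continuous g ->
  fourier b k (fun x => f x + g x) = fourier b k f + fourier b k g.
Proof.
move=> cf cg; rewrite /fourier -mulrDr -period_intD; try exact: cprod.
by congr (_ * _); apply: period_int_ext => x; rewrite mulrDl.
Qed.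

Lemma fourierZ b k c f : continuous f ->
  fourier b k (fun x => c * f x) = c * fourier b k f.
Proof.
move=> cf; rewrite /fourier mulrCA -(period_intZ c); last exact: cprod.
by congr (_ * _); apply: period_int_ext => x; rewrite mulrA.
Qed.

Lemma fourier_ext b k f g : f =1 g -> fourier b k f = fourier b k g.
Proof. by move=> h; congr (_ * _); apply: period_int_ext => x; rewrite h. Qed.

Lemma fourier0 b k : fourier b k (fun=> 0) = 0.
Proof.
rewrite /fourier (@period_int_ext _ _ (fun=> 0)) ?period_int_cst ?mulr0//.
by move=> x; rewrite mul0r.
Qed.

Lemma fourier_sum b k n (F : 'I_n -> R -> R) : (forall i, continuous (F i)) ->
  fourier b k (fun x => \sum_(i < n) F i x) = \sum_(i < n) fourier b k (F i).
Proof.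
elim: n F => [|n IH] F cF.
  by rewrite big_ord0 -[RHS](fourier0 b k); apply: fourier_ext => x; rewrite big_ord0.
rewrite big_ord_recl -IH; last by move=> i; exact: cF.
rewrite -fourierD; [|exact: cF|].
  by apply: fourier_ext => x; rewrite big_ord_recl.
move=> x; rewrite (_ : (fun x => _) = \sum_(i < n) F (lift ord0 i)); last first.
  by apply/funext => y; rewrite fct_sumE.
by elim/big_ind : _ => [|u v hu hv|i _]; [exact: cst_continuous|exact: continuousD|exact: cF].
Qed.

Lemma fourier_bound b k f M : continuous f -> (forall x, `|f x| <= M) ->
  `|fourier b k f| <= 2 * M.
Proof.
move=> cf hM; have M0 : 0 <= M by exact: le_trans (normr_ge0 _) (hM 0).
have := pi_gt0 R => pi0.
have h : `|period_int (fun x => f x * trig b k x)| <= 2 * pi * M.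
  apply: period_int_bound; first exact: cprod.
  by move=> x; rewrite normrM -[leRHS]mulr1 ler_pM// trig_le1.
rewrite /fourier normrM normfV mulrC ler_pdivrMr; last by case: ifP => _;
  rewrite gtr0_norm ?mulr_gt0.
apply: le_trans h _; case: ifP => _; rewrite gtr0_norm ?mulr_gt0//.
  have : 0 <= M * pi by rewrite mulr_ge0// ltW.
  lra.
by lra.
Qed.

Lemma fourier_shift b k f : continuous f -> (forall x, f (x + 2 * pi) = f x) ->
  fourier b k (fun x => f (x + pi)) = (-1) ^+ k * fourier b k f.
Proof.
move=> cf pf; rewrite /fourier mulrCA; congr (_ * _).
rewrite -(period_intZ ((-1) ^+ k)); last exact: cprod.
rewrite -[in RHS]period_int_shift.
- apply: period_int_ext => x; transitivity ((-1) ^+ k * (-1) ^+ k * (f (x + pi) * trig b k x)).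
    by rewrite sgn2 mul1r.
  by rewrite trig_pi; ring.
- by apply: contZ; exact: cprod.
- by move=> x; rewrite pf trig_2pi.
Qed.

(* Only the part of f of the parity of k under x |-> x + pi matters. *)
Lemma fourier_parity_bound b k f M : continuous f -> (forall x, f (x + 2 * pi) = f x) ->
  (forall x, `|f x + (-1) ^+ k * f (x + pi)| <= M) -> `|fourier b k f| <= M.
Proof.
move=> cf pf hM.
have cs : continuous (fun x => f (x + pi)).
  move=> x; apply: (@continuous_comp _ _ _ (fun x => x + pi) f); last exact: cf.
  by apply: cvgD => //; exact: cvg_cst.
have cs' : continuous (fun x => (-1) ^+ k * f (x + pi)).
  exact: contZ.
have cg : continuous (fun x => f x + (-1) ^+ k * f (x + pi)).
  exact: contD.
(* Both summands have the same coefficient of index k, which cancels the factor 2 of this bound. *)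
have := fourier_bound b k cg hM.
rewrite fourierD// fourierZ// fourier_shift// mulrA -exprMn mulrNN mulr1 expr1n mul1r.
by move: (fourier _ _ _) => y; rewrite !ler_norml; lra.
Qed.

(** Product-to-sum formulas with the difference and the sum of the frequencies reduce each case to
    the mean of a single sine or cosine. *)
Lemma period_int_trig b b' j k : period_int (fun x => trig b j x * trig b' k x) =
  if (b == b') && (j == k) then
    if k == 0%N then if b then 0 else 2 * pi else pi
  else 0.
Proof.
have cs2 (n : int) : cos (2 * pi * n%:~R) = 1 :> R /\ sin (2 * pi * n%:~R) = 0 :> R.
  have -> : 2 * pi * n%:~R = 0 + n%:~R * (2 * pi) :> R by rewrite add0r mulrC.
  have pc x : cos (x + 2 * pi) = cos x by have := trig_2pi false 1 x; rewrite /trig !mul1r.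
  have ps x : sin (x + 2 * pi) = sin x by have := trig_2pi true 1 x; rewrite /trig !mul1r.
  by rewrite (periodic_int pc) (periodic_int ps) cos0 sin0.
have cc nu : continuous (fun x => cos (nu * x)) by move=> x; exact: der_cont (der_cosM nu x).
have ss nu : continuous (fun x => sin (nu * x)) by move=> x; exact: der_cont (der_sinM nu x).
have [hc1 hs1] := cs2 (j%:Z - k%:Z); have [hc2 hs2] := cs2 (j%:Z + k%:Z).
rewrite intrB in hc1 hs1; rewrite intrD in hc2 hs2.
pose u := j%:R - k%:R : R; pose v := j%:R + k%:R : R.
have u0 : (u == 0) = (j == k) by rewrite subr_eq0 eqr_nat.
have v0 : (v == 0) = (j == 0%N) && (k == 0%N) by rewrite /v -natrD pnatr_eq0 addn_eq0.
have uv x : j%:R * x = (u * x + v * x) / 2 /\ k%:R * x = (v * x - u * x) / 2.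
  by rewrite /u /v; split; field.
have jx x : u * x = j%:R * x - k%:R * x by rewrite mulrBl.
have kx x : v * x = j%:R * x + k%:R * x by rewrite mulrDl.
have cz nu c : continuous (fun x => c * cos (nu * x)).
  exact: contZ.
have sz nu c : continuous (fun x => c * sin (nu * x)).
  exact: contZ.
case: b; case: b' => /=.
- rewrite (@period_int_ext _ _ (fun x => 2^-1 * cos (u * x) + (- 2^-1) * cos (v * x))); last first.
    by move=> x; rewrite jx kx cosB cosD; field.
  rewrite period_intD// !period_intZ// !period_int_cos// u0 v0.
  case: (j =P k) => [->|jk]; first by rewrite andbb; case: ifP => _; field.
  have -> : (j == 0%N) && (k == 0%N) = false.
    by apply/negP => /andP[/eqP jj /eqP kk]; apply: jk; rewrite jj kk.
  by rewrite !mulr0 addr0.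
- rewrite (@period_int_ext _ _ (fun x => 2^-1 * sin (u * x) + 2^-1 * sin (v * x))); last first.
    by move=> x; rewrite jx kx sinB sinD; field.
  by rewrite period_intD// !period_intZ// !period_int_sin// mulr0 addr0.
- rewrite (@period_int_ext _ _ (fun x => (- 2^-1) * sin (u * x) + 2^-1 * sin (v * x))); last first.
    by move=> x; rewrite jx kx sinB sinD; field.
  by rewrite period_intD// !period_intZ// !period_int_sin// !mulr0 addr0.
- rewrite (@period_int_ext _ _ (fun x => 2^-1 * cos (u * x) + 2^-1 * cos (v * x))); last first.
    by move=> x; rewrite jx kx cosB cosD; field.
  rewrite period_intD// !period_intZ// !period_int_cos// u0 v0.
  case: (j =P k) => [->|jk]; first by rewrite andbb; case: ifP => _; field.
  have -> : (j == 0%N) && (k == 0%N) = false.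
    by apply/negP => /andP[/eqP jj /eqP kk]; apply: jk; rewrite jj kk.
  by rewrite !mulr0 addr0.
Qed.

Lemma fourier_trig b b' j k : fourier b' k (trig b j) =
  ((b == b') && (j == k) && ~~ ((k == 0%N) && b))%:R.
Proof.
have pi0 : pi != 0 :> R by rewrite gt_eqF ?pi_gt0.
rewrite /fourier period_int_trig.
case: (eqVneq b b') => [->|_] /=; last by rewrite mulr0.
case: (eqVneq j k) => [_|_] /=; last by rewrite mulr0.
case: (eqVneq k 0%N) => [_|k0] /=; last by rewrite mulVf.
by case: b'; rewrite ?mulr0// mulVf// mulf_neq0.
Qed.

Lemma fourier_poly n (c : bool -> nat -> R) b k : (k < n)%N -> ~~ (b && (k == 0%N)) ->
  fourier b k (fun x => \sum_(j < n) (c false j * trig false j x + c true j * trig true j x)) =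
    c b k.
Proof.
move=> kn bk; rewrite fourier_sum; last first.
  by move=> j; apply: contD; apply: contZ; exact: trig_cont.
under eq_bigr => j _.
  rewrite fourierD; try by apply: contZ; exact: trig_cont.
  rewrite !fourierZ; try exact: trig_cont.
  rewrite !fourier_trig; over.
rewrite (bigD1 (Ordinal kn))//= eqxx big1 ?addr0; last first.
  move=> j; rewrite -val_eqE/= => /negbTE ->; rewrite !andbF/=.
  by rewrite !mulr0 addr0.
by case: b bk => /=; case: (k =P 0%N) => //= _ _; rewrite ?mulr0 ?mulr1 ?addr0 ?add0r.
Qed.

End fourier_coefficients.

(** * Uniform Taylor expansions of the vector field *)

Section bounds_on_compacts.
Variable R : realType.

Lemma continuous_bounded (T : topologicalType) (A : set T) (f : T -> R) :
  compact A -> (forall x, A x -> {for x, continuous f}) ->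
  exists2 K, 0 <= K & forall x, A x -> `|f x| <= K.
Proof.
move=> cA cf; have [->|A0] := eqVneq A set0; first by exists 0.
have [||c _ hc] := @compact_EVT_max T R (fun x => `|f x|) A _ cA.
- exact/set0P.
- apply: continuous_in_subspaceT => x /set_mem Ax.
  by apply: cvg_norm; exact: cf.
- by exists `|f c| => // x Ax; apply: hc; exact/mem_set.
Qed.

Lemma box_compact n (rho : R) : compact [set x : 'cV[R]_n | forall j, `|x j 0| <= rho].
Proof.
have -> : [set x : 'cV[R]_n | forall j, `|x j 0| <= rho] =
    (fun u : 'rV[R]_n => u^T) @` [set v : 'rV[R]_n | forall i, `[- rho, rho]%classic (v ord0 i)].
  apply/seteqP; split=> [x hx|_ [v hv <-] j].
    exists x^T; last by rewrite trmxK.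
    by move=> j; rewrite /= mxE in_itv/= -ler_norml; exact: hx.
  by have := hv j; rewrite /= mxE in_itv/= -ler_norml.
apply: continuous_compact; last first.
  by apply: (@rV_compact R n (fun=> `[- rho, rho]%classic)) => i; exact: segment_compact.
apply: continuous_subspaceT => M s /= /nbhs_ballP[e e0 es].
apply/nbhs_ballP; exists e => //= N [h MN]; apply: es; split=> // i j.
by rewrite !mxE.
Qed.

End bounds_on_compacts.

Section chain_rules.
Variables (R : realType) (V : normedModType R).
Implicit Types (H : V -> R) (w : V).

Lemma der_chain H (ga : R -> V) (s : R) (dga : V) :
  is_derive s 1 ga dga -> differentiable H (ga s) ->
  is_derive s 1 (fun s => H (ga s)) ('D_dga H (ga s)).
Proof.
move=> [d1 d2] dH; have dg : differentiable ga s by exact/derivable1_diffP.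
apply: DeriveDef; first exact/derivable1_diffP/(differentiable_comp dg dH).
rewrite deriveE; last exact: (differentiable_comp dg dH).
have hd : 'd ga s 1 = dga by rewrite -deriveE.
by rewrite (diff_comp dg dH)/= hd deriveE.
Qed.

Lemma der_line H (a w : V) (s : R) : differentiable H (a + s *: w) ->
  is_derive s 1 (fun s => H (a + s *: w)) ('D_w H (a + s *: w)).
Proof.
move=> dH; apply: (der_chain (ga := fun s => a + s *: w)) => //.
apply: is_derive_eq (is_deriveD (is_derive_cst a s 1) (_ : is_derive s 1 (fun s : R => s *: w) w))
  _.
  apply: DeriveDef; first by apply/derivable1_diffP.
  by rewrite deriveE// diff_val/= scale1r.
by rewrite add0r.
Qed.

End chain_rules.

Section taylor_one_variable.
Variable R : realType.

(** [ph k] is the derivative of order k. The derivative of a remainder is the remainder of one order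
    less for [ph 1], and the mean value inequality restores one power of s. The factor 1/n! is not
    tracked, hence the plain M. *)
Lemma taylor_bound (n : nat) (ph : nat -> R -> R) (M : R) :
  (forall k (s : R), (k < n)%N -> `|s| <= 1 -> is_derive s 1 (ph k) (ph k.+1 s)) ->
  (forall s, `|s| <= 1 -> `|ph n s| <= M) ->
  forall s, `|s| <= 1 ->
    `|ph 0 s - \sum_(k < n) (k`!%:R^-1 * ph k 0) * s ^+ k| <= M * `|s| ^+ n.
Proof.
elim: n ph => [|n IH] ph dph hM s hs; first by rewrite big_ord0 subr0 mulr1 hM.
pose g s := ph 0 s - \sum_(k < n.+1) (k`!%:R^-1 * ph k 0) * s ^+ k.
pose dg s := ph 1 s - \sum_(k < n) (k`!%:R^-1 * ph k.+1 0) * s ^+ k.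
have dgE (x : R) : `|x| <= 1 -> is_derive x 1 g (dg x).
  move=> hx; apply: derB; first exact: dph.
  have dpow k : is_derive x 1 (fun y : R => (k`!%:R^-1 * ph k 0) * y ^+ k)
      ((k`!%:R^-1 * ph k 0) * (k%:R * x ^+ k.-1)).
    exact: derZ (derX k x).
  apply: is_derive_eq (der_sum (fun k : 'I_n.+1 => dpow k)) _.
  rewrite big_ord_recl/= mul0r mulr0 add0r; apply: eq_bigr => k _.
  rewrite /bump/= add1n factS natrM invfM mulrA; congr (_ * _).
  have a0 : k.+1%:R != 0 :> R by rewrite pnatr_eq0.
  have b0 : k`!%:R != 0 :> R by rewrite pnatr_eq0 -lt0n fact_gt0.
  by move: (k.+1%:R) (k`!%:R) a0 b0 => u v u0 v0; field; rewrite ?u0 ?v0.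
have g0 : g 0 = 0.
  rewrite /g big_ord_recl/= expr0 mulr1 fact0 invr1 mul1r big1 ?addr0 ?subrr//.
  by move=> k _; rewrite expr0n mulr0.
have hdg x : `|x| <= `|s| -> `|dg x| <= M * `|s| ^+ n.
  move=> hx; have hx1 := le_trans hx hs.
  apply: le_trans (IH (fun k => ph k.+1) (fun k y kn hy => dph k.+1 y kn hy) hM x hx1) _.
  rewrite ler_wpM2l//; first by apply: le_trans (normr_ge0 _) (hM 0 _); rewrite normr0.
  by rewrite lerXn2r// nnegrE.
have hseg x : Num.min 0 s <= x <= Num.max 0 s -> `|x| <= `|s|.
  move=> /andP[]; rewrite ler_norml.
  by have [s0|s0] := lerP 0 s => h1 h2; rewrite ?(ger0_norm s0) ?(ltr0_norm s0); lra.
have := @der_bound R g dg 0 s (M * `|s| ^+ n) (fun x hx => dgE x (le_trans (hseg x hx) hs))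
  (fun x hx => hdg x (hseg x hx)).
by rewrite g0 !subr0 exprSr mulrA.
Qed.

End taylor_one_variable.

Section smooth_periodic_functions.
Variables (R : realType) (n : nat).
Local Notation V3 := ('cV[R]_n * R * R)%type.
Implicit Types (H : V3 -> R) (u x y : 'cV[R]_n) (t l : R).

Definition smper H := smooth_on setT H /\ forall x t l, H (x, t + 2 * pi, l) = H (x, t, l).

Lemma smper_diff H a : smper H -> differentiable H a.
Proof. by move=> [hs _]; have [h _] := hs 1; exact: h. Qed.

Lemma smper_cont H : smper H -> continuous H.
Proof. by move=> hs a; apply: differentiable_continuous; exact: smper_diff. Qed.

Lemma smper_derive H w : smper H -> smper (fun a => 'D_w H a).
Proof.
move=> [hs hp]; split=> [k|x t l]; first by have [_ h] := hs k.+1; exact: h.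
have hp' (a : V3) : H (a + (0, 2 * pi, 0)) = H a.
  by case: a => -[x' t'] l'; rewrite -[RHS]hp; congr H; congr (_, _, _); rewrite /= addr0.
have E : (fun h : R => h^-1 *: ((H \o shift (x, t + 2 * pi, l)) (h *: w) - H (x, t + 2 * pi, l))) =
    (fun h : R => h^-1 *: ((H \o shift (x, t, l)) (h *: w) - H (x, t, l))).
  apply/funext => h /=; rewrite hp -[in RHS]hp'; congr (_ *: (H _ - _)).
  by rewrite -addrA; congr (_ + _); congr (_, _, _); rewrite /= addr0.
by rewrite /derive E.
Qed.

(** Directions without theta component: theta enters these expansions as a parameter only. *)
Definition dir u (c : R) : V3 := (u, 0, c).
Definition edir j := dir (delta_mx j 0) 0.

Lemma derive_dir H u c a : smper H ->
  'D_(dir u c) H a = \sum_j u j 0 * 'D_(edir j) H a + c * 'D_(dir 0 1) H a.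
Proof.
move=> hs; have hd := smper_diff a hs.
rewrite !deriveE//; under eq_bigr do rewrite deriveE//.
have -> : dir u c = \sum_j u j 0 *: edir j + c *: dir 0 1.
  have hs1 (I : finType) (f : I -> V3) : (\sum_i f i).1.1 = \sum_i (f i).1.1.
    by elim/big_rec2 : _ => // i _ v _ <-.
  have hs2 (I : finType) (f : I -> V3) : (\sum_i f i).1.2 = \sum_i (f i).1.2.
    by elim/big_rec2 : _ => // i _ v _ <-.
  have hs3 (I : finType) (f : I -> V3) : (\sum_i f i).2 = \sum_i (f i).2.
    by elim/big_rec2 : _ => // i _ v _ <-.
  rewrite [RHS]surjective_pairing [X in (X, _)]surjective_pairing /=.
  rewrite hs1 hs2 hs3 /=; congr (_, _, _).
  - rewrite scaler0 addr0; apply/colP => i; rewrite summxE (bigD1 i)//= big1 => [|j ji].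
      by rewrite !mxE !eqxx mulr1 addr0.
    by rewrite !mxE eq_sym (negbTE ji) mulr0.
  - by rewrite scaler0 addr0 big1// => i _; rewrite scaler0.
  - by rewrite big1 ?add0r ?[LHS]mulr1 1?[RHS]mulr1// => i _; rewrite scaler0.
rewrite linearD linear_sum linearZ/=; congr (_ + _).
by apply: eq_bigr => j _; rewrite linearZ.
Qed.

Section local_bounds.
Variable (ls : R).

(** Periodicity brings t into [0, 2 pi], which makes the set of arguments compact. *)
Lemma smper_bounded H (rho : R) : smper H ->
  exists2 K, 0 <= K & forall x t l, (forall j, `|x j 0| <= rho) -> `|l - ls| <= 1 ->
    `|H (x, t, l)| <= K.
Proof.
move=> hs.
have [||K K0 hK] := @continuous_bounded R V3
   (([set x : 'cV[R]_n | forall j, `|x j 0| <= rho] `*` `[0, 2 * pi]%classic) `*` `[ls - 1,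
     ls + 1]%classic) H.
- by apply: compact_setX; [apply: compact_setX;
  [exact: box_compact|exact: segment_compact]|exact: segment_compact].
- by move=> a _; exact: smper_cont.
exists K => // x t l hx hl.
have [s s02 ->] := @periodic_reduce R (fun t => H (x, t, l)) (hs.2 x ^~ l) t.
apply: hK; split=> /=; first by split=> //=; rewrite in_itv.
by rewrite in_itv/=; move: hl; rewrite ler_norml; lra.
Qed.

Lemma smper_lipschitz H (rho : R) : smper H ->
  exists2 K, 0 <= K & forall x y t l l' d, (forall j, `|x j 0| <= rho) -> (forall j, `|y j 0| <=
    rho) ->
    `|l - ls| <= 1 -> `|l' - ls| <= 1 -> (forall j, `|x j 0 - y j 0| <= d) -> `|l - l'| <= d ->
    `|H (x, t, l) - H (y, t, l')| <= K * d.
Proof.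
move=> hs.
have hb w : exists K, 0 <= K /\ forall x t l, (forall j, `|x j 0| <= rho) -> `|l - ls| <= 1 ->
    `|'D_w H (x, t, l)| <= K.
  by have [K K0 hK] := smper_bounded rho (smper_derive w hs); exists K.
have [Kj hKj] := choice (fun j => hb (edir j)); have [K1 [K10 hK1]] := hb (dir 0 1).
exists (\sum_j Kj j + K1); first by rewrite addr_ge0// sumr_ge0// => j _; exact: (hKj j).1.
move=> x y t l l' d hx hy hl hl' hd hdl.
pose a : V3 := (y, t, l'); pose w := dir (x - y) (l - l').
have aE s : a + s *: w = (y + s *: (x - y), t, l' + s * (l - l')).
  by congr (_, _, _); rewrite /= scaler0 addr0.
have := @der_bound R (fun s => H (a + s *: w)) (fun s => 'D_w H (a + s *: w)) 0 1
  ((\sum_j Kj j + K1) * d) (fun s _ => der_line (smper_diff _ hs)).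
rewrite !aE !scale0r !scale1r mul0r mul1r !addr0 subr0 normr1 mulr1 ![_ + (_ - _)]addrC !subrK;
  apply => s.
have min01 : Num.min 0 1 = 0 :> R by apply/min_idPl.
have max01 : Num.max 0 1 = 1 :> R by apply/max_idPr.
rewrite min01 max01 => /andP[s0 s1].
have conv (p q r : R) : `|p| <= r -> `|q| <= r -> `|p + s * (q - p)| <= r.
  by rewrite !ler_norml => /andP[p1 p2] /andP[q1 q2]; nra.
have hz j : `|(y + s *: (x - y)) j 0| <= rho by rewrite !mxE; exact: conv.
have hzl : `|l' + s * (l - l') - ls| <= 1.
  have -> : l' + s * (l - l') - ls = (l' - ls) + s * ((l - ls) - (l' - ls)) by ring.
  exact: conv.
rewrite aE derive_dir// (mulrDl (\sum_j Kj j)); apply: le_trans (ler_normD _ _) _; apply: lerD.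
  apply: le_trans (ler_norm_sum _ _ _) _; rewrite mulr_suml; apply: ler_sum => j _.
  rewrite normrM mulrC; apply: ler_pM => //; first exact: (hKj j).2.
  by have := hd j; rewrite !mxE.
by rewrite normrM mulrC; apply: ler_pM => //; exact: hK1.
Qed.

End local_bounds.

Fixpoint iter_derive (k : nat) (w : V3) H : V3 -> R :=
  if k is k'.+1 then iter_derive k' w (fun a => 'D_w H a) else H.

Lemma iter_derive_smper k w H : smper H -> smper (iter_derive k w H).
Proof. by elim: k H => [//|k IH] H hs; apply: IH; exact: smper_derive. Qed.

Lemma iter_deriveS k w H a : iter_derive k.+1 w H a = 'D_w (iter_derive k w H) a.
Proof. by elim: k H => [//|k IH] H; exact: IH. Qed.

Lemma iter_derive_sum k w (I : Type) (r : seq I) (c : I -> R) (F : I -> V3 -> R) a :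
  (forall i, smper (F i)) ->
  iter_derive k w (fun a => \sum_(i <- r) c i * F i a) a =
    \sum_(i <- r) c i * iter_derive k w (F i) a.
Proof.
elim: k F a => [//|k IH] F a hF.
rewrite -[RHS](IH (fun i a => 'D_w (F i) a)); last by move=> i; exact: smper_derive.
rewrite /=; congr (iter_derive k w _ a); apply/funext => b.
have dF i : is_derive b w (F i) ('D_w (F i) b) by apply/derivableP/diff_derivable/smper_diff.
have : is_derive b w (fun a => \sum_(i <- r) c i * F i a) (\sum_(i <- r) c i * 'D_w (F i) b).
  elim: r {IH} => [|i r IHr].
    by rewrite big_nil (_ : (fun a => _) = (fun=> 0)) ?boolp.funeqE => [|x];
      [exact: der_cst|rewrite big_nil].
  rewrite big_cons (_ : (fun a => _) = (fun a => c i * F i a + \sum_(j <- r) c j * F j a)).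
    by apply: derD IHr; exact: derZ.
  by apply/funext => x; rewrite big_cons.
by case.
Qed.

(** Expanding one derivative along the coordinate directions shows, by induction, that the
    derivative of order k along u is a form of degree k in u. Bounds uniform in u follow, and so
    does the membership of Taylor terms in [hom]. *)
Lemma iter_derive_dir k u H : smper H ->
  iter_derive k.+1 (dir u 0) H =
  (fun a => \sum_j u j 0 * iter_derive k (dir u 0) (fun b => 'D_(edir j) H b) a).
Proof.
move=> hs; apply/funext => a; rewrite -iter_derive_sum; last by move=> j; exact: smper_derive.
rewrite /=; congr (iter_derive k _ _ a); apply/funext => b.
by rewrite derive_dir// mul0r addr0.
Qed.

Lemma iter_derive_bounded ls k H (rho : R) : smper H ->
  exists2 K, 0 <= K & forall u x t l, (forall j, `|u j 0| <= rho) ->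
    (forall j, `|x j 0| <= rho) -> `|l - ls| <= 1 -> `|iter_derive k (dir u 0) H (x, t, l)| <= K.
Proof.
elim: k H => [|k IH] H hs.
  by have [K K0 hK] := smper_bounded ls rho hs; exists K => // u x t l _; exact: hK.
have hb j : exists K, 0 <= K /\ forall u x t l, (forall j, `|u j 0| <= rho) ->
    (forall j, `|x j 0| <= rho) -> `|l - ls| <= 1 ->
    `|iter_derive k (dir u 0) (fun b => 'D_(edir j) H b) (x, t, l)| <= K.
  by have [K K0 hK] := IH _ (smper_derive (edir j) hs); exists K.
have [Kj hKj] := choice hb; exists (\sum_j `|rho| * Kj j).
  by rewrite sumr_ge0// => j _; rewrite mulr_ge0//; exact: (hKj j).1.
move=> u x t l hu hx hl; rewrite iter_derive_dir//.
apply: le_trans (ler_norm_sum _ _ _) _; apply: ler_sum => j _.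
rewrite normrM; apply: ler_pM => //; last exact: (hKj j).2.
exact: le_trans (hu j) (ler_norm _).
Qed.

End smooth_periodic_functions.
Arguments edir {R n} j.

Section smooth_in_the_plane.
Variable R : realType.
Implicit Types (f : R * R -> R) (t l : R).

Lemma der_left f t l : differentiable f (t, l) ->
  is_derive t 1 (fun t => f (t, l)) ('D_(1, 0) f (t, l)).
Proof.
have E s : (0, l) + s *: (1, 0) = (s, l) :> R * R.
  by congr (_, _); rewrite /= ?add0r ?scaler0 ?addr0//; exact: mulr1.
rewrite -E => h; have := der_line h; congr is_derive.
by apply/funext => s; rewrite E.
Qed.

Lemma der_right f t l : differentiable f (t, l) ->
  is_derive l 1 (fun l => f (t, l)) ('D_(0, 1) f (t, l)).
Proof.
have E s : (t, 0) + s *: (0, 1) = (t, s) :> R * R.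
  by congr (_, _); rewrite /= ?add0r ?scaler0 ?addr0//; exact: mulr1.
rewrite -E => h; have := der_line h; congr is_derive.
by apply/funext => s; rewrite E.
Qed.

Lemma C1_entry (V : normedModType R) (A : set V) (p q : nat) (F : V -> 'M[R]_(p, q)) i j :
  open A -> Ck_on 1 A F -> Ck_on 1 A (fun x => F x i j).
Proof.
move=> oA [h1 h2].
have dij x : A x -> differentiable (fun x => F x i j) x.
  by move=> Ax; exact: (differentiable_comp (h1 x Ax) (@differentiable_coord R p q (F x) i j)).
split=> // u x Ax.
have E y : A y -> 'D_u (fun x => F x i j) y = ('D_u F y) i j.
  move=> Ay; have dF : derivable F y u := diff_derivable (h1 y Ay).
  by rewrite (derive_mx dF) mxE.
have hc : {for x, continuous (fun y => ('D_u F y) i j)}.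
  apply: (@continuous_comp _ _ _ (fun y => 'D_u F y) (fun M : 'M[R]_(p, q) => M i j));
    first exact: h2.
  exact: coord_continuous.
rewrite /prop_for /continuous_at E//; apply: cvg_trans hc; apply: near_eq_cvg.
by apply: filterS (open_nbhs_nbhs (conj oA Ax)) => y Ay; rewrite E.
Qed.

Lemma periodic_continuous_bounded (g : R -> R) : (forall t, g (t + 2 * pi) = g t) -> continuous g ->
  exists2 K, 0 <= K & forall t, `|g t| <= K.
Proof.
move=> pg cg; have [K K0 hK] := continuous_bounded (@segment_compact R 0 (2 * pi)) (fun t _ =>
  cg t).
exists K => // t; have [s hs ->] := periodic_reduce pg t.
by apply: hK; rewrite /= in_itv.
Qed.

Lemma periodic_continuous_lower_bound (g : R -> R) : (forall t, g (t + 2 * pi) = g t) ->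
  continuous g ->
  (forall t, g t != 0) -> exists2 d, 0 < d & forall t, d <= `|g t|.
Proof.
move=> pg cg g0.
have [K K0 hK] := @periodic_continuous_bounded (fun t => (g t)^-1) (fun t => congr1 _ (pg t))
  (fun t => cvgV (g0 t) (cg t)).
have K1 : 0 < K + 1 by lra.
exists (K + 1)^-1; first by rewrite invr_gt0.
move=> t; rewrite -[leRHS]invrK lef_pV2 ?posrE ?invr_gt0 ?normr_gt0//.
by rewrite -normfV; apply: le_trans (hK t) _; lra.
Qed.

End smooth_in_the_plane.

(** * Homogeneous forms whose coefficients are Lipschitz in lambda, uniformly in theta *)

Section polynomial_forms.
Variables (R : realType) (ls : R).
Implicit Types (c : R -> R -> R) (t l : R).

(** All that is kept of the smoothness of a coefficient: a bound and a Lipschitz estimate against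
    its value at [ls], both uniform in theta. The class is closed under sums, products and inverses
    of functions bounded away from 0. *)
Definition lipb c := exists K, \forall l \near ls, forall t,
  `|c t l| <= K /\ `|c t l - c t ls| <= K * `|l - ls|.

Lemma near_fin (I : finType) (Q : I -> R -> Prop) :
  (forall i, \forall l \near ls, Q i l) -> \forall l \near ls, forall i, Q i l.
Proof. by move=> h; apply: (@filter_forall _ _ _ (nbhs ls) _). Qed.

Lemma lipb_pos c : lipb c -> exists2 K, 0 <= K & \forall l \near ls, forall t,
  `|c t l| <= K /\ `|c t l - c t ls| <= K * `|l - ls|.
Proof.
move=> [K hK]; exists `|K| => //; near=> l => t.
have [|h1 h2] := (near hK l) _ t; first by [].
split; first exact: le_trans h1 (ler_norm _).
by apply: le_trans h2 _; rewrite ler_wpM2r// ler_norm.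
Unshelve. all: by end_near. Qed.

Lemma lipb_cst (k : R) : lipb (fun _ _ => k).
Proof.
exists `|k|; near=> l => t; split=> //.
by rewrite subrr normr0 mulr_ge0.
Unshelve. all: by end_near. Qed.

Lemma lipbD c d : lipb c -> lipb d -> lipb (fun t l => c t l + d t l).
Proof.
move=> [K hK] [L hL]; exists (K + L); near=> l => t.
have [|h1 h2] := (near hK l) _ t; first by [].
have [|h3 h4] := (near hL l) _ t; first by [].
split; first by apply: le_trans (ler_normD _ _) _; exact: lerD.
have -> : c t l + d t l - (c t ls + d t ls) = (c t l - c t ls) + (d t l - d t ls) by ring.
by rewrite mulrDl; apply: le_trans (ler_normD _ _) _; exact: lerD.
Unshelve. all: by end_near. Qed.

Lemma lipbM c d : lipb c -> lipb d -> lipb (fun t l => c t l * d t l).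
Proof.
move=> /lipb_pos[K K0 hK] /lipb_pos[L L0 hL]; exists (2 * (K * L)); near=> l => t.
have [|h1 h2] := (near hK l) _ t; first by [].
have [|h3 h4] := (near hL l) _ t; first by [].
have [h5 _] := nbhs_singleton hK t.
have h6 : `|c t l * d t l| <= K * L by rewrite normrM ler_pM.
have KL : 0 <= K * L by exact: mulr_ge0.
split; first by apply: le_trans h6 _; lra.
have -> : c t l * d t l - c t ls * d t ls = (c t l - c t ls) * d t l + c t ls * (d t l - d t ls)
  by ring.
have -> : 2 * (K * L) * `|l - ls| = (K * `|l - ls|) * L + K * (L * `|l - ls|) by ring.
by apply: le_trans (ler_normD _ _) _; rewrite !normrM; apply: lerD; exact: ler_pM.
Unshelve. all: by end_near. Qed.

Lemma lipb_sum (I : Type) (r : seq I) (P : pred I) (c : I -> R -> R -> R) :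
  (forall i, P i -> lipb (c i)) -> lipb (fun t l => \sum_(i <- r | P i) c i t l).
Proof.
move=> hc; elim: r => [|i r IH].
  by have := lipb_cst 0; congr lipb; apply/funext => t; apply/funext => l; rewrite big_nil.
case: (boolP (P i)) => Pi.
  have := lipbD (hc i Pi) IH; congr lipb; apply/funext => t; apply/funext => l.
  by rewrite big_cons Pi.
move: IH; congr lipb; apply/funext => t; apply/funext => l.
by rewrite big_cons (negbTE Pi).
Qed.

Lemma lipb_prod (I : Type) (r : seq I) (P : pred I) (c : I -> R -> R -> R) :
  (forall i, P i -> lipb (c i)) -> lipb (fun t l => \prod_(i <- r | P i) c i t l).
Proof.
move=> hc; elim: r => [|i r IH].
  by have := lipb_cst 1; congr lipb; apply/funext => t; apply/funext => l; rewrite big_nil.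
case: (boolP (P i)) => Pi.
  have := lipbM (hc i Pi) IH; congr lipb; apply/funext => t; apply/funext => l.
  by rewrite big_cons Pi.
move: IH; congr lipb; apply/funext => t; apply/funext => l.
by rewrite big_cons (negbTE Pi).
Qed.

Lemma near_dist (d : R) : 0 < d -> \forall l \near ls, `|l - ls| <= d.
Proof.
move=> d0; apply/nbhs_ballP; exists d => // l.
by rewrite /ball/= distrC => /ltW.
Qed.

Lemma lipbV c (d : R) : lipb c -> 0 < d -> (forall t, d <= `|c t ls|) -> lipb (fun t l =>
  (c t l)^-1).
Proof.
(* Near [ls] one has |c| >= d / 2, so the inverse is at most 2 / d; the difference of the inverses
   is the difference of the values over a product that is at least d^2 / 2. *)
move=> /lipb_pos[K K0 hK] d0 hd; exists (2 / d + 2 * K / d ^+ 2).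
have d20 : 0 < d / 2 by rewrite divr_gt0.
have K10 : 0 < K + 1 by lra.
near=> l => t.
have [|_ h2] := (near hK l) _ t; first by [].
have h3 : `|l - ls| <= d / 2 / (K + 1) by near: l; apply: near_dist; rewrite divr_gt0.
have h4 : K * `|l - ls| <= d / 2.
  rewrite ler_pdivlMr// in h3; have := normr_ge0 (l - ls); lra.
have h1 := hd t.
have h5 : d / 2 <= `|c t l|.
  by have := ler_distD 0 (c t ls) (c t l); have := lerB_dist (c t ls) (c t l);
    rewrite (distrC (c t ls)); lra.
have c0 : c t l != 0 by rewrite -normr_gt0; lra.
have cs0 : c t ls != 0 by rewrite -normr_gt0; lra.
have inv1 : `|(c t l)^-1| <= 2 / d.
  by rewrite normfV -[2 / d]invf_div lef_pV2// ?posrE//; lra.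
have inv2 : `|(c t ls)^-1| <= d^-1.
  by rewrite normfV lef_pV2// ?posrE//; lra.
have K2 : 0 <= 2 * K / d ^+ 2 by apply: divr_ge0; [exact: mulr_ge0|exact: sqr_ge0].
have d2 : 0 <= 2 / d by rewrite divr_ge0// ltW.
split; first lra.
have -> : (c t l)^-1 - (c t ls)^-1 = - (c t l - c t ls) * ((c t l)^-1 * (c t ls)^-1).
  by field; rewrite c0 cs0.
rewrite normrM normrN normrM.
apply: le_trans (_ : K * `|l - ls| * (2 / d * d^-1) <= _).
  by apply: ler_pM => //; exact: ler_pM.
have -> : K * `|l - ls| * (2 / d * d^-1) = 2 * K / d ^+ 2 * `|l - ls|.
  by field; rewrite gt_eqF.
by rewrite ler_wpM2r// lerDr.
Unshelve. all: by end_near. Qed.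

Lemma lipb_near c d : (\forall l \near ls, forall t, c t l = d t l) -> lipb c -> lipb d.
Proof.
move=> h [K hK]; exists K; have h0 := nbhs_singleton h; near=> l => t.
have [|h1 h2] := (near hK l) _ t; first by [].
have hl : forall t, c t l = d t l by near: l.
by rewrite -hl -h0.
Unshelve. all: by end_near. Qed.

Lemma lipb_det k (A : R -> R -> 'M[R]_k) : (forall i j, lipb (fun t l => A t l i j)) ->
  lipb (fun t l => \det (A t l)).
Proof.
move=> hA; apply: lipb_sum => s _; apply: lipbM; first exact: lipb_cst.
by apply: lipb_prod => i _; exact: hA.
Qed.

Lemma lipb_invmx k (A : R -> R -> 'M[R]_k) (d : R) : (forall i j, lipb (fun t l => A t l i j)) ->
  0 < d -> (forall t, d <= `|\det (A t ls)|) -> (\forall l \near ls, forall t, A t l \in unitmx) ->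
  forall i j, lipb (fun t l => invmx (A t l) i j).
Proof.
move=> hA d0 hd hu i j.
have hdet : lipb (fun t l => (\det (A t l))^-1) by apply: lipbV d0 hd; exact: lipb_det.
have hcof : lipb (fun t l => cofactor (A t l) j i).
  apply: lipbM; first exact: lipb_cst.
  by apply: lipb_det => i' j'; apply: lipb_near (hA _ _); near=> l => t; rewrite !mxE.
apply: lipb_near (lipbM hdet hcof); near=> l => t.
have hut : A t l \in unitmx by move: t; near: l.
by rewrite /invmx hut !mxE.
Unshelve. all: by end_near. Qed.

Section smooth_coefficients.
Variable U : set R.
Hypotheses (oU : open U) (Uls : U ls).

Let oA : open (setT `*` U : set (R * R)).
Proof.
rewrite (_ : _ `*` _ = @snd R R @^-1` U); last by apply/seteqP; split=> [a []|a]//.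
by apply: open_comp => // a _; exact: cvg_snd.
Qed.

Lemma C1_periodic_lipb (c : R -> R -> R) : Ck_on 1 (setT `*` U) (fun a : R * R => c a.1 a.2) ->
  (forall t l, U l -> c (t + 2 * pi) l = c t l) -> lipb c.
Proof.
move=> [h1 h2] pc; pose f (a : R * R) := c a.1 a.2.
have [d d0 hd] : exists2 d : R, 0 < d & forall l, `|l - ls| <= d -> U l.
  have /nbhs_ballP[e /= e0 he] := open_nbhs_nbhs (conj oU Uls).
  exists (e / 2); first by rewrite divr_gt0.
  by move=> l hl; apply: he; rewrite /ball/= distrC; apply: le_lt_trans hl _;
    rewrite ltr_pdivrMr//; lra.
have inI l : `[ls - d, ls + d]%classic l -> U l.
  by rewrite /= in_itv/= => h; apply: hd; rewrite ler_norml; lra.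
have cmp := compact_setX (@segment_compact R 0 (2 * pi)) (@segment_compact R (ls - d) (ls + d)).
have [|K K0 hK] := continuous_bounded cmp (f := f).
  by move=> a [_ /= h]; apply/differentiable_continuous/h1; split=> //; exact: inI.
have [|L L0 hL] := continuous_bounded cmp (f := fun a => 'D_(0, 1) f a).
  by move=> a [_ /= h]; apply: h2; split=> //; exact: inI.
exists (K + L); near=> l => t.
have hl : `|l - ls| <= d by near: l; exact: near_dist.
have Ul : U l by exact: hd.
have [m hm] := period_reduce t; set s := t + m%:~R * (2 * pi) in hm.
have cE x : U x -> c t x = c s x by move=> Ux; rewrite /s (periodic_int (fun t => pc t x Ux)).
rewrite !cE//; have lI x : `|x - ls| <= d -> (`[0, 2 * pi] `*` `[ls - d, ls + d])%classic (s, x).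
  by move=> hx; split; rewrite /= in_itv//=; move: hx; rewrite ler_norml; lra.
split; first by apply: le_trans (hK _ (lI l hl)) _; rewrite lerDl.
have hx x : Num.min ls l <= x <= Num.max ls l -> `|x - ls| <= d.
  move: hl; rewrite !ler_norml => /andP[h3 h4] /andP[]; have [h|h] := lerP ls l => h5 h6; lra.
apply: le_trans (@der_bound R (c s) (fun x => 'D_(0, 1) f (s, x)) ls l L _ _) _.
- move=> x /hx hd'; apply: (@der_right R f s x); apply: h1; split=> //; exact: hd.
- by move=> x /hx hd'; apply: hL; exact: lI.
- by rewrite ler_wpM2r// lerDr.
Unshelve. all: by end_near. Qed.

End smooth_coefficients.

Variable n : nat.
Implicit Types (q : R -> R -> 'cV[R]_n -> R) (x y : 'cV[R]_n).

Lemma lipb_smper (H : 'cV[R]_n * R * R -> R) (v : R -> R -> 'cV[R]_n) :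
  smper H -> (forall j, lipb (fun t l => v t l j 0)) -> lipb (fun t l => H (v t l, t, l)).
Proof.
move=> hs hv.
have [Kj hKj] := choice (fun j => let: ex_intro2 K K0 hK := lipb_pos (hv j) in
   ex_intro (fun K => 0 <= K /\ \forall l \near ls, forall t,
      `|v t l j 0| <= K /\ `|v t l j 0 - v t ls j 0| <= K * `|l - ls|) K (conj K0 hK)).
pose rho := \sum_j Kj j.
have hrho j : Kj j <= rho.
  by rewrite /rho (bigD1 j)//= lerDl sumr_ge0// => i _; exact: (hKj i).1.
have rho0 : 0 <= rho by rewrite sumr_ge0// => i _; exact: (hKj i).1.
have hall : \forall l \near ls, forall j t, `|v t l j 0| <= rho /\ `|v t l j 0 - v t ls j 0| <=
  rho * `|l - ls|.
  have : \forall l \near ls, forall j, forall t, `|v t l j 0| <=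
    Kj j /\ `|v t l j 0 - v t ls j 0| <= Kj j * `|l - ls|.
    by apply: near_fin => j; exact: (hKj j).2.
  apply: filterS => l h j t; have [h1 h2] := h j t; split; first exact: le_trans h1 (hrho j).
  by apply: le_trans h2 _; rewrite ler_wpM2r.
have [K K0 hK] := smper_bounded ls rho hs; have [L L0 hL] := smper_lipschitz ls rho hs.
exists (K + L * (rho + 1)); near=> l => t.
have l1 : `|l - ls| <= 1 by near: l; exact: near_dist.
have [|h1 h2] := all_and2 (fun j => (near hall l) _ j t); first by [].
have [h3 _] := all_and2 (fun j => nbhs_singleton hall j t).
split; first by apply: le_trans (hK _ _ _ h1 l1) _; rewrite lerDl mulr_ge0// addr_ge0.
apply: le_trans (hL _ _ _ _ _ ((rho + 1) * `|l - ls|) h1 h3 l1 _ _ _) _.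
- by rewrite subrr normr0.
- by move=> j; apply: le_trans (h2 j) _; rewrite mulrDl lerDl mul1r.
- by rewrite mulrDl mul1r lerDr mulr_ge0.
- by rewrite mulrA ler_wpM2r// lerDr.
Unshelve. all: by end_near. Qed.

(** Forms of degree k in x with [lipb] coefficients, encoded by splitting off one linear factor at a
    time. Bounds, Lipschitz estimates and compositions then go by induction on k, without
    multi-indices. *)
Fixpoint hom k q : Prop :=
  if k is k'.+1 then exists qj : 'I_n -> R -> R -> 'cV[R]_n -> R,
    (forall j, hom k' (qj j)) /\ forall t l x, q t l x = \sum_j x j 0 * qj j t l x
  else exists c, lipb c /\ forall t l x, q t l x = c t l.

Lemma hom_ext k q q' : (forall t l x, q t l x = q' t l x) -> hom k q -> hom k q'.
Proof.
by move=> h; rewrite (_ : q' = q)//; apply/funext => t; apply/funext => l; apply/funext => x.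
Qed.

Lemma homD k q q' : hom k q -> hom k q' -> hom k (fun t l x => q t l x + q' t l x).
Proof.
elim: k q q' => [|k IH] q q' /=.
  move=> [c [hc qE]] [d [hd q'E]]; exists (fun t l => c t l + d t l); split; first exact: lipbD.
  by move=> t l x; rewrite qE q'E.
move=> [qj [hj qE]] [q'j [h'j q'E]]; exists (fun j t l x => qj j t l x + q'j j t l x); split.
  by move=> j; exact: IH.
by move=> t l x; rewrite qE q'E -big_split; apply: eq_bigr => j _; rewrite mulrDr.
Qed.

Lemma homZ k c q : lipb c -> hom k q -> hom k (fun t l x => c t l * q t l x).
Proof.
move=> hc; elim: k q => [|k IH] q /=.
  by move=> [d [hd qE]]; exists (fun t l => c t l * d t l); split; [exact: lipbM|move=> t l x;
    rewrite qE].
move=> [qj [hj qE]]; exists (fun j t l x => c t l * qj j t l x); split; first by move=> j;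
  exact: IH.
by move=> t l x; rewrite qE mulr_sumr; apply: eq_bigr => j _; rewrite mulrCA.
Qed.

Lemma hom0 k : hom k (fun _ _ _ => 0).
Proof.
elim: k => [|k IH] /=; first by exists (fun _ _ => 0); split => //; exact: lipb_cst.
by exists (fun _ _ _ _ => 0); split=> // t l x; rewrite big1// => j _; rewrite mulr0.
Qed.

Lemma hom_sum k (I : Type) (r : seq I) (F : I -> R -> R -> 'cV[R]_n -> R) :
  (forall i, hom k (F i)) -> hom k (fun t l x => \sum_(i <- r) F i t l x).
Proof.
move=> hF; elim: r => [|i r IH].
  by apply: hom_ext (hom0 k) => t l x; rewrite big_nil.
by apply: hom_ext (homD (hF i) IH) => t l x; rewrite big_cons.
Qed.

(** The constant and the neighbourhood of [ls] are fixed before t, x, y and d, which makes the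
    estimates usable along unknown curves. *)
Lemma hom_bounds k q (rho : R) : hom k q -> 0 <= rho -> exists2 K, 0 <= K & \forall l \near ls,
  forall t x y d,
  (forall j, `|x j 0| <= rho) -> (forall j, `|y j 0| <= rho) -> (forall j, `|x j 0 - y j 0| <=
    d) -> 0 <= d ->
  [/\ `|q t l x| <= K, `|q t l x - q t l y| <= K * d & `|q t l x - q t ls x| <= K * `|l - ls|].
Proof.
move=> + rho0; elim: k q => [|k IH] q /=.
  move=> [c [/lipb_pos[K K0 hK] qE]]; exists K => //; near=> l => t x y d _ _ _ d0;
    rewrite !qE subrr normr0.
  have [|h1 h2] := (near hK l) _ t; first by [].
  by split=> //; exact: mulr_ge0.
move=> [qj [hj qE]].
have [Kj hKj] := choice (fun j => let: ex_intro2 K K0 hK := IH _ (hj j) in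
   ex_intro (fun K => 0 <= K /\ \forall l \near ls, forall t x y d,
  (forall j, `|x j 0| <= rho) -> (forall j, `|y j 0| <= rho) -> (forall j, `|x j 0 - y j 0| <=
    d) -> 0 <= d ->
  [/\ `|qj j t l x| <= K, `|qj j t l x - qj j t l y| <= K * d & `|qj j t l x - qj j t ls x| <=
    K * `|l - ls|])
   K (conj K0 hK)).
have hall : \forall l \near ls, forall j, forall t x y d,
  (forall j, `|x j 0| <= rho) -> (forall j, `|y j 0| <= rho) -> (forall j, `|x j 0 - y j 0| <=
    d) -> 0 <= d ->
  [/\ `|qj j t l x| <= Kj j, `|qj j t l x - qj j t l y| <=
    Kj j * d & `|qj j t l x - qj j t ls x| <= Kj j * `|l - ls|].
  by apply: near_fin => j; exact: (hKj j).2.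
have Kj0 j : 0 <= Kj j by exact: (hKj j).1.
exists (\sum_j (rho + 1) * Kj j); first by rewrite sumr_ge0// => j _; rewrite mulr_ge0// addr_ge0.
near=> l => t x y d hx hy hd d0.
have [|h1 h2 h3] := all_and3 (fun j => (near hall l) _ j t x y d hx hy hd d0); first by [].
have hyy j : `|y j 0 - y j 0| <= d by rewrite subrr normr0.
have [|h4 _ _] := all_and3 (fun j => (near hall l) _ j t y y d hy hy hyy d0); first by [].
rewrite !qE; split.
- apply: le_trans (ler_norm_sum _ _ _) _; apply: ler_sum => j _; rewrite normrM.
  by rewrite mulrDl mul1r; apply: ler_wpDr => //; exact: ler_pM.
- rewrite -sumrB mulr_suml; apply: le_trans (ler_norm_sum _ _ _) _; apply: ler_sum => j _.
  have -> : x j 0 * qj j t l x - y j 0 * qj j t l y =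
     x j 0 * (qj j t l x - qj j t l y) + (x j 0 - y j 0) * qj j t l y by ring.
  apply: le_trans (ler_normD _ _) _; rewrite !normrM !mulrDl mul1r; apply: lerD.
    by rewrite -mulrA; apply: ler_pM.
  by rewrite mulrC; apply: ler_pM.
- rewrite -sumrB mulr_suml; apply: le_trans (ler_norm_sum _ _ _) _; apply: ler_sum => j _.
  rewrite -mulrBr normrM !mulrDl mul1r; apply: ler_wpDr; first by rewrite mulr_ge0.
  by rewrite -mulrA; apply: ler_pM.
Unshelve. all: by end_near. Qed.

Section taylor_forms.
Variables (v : R -> R -> 'cV[R]_n) (P : R -> R -> 'M[R]_n).
Hypotheses (hv : forall j, lipb (fun t l => v t l j 0)) (hP : forall i j, lipb (fun t l =>
  P t l i j)).

(** The coefficient of s^k in the expansion of H(v + s P x, theta, lambda). *)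
Definition taylor_form (H : 'cV[R]_n * R * R -> R) k t l x : R :=
  k`!%:R^-1 * iter_derive k (dir (P t l *m x) 0) H (v t l, t, l).

Lemma hom_taylor_form H k : smper H -> hom k (taylor_form H k).
Proof.
move=> hs; apply: homZ; first exact: lipb_cst.
elim: k H hs => [|k IH] H hs /=.
  by exists (fun t l => H (v t l, t, l)); split=> //; exact: lipb_smper.
pose g i t l x := iter_derive k (dir (P t l *m x) 0) (fun b => 'D_(edir i) H b) (v t l, t, l).
exists (fun j t l x => \sum_i P t l i j * g i t l x); split.
  by move=> j; apply: hom_sum => i; apply: homZ => //; apply: IH; exact: smper_derive.
move=> t l x; rewrite -[LHS]/(iter_derive k.+1 (dir (P t l *m x) 0) H (v t l, t, l))
  iter_derive_dir//.
transitivity (\sum_i \sum_j P t l i j * x j 0 * g i t l x).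
  by apply: eq_bigr => i _; rewrite mxE mulr_suml.
rewrite exchange_big/=; apply: eq_bigr => j _; rewrite mulr_sumr; apply: eq_bigr => i _; ring.
Qed.

Lemma taylor_form_bound H m (rho : R) : smper H -> 0 <= rho -> exists2 K, 0 <=
  K & \forall l \near ls, forall t x s,
  (forall j, `|x j 0| <= rho) -> `|s| <= 1 ->
  `|H (v t l + s *: (P t l *m x), t, l) - \sum_(k < m) s ^+ k * taylor_form H k t l x| <=
    K * `|s| ^+ m.
Proof.
move=> hs rho0.
have hB (c : R -> R -> R) : lipb c -> exists K, 0 <= K /\ \forall l \near ls, forall t, `|c t l| <=
  K.
  move=> /lipb_pos[K K0 hK]; exists K; split=> //; apply: filterS hK => l h t; exact: (h t).1.
have [Kv hKv] := choice (fun j => hB _ (hv j)).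
have [KP hKP] := choice (fun ij : 'I_n * 'I_n => hB _ (hP ij.1 ij.2)).
pose KV := \sum_j Kv j; pose KPP := \sum_ij KP ij.
have Kv0 j : 0 <= Kv j by exact: (hKv j).1.
have KP0 j : 0 <= KP j by exact: (hKP j).1.
(* Bounds the entries of P x as well as those of v + s P x for |s| <= 1. *)
pose B := KV + \sum_(j < n) KPP * rho.
have KPP0 : 0 <= KPP by exact: sumr_ge0.
have S0 : 0 <= \sum_(j < n) KPP * rho by apply: sumr_ge0 => j _; exact: mulr_ge0.
have [K K0 hK] := iter_derive_bounded ls m B hs.
exists K => //.
have hallv : \forall l \near ls, forall j t, `|v t l j 0| <= Kv j.
  by apply: near_fin => j; exact: (hKv j).2.
have hallP : \forall l \near ls, forall ij t, `|P t l ij.1 ij.2| <= KP ij.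
  by apply: near_fin => j; exact: (hKP j).2.
near=> l => t x s hx hs1.
have l1 : `|l - ls| <= 1 by near: l; exact: near_dist.
have hvj j : `|v t l j 0| <= KV.
  have /(_ _ j t) := near hallv l => /(_ _)/le_trans; apply => //.
  by rewrite /KV (bigD1 j)//= lerDl sumr_ge0.
have hPx j : `|(P t l *m x) j 0| <= \sum_(j < n) KPP * rho.
  rewrite mxE; apply: le_trans (ler_norm_sum _ _ _) _; apply: ler_sum => i _.
  rewrite normrM; apply: ler_pM => //.
  have /(_ _ (j, i) t) := near hallP l => /(_ _)/le_trans; apply => //.
  by rewrite /KPP (bigD1 (j, i))//= lerDl sumr_ge0.
pose w : 'cV[R]_n * R * R := dir (P t l *m x) 0.
pose ph k (s : R) := iter_derive k w H ((v t l, t, l) + s *: w).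
have aE (r : R) : (v t l, t, l) + r *: w = (v t l + r *: (P t l *m x), t, l).
  by congr (_, _, _); rewrite /= scaler0 addr0.
have := @taylor_bound R m ph K _ _ s hs1.
rewrite [ph 0%N s]/ph/= aE => h.
have -> : \sum_(k < m) s ^+ k * taylor_form H k t l x = \sum_(k < m) k`!%:R^-1 * ph k 0 * s ^+ k.
  by apply: eq_bigr => k _; rewrite /taylor_form /ph aE scale0r addr0 mulrC.
apply: h => [k r _ _|r r1].
  by rewrite /ph iter_deriveS; apply: der_line; exact: smper_diff (iter_derive_smper _ _ _).
rewrite /ph aE; apply: hK => // j.
  by apply: le_trans (hPx j) _; rewrite lerDr sumr_ge0.
rewrite !mxE; apply: le_trans (ler_normD _ _) _; apply: lerD => //.
by rewrite normrM -[leRHS]mul1r; apply: ler_pM => //; have := hPx j; rewrite mxE.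
Unshelve. all: by end_near. Qed.

End taylor_forms.
End polynomial_forms.

(** * Taylor expansions in epsilon, uniform in a parameter *)

Section jets.
Variables (R : realType) (T : Type) (r : R).
Implicit Types (f g : T -> R -> R) (c : T -> R).

Definition bounded_family c := exists K, forall u, `|c u| <= K.

(* Taylor expansions of order n at s = 0 with bounded coefficients and remainder,
   uniformly in a parameter, in the form c0 + s (c1 + s (... + s g)). *)
Fixpoint jet n f : Prop :=
  if n is n'.+1 then exists c g, [/\ bounded_family c, jet n' g &
    forall u s, `|s| <= r -> f u s = c u + s * g u s]
  else exists K, forall u s, `|s| <= r -> `|f u s| <= K.

Lemma jetS n f : jet n.+1 f -> exists c g, [/\ bounded_family c, jet n g &
  forall u s, `|s| <= r -> f u s = c u + s * g u s].
Proof. by []. Qed.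

Hypothesis r0 : 0 <= r.

Lemma jet_ext n f g : (forall u s, `|s| <= r -> f u s = g u s) -> jet n f -> jet n g.
Proof.
case: n => [|n] h /=; first by move=> [K hK]; exists K => u s hs; rewrite -h// hK.
by move=> [c [k [hc hk fE]]]; exists c, k; split=> // u s hs; rewrite -h// fE.
Qed.

Lemma jetW n f : jet n.+1 f -> jet n f.
Proof.
elim: n f => [|n IH] f [c [g [[K hK] hg fE]]].
  have [L hL] := hg; exists (K + r * L) => u s hs; rewrite fE//.
  apply: le_trans (ler_normD _ _) _; apply: lerD => //.
  by rewrite normrM; apply: ler_pM => //; exact: hL.
by exists c, g; split=> //; [exists K|exact: IH].
Qed.

Lemma jet_bounded n f : jet n f -> exists K, forall u s, `|s| <= r -> `|f u s| <= K.
Proof. by elim: n f => [//|n IH] f /jetW; exact: IH. Qed.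

Lemma jet_shift n f : jet n f -> jet n.+1 (fun u s => s * f u s).
Proof.
move=> hf; exists (fun=> 0), f; split=> //; first by exists 0 => u; rewrite normr0.
by move=> u s _; rewrite add0r.
Qed.

Lemma jet_cst n c : bounded_family c -> jet n (fun u _ => c u).
Proof.
elim: n c => [|n IH] c [K hK]; first by exists K.
exists c, (fun _ _ => 0); split; [by exists K| |by move=> u s _; rewrite mulr0 addr0].
by apply: (IH (fun=> 0)); exists 0 => u; rewrite normr0.
Qed.

Lemma jetD n f g : jet n f -> jet n g -> jet n (fun u s => f u s + g u s).
Proof.
elim: n f g => [|n IH] f g /=.
  move=> [K hK] [L hL]; exists (K + L) => u s hs.
  by apply: le_trans (ler_normD _ _) _; apply: lerD; [exact: hK|exact: hL].
move=> [c [f1 [[K hK] hf1 fE]]] [d [g1 [[L hL] hg1 gE]]].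
exists (fun u => c u + d u), (fun u s => f1 u s + g1 u s); split.
- by exists (K + L) => u; apply: le_trans (ler_normD _ _) _; exact: lerD.
- exact: IH.
- by move=> u s hs; rewrite fE// gE//; ring.
Qed.

Lemma jetM n f g : jet n f -> jet n g -> jet n (fun u s => f u s * g u s).
Proof.
elim: n f g => [|n IH] f g.
  move=> [K hK] [L hL]; exists (K * L) => u s hs.
  by rewrite normrM; apply: ler_pM => //; [exact: hK|exact: hL].
move=> [c [f1 [hc hf1 fE]]] [d [g1 [hd hg1 gE]]].
exists (fun u => c u * d u), (fun u s => (c u * g1 u s + d u * f1 u s) + s * (f1 u s * g1 u s));
  split.
- have [K hK] := hc; have [L hL] := hd; exists (K * L) => u.
  by rewrite normrM; exact: ler_pM.
- apply: jetD; last exact/jetW/jet_shift/IH.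
  by apply: jetD; apply: IH => //; exact: jet_cst.
- by move=> u s hs; rewrite fE// gE//; ring.
Qed.

Lemma jetZ n (k : R) f : jet n f -> jet n (fun u s => k * f u s).
Proof. by move=> hf; apply: (jetM _ hf); apply: (jet_cst n (c := fun=> k)); exists `|k|. Qed.

Lemma jet_sum n (I : Type) (s : seq I) (F : I -> T -> R -> R) : (forall i, jet n (F i)) ->
  jet n (fun u x => \sum_(i <- s) F i u x).
Proof.
move=> hF; elim: s => [|i s IH].
  apply: (@jet_ext n (fun _ _ => 0)); first by move=> u x _; rewrite big_nil.
  by apply: (jet_cst n (c := fun=> 0)); exists 0 => u; rewrite normr0.
by apply: jet_ext (jetD (hF i) IH) => u x _; rewrite big_cons.
Qed.

Lemma jet_remainder n f (K : R) : 0 <= K ->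
  (forall u s, `|s| <= r -> `|f u s| <= K * `|s| ^+ n) -> jet n f.
Proof.
move=> K0; elim: n f => [|n IH] f hf; first by exists K => u s hs; rewrite -[K]mulr1 hf.
exists (fun=> 0), (fun u s => if s == 0 then 0 else f u s / s); split.
- by exists 0 => u; rewrite normr0.
- apply: IH => u s hs; have [->|s0] := eqVneq s 0.
    by rewrite normr0 mulr_ge0// exprn_ge0.
  by rewrite normrM normfV ler_pdivrMr ?normr_gt0// -mulrA -exprSr; exact: hf.
- move=> u s hs; rewrite add0r; have [->|s0] := eqVneq s 0.
    by have := hf u 0; rewrite normr0 expr0n mulr0 mul0r normr_le0 => /(_ r0)/eqP.
  by rewrite mulrC divfK.
Qed.

Definition little_o k (h : R -> R) := forall eta, 0 < eta -> exists2 d, 0 < d &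
  forall s, s != 0 -> `|s| <= d -> `|h s| <= eta * `|s| ^+ k.

Lemma little_o_cst (h g : R -> R) (c L : R) : 0 < r -> little_o 0 h ->
  (forall s, `|s| <= r -> `|g s| <= L) -> (forall s, `|s| <= r -> h s = c + s * g s) -> c = 0.
Proof.
move=> rp hlo hL hE; apply/eqP; rewrite -normr_le0; apply/ler_addgt0Pl => eta eta0; rewrite addr0.
have eta2 : 0 < eta / 2 by rewrite divr_gt0.
have [d d0 hd] := hlo _ eta2.
have L0 : 0 <= L by apply: le_trans (hL 0 _); rewrite ?normr0.
have L1 : 0 < L + 1 by lra.
(* One point suffices: x is within the range of both hypotheses and so small that x g is at most eta
   / 2. The 1 added to L keeps the denominator positive. *)
pose x := Num.min (Num.min r d) (eta / 2 / (L + 1)).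
have x0 : 0 < x by rewrite !lt_min rp d0 divr_gt0.
have xr : `|x| <= r by rewrite gtr0_norm// !ge_min lexx.
have xd : `|x| <= d by rewrite gtr0_norm// !ge_min lexx orbT.
have xe : x * (L + 1) <= eta / 2 by rewrite -ler_pdivlMr// ge_min lexx orbT.
have := hd x (lt0r_neq0 x0) xd; rewrite expr0 mulr1 hE// => h1.
have h2 : `|x * g x| <= eta / 2.
  rewrite normrM gtr0_norm//; apply: le_trans xe; rewrite ler_pM2l//.
  by apply: le_trans (hL x xr) _; rewrite lerDl.
have -> : c = (c + x * g x) - x * g x by ring.
by apply: le_trans (ler_normB _ _) _; lra.
Qed.

(** The passage from pointwise to uniform. For each parameter the little-o hypothesis annihilates
    the coefficients up to order k, while the jet provides the bounds on the remaining factor,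
    uniformly in the parameter. *)
Lemma jet_leading k n f : 0 < r -> (forall u, little_o k (f u)) -> jet (k.+1 + n) f ->
  exists2 g, jet n g & forall u (s : R), s != 0 -> `|s| <= r -> f u s = s ^+ k.+1 * g u s.
Proof.
move=> rp; elim: k n f => [|k IH] n f hlo; rewrite addSn => /jetS[c [g [hc hg fE]]].
  exists g => // u s s0 hs; rewrite fE//.
  have [L hL] := jet_bounded hg.
  by rewrite (little_o_cst rp (hlo u) (hL u) (fE u)) add0r.
have lo0 u : little_o 0 (f u).
  move=> eta eta0; have [d d0 hd] := hlo u eta eta0; exists (Num.min d 1);
    first by rewrite lt_min d0 ltr01.
  move=> s s0; rewrite le_min => /andP[h1 h2]; apply: le_trans (hd s s0 h1) _.
  by rewrite expr0 ler_wpM2l ?exprn_ile1// ltW.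
have c0 u : c u = 0.
  by have [L hL] := jet_bounded hg; exact: little_o_cst rp (lo0 u) (hL u) (fE u).
have [u||h hh gE] := IH n g; last 1 first.
- by exists h => // u s s0 hs; rewrite fE// c0 add0r gE// mulrA -exprS.
- move=> eta eta0; have [d d0 hd] := hlo u eta eta0.
  exists (Num.min d r); first by rewrite lt_min d0.
  move=> s s0; rewrite le_min => /andP[h1 h2]; have := hd s s0 h1.
  by rewrite fE// c0 add0r normrM exprS mulrCA ler_pM2l// normr_gt0.
- exact: hg.
Qed.

(* The coefficient of s^(k+2) cancels in f s - (-1)^k f (- s). *)
Lemma jet_leading_parity k f : 0 < r -> (forall u, little_o k.+1 (f u)) -> jet k.+3 f ->
  exists2 K, 0 <= K & forall u (s : R), s != 0 -> `|s| <= r ->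
    `|f u s| <= K * `|s| ^+ k.+2 /\ `|f u s - (-1) ^+ k * f u (- s)| <= K * `|s| ^+ k.+3.
Proof.
move=> rp hlo hf.
have [|g /jetS[c [h [[K hK] hh gE]]] fE] := @jet_leading k.+1 1 f rp hlo; first by rewrite addn1.
have [L hL] := jet_bounded hh.
exists (`|K| + (1 + r) * (`|L| + `|L|)); first by rewrite addr_ge0// mulr_ge0// addr_ge0.
move=> u s s0 hs; have hns : `|- s| <= r by rewrite normrN.
have hLs : `|h u s| <= `|L| by apply: le_trans (hL u s hs) (ler_norm _).
have hLn : `|h u (- s)| <= `|L| by apply: le_trans (hL u _ hns) (ler_norm _).
have L0 : 0 <= `|L| := normr_ge0 L.
have hKu : `|c u| <= `|K| by apply: le_trans (hK u) (ler_norm _).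
rewrite !fE ?oppr_eq0// !gE//; split.
  rewrite normrM normrX mulrC ler_wpM2r ?exprn_ge0//.
  apply: le_trans (ler_normD _ _) _; apply: lerD => //; rewrite normrM.
  apply: le_trans (ler_pM _ _ hs hLs) _ => //; nra.
have -> : s ^+ k.+2 * (c u + s * h u s) - (-1) ^+ k * ((- s) ^+ k.+2 * (c u + - s * h u (- s))) =
   s ^+ k.+3 * (h u s + h u (- s)).
  have e1 : (- s) ^+ k.+2 = (-1) ^+ k * s ^+ k.+2.
    have -> : (-1) ^+ k = (-1) ^+ k.+2 :> R by rewrite (exprS (-1) k.+1) (exprS (-1) k) mulrA
      mulrNN mulr1 mul1r.
    by rewrite -exprMn mulN1r.
  have e2 : (-1) ^+ k * (-1) ^+ k = 1 :> R by rewrite -exprMn mulrNN mulr1 expr1n.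
  by rewrite e1 mulrA mulrA e2 [s ^+ k.+3]exprS; ring.
rewrite normrM normrX mulrC ler_wpM2r ?exprn_ge0//.
apply: le_trans (ler_normD _ _) _; apply: le_trans (lerD hLs hLn) _.
have := normr_ge0 K; nra.
Qed.

End jets.

Section jets_of_forms.
Variables (R : realType) (T : Type) (r ls : R) (n : nat).

Lemma jet_hom (th : T -> R) (x : T -> R -> 'cV[R]_n) k q N : 0 <= r -> hom ls k q ->
  (forall j, jet r N (fun u s => x u s j 0)) -> jet r N (fun u s => q (th u) ls (x u s)).
Proof.
move=> r0 + hx; elim: k q => [|k IH] q.
  move=> [c [[K hK] qE]]; apply: (@jet_ext _ _ _ _ (fun u _ => c (th u) ls)).
    by move=> u s _; rewrite qE.
  by apply: jet_cst; exists K => u; have [] := nbhs_singleton hK (th u).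
move=> [qj [hq qE]];
  apply: (@jet_ext _ _ _ _ (fun u s => \sum_j x u s j 0 * qj j (th u) ls (x u s))).
  by move=> u s _; rewrite qE.
by apply: jet_sum => // j; apply: jetM => //; apply: IH; exact: hq.
Qed.

End jets_of_forms.

(** * Second derivatives in epsilon at 0 *)

Section twice_differentiable_at_zero.
Variable R : realType.
Implicit Types (f g : R -> R) (e : R).

(** Just enough for the first two iterated derivatives at 0 to be Taylor coefficients:
    [expansion_term] of index 2 and 3, the quadratic and cubic terms of the normal form, are of this
    kind. *)
Definition twice_der f (f1 : R -> R) (f2 : R) :=
  (\forall e \near (0 : R), is_derive (e : R) 1 f (f1 e)) /\ is_derive (0 : R) 1 f1 f2.

Definition T2 f := exists (f1 : R -> R) (f2 : R), twice_der f f1 f2.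

Lemma T2_near f g : (\forall e \near (0 : R), f e = g e) -> T2 f -> T2 g.
Proof.
move=> h [f1 [f2 [hf1 hf2]]]; exists f1, f2; split=> //.
have h' := near_join h.
near=> e.
have he : \forall x \near e, f x = g x by near: e.
by apply: near_eq_is_derive he _; near: e.
Unshelve. all: by end_near. Qed.

Lemma T2_cst (c : R) : T2 (fun=> c).
Proof. by exists (fun=> 0), 0; split; [near=> e; exact: der_cst|exact: der_cst]. Unshelve. all:
  by end_near. Qed.

Lemma T2_id : T2 (fun e => e).
Proof. by exists (fun=> 1), 0; split; [near=> e; exact: der_id|exact: der_cst]. Unshelve. all:
  by end_near. Qed.

Lemma T2D f g : T2 f -> T2 g -> T2 (fun e => f e + g e).
Proof.
move=> [f1 [f2 [hf1 hf2]]] [g1 [g2 [hg1 hg2]]]; exists (fun e => f1 e + g1 e), (f2 + g2); split.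
  by near=> e; apply: derD; near: e.
exact: derD.
Unshelve. all: by end_near. Qed.

Lemma T2M f g : T2 f -> T2 g -> T2 (fun e => f e * g e).
Proof.
move=> [f1 [f2 [hf1 hf2]]] [g1 [g2 [hg1 hg2]]].
exists (fun e => f e * g1 e + f1 e * g e), (f 0 * g2 + f1 0 * g1 0 + (f1 0 * g1 0 + f2 * g 0));
  split.
  by near=> e; apply: derM; near: e.
by apply: derD; apply: derM => //; [exact: nbhs_singleton hf1|exact: nbhs_singleton hg1].
Unshelve. all: by end_near. Qed.

Lemma T2Z (c : R) f : T2 f -> T2 (fun e => c * f e).
Proof. by move=> hf; apply: T2M => //; exact: T2_cst. Qed.

Lemma T2B f g : T2 f -> T2 g -> T2 (fun e => f e - g e).
Proof.
move=> hf hg; have := T2D hf (T2Z (-1) hg); congr T2.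
by apply/funext => e; rewrite mulN1r.
Qed.

Lemma T2_sum (I : Type) (s : seq I) (F : I -> R -> R) : (forall i, T2 (F i)) ->
  T2 (fun e => \sum_(i <- s) F i e).
Proof.
move=> hF; elim: s => [|i s IH].
  by have := T2_cst 0; congr T2; apply/funext => e; rewrite big_nil.
by have := T2D (hF i) IH; congr T2; apply/funext => e; rewrite big_cons.
Qed.

Lemma T2_prod (I : Type) (s : seq I) (F : I -> R -> R) : (forall i, T2 (F i)) ->
  T2 (fun e => \prod_(i <- s) F i e).
Proof.
move=> hF; elim: s => [|i s IH].
  by have := T2_cst 1; congr T2; apply/funext => e; rewrite big_nil.
by have := T2M (hF i) IH; congr T2; apply/funext => e; rewrite big_cons.
Qed.

Lemma T2_cont f : T2 f -> {for 0, continuous f}.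
Proof. by move=> [f1 [f2 [hf1 _]]]; exact: der_cont (nbhs_singleton hf1). Qed.

Lemma near_neq0 f : {for 0, continuous f} -> f 0 != 0 -> \forall e \near (0 : R), f e != 0.
Proof. by move=> cf f0; apply: (@cvgr_neq0 R R^o R (nbhs (0 : R)) _ f (f 0)). Qed.

Lemma derV f x (df : R) : f x != 0 -> is_derive x 1 f df ->
  is_derive x 1 (fun y => (f y)^-1) (- ((f x)^-1 * (f x)^-1 * df)).
Proof.
move=> f0 [h1 h2]; apply: DeriveDef; first exact: derivableV.
by rewrite deriveV// h2 /GRing.scale/= -exprVn expr2 mulNr.
Qed.

Lemma T2V f : f 0 != 0 -> T2 f -> T2 (fun e => (f e)^-1).
Proof.
move=> f0 hf; have cf := T2_cont hf; move: hf => [f1 [f2 [hf1 hf2]]].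
have hn : \forall e \near (0 : R), f e != 0.
  exact: near_neq0.
have d1 := derV f0 (nbhs_singleton hf1).
exists (fun e => - ((f e)^-1 * (f e)^-1 * f1 e)).
eexists; split; last by apply: derN; apply: derM hf2; exact: derM d1 d1.
by near=> e; apply: derV; near: e.
Unshelve. all: by end_near. Qed.

Lemma T2_det n (A : R -> 'M[R]_n) : (forall i j, T2 (fun e => A e i j)) -> T2 (fun e => \det (A e)).
Proof. by move=> hA; apply: T2_sum => s; apply: T2Z; apply: T2_prod => i. Qed.

Lemma T2_invmx n (A : R -> 'M[R]_n) : (forall i j, T2 (fun e => A e i j)) -> A 0 \in unitmx ->
  (\forall e \near (0 : R), A e \in unitmx) /\ forall i j, T2 (fun e => invmx (A e) i j).
Proof.
move=> hA; rewrite unitmxE unitfE => u0.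
have hu : \forall e \near (0 : R), A e \in unitmx.
  have : \forall e \near (0 : R), \det (A e) != 0.
    exact: near_neq0 (T2_cont (T2_det hA)) u0.
  by apply: filterS => e; rewrite unitmxE unitfE.
split=> // i j; apply: (@T2_near (fun e => (\det (A e))^-1 * ((-1) ^+ (j + i) * \det
  (row' j (col' i (A e)))))).
  near=> e; have ue : A e \in unitmx by near: e.
  by rewrite /invmx ue !mxE.
apply: T2M; first exact/T2V/T2_det.
apply: T2Z; apply: T2_det => i' j'.
by have := hA (lift j i') (lift i j'); congr T2; apply/funext => e; rewrite !mxE.
Unshelve. all: by end_near. Qed.

Lemma der_zeroP f (df : R) : is_derive (0 : R) 1 f df ->
  little_o 1 (fun e => f e - (f 0 + df * e)).
Proof.
move=> [hf1 hf2] eta eta0.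
move/derivable_nbhsP: (hf1); rewrite hf2 => /eqaddoP/(_ eta eta0).
move=> /nbhs_ballP[d /= d0 hd]; exists (d / 2); first by rewrite divr_gt0.
move=> s s0 hs; have := hd s; rewrite /ball/= sub0r normrN => /(_ (le_lt_trans hs _)).
rewrite expr1 => h; have {h} := h (ltac:(lra)).
suff -> : f s - (f 0 + df * s) = ((fun h : R => f (h%:A + 0)) - (cst (f 0) + *:%R^~ df)) s by [].
by rewrite /= !fctE addr0 /GRing.scale/= mulr1 (mulrC df).
Qed.

Lemma der_of_bound f (d df K : R) : 0 < d -> (forall e, `|e| <= d -> `|f e - f 0 - df * e| <=
  K * e ^+ 2) ->
  is_derive (0 : R) 1 f df.
Proof.
move=> d0 hf.
have hl : (fun h : R => h^-1 *: ((f \o shift 0) (h *: 1) - f 0)) @ 0^' --> df.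
  apply/cvgrPdist_le => eta eta0.
  have K1 : 0 < `|K| + 1 by have := normr_ge0 K; lra.
  near=> h.
  have h0 : h != 0 by near: h; exact: nbhs_dnbhs_neq.
  have hd : `|h| <= d by near: h; exact: dnbhs0_le.
  have he : `|h| <= eta / (`|K| + 1) by near: h; apply: dnbhs0_le; rewrite divr_gt0.
  rewrite /= addr0 [_%:A]mulr1 distrC.
  have -> : h^-1 *: (f h - f 0) - df = h^-1 * (f h - f 0 - df * h).
    by rewrite /GRing.scale/=; field.
  rewrite normrM normfV mulrC ler_pdivrMr ?normr_gt0//.
  apply: le_trans (hf h hd) _.
  have -> : K * h ^+ 2 = K * `|h| * `|h| by rewrite -mulrA -expr2 real_normK ?num_real.
  rewrite ler_wpM2r//; rewrite ler_pdivlMr// in he.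
  have := ler_norm K; have := normr_ge0 h; nra.
by apply: DeriveDef; [apply/cvg_ex; exists df|apply: cvg_lim].
Unshelve. all: by end_near. Qed.

(** Peano form of Taylor's formula: the derivative of the remainder is o(e) because f1 is
    differentiable at 0, and the mean value inequality makes the remainder o(e^2). *)
Lemma T2_taylor f (f1 : R -> R) (f2 : R) : twice_der f f1 f2 ->
  little_o 2 (fun e => f e - (f 0 + f1 0 * e + f2 / 2 * e ^+ 2)).
Proof.
move=> [hf1 hf2] eta eta0.
have [d d0 hd] := der_zeroP hf2 eta0.
move/nbhs_ballP: hf1 => [d' /= d'0 hd'].
exists (Num.min d (d' / 2)); first by rewrite lt_min d0 divr_gt0.
move=> s s0; rewrite le_min => /andP[sd sd'].
pose g e := f e - (f 0 + f1 0 * e + f2 / 2 * e ^+ 2).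
have hseg (x : R) : Num.min 0 s <= x <= Num.max 0 s -> `|x| <= `|s|.
  move=> /andP[]; rewrite ler_norml.
  by have [s1|s1] := lerP 0 s => h1 h2; rewrite ?(ger0_norm s1) ?(ltr0_norm s1); lra.
have g0 : g 0 = 0 by rewrite /g; ring.
suff : `|g s - g 0| <= eta * `|s| * `|s - 0| by rewrite g0 !subr0 -mulrA -expr2.
apply: (@der_bound R g (fun e => f1 e - (f1 0 + f2 * e)) 0 s (eta * `|s|)) => x /hseg hx.
  have dfx : is_derive x 1 f (f1 x).
    by apply: hd'; rewrite /ball/= sub0r normrN; lra.
  apply: is_derive_eq (derB dfx (derD (derD (der_cst (f 0) x 1) (derZ (f1 0) (der_id x)))
    (derZ (f2 / 2) (derX 2 x)))) _.
  by rewrite /=; field.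
have [->|x0] := eqVneq x 0; first by rewrite mulr0 addr0 subrr normr0 mulr_ge0// ltW.
apply: le_trans (hd x x0 (le_trans hx sd)) _.
by rewrite expr1 ler_pM2l.
Qed.

(* (f e - f 0) / e inherits one derivative less, also at e = 0. *)
Lemma T2_quotient f (df : R -> R) (d c0 c1 c2 K : R) : 0 < d ->
  (forall e, `|e| <= d -> is_derive e 1 f (df e)) ->
  (forall e, `|e| <= d -> `|df e - (c0 + c1 * e + c2 * e ^+ 2)| <= K * `|e| ^+ 3) ->
  T2 (fun e => if e == 0 then df 0 else (f e - f 0) / e).
Proof.
move=> d0 hdf hb.
have df0 : df 0 = c0.
  have := hb 0; rewrite !mulr0 expr0n/= mulr0 !addr0 normr0 expr0n/= mulr0 normr_le0 subr_eq0.
  by move=> /(_ (ltW d0))/eqP.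
have fb e : `|e| <= d -> `|f e - f 0 - (c0 * e + c1 / 2 * e ^+ 2 + c2 / 3 * e ^+ 3)| <=
  K * `|e| ^+ 3 * `|e|.
  move=> he; pose g x := f x - (c0 * x + c1 / 2 * x ^+ 2 + c2 / 3 * x ^+ 3).
  have hseg (x : R) : Num.min 0 e <= x <= Num.max 0 e -> `|x| <= `|e|.
    move=> /andP[]; rewrite ler_norml.
    by have [s1|s1] := lerP 0 e => h1 h2; rewrite ?(ger0_norm s1) ?(ltr0_norm s1); lra.
  have K0 : 0 <= K.
    have := le_trans (normr_ge0 _) (hb d _); rewrite (gtr0_norm d0) => /(_ (lexx d)).
    by rewrite pmulr_lge0// exprn_gt0.
  have := @der_bound R g (fun x => df x - (c0 + c1 * x + c2 * x ^+ 2)) 0 e (K * `|e| ^+ 3).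
  have -> : g e - g 0 = f e - f 0 - (c0 * e + c1 / 2 * e ^+ 2 + c2 / 3 * e ^+ 3) by rewrite /g;
    ring.
  rewrite subr0; apply => x /hseg hx.
    apply: is_derive_eq (derB (hdf x (le_trans hx he)) (derD (derD (derZ c0 (der_id x))
      (derZ (c1 / 2) (derX 2 x))) (derZ (c2 / 3) (derX 3 x)))) _.
    by rewrite /=; field.
  apply: le_trans (hb x (le_trans hx he)) _.
  by rewrite ler_wpM2l// lerXn2r// nnegrE.
(* Integrating the expansion of f' and dividing by e gives c0 + c1 e / 2 + c2 e^2 / 3 + O(e^3) for
   the quotient, hence the value c1 / 2 of its derivative at 0 and the second derivative 2 c2 /
   3. *)
exists (fun e => if e == 0 then c1 / 2 else df e / e - (f e - f 0) / e ^+ 2), (2 * c2 / 3); split.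
  near=> e; have he : `|e| <= d.
    by near: e; have := near_dist (0 : R) d0; apply: filterS => e; rewrite subr0.
  have [->|e0] := eqVneq e 0.
    apply: (@der_of_bound _ d _ (`|c2 / 3| + `|K| * d)) => // h hh; rewrite eqxx.
    have [->|h0] := eqVneq h 0; first by rewrite subrr mulr0 subrr normr0 expr0n/= mulr0.
    have -> : (f h - f 0) / h - df 0 - c1 / 2 * h =
        ((f h - f 0 - (c0 * h + c1 / 2 * h ^+ 2 + c2 / 3 * h ^+ 3)) + c2 / 3 * h ^+ 3) / h.
      by rewrite df0; field.
    have h2E : h ^+ 2 = `|h| ^+ 2 by rewrite real_normK ?num_real.
    rewrite normrM normfV ler_pdivrMr ?normr_gt0//.
    apply: le_trans (ler_normD _ _) _; rewrite addrC mulrDl mulrDl; apply: lerD.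
      by rewrite normrM normrX -mulrA h2E -exprSr.
    apply: le_trans (fb h hh) _; rewrite ler_wpM2r// h2E exprS !mulrA ler_wpM2r// ler_wpM2r//.
    by apply: le_trans (ler_wpM2r _ (ler_norm K)) _ => //; rewrite ler_wpM2l.
  have dq : is_derive e 1 (fun x => (f x - f 0) / x) (df e / e - (f e - f 0) / e ^+ 2).
    apply: is_derive_eq (derM (derB (hdf e he) (der_cst (f 0) e 1)) (derV e0 (der_id e))) _.
    by field.
  apply: near_eq_is_derive dq; near=> x.
  have -> // : (x == 0) = false; apply/negbTE; near: x.
  by apply: open_nbhs_nbhs; split=> //; exact: open_neq.
apply: (@der_of_bound _ d _ (2 * `|K|)) => // h hh; rewrite eqxx.
have [->|h0] := eqVneq h 0; first by rewrite subrr mulr0 subrr normr0 expr0n/= mulr0.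
have -> : df h / h - (f h - f 0) / h ^+ 2 - c1 / 2 - 2 * c2 / 3 * h =
    (df h - (c0 + c1 * h + c2 * h ^+ 2)) / h
    - (f h - f 0 - (c0 * h + c1 / 2 * h ^+ 2 + c2 / 3 * h ^+ 3)) / h ^+ 2.
  by field.
have h2 : `|h ^+ 2| = `|h| ^+ 2 by rewrite normrX.
have hp : 0 < `|h| by rewrite normr_gt0.
rewrite -[X in _ <= _ * X]real_normK ?num_real//.
have -> : 2 * `|K| * `|h| ^+ 2 = `|K| * `|h| ^+ 2 + `|K| * `|h| ^+ 2 by ring.
apply: le_trans (ler_normB _ _) _; apply: lerD.
  rewrite normrM normfV ler_pdivrMr//; apply: le_trans (hb h hh) _.
  by rewrite -mulrA -exprSr ler_wpM2r ?exprn_ge0// ler_norm.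
rewrite normrM normfV h2 ler_pdivrMr ?exprn_gt0//; apply: le_trans (fb h hh) _.
have -> : K * `|h| ^+ 3 * `|h| = K * `|h| ^+ 4 by ring.
have -> : `|K| * `|h| ^+ 2 * `|h| ^+ 2 = `|K| * `|h| ^+ 4 by ring.
by rewrite ler_wpM2r ?exprn_ge0// ler_norm.
Unshelve. all: by end_near. Qed.

Lemma derive1n_col n (g : R -> 'cV[R]_n) (g1 : 'I_n -> R -> R) (g2 : 'I_n -> R) :
  (forall i, twice_der (fun e => g e i 0) (g1 i) (g2 i)) ->
  derive1n 1 g 0 = \col_i g1 i 0 /\ derive1n 2 g 0 = \col_i g2 i.
Proof.
move=> hg.
have hn : \forall e \near (0 : R), forall i, is_derive (e : R) 1 (fun e => g e i 0) (g1 i e).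
  by apply: near_fin => i; have [] := hg i.
have h1 e : (forall i, is_derive (e : R) 1 (fun e => g e i 0) (g1 i e)) -> derive1 g e =
  \col_i g1 i e.
  move=> hi; have dg : derivable g e 1.
    by apply/derivable_mxP => i j; rewrite ord1; have [] := hi i.
  by rewrite derive1E (derive_mx dg); apply/colP => i; rewrite !mxE; have [_ ->] := hi i.
rewrite derive1n1 derive1nS derive1n1; split; first exact: h1 (nbhs_singleton hn).
have E : \forall e \near (0 : R), \col_i g1 i e = derive1 g e.
  by apply: filterS hn => e he; rewrite h1.
rewrite derive1E -(@near_eq_derive R R _ _ _ 0 1 E).
have dc : derivable (fun e => \col_i g1 i e) 0 1.
  apply/derivable_mxP => i j; have [_ [d _]] := hg i.
  suff -> : (fun e => (\col_i g1 i e) i j) = g1 i by [].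
  by apply/funext => e; rewrite mxE.
rewrite (derive_mx dc); apply/colP => i; rewrite !mxE; have [_ [_ <-]] := hg i.
suff -> : (fun e => (\col_i g1 i e) i 0) = g1 i by [].
by apply/funext => e; rewrite mxE.
Qed.

End twice_differentiable_at_zero.

Section smooth_vector_fields.
Variable R : realType.

Lemma Ck_entry (V : normedModType R) (p q k : nat) (f : V -> 'M[R]_(p, q)) i j :
  Ck_on k setT f -> Ck_on k setT (fun x => f x i j).
Proof.
elim: k f => [|k IH] f.
  move=> h x _; apply: (@continuous_comp _ _ _ f (fun M : 'M[R]_(p, q) => M i j)); first exact: h.
  exact: coord_continuous.
move=> [h1 h2]; split=> [x _|u].
  exact: (differentiable_comp (h1 x I) (@differentiable_coord R p q (f x) i j)).
have -> : (fun x => 'D_u (fun x => f x i j) x) = (fun x => ('D_u f x) i j).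
  apply/funext => y; have dF : derivable f y u := diff_derivable (h1 y I).
  by rewrite (derive_mx dF) mxE.
exact: IH (h2 u).
Qed.

Variable m : nat.
Variable F : vector_field R m.
Hypothesis F_smooth : smooth_field F.
Local Notation n := (2 + m)%N.
Local Notation V3 := ('cV[R]_n * R * R)%type.

Definition component i (a : V3) : R := F a.1.1 a.1.2 a.2 i 0.

Lemma component_smper i : smper (component i).
Proof.
have [hs hp] := F_smooth; split=> [k|x t l]; last by rewrite /component/= hp.
exact: Ck_entry (hs k).
Qed.

Lemma J_entry v t l i j : J F v t l i j = 'D_(edir j) (component i) (v, t, l).
Proof.
have E i' u : (fun h : R => h^-1 *: (((fun x => F x t l i' 0) \o shift v) (h *: u) - F v t l i' 0))
  =
    (fun h : R => h^-1 *: ((component i' \o shift (v, t, l)) (h *: dir u 0) - component i' (v, t,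
      l))).
  by apply/funext => h; rewrite /component/= !scaler0 !add0r.
have dF u : derivable (fun x => F x t l) v u.
  apply/derivable_mxP => i' j'; rewrite ord1 /derivable E.
  exact: (@diff_derivable _ _ _ _ _ (dir u 0) (smper_diff (v, t, l) (component_smper i'))).
by rewrite /J /jac mxE (derive_mx (dF _)) mxE /derive E.
Qed.

Lemma J_mulmx v t l i w : (J F v t l *m w) i 0 = 'D_(dir w 0) (component i) (v, t, l).
Proof.
rewrite derive_dir; last exact: component_smper.
by rewrite mul0r addr0 mxE; apply: eq_bigr => j _; rewrite J_entry mulrC.
Qed.

End smooth_vector_fields.

Section continuity_of_determinants.
Variable R : realType.

Lemma cont_sum (I : Type) (r : seq I) (f : I -> R -> R) : (forall i, continuous (f i)) ->
  continuous (fun t => \sum_(i <- r) f i t).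
Proof.
move=> cf; elim: r => [|i r IH].
  by rewrite (_ : (fun t => _) = fun=> 0); [exact: cst_continuous|apply/funext => t;
    rewrite big_nil].
rewrite (_ : (fun t => _) = fun t => f i t + \sum_(j <- r) f j t); last first.
  by apply/funext => t; rewrite big_cons.
exact: contD.
Qed.

Lemma cont_prod (I : Type) (r : seq I) (f : I -> R -> R) : (forall i, continuous (f i)) ->
  continuous (fun t => \prod_(i <- r) f i t).
Proof.
move=> cf; elim: r => [|i r IH].
  by rewrite (_ : (fun t => _) = fun=> 1); [exact: cst_continuous|apply/funext => t;
    rewrite big_nil].
rewrite (_ : (fun t => _) = fun t => f i t * \prod_(j <- r) f j t); last first.
  by apply/funext => t; rewrite big_cons.
by move=> t; apply: continuousM; [exact: cf|exact: IH].
Qed.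

Lemma cont_det n (A : R -> 'M[R]_n) : (forall i j, continuous (fun t => A t i j)) ->
  continuous (fun t => \det (A t)).
Proof. by move=> cA; apply: cont_sum => s; apply: contZ; apply: cont_prod => i. Qed.

End continuity_of_determinants.

(** * Uniform expansion of [G] in epsilon *)

Section expansion_of_G.
Variables (R : realType) (m : nat) (F : vector_field R m) (ls : R) (U : set R) (C : continuation R
  m).
Local Notation n := (2 + m)%N.
Hypotheses (F_smooth : smooth_field F) (U_open : open U) (U_ls : U ls)
  (smooth_v : smooth_periodic U (cv C)) (smooth_P : smooth_periodic U (cP C))
  (floquet : forall l, U l -> is_floquet F l (cv C ^~ l) (cP C ^~ l) (cE C l)).

Let near_U : \forall l \near ls, U l.
Proof. exact: open_nbhs_nbhs. Qed.

Lemma open_strip : open (setT `*` U : set (R * R)).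
Proof.
rewrite (_ : _ `*` _ = @snd R R @^-1` U); last by apply/seteqP; split=> [a []|a]//.
by apply: open_comp => // a _; exact: cvg_snd.
Qed.

Lemma smooth_periodic_lipb (p q : nat) (f : R -> R -> 'M[R]_(p, q)) i j : smooth_periodic U f ->
  lipb ls (fun t l => f t l i j).
Proof.
move=> [hs hp]; apply: (C1_periodic_lipb U_open U_ls).
  exact: (C1_entry i j open_strip (hs 1%N)).
by move=> t l Ul; rewrite hp.
Qed.

Lemma smooth_periodic_der_left (p q : nat) (f : R -> R -> 'M[R]_(p, q)) i j (t l : R) :
  smooth_periodic U f -> U l ->
  is_derive t 1 (fun t => f t l i j) ('D_(1, 0) (fun a : R * R => f a.1 a.2 i j) (t, l)).
Proof.
move=> [hs hp] Ul; have [h1 _] := C1_entry i j open_strip (hs 1%N).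
by apply: (@der_left R (fun a : R * R => f a.1 a.2 i j) t l); apply: h1.
Qed.

Lemma lipb_v j : lipb ls (fun t l => cv C t l j 0).
Proof. exact: smooth_periodic_lipb. Qed.

Lemma lipb_P i j : lipb ls (fun t l => cP C t l i j).
Proof. exact: smooth_periodic_lipb. Qed.

(** By periodicity and continuity the determinant of the Floquet matrix at [ls] is bounded away from
    0. *)
Lemma lipb_invP i j : lipb ls (fun t l => invmx (cP C t l) i j).
Proof.
have [d d0 hd] := @periodic_continuous_lower_bound R (fun t => \det (cP C t ls))
  (fun t => congr1 _ ((floquet U_ls).1 t))
  (cont_det (fun i j t => der_cont (smooth_periodic_der_left i j t smooth_P U_ls)))
  (fun t => ltac:(rewrite -unitfE -unitmxE; exact: (floquet U_ls).2.1)).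
apply: (lipb_invmx lipb_P d0 hd).
by apply: filterS near_U => l Ul t; exact: (floquet Ul).2.1.
Qed.

(** For k >= 2 this is the coefficient of e^(k-1) in the i-th entry of [G]; the shift by one comes
    from the factor 1/e. *)
Definition taylor_coefficient i k t l z : R :=
  \sum_j invmx (cP C t l) i j * taylor_form (cv C) (cP C) (component F j) k t l z.

Lemma hom_taylor_coefficient i k : hom ls k (taylor_coefficient i k).
Proof.
apply: hom_sum => j; apply: homZ; first exact: lipb_invP.
by apply: hom_taylor_form; [exact: lipb_v|exact: lipb_P|exact: component_smper].
Qed.

Lemma derive1_P t l : U l -> derive1 (cP C ^~ l) t = J F (cv C t l) t l *m cP C t l
  - cP C t l *m cE C l.
Proof.
by move=> Ul; have [_ [_ /(_ t)[_ <-]]] := floquet Ul; rewrite opprB addrC subrK.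
Qed.

(** The order 0 term of F cancels. The order 1 term combines with the derivative of P through the
    Floquet relation into P E, from which P^-1 leaves E. Multiplication by e clears the quotient, so
    a remainder of order five for F becomes one of order four for [G]. *)
Lemma G_expansion (rho : R) i : 0 <= rho -> exists2 K, 0 <= K & \forall l \near ls,
  forall t (z : 'cV[R]_n) (e : R),
  (forall j, `|z j 0| <= rho) -> e != 0 -> `|e| <= 1 ->
  `|G F C z l t e i 0 - ((cE C l *m z) i 0 + e * taylor_coefficient i 2 t l z
     + e ^+ 2 * taylor_coefficient i 3 t l z + e ^+ 3 * taylor_coefficient i 4 t l z)| <=
       K * `|e| ^+ 4.
Proof.
move=> rho0.
have hT j : exists K : R, 0 <= K /\ \forall l \near ls, forall t (x : 'cV[R]_n) (s : R),
  (forall j, `|x j 0| <= rho) -> `|s| <= 1 ->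
  `|component F j (cv C t l + s *: (cP C t l *m x), t, l)
    - \sum_(k < 5) s ^+ k * taylor_form (cv C) (cP C) (component F j) k t l x| <= K * `|s| ^+ 5.
  have [K K0 hK] := taylor_form_bound lipb_v lipb_P 5 (component_smper F_smooth j) rho0.
  by exists K.
have [Kj hKj] := choice hT.
have hI j : exists K : R, 0 <= K /\ \forall l \near ls, forall t, `|invmx (cP C t l) i j| <= K.
  have [K K0 hK] := lipb_pos (lipb_invP i j); exists K; split=> //.
  by apply: filterS hK => l h t; exact: (h t).1.
have [Lj hLj] := choice hI.
exists (\sum_j Lj j * Kj j); first by rewrite sumr_ge0// => j _; rewrite mulr_ge0//;
  [exact: (hLj j).1|exact: (hKj j).1].
have hallK := near_fin (fun j => (hKj j).2); have hallL := near_fin (fun j => (hLj j).2).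
apply: filterS3 near_U hallK hallL => l Ul hK hL t z e hz e0 e1.
pose rem j := component F j (cv C t l + e *: (cP C t l *m z), t, l)
    - \sum_(k < 5) e ^+ k * taylor_form (cv C) (cP C) (component F j) k t l z.
have hrem j : `|rem j| <= Kj j * `|e| ^+ 5 by exact: hK.
have uP : cP C t l \in unitmx by exact: (floquet Ul).2.1.
have PE : \sum_j invmx (cP C t l) i j * (cP C t l *m cE C l *m z) j 0 = (cE C l *m z) i 0.
  by have := congr1 (fun M : 'cV_n => M i 0) (mulKmx uP (cE C l *m z)); rewrite mxE mulmxA.
have GE : e * (G F C z l t e i 0 - ((cE C l *m z) i 0 + e * taylor_coefficient i 2 t l z
     + e ^+ 2 * taylor_coefficient i 3 t l z + e ^+ 3 * taylor_coefficient i 4 t l z)) =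
   \sum_j invmx (cP C t l) i j * rem j.
  rewrite /G (negbTE e0) derive1_P// mxE mulrBr mulrA divff// mul1r -PE /taylor_coefficient.
  rewrite mxE mulrDr mulrDr mulrDr !mulr_sumr -!big_split -sumrB; apply: eq_bigr => j _.
  rewrite /rem !big_ord_recr big_ord0/= add0r.
  have -> : taylor_form (cv C) (cP C) (component F j) 0 t l z = F (cv C t l) t l j 0.
    by rewrite /taylor_form fact0 invr1 mul1r.
  have -> : taylor_form (cv C) (cP C) (component F j) 1 t l z =
    (J F (cv C t l) t l *m cP C t l *m z) j 0.
    have f1 : 1`! = 1%N by [].
    by rewrite /taylor_form f1 invr1 mul1r/= -J_mulmx// mulmxA.
  rewrite /component/= mulmxBl.
  have -> (a b x : 'cV[R]_n) : (a - b - x) j 0 = a j 0 - b j 0 - x j 0 by rewrite !mxE.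
  have -> (a b : 'cV[R]_n) (s : R) : (s *: (a - b)) j 0 = s * (a j 0 - b j 0) by rewrite !mxE.
  move: (taylor_form _ _ _ 2 t l z) (taylor_form _ _ _ 3 t l z) (taylor_form _ _ _ 4 t l z)
    (invmx (cP C t l) i j) (F (cv C t l) t l j 0) (F (cv C t l + _) t l j 0)
    ((J F (cv C t l) t l *m _ *m _) j 0) ((cP C t l *m _ *m _) j 0) => ? ? ? ? ? ? ? ?; ring.
have en : 0 < `|e| by rewrite normr_gt0.
rewrite -(ler_pM2l en) -normrM GE.
have -> : `|e| * ((\sum_j Lj j * Kj j) * `|e| ^+ 4) = \sum_j Lj j * (Kj j * `|e| ^+ 5).
  by rewrite !mulr_suml mulr_sumr; apply: eq_bigr => j _; rewrite (exprS _ 4); ring.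
apply: le_trans (ler_norm_sum _ _ _) _; apply: ler_sum => j _; rewrite normrM.
by apply: ler_pM.
Qed.

End expansion_of_G.

(** * The residual of the normal form *)

Section derivatives_along_curves.
Variable R : realType.

Lemma der_scale_cst (V W : normedModType R) (f : V -> R) (x u : V) (df : R) (w : W) : is_derive x u
  f df ->
  is_derive x u (fun y => f y *: w) (df *: w).
Proof.
move=> [h1 h2].
have E : (fun h : R => h^-1 *: (((fun y => f y *: w) \o shift x) (h *: u) - f x *: w)) =
    (fun h : R => (h^-1 *: ((f \o shift x) (h *: u) - f x)) *: w).
  by apply/funext => h /=; rewrite -scalerBl scalerA.
have hl : (fun h : R => (h^-1 *: ((f \o shift x) (h *: u) - f x)) *: w) @ 0^' --> df *: w.
  by rewrite -h2; apply: cvgZr_tmp.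
by apply: DeriveDef; [rewrite /derivable E; apply/cvg_ex; exists (df *: w)|rewrite /derive E;
  exact: cvg_lim].
Qed.

Lemma der_coord (p q : nat) (x u : 'M[R]_(p, q)) i j : is_derive x u (fun y : 'M[R]_(p, q) =>
  y i j) (u i j).
Proof.
have hd : derivable (id : 'M[R]_(p, q) -> 'M[R]_(p, q)) x u by exact: derivable_id.
apply: DeriveDef; first exact: (derivable_mxP id x u).1.
by have /matrixP/(_ i j) := derive_mx hd; rewrite derive_id mxE.
Qed.

Lemma der_entry (V : normedModType R) (p q : nat) (f : V -> 'M[R]_(p, q)) x u df i j :
  is_derive x u f df -> is_derive x u (fun y => f y i j) (df i j).
Proof.
move=> [h1 h2]; apply: DeriveDef; first exact: (derivable_mxP f x u).1.
by rewrite -h2 (derive_mx h1) mxE.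
Qed.

Lemma der_mx (V : normedModType R) (p q : nat) (f : V -> 'M[R]_(p, q)) x u (df : 'M[R]_(p, q)) :
  (forall i j, is_derive x u (fun y => f y i j) (df i j)) -> is_derive x u f df.
Proof.
move=> h; have d : derivable f x u by apply/derivable_mxP => i j; have [] := h i j.
by apply: DeriveDef => //; rewrite (derive_mx d); apply/matrixP => i j; rewrite mxE;
  have [_ ->] := h i j.
Qed.

End derivatives_along_curves.

Section normal_form_polynomials.
Variable R : realType.
Implicit Types (e : R).

(** On the unit circle these quadratic polynomials are 1, cos 2phi and sin 2phi; the cubic ones of
    [hc] are cos phi, sin phi, cos 3phi and sin 3phi. *)
Definition hq (W : lmodType R) (x1 x2 : R) (a0 a2 b2 : W) : W :=
  (x1 ^+ 2 + x2 ^+ 2) *: a0 + (x1 ^+ 2 - x2 ^+ 2) *: a2 + (2 * x1 * x2) *: b2.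

Definition hc (W : lmodType R) (x1 x2 : R) (a1 b1 a3 b3 : W) : W :=
  (x1 * (x1 ^+ 2 + x2 ^+ 2)) *: a1 + (x2 * (x1 ^+ 2 + x2 ^+ 2)) *: b1
  + (x1 * (x1 ^+ 2 - 3 * x2 ^+ 2)) *: a3 + (x2 * (3 * x1 ^+ 2 - x2 ^+ 2)) *: b3.

Definition dhq (W : lmodType R) (x1 x2 d1 d2 : R) (a0 a2 b2 : W) : W :=
  (2 * x1 * d1 + 2 * x2 * d2) *: a0 + (2 * x1 * d1 - 2 * x2 * d2) *: a2
  + (2 * (x1 * d2 + d1 * x2)) *: b2.

Definition dhc (W : lmodType R) (x1 x2 d1 d2 : R) (a1 b1 a3 b3 : W) : W :=
  (3 * x1 ^+ 2 * d1 + d1 * x2 ^+ 2 + 2 * x1 * x2 * d2) *: a1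
  + (2 * x1 * x2 * d1 + d2 * x1 ^+ 2 + 3 * x2 ^+ 2 * d2) *: b1
  + (3 * x1 ^+ 2 * d1 - 3 * x2 ^+ 2 * d1 - 6 * x1 * x2 * d2) *: a3
  + (6 * x1 * x2 * d1 + 3 * x1 ^+ 2 * d2 - 3 * x2 ^+ 2 * d2) *: b3.

Lemma hq_scale (W : lmodType R) e (x1 x2 : R) (a0 a2 b2 : W) :
  hq (e * x1) (e * x2) a0 a2 b2 = e ^+ 2 *: hq x1 x2 a0 a2 b2.
Proof. by rewrite /hq !scalerDr !scalerA; congr (_ *: _ + _ *: _ + _ *: _); ring. Qed.

Lemma hc_scale (W : lmodType R) e (x1 x2 : R) (a1 b1 a3 b3 : W) :
  hc (e * x1) (e * x2) a1 b1 a3 b3 = e ^+ 3 *: hc x1 x2 a1 b1 a3 b3.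
Proof. by rewrite /hc !scalerDr !scalerA; congr (_ *: _ + _ *: _ + _ *: _ + _ *: _); ring. Qed.

Lemma dhq_scale (W : lmodType R) e (x1 x2 d1 d2 : R) (a0 a2 b2 : W) :
  dhq (e * x1) (e * x2) d1 d2 a0 a2 b2 = e *: dhq x1 x2 d1 d2 a0 a2 b2.
Proof. by rewrite /dhq !scalerDr !scalerA; congr (_ *: _ + _ *: _ + _ *: _); ring. Qed.

Lemma dhc_scale (W : lmodType R) e (x1 x2 d1 d2 : R) (a1 b1 a3 b3 : W) :
  dhc (e * x1) (e * x2) d1 d2 a1 b1 a3 b3 = e ^+ 2 *: dhc x1 x2 d1 d2 a1 b1 a3 b3.
Proof. by rewrite /dhc !scalerDr !scalerA; congr (_ *: _ + _ *: _ + _ *: _ + _ *: _); ring. Qed.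

Section derivatives.
Variables (V W : normedModType R) (X1 X2 : V -> R) (x u : V) (d1 d2 : R).
Hypotheses (h1 : is_derive x u X1 d1) (h2 : is_derive x u X2 d2).

Lemma der_hq (a0 a2 b2 : W) : is_derive x u (fun y => hq (X1 y) (X2 y) a0 a2 b2)
  (dhq (X1 x) (X2 x) d1 d2 a0 a2 b2).
Proof.
have s1 := derM h1 h1; have s2 := derM h2 h2; have s12 := derM (derZ 2 h1) h2.
have := is_deriveD (is_deriveD (der_scale_cst a0 (derD s1 s2)) (der_scale_cst a2 (derB s1 s2)))
  (der_scale_cst b2 s12).
rewrite /dhq => h; apply: is_derive_eq h _.
by congr (_ *: _ + _ *: _ + _ *: _); ring.
Qed.

Lemma der_hc (a1 b1 a3 b3 : W) : is_derive x u (fun y => hc (X1 y) (X2 y) a1 b1 a3 b3)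
  (dhc (X1 x) (X2 x) d1 d2 a1 b1 a3 b3).
Proof.
have s1 := derM h1 h1; have s2 := derM h2 h2.
have := is_deriveD (is_deriveD (is_deriveD
  (der_scale_cst a1 (derM h1 (derD s1 s2))) (der_scale_cst b1 (derM h2 (derD s1 s2))))
  (der_scale_cst a3 (derM h1 (derB s1 (derZ 3 s2))))) (der_scale_cst b3 (derM h2 (derB (derZ 3 s1)
    s2))).
rewrite /dhc => h; apply: is_derive_eq h _.
by congr (_ *: _ + _ *: _ + _ *: _ + _ *: _); ring.
Qed.

End derivatives.

Section coefficient_derivatives.
Variables (V W : normedModType R) (x u : V) (x1 x2 : R).

Lemma der_hq_coef (a0 a2 b2 : V -> W) da0 da2 db2 :
  is_derive x u a0 da0 -> is_derive x u a2 da2 -> is_derive x u b2 db2 ->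
  is_derive x u (fun y => hq x1 x2 (a0 y) (a2 y) (b2 y)) (hq x1 x2 da0 da2 db2).
Proof. by move=> h0 h2 k2; exact: is_deriveD. Qed.

Lemma der_hc_coef (a1 b1 a3 b3 : V -> W) da1 db1 da3 db3 :
  is_derive x u a1 da1 -> is_derive x u b1 db1 -> is_derive x u a3 da3 -> is_derive x u b3 db3 ->
  is_derive x u (fun y => hc x1 x2 (a1 y) (b1 y) (a3 y) (b3 y)) (hc x1 x2 da1 db1 da3 db3).
Proof. by move=> h1 k1 h3 k3; exact: is_deriveD. Qed.

End coefficient_derivatives.
End normal_form_polynomials.

Section twice_differentiability_of_G.
Variables (R : realType) (ls : R).

Lemma jet_id (T : Type) (r : R) n : jet r n (fun (_ : T) e => e).
Proof.
have h1 : jet r n (fun (_ : T) _ => 1) by apply: (jet_cst r n (c := fun _ : T => (1 : R)));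
  exists 1 => u; rewrite normr1.
by apply: (@jet_ext _ _ _ _ (fun (_ : T) (e : R) => e * 1)) (jetW (jet_shift h1)) => u s _;
  rewrite mulr1.
Qed.

Lemma jet_expr (T : Type) (r : R) n k : jet r n (fun (_ : T) e => e ^+ k).
Proof.
elim: k => [|k IH].
  by apply: (jet_cst r n (c := fun _ : T => (1 : R))); exists 1 => u; rewrite normr1.
by apply: (@jet_ext _ _ _ _ (fun (_ : T) (e : R) => e * e ^+ k)) (jetM (jet_id T r n) IH) => u s _;
  rewrite exprS.
Qed.

Lemma jet_poly2 (T : Type) (r : R) n (a b c : T -> R) :
  bounded_family a -> bounded_family b -> bounded_family c ->
  jet r n (fun u e => a u + e * b u + e ^+ 2 * c u).
Proof.
move=> ha hb hc; apply: jetD; last by apply: jetM; [exact: jet_expr|exact: jet_cst].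
by apply: jetD; [exact: jet_cst|apply: jetM; [exact: jet_id|exact: jet_cst]].
Qed.

Variables (n : nat) (v : R -> R -> 'cV[R]_n) (P : R -> R -> 'M[R]_n) (H : 'cV[R]_n * R * R -> R).
Hypotheses (hv : forall j, lipb ls (fun t l => v t l j 0)) (hP : forall i j, lipb ls (fun t l =>
  P t l i j))
  (H_smooth : smper H).

(** The quotient by e costs one derivative at e = 0. It is recovered from an expansion, up to a
    third order remainder, of the derivative of H along the curve, which the jets supply. *)
Lemma T2_difference_quotient (t : R) (a b c : 'cV[R]_n) :
  T2 (fun e : R => if e == 0 then 'D_(dir (P t ls *m a) 0) H (v t ls, t, ls)
    else (H (v t ls + e *: (P t ls *m (a + e *: b + e ^+ 2 *: c)), t, ls) - H (v t ls, t, ls)) / e).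
Proof.
(* [w] is the derivative of e z(e), so [P *m w] is the velocity of the curve v + e P z(e). *)
pose z (e : R) := a + e *: b + e ^+ 2 *: c;
  pose w (e : R) := a + e *: (2 *: b) + e ^+ 2 *: (3 *: c).
pose ga (e : R) := (v t ls + e *: (P t ls *m z e), t, ls).
pose df (e : R) := 'D_(dir (P t ls *m w e) 0) H (ga e).
have ga0 : ga 0 = (v t ls, t, ls) by rewrite /ga scale0r addr0.
have dga (e : R) : is_derive e 1 ga (dir (P t ls *m w e) 0).
  have EX (x : R) : ga x = (v t ls, t, ls) + x *: dir (P t ls *m a) 0 + x ^+ 2 *: dir (P t ls *m b)
    0 + x ^+ 3 *: dir (P t ls *m c) 0.
    rewrite /ga /dir /z; congr (_, _, _); rewrite /= ?scaler0 ?addr0//.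
    by rewrite !mulmxDr -!scalemxAr !scalerDr !scalerA !addrA -expr2 -exprS.
  have -> : ga = fun x => (v t ls, t, ls) + x *: dir (P t ls *m a) 0 + x ^+ 2 *: dir (P t ls *m b)
    0 + x ^+ 3 *: dir (P t ls *m c) 0.
    by apply/funext => x; rewrite EX.
  have := is_deriveD (is_deriveD (is_deriveD (is_derive_cst (v t ls, t, ls) e 1)
    (der_scale_cst (dir (P t ls *m a) 0) (der_id e))) (der_scale_cst (dir (P t ls *m b) 0)
      (derX 2 e)))
    (der_scale_cst (dir (P t ls *m c) 0) (derX 3 e)).
  move=> h; apply: is_derive_eq h _.
  rewrite /dir /w; congr (_, _, _); rewrite /= ?scaler0 ?addr0//.
  by rewrite add0r !mulmxDr -!scalemxAr !scalerA expr1; congr (_ + _ *: _ + _ *: _);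
    [rewrite scale1r|rewrite /=; ring..].
have w0 : w 0 = a by rewrite /w expr0n/= !scale0r !addr0.
have zE j (e : R) : z e j 0 = a j 0 + e * b j 0 + e ^+ 2 * c j 0 by rewrite !mxE.
have wE j (e : R) : w e j 0 = a j 0 + e * (2 * b j 0) + e ^+ 2 * (3 * c j 0) by rewrite !mxE.
have bf (k : R) : bounded_family (fun _ : unit => k) by exists `|k|.
have jz N j : jet 1 N (fun (_ : unit) e => z e j 0).
  by apply: jet_ext (jet_poly2 1 N (bf (a j 0)) (bf (b j 0)) (bf (c j 0))) => u s _; rewrite zE.
have jw N j : jet 1 N (fun (_ : unit) e => w e j 0).
  by apply: jet_ext (jet_poly2 1 N (bf (a j 0)) (bf (2 * b j 0)) (bf (3 * c j 0))) => u s _;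
    rewrite wE.
pose rho := \sum_j (`|a j 0| + `|b j 0| + `|c j 0|).
have rho0 : 0 <= rho by apply: sumr_ge0 => j _; rewrite !addr_ge0.
have zb (e : R) j : `|e| <= 1 -> `|z e j 0| <= rho.
  move=> he; rewrite zE /rho (bigD1 j)//=.
  apply: le_trans (_ : `|a j 0| + `|b j 0| + `|c j 0| <= _); last first.
    by rewrite lerDl; apply: sumr_ge0 => i _; rewrite !addr_ge0.
  apply: le_trans (ler_normD _ _) _; apply: lerD.
    by apply: le_trans (ler_normD _ _) _; apply: lerD => //; rewrite normrM ler_piMl.
  by rewrite normrM normrX ler_piMl// exprn_ile1.
have jD i : jet 1 3 (fun (_ : unit) e => 'D_(edir i) H (ga e)).
  have hs := smper_derive (edir i) H_smooth.
  have [K K0 hK] := taylor_form_bound hv hP 3 hs rho0.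
  have {}hK := nbhs_singleton hK.
  pose S (e : R) := \sum_(k < 3) e ^+ k * taylor_form v P (fun b => 'D_(edir i) H b) k t ls (z e).
  have jS : jet 1 3 (fun (_ : unit) e => S e).
    apply: jet_sum => // k; apply: jetM => //; first exact: jet_expr.
    apply: (@jet_hom _ unit 1 ls n (fun=> t) (fun _ => z) k) => //.
    exact: hom_taylor_form.
  have jR : jet 1 3 (fun (_ : unit) e => 'D_(edir i) H (ga e) - S e).
    by apply: (jet_remainder ler01 K0) => u s hs1; apply: hK => // j; exact: zb.
  by apply: jet_ext (jetD jR jS) => u s _; rewrite subrK.
have jdf : jet 1 3 (fun (_ : unit) e => df e).
  apply: (@jet_ext _ _ _ _ (fun (_ : unit) e => \sum_i (\sum_j P t ls i j * w e j 0) * 'D_(edir i)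
    H (ga e))).
    move=> u s _; rewrite /df derive_dir// mul0r addr0; apply: eq_bigr => i _.
    by rewrite mxE.
  apply: jet_sum => // i; apply: jetM => //.
  by apply: jet_sum => // j; apply: jetZ => //.
move: jdf => /jetS[c0 [g0 [_ /jetS[c1 [g1 [_ /jetS[c2 [g2 [_ [K hK] E2]]] E1]]] E0]]].
have dfb (e : R) : `|e| <= 1 -> `|df e - (c0 tt + c1 tt * e + c2 tt * e ^+ 2)| <= K * `|e| ^+ 3.
  move=> he; rewrite (E0 tt)// E1// E2//.
  have -> : c0 tt + e * (c1 tt + e * (c2 tt + e * g2 tt e)) - (c0 tt + c1 tt * e + c2 tt * e ^+ 2)
    = g2 tt e * e ^+ 3 by ring.
  by rewrite normrM normrX ler_wpM2r ?exprn_ge0//; exact: hK.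
have := @T2_quotient R (fun e => H (ga e)) df 1 (c0 tt) (c1 tt) (c2 tt) K ltr01 _ dfb.
have -> : df 0 = 'D_(dir (P t ls *m a) 0) H (v t ls, t, ls) by rewrite /df w0 ga0.
rewrite ga0; apply=> e _.
by exact: (der_chain (dga e) (smper_diff (ga e) H_smooth)).
Qed.

End twice_differentiability_of_G.

Section G_along_polynomial_curves.
Variables (R : realType) (m : nat) (F : vector_field R m) (ls : R) (U : set R) (C : continuation R
  m).
Local Notation n := (2 + m)%N.
Hypotheses (F_smooth : smooth_field F) (U_open : open U) (U_ls : U ls)
  (smooth_v : smooth_periodic U (cv C)) (smooth_P : smooth_periodic U (cP C))
  (floquet : forall l, U l -> is_floquet F l (cv C ^~ l) (cP C ^~ l) (cE C l)).

(** The value prescribed for [G] at e = 0 is its limit, by the Floquet relation. Hence [G] is a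
    fixed combination of extended difference quotients at e = 0 too. *)
Lemma T2_G (t : R) (a b c : 'cV[R]_n) i :
  T2 (fun e : R => G F C (a + e *: b + e ^+ 2 *: c) ls t e i 0).
Proof.
pose q j (e : R) := if e == 0 then 'D_(dir (cP C t ls *m a) 0) (component F j) (cv C t ls, t, ls)
    else (component F j (cv C t ls + e *: (cP C t ls *m (a + e *: b + e ^+ 2 *: c)), t, ls)
      - component F j (cv C t ls, t, ls)) / e.
pose z (e : R) := a + e *: b + e ^+ 2 *: c.
have uP : cP C t ls \in unitmx by exact: (floquet U_ls).2.1.
have -> : (fun e : R => G F C (a + e *: b + e ^+ 2 *: c) ls t e i 0) =
   fun e : R => \sum_j invmx (cP C t ls) i j * (q j e - (derive1 (cP C ^~ ls) t *m z e) j 0).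
  apply/funext => e; rewrite /G /q; have [->|e0] := eqVneq e 0.
    have -> : z 0 = a by rewrite /z expr0n/= !scale0r !addr0.
    rewrite -/(z 0) (_ : z 0 = a); last by rewrite /z expr0n/= !scale0r !addr0.
    rewrite (derive1_P floquet)//.
    have := congr1 (fun M : 'cV_n => M i 0) (mulKmx uP (cE C ls *m a)); rewrite mxE => <-.
    apply: eq_bigr => j _; congr (_ * _).
    rewrite -(J_mulmx F_smooth) mulmxBl !mulmxA.
    have -> (M N : 'cV[R]_n) : (M - N) j 0 = M j 0 - N j 0 by rewrite !mxE.
    by rewrite opprB [RHS]addrC subrK.
  rewrite [LHS]mxE mxE mulr_sumr; apply: eq_bigr => j _.
  rewrite /component/= -/(z e).
  have -> (x y w : 'cV[R]_n) : (x - y - e *: w) j 0 = x j 0 - y j 0 - e * w j 0 by rewrite !mxE.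
  by field.
apply: T2_sum => j; apply: T2Z; apply: T2B.
  exact: (T2_difference_quotient (lipb_v U_open U_ls smooth_v) (lipb_P U_open U_ls smooth_P)
    (component_smper F_smooth j) t a b c).
have -> : (fun e => (derive1 (cP C ^~ ls) t *m z e) j 0) = fun e => \sum_k derive1 (cP C ^~ ls) t j
  k *
   (a k 0 + e * b k 0 + e * e * c k 0).
  by apply/funext => e; rewrite mxE; apply: eq_bigr => k _; rewrite !mxE expr2.
apply: T2_sum => k; apply: T2Z; apply: T2D; first (apply: T2D; first exact: T2_cst).
  by apply: T2M; [exact: T2_id|exact: T2_cst].
by apply: T2M; [apply: T2M; exact: T2_id|exact: T2_cst].
Qed.

End G_along_polynomial_curves.

Section periodic_curves.
Variable R : realType.

(** The bounds on the derivative make the theta-derivative of z^N, hence its residual, expandable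
    uniformly in theta. *)
Definition per_curve q (f : R -> 'cV[R]_q) := [/\ forall t : R, is_derive t 1 f (derive1 f t),
  forall t, f (t + 2 * pi) = f t, forall i, bounded_family (fun t => f t i 0) &
  forall i, bounded_family (fun t => derive1 f t i 0)].

Lemma smooth_per_curve q (U : set R) (ls : R) (f : R -> R -> 'cV[R]_q) : open U -> U ls ->
  smooth_periodic U f -> per_curve (f^~ ls).
Proof.
move=> oU Uls hf; have d t i := smooth_periodic_der_left oU i 0 t hf Uls.
have [hs hp] := hf.
have D (t : R) : is_derive t 1 (f^~ ls) (derive1 (f^~ ls) t).
  have h : is_derive t 1 (f^~ ls) (\col_i 'D_(1, 0) (fun a : R * R => f a.1 a.2 i 0) (t, ls)).
    by apply: der_mx => i j; rewrite ord1 mxE; exact: d.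
  have [h1 _] := h; rewrite derive1E; exact: derivableP.
split=> // [t|i|i]; first exact: hp.
  have [K K0 hK] := lipb_pos (smooth_periodic_lipb oU Uls i 0 hf); exists K => t.
  by have [] := nbhs_singleton hK t.
have E t : derive1 (f^~ ls) t i 0 = 'D_(1, 0) (fun a : R * R => f a.1 a.2 i 0) (t, ls).
  have [_ <-] := der_entry i 0 (D t); have [_ ->] := d t i; by [].
have pd t : derive1 (f^~ ls) (t + 2 * pi) i 0 = derive1 (f^~ ls) t i 0.
  rewrite !derive1E /derive.
  suff -> : (fun h : R => h^-1 *: (((f^~ ls) \o shift (t + 2 * pi)) (h *: 1) - f (t + 2 * pi) ls)) =
    (fun h : R => h^-1 *: (((f^~ ls) \o shift t) (h *: 1) - f t ls)) by [].
  by apply/funext => h; rewrite /= addrA !hp.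
have cd : continuous (fun t => derive1 (f^~ ls) t i 0).
  have -> : (fun t => derive1 (f^~ ls) t i 0) = fun t => 'D_(1, 0) (fun a : R * R => f a.1 a.2 i 0)
    (t, ls).
    by apply/funext => t; exact: E.
  move=> t; have [_ h2] := C1_entry i 0 (open_strip oU) (hs 1%N).
  apply: (@continuous_comp _ _ _ (fun t : R => (t, ls)) (fun a => 'D_(1, 0) (fun a : R * R =>
    f a.1 a.2 i 0) a)).
    exact: (cvg_pair cvg_id (cvg_cst _)).
  exact: h2.
by have [K K0 hK] := periodic_continuous_bounded pd cd; exists K.
Qed.

Lemma per_curve0 q : per_curve (fun=> 0 : 'cV[R]_q).
Proof.
have D (t : R) : is_derive t 1 (fun=> 0 : 'cV[R]_q) 0 by exact: is_derive_cst.
have E (t : R) : derive1 (fun=> 0 : 'cV[R]_q) t = 0 by rewrite derive1E; have [_ ->] := D t.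
by split=> [t|//|i|i]; [rewrite E; exact: D|exists 0 => t; rewrite mxE normr0|exists 0 => t;
  rewrite E mxE normr0].
Qed.

Lemma col_mx_derive p q (f : R -> 'cV[R]_p) (g : R -> 'cV[R]_q) (x : R) df dg :
  is_derive x 1 f df -> is_derive x 1 g dg -> is_derive x 1 (fun t => col_mx (f t) (g t))
    (col_mx df dg).
Proof.
move=> hf hg; apply: der_mx => i j; case: (split_ordP i) => k ->.
  have -> : (fun y => col_mx (f y) (g y) (lshift q k) j) = fun y => f y k j by apply/funext => y;
    rewrite col_mxEu.
  by rewrite col_mxEu; exact: der_entry.
have -> : (fun y => col_mx (f y) (g y) (rshift p k) j) = fun y => g y k j by apply/funext => y;
  rewrite col_mxEd.
by rewrite col_mxEd; exact: der_entry.
Qed.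

Lemma derive1_col_mx p q (f : R -> 'cV[R]_p) (g : R -> 'cV[R]_q) t : per_curve f -> per_curve g ->
  derive1 (fun t => col_mx (f t) (g t)) t = col_mx (derive1 f t) (derive1 g t).
Proof. by move=> [hf _ _ _] [hg _ _ _]; rewrite derive1E;
  have [_ ->] := col_mx_derive (hf t) (hg t). Qed.

Lemma per_curve_col_mx p q (f : R -> 'cV[R]_p) (g : R -> 'cV[R]_q) : per_curve f -> per_curve g ->
  per_curve (fun t => col_mx (f t) (g t)).
Proof.
move=> hf hg; have E t := derive1_col_mx t hf hg; have [df pf bf bdf] := hf;
  have [dg pg bg bdg] := hg.
split=> [t|t|i|i]; first by rewrite E; exact: col_mx_derive.
- by rewrite pf pg.
- case: (split_ordP i) => k ->.
    by have [K hK] := bf k; exists K => t; rewrite col_mxEu.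
  by have [K hK] := bg k; exists K => t; rewrite col_mxEd.
- case: (split_ordP i) => k ->.
    by have [K hK] := bdf k; exists K => t; rewrite E col_mxEu.
  by have [K hK] := bdg k; exists K => t; rewrite E col_mxEd.
Qed.

End periodic_curves.

Section little_o_algebra.
Variable R : realType.
Implicit Types (f g h : R -> R) (e : R).

Lemma little_o_add k f g : little_o k f -> little_o k g -> little_o k (fun e => f e + g e).
Proof.
move=> hf hg eta eta0; have eta2 : 0 < eta / 2 by rewrite divr_gt0.
have [d d0 hd] := hf _ eta2; have [c c0 hc] := hg _ eta2.
exists (Num.min d c); first by rewrite lt_min d0.
move=> s s0; rewrite le_min => /andP[h1 h2]; apply: le_trans (ler_normD _ _) _.
have -> : eta = eta / 2 + eta / 2 by rewrite -splitr.
by rewrite mulrDl; apply: lerD; [exact: hd|exact: hc].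
Qed.

Lemma little_o_near k f g : (\forall e \near (0 : R), f e = g e) -> little_o k f -> little_o k g.
Proof.
move=> /nbhs_ballP[r /= r0 hr] hf eta eta0; have [d d0 hd] := hf _ eta0.
exists (Num.min d (r / 2)); first by rewrite lt_min d0 divr_gt0.
move=> s s0; rewrite le_min => /andP[h1 h2]; rewrite -hr; first exact: hd.
by rewrite /ball/= sub0r normrN; lra.
Qed.

Lemma little_o_mul k f g : {for 0, continuous g} -> little_o k f -> little_o k (fun e => g e * f e).
Proof.
move=> cg hf eta eta0.
have : \forall e \near (0 : R), `|g e - g 0| <= 1.
  by have /cvgrPdist_le /(_ 1 ltr01) := cg; apply: filterS => e; rewrite distrC.
move=> /nbhs_ballP[r /= r0 hr].
have K0 : 0 < `|g 0| + 1 by have := normr_ge0 (g 0); lra.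
have [d d0 hd] := hf _ (divr_gt0 eta0 K0).
exists (Num.min d (r / 2)); first by rewrite lt_min d0 divr_gt0.
move=> s s0; rewrite le_min => /andP[h1 h2].
have hg : `|g s| <= `|g 0| + 1.
  have -> : g s = g 0 + (g s - g 0) by ring.
  apply: le_trans (ler_normD _ _) _; rewrite lerD2l; apply: hr.
  by rewrite /ball/= sub0r normrN; lra.
rewrite normrM; apply: le_trans (ler_pM _ _ hg (hd s s0 h1)) _ => //.
by rewrite mulrA mulrCA divff ?lt0r_neq0// mulr1.
Qed.

Lemma little_o_monomial k : little_o k (fun e => e ^+ k.+1).
Proof.
move=> eta eta0; exists eta => // s s0 hs; rewrite normrX exprS.
by rewrite ler_wpM2r// exprn_ge0.
Qed.

Lemma little_o_scale k f : little_o k f -> little_o k.+1 (fun e => e * f e).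
Proof.
move=> hf eta eta0; have [d d0 hd] := hf _ eta0; exists d => // s s0 hs.
by rewrite normrM exprS mulrCA ler_wpM2l//; exact: hd.
Qed.

Lemma little_oW k f : little_o k.+1 f -> little_o k f.
Proof.
move=> hf eta eta0; have [d d0 hd] := hf _ eta0; exists (Num.min d 1);
  first by rewrite lt_min d0 ltr01.
move=> s s0; rewrite le_min => /andP[h1 h2]; apply: le_trans (hd s s0 h1) _.
by rewrite exprS mulrCA ler_piMl// mulr_ge0 ?exprn_ge0// ltW.
Qed.

Lemma little_o0 k : little_o k (fun=> 0 : R).
Proof. by move=> eta eta0; exists 1 => // s _ _; rewrite normr0 mulr_ge0 ?exprn_ge0// ltW. Qed.

Lemma little_o_sum k n (f : 'I_n -> R -> R) : (forall i, little_o k (f i)) ->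
  little_o k (fun e => \sum_i f i e).
Proof.
move=> hf; elim: n f hf => [|n IH] f hf.
  by rewrite (_ : (fun e => _) = fun=> 0); [exact: little_o0|apply/funext => e; rewrite big_ord0].
rewrite (_ : (fun e => _) = fun e => \sum_(i < n) f (widen_ord (leqnSn n) i) e + f ord_max e).
  by apply: little_o_add => //; apply: IH => i.
by apply/funext => e; rewrite big_ord_recr.
Qed.

End little_o_algebra.

Section entries.
Variable R : realType.

Lemma ord2 (i : 'I_2) : i = 0 \/ i = 1.
Proof. by case: i => [[|[|//]] hi]; [left|right]; exact: val_inj. Qed.

Lemma hq_entry q (x1 x2 : R) (a0 a2 b2 : 'cV[R]_q) i :
  (hq x1 x2 a0 a2 b2) i 0 = hq x1 x2 (a0 i 0 : R^o) (a2 i 0) (b2 i 0).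
Proof. by rewrite !mxE. Qed.

Lemma hc_entry q (x1 x2 : R) (a1 b1 a3 b3 : 'cV[R]_q) i :
  (hc x1 x2 a1 b1 a3 b3) i 0 = hc x1 x2 (a1 i 0 : R^o) (b1 i 0) (a3 i 0) (b3 i 0).
Proof. by rewrite !mxE. Qed.

Lemma dhq_entry q (x1 x2 d1 d2 : R) (a0 a2 b2 : 'cV[R]_q) i :
  (dhq x1 x2 d1 d2 a0 a2 b2) i 0 = dhq x1 x2 d1 d2 (a0 i 0 : R^o) (a2 i 0) (b2 i 0).
Proof. by rewrite !mxE. Qed.

Lemma dhc_entry q (x1 x2 d1 d2 : R) (a1 b1 a3 b3 : 'cV[R]_q) i :
  (dhc x1 x2 d1 d2 a1 b1 a3 b3) i 0 = dhc x1 x2 d1 d2 (a1 i 0 : R^o) (b1 i 0) (a3 i 0) (b3 i 0).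
Proof. by rewrite !mxE. Qed.

Lemma h_rescale q r (x1 x2 e : R) (a0 a2 b2 a1 b1 a3 b3 : 'cV[R]_q) (A0 A2 B2 A1 B1 A3 B3 :
  'cV[R]_r) i j :
  A0 j 0 = a0 i 0 -> A1 j 0 = a1 i 0 -> A2 j 0 = a2 i 0 -> A3 j 0 = a3 i 0 ->
  B1 j 0 = b1 i 0 -> B2 j 0 = b2 i 0 -> B3 j 0 = b3 i 0 ->
  (e^-1 *: (hq (e * x1) (e * x2) a0 a2 b2 + hc (e * x1) (e * x2) a1 b1 a3 b3)) i 0 =
  (e *: hq x1 x2 A0 A2 B2 + e ^+ 2 *: hc x1 x2 A1 B1 A3 B3) j 0.
Proof.
move=> E0 E1 E2 E3 F1 F2 F3; rewrite hq_scale hc_scale.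
have -> (a b : 'cV[R]_q) : (e^-1 *: (e ^+ 2 *: a + e ^+ 3 *: b)) i 0 =
  e^-1 * (e ^+ 2 * a i 0 + e ^+ 3 * b i 0) by rewrite !mxE.
have -> (a b : 'cV[R]_r) : (e *: a + e ^+ 2 *: b) j 0 = e * a j 0 + e ^+ 2 * b j 0 by rewrite !mxE.
rewrite !hq_entry !hc_entry E0 E1 E2 E3 F1 F2 F3; move: (hq _ _ _ _ _) (hc _ _ _ _ _ _) => a b.
have [->|e0] := eqVneq e 0; first by rewrite invr0 !expr0n/= !mul0r addr0.
by field.
Qed.

Lemma der1E (W : normedModType R) (f : R -> W) (t : R) df : is_derive t 1 f df -> derive1 f t = df.
Proof. by move=> [_ <-]; rewrite derive1E. Qed.

Lemma little_o_quadratic (f f1 : R -> R) (f2 c w : R) : twice_der f f1 f2 -> f 0 = c -> f1 0 =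
  0 -> f2 / 2 = w ->
  little_o 2 (fun e => f e - c - e ^+ 2 * w).
Proof.
move=> hf <- f10 <-;
  rewrite (_ : (fun e => _) = fun e => f e - (f 0 + f1 0 * e + f2 / 2 * e ^+ 2));
  first exact: T2_taylor.
by apply/funext => e; rewrite f10; ring.
Qed.

Lemma little_o_linear (f : R -> R) (df : R) : is_derive (0 : R) 1 f df -> f 0 = 0 -> df =
  0 -> little_o 1 f.
Proof.
move=> hf f0 df0; rewrite (_ : f = fun e => f e - (f 0 + df * e)); first exact: der_zeroP.
by apply/funext => e; rewrite f0 df0 mul0r addr0 subr0.
Qed.

End entries.

(** * The image of the circle under the normal form transformation, at fixed angles *)

Section normal_form_curves.
Variables (R : realType) (m : nat) (F : vector_field R m) (ls os : R) (U : set R)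
  (C : continuation R m) (N : nf_coeffs R m) (Ets : 'M[R]_m).
Local Notation n := (2 + m)%N.
Hypotheses (F_smooth : smooth_field F) (U_open : open U) (U_ls : U ls)
  (smooth_v : smooth_periodic U (cv C)) (smooth_P : smooth_periodic U (cP C))
  (floquet : forall l, U l -> is_floquet F l (cv C ^~ l) (cP C ^~ l) (cE C l))
  (E_ls : cE C ls = Estar os Ets) (nf : is_normal_form F U C N).

(** Hat and tilde coefficients in one vector. The tilde transformation is purely quadratic, hence
    the zero block for odd k. *)
Definition nfA k t : 'cV[R]_n := col_mx (ah N k t ls) (if odd k then 0 else at_ N k t ls).
Definition nfB k t : 'cV[R]_n := col_mx (bh N k t ls) (if odd k then 0 else bt N k t ls).

Lemma per_nfA k : (k <= 3)%N -> per_curve (nfA k).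
Proof.
move=> k3; apply: per_curve_col_mx; first exact: smooth_per_curve U_open U_ls (nf_ah nf k3).
case: k k3 => [|[|[|[|//]]]] _ /=; try exact: per_curve0.
  exact: smooth_per_curve U_open U_ls (nf_at0 nf).
exact: smooth_per_curve U_open U_ls (nf_at2 nf).
Qed.

Lemma per_nfB k : (1 <= k <= 3)%N -> per_curve (nfB k).
Proof.
move=> k3; apply: per_curve_col_mx; first exact: smooth_per_curve U_open U_ls (nf_bh nf k3).
case: k k3 => [//|[|[|[|//]]]] _ /=; try exact: per_curve0.
exact: smooth_per_curve U_open U_ls (nf_bt2 nf).
Qed.

(* The image under the normal form transformation of yhat = (x1, x2), ytilde = 0. *)
Definition nf_point (x1 x2 t e : R) : 'cV[R]_n :=
  col_mx (x1 *: e1 R + x2 *: e2 R) 0 + e *: hq x1 x2 (nfA 0 t) (nfA 2 t) (nfB 2 t)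
  + e ^+ 2 *: hc x1 x2 (nfA 1 t) (nfB 1 t) (nfA 3 t) (nfB 3 t).

Lemma e12E (y : 'cV[R]_2) : y 0 0 *: e1 R + y 1 0 *: e2 R = y.
Proof.
apply/colP => i; rewrite !mxE eqxx !andbT.
by case: (ord2 i) => ->; rewrite ?eqxx /= ?mulr1 ?mulr0 ?addr0 ?add0r.
Qed.

Lemma hhatE y t : hhat N y t ls = hq (y 0 0) (y 1 0) (ah N 0 t ls) (ah N 2 t ls) (bh N 2 t ls)
  + hc (y 0 0) (y 1 0) (ah N 1 t ls) (bh N 1 t ls) (ah N 3 t ls) (bh N 3 t ls).
Proof. by rewrite /hhat /hq /hc !addrA. Qed.

Lemma htildeE y t : htilde N y t ls = hq (y 0 0) (y 1 0) (at_ N 0 t ls) (at_ N 2 t ls)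
  (bt N 2 t ls).
Proof. by []. Qed.

(** At e = 0 the two sides agree as well, since [0^-1 = 0] makes the transformation the identity. *)
Lemma nf_mapE y t e : nf_map N y 0 ls t e = nf_point (y 0 0) (y 1 0) t e.
Proof.
have s2 (x : R) : e^-1 * (e ^+ 2 * x) = e * x.
  have [->|e0] := eqVneq e 0; first by rewrite invr0 !mul0r.
  by rewrite expr2 mulrA mulrA mulVf// mul1r.
have s3 (x : R) : e^-1 * (e ^+ 3 * x) = e ^+ 2 * x.
  have [->|e0] := eqVneq e 0; first by rewrite invr0 !expr0n/= !mul0r.
  by rewrite exprS mulrA mulrA mulVf// mul1r.
rewrite /nf_map hhatE htildeE ![(e *: y) _ _]mxE !hq_scale !hc_scale.
rewrite /nf_point e12E; apply/colP => i.
have EE (a b c : 'cV[R]_n) : (a + e *: b + e ^+ 2 *: c) i 0 = a i 0 + e * b i 0 + e ^+ 2 * c i 0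
  by rewrite !mxE.
rewrite EE hq_entry hc_entry; case: (split_ordP i) => k ->.
  rewrite !col_mxEu.
  have -> (a b c : 'cV[R]_2) : (a + e^-1 *: (e ^+ 2 *: b + e ^+ 3 *: c)) k 0 =
    a k 0 + e * b k 0 + e ^+ 2 * c k 0.
    by rewrite !mxE mulrDr s2 s3 addrA.
  by rewrite hq_entry hc_entry.
rewrite !col_mxEd.
have -> (a b : 'cV[R]_m) : (a + e^-1 *: (e ^+ 2 *: b)) k 0 = a k 0 + e * b k 0 by rewrite !mxE s2.
by rewrite hq_entry !mxE /hc !scaler0 !addr0 mulr0 addr0.
Qed.

(* (d1, d2) is the direction of differentiation in the first two arguments. *)
Definition nf_point_dx (x1 x2 d1 d2 t e : R) : 'cV[R]_n :=
  col_mx (d1 *: e1 R + d2 *: e2 R) 0 + e *: dhq x1 x2 d1 d2 (nfA 0 t) (nfA 2 t) (nfB 2 t)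
  + e ^+ 2 *: dhc x1 x2 d1 d2 (nfA 1 t) (nfB 1 t) (nfA 3 t) (nfB 3 t).

Definition nf_point_dt (x1 x2 t e : R) : 'cV[R]_n :=
  e *: hq x1 x2 (derive1 (nfA 0) t) (derive1 (nfA 2) t) (derive1 (nfB 2) t)
  + e ^+ 2 *: hc x1 x2 (derive1 (nfA 1) t) (derive1 (nfB 1) t) (derive1 (nfA 3) t) (derive1 (nfB 3)
    t).

Lemma der_nf_point_t x1 x2 (t : R) e : is_derive t 1 (fun t => nf_point x1 x2 t e) (nf_point_dt x1
  x2 t e).
Proof.
have [[A0 _ _ _] [A1 _ _ _]] := (per_nfA (isT : 0 <= 3)%N, per_nfA (isT : 1 <= 3)%N).
have [[A2 _ _ _] [A3 _ _ _]] := (per_nfA (isT : 2 <= 3)%N, per_nfA (isT : 3 <= 3)%N).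
have [[B1 _ _ _] [B2 _ _ _]] := (per_nfB (isT : 1 <= 1 <= 3)%N, per_nfB (isT : 1 <= 2 <= 3)%N).
have [B3 _ _ _] := per_nfB (isT : 1 <= 3 <= 3)%N.
have := is_deriveD (is_deriveD (is_derive_cst (col_mx (x1 *: e1 R + x2 *: e2 R) (0 : 'cV[R]_m)) t 1)
   (is_deriveZ e (der_hq_coef x1 x2 (A0 t) (A2 t) (B2 t))))
   (is_deriveZ (e ^+ 2) (der_hc_coef x1 x2 (A1 t) (B1 t) (A3 t) (B3 t))).
by move=> h; apply: is_derive_eq h _; rewrite add0r.
Qed.

Lemma der_nf_point_x (V : normedModType R) (X1 X2 : V -> R) (x u : V) d1 d2 t e :
  is_derive x u X1 d1 -> is_derive x u X2 d2 ->
  is_derive x u (fun y => nf_point (X1 y) (X2 y) t e) (nf_point_dx (X1 x) (X2 x) d1 d2 t e).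
Proof.
move=> h1 h2.
have hcol : is_derive x u (fun y => col_mx (X1 y *: e1 R + X2 y *: e2 R) (0 : 'cV[R]_m))
  (col_mx (d1 *: e1 R + d2 *: e2 R) 0).
  have E (y1 y2 : R) : col_mx (y1 *: e1 R + y2 *: e2 R) (0 : 'cV[R]_m) =
    y1 *: col_mx (e1 R) 0 + y2 *: col_mx (e2 R) 0.
    by rewrite !scale_col_mx add_col_mx !scaler0 addr0.
  rewrite E (_ : (fun y => _) = fun y => X1 y *: col_mx (e1 R) 0 + X2 y *: col_mx (e2 R) 0);
    last by apply/funext => y; exact: E.
  by apply: is_deriveD; exact: der_scale_cst.
exact: is_deriveD (is_deriveD hcol (is_deriveZ e (der_hq h1 h2 _ _ _))) (is_deriveZ (e ^+ 2)
  (der_hc h1 h2 _ _ _ _)).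
Qed.

Lemma jac_hhat (y : 'cV[R]_2) t e (d : 'cV[R]_2) i :
  (jac (fun x => hhat N x t ls) (e *: y) *m d) i 0 =
  e * (dhq (y 0 0) (y 1 0) (d 0 0) (d 1 0) (ah N 0 t ls) (ah N 2 t ls) (bh N 2 t ls)) i 0
  + e ^+ 2 * (dhc (y 0 0) (y 1 0) (d 0 0) (d 1 0) (ah N 1 t ls) (bh N 1 t ls) (ah N 3 t ls)
    (bh N 3 t ls)) i 0.
Proof.
have hd (u : 'cV[R]_2) : is_derive (e *: y) u (fun x => hhat N x t ls)
   (e *: dhq (y 0 0) (y 1 0) (u 0 0) (u 1 0) (ah N 0 t ls) (ah N 2 t ls) (bh N 2 t ls)
    + e ^+ 2 *: dhc (y 0 0) (y 1 0) (u 0 0) (u 1 0) (ah N 1 t ls) (bh N 1 t ls) (ah N 3 t ls)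
      (bh N 3 t ls)).
  have := is_deriveD (der_hq (der_coord (e *: y) u 0 0) (der_coord (e *: y) u 1 0) (ah N 0 t ls)
    (ah N 2 t ls) (bh N 2 t ls))
    (der_hc (der_coord (e *: y) u 0 0) (der_coord (e *: y) u 1 0) (ah N 1 t ls) (bh N 1 t ls)
      (ah N 3 t ls) (bh N 3 t ls)).
  rewrite ![(e *: y) _ _]mxE dhq_scale dhc_scale => h; congr is_derive: h.
  by apply/funext => x; rewrite hhatE.
rewrite mxE !big_ord_recl big_ord0 addr0 !mxE.
have -> : lift 0 0 = 1 :> 'I_2 by apply/val_inj.
have [_ ->] := hd (delta_mx ord0 0); have [_ ->] := hd (delta_mx 1 0).
rewrite !mxE /=; ring.
Qed.

Lemma jac_htilde (y : 'cV[R]_2) t e (d : 'cV[R]_2) i :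
  (jac (fun x => htilde N x t ls) (e *: y) *m d) i 0 =
  e * (dhq (y 0 0) (y 1 0) (d 0 0) (d 1 0) (at_ N 0 t ls) (at_ N 2 t ls) (bt N 2 t ls)) i 0.
Proof.
have hd (u : 'cV[R]_2) : is_derive (e *: y) u (fun x => htilde N x t ls)
   (e *: dhq (y 0 0) (y 1 0) (u 0 0) (u 1 0) (at_ N 0 t ls) (at_ N 2 t ls) (bt N 2 t ls)).
  have := der_hq (der_coord (e *: y) u 0 0) (der_coord (e *: y) u 1 0) (at_ N 0 t ls)
    (at_ N 2 t ls) (bt N 2 t ls).
  by rewrite ![(e *: y) _ _]mxE dhq_scale.
rewrite mxE !big_ord_recl big_ord0 addr0 !mxE.
have -> : lift 0 0 = 1 :> 'I_2 by apply/val_inj.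
have [_ ->] := hd (delta_mx ord0 0); have [_ ->] := hd (delta_mx 1 0).
rewrite !mxE /=; ring.
Qed.

Lemma der_hhat_t (y : 'cV[R]_2) t e i :
  (e^-1 *: derive1 (fun t => hhat N (e *: y) t ls) t) i 0 =
    nf_point_dt (y 0 0) (y 1 0) t e (lshift m i) 0.
Proof.
have pa k (k3 : (k <= 3)%N) := smooth_per_curve U_open U_ls (nf_ah nf k3).
have pb k (k3 : (1 <= k <= 3)%N) := smooth_per_curve U_open U_ls (nf_bh nf k3).
have EA k (k3 : (k <= 3)%N) : derive1 (nfA k) t (lshift m i) 0 = derive1 (ah N k ^~ ls) t i 0.
  rewrite derive1_col_mx; [by rewrite col_mxEu|exact: pa|].
  case: k k3 => [|[|[|[|//]]]] _ /=; try exact: per_curve0.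
    exact: smooth_per_curve U_open U_ls (nf_at0 nf).
  exact: smooth_per_curve U_open U_ls (nf_at2 nf).
have EB k (k3 : (1 <= k <= 3)%N) : derive1 (nfB k) t (lshift m i) 0 = derive1 (bh N k ^~ ls) t i 0.
  rewrite derive1_col_mx; [by rewrite col_mxEu|exact: pb|].
  case: k k3 => [//|[|[|[|//]]]] _ /=; try exact: per_curve0.
  exact: smooth_per_curve U_open U_ls (nf_bt2 nf).
have [[A0 _ _ _] [A1 _ _ _]] := (pa 0%N isT, pa 1%N isT).
have [[A2 _ _ _] [A3 _ _ _]] := (pa 2%N isT, pa 3%N isT).
have [[B1 _ _ _] [B2 _ _ _]] := (pb 1%N isT, pb 2%N isT).
have [B3 _ _ _] := pb 3%N isT.
have := is_deriveD (der_hq_coef (e * y 0 0) (e * y 1 0) (A0 t) (A2 t) (B2 t))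
   (der_hc_coef (e * y 0 0) (e * y 1 0) (A1 t) (B1 t) (A3 t) (B3 t)).
have -> : (fun t => hhat N (e *: y) t ls) =
    (fun x => hq (e * y 0 0) (e * y 1 0) (ah N 0 x ls) (ah N 2 x ls) (bh N 2 x ls)) +
    (fun x => hc (e * y 0 0) (e * y 1 0) (ah N 1 x ls) (bh N 1 x ls) (ah N 3 x ls) (bh N 3 x ls)).
  by apply/funext => x; rewrite hhatE ![(e *: y) _ _]mxE.
move=> /der1E ->.
rewrite /nf_point_dt; apply: h_rescale;
  [exact: EA|exact: EA|exact: EA|exact: EA|exact: EB|exact: EB|exact: EB].
Qed.

Lemma der_htilde_t (y : 'cV[R]_2) t e i :
  (e^-1 *: derive1 (fun t => htilde N (e *: y) t ls) t) i 0 =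
    nf_point_dt (y 0 0) (y 1 0) t e (rshift 2 i) 0.
Proof.
have pa k (k3 : (k <= 3)%N) := smooth_per_curve U_open U_ls (nf_ah nf k3).
have pb k (k3 : (1 <= k <= 3)%N) := smooth_per_curve U_open U_ls (nf_bh nf k3).
have EA k (k3 : (k <= 3)%N) : derive1 (nfA k) t (rshift 2 i) 0 =
  if odd k then 0 else derive1 (at_ N k ^~ ls) t i 0.
  have E0 : derive1 (fun=> 0 : 'cV[R]_m) t = 0 by rewrite derive1E derive_cst.
  rewrite derive1_col_mx; [rewrite col_mxEd|exact: pa|].
    by case: (odd k); rewrite ?E0 ?mxE.
  case: k k3 => [|[|[|[|//]]]] _ /=; try exact: per_curve0.
    exact: smooth_per_curve U_open U_ls (nf_at0 nf).
  exact: smooth_per_curve U_open U_ls (nf_at2 nf).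
have EB k (k3 : (1 <= k <= 3)%N) : derive1 (nfB k) t (rshift 2 i) 0 =
  if odd k then 0 else derive1 (bt N k ^~ ls) t i 0.
  have E0 : derive1 (fun=> 0 : 'cV[R]_m) t = 0 by rewrite derive1E derive_cst.
  rewrite derive1_col_mx; [rewrite col_mxEd|exact: pb|].
    by case: (odd k); rewrite ?E0 ?mxE.
  case: k k3 => [//|[|[|[|//]]]] _ /=; try exact: per_curve0.
  exact: smooth_per_curve U_open U_ls (nf_bt2 nf).
have [A0 _ _ _] := smooth_per_curve U_open U_ls (nf_at0 nf).
have [A2 _ _ _] := smooth_per_curve U_open U_ls (nf_at2 nf).
have [B2 _ _ _] := smooth_per_curve U_open U_ls (nf_bt2 nf).
have := der_hq_coef (e * y 0 0) (e * y 1 0) (A0 t) (A2 t) (B2 t).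
have -> : (fun t => htilde N (e *: y) t ls) =
    (fun x => hq (e * y 0 0) (e * y 1 0) (at_ N 0 x ls) (at_ N 2 x ls) (bt N 2 x ls)).
  by apply/funext => x; rewrite htildeE ![(e *: y) _ _]mxE.
move=> /der1E ->.
have hc0 : hc (e * y 0 0) (e * y 1 0) 0 0 0 0 = 0 :> 'cV[R]_m by rewrite /hc !scaler0 !addr0.
rewrite -[X in _ *: X]addr0 -hc0 /nf_point_dt; apply: h_rescale.
- exact: EA.
- by rewrite (EA 1%N isT) mxE.
- exact: EA.
- by rewrite (EA 3%N isT) mxE.
- by rewrite (EB 1%N isT) mxE.
- exact: EB.
- by rewrite (EB 3%N isT) mxE.
Qed.

(** Identifies the phi-derivative of the image with the matrix that is inverted in [Ghat_dag]. *)
Lemma nf_dx_hat (y d : 'cV[R]_2) t e i :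
  nf_point_dx (y 0 0) (y 1 0) (d 0 0) (d 1 0) t e (lshift m i) 0 =
  ((1%:M + jac (fun x => hhat N x t ls) (e *: y)) *m d) i 0.
Proof.
rewrite mulmxDl mul1mx.
have -> (a b : 'cV[R]_2) : (a + b) i 0 = a i 0 + b i 0 by rewrite mxE.
rewrite jac_hhat /nf_point_dx e12E.
have -> (a b c : 'cV[R]_n) : (a + e *: b + e ^+ 2 *: c) (lshift m i) 0 =
  a (lshift m i) 0 + e * b (lshift m i) 0 + e ^+ 2 * c (lshift m i) 0 by rewrite !mxE.
by rewrite !dhq_entry !dhc_entry !col_mxEu addrA.
Qed.

Lemma nf_dx_tilde (y d : 'cV[R]_2) t e i :
  nf_point_dx (y 0 0) (y 1 0) (d 0 0) (d 1 0) t e (rshift 2 i) 0 =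
  (jac (fun x => htilde N x t ls) (e *: y) *m d) i 0.
Proof.
rewrite jac_htilde /nf_point_dx e12E.
have -> (a b c : 'cV[R]_n) : (a + e *: b + e ^+ 2 *: c) (rshift 2 i) 0 =
  a (rshift 2 i) 0 + e * b (rshift 2 i) 0 + e ^+ 2 * c (rshift 2 i) 0 by rewrite !mxE.
by rewrite !dhq_entry !dhc_entry !col_mxEd !mxE /dhc !scaler0 !addr0 mulr0 addr0 add0r.
Qed.

Definition circ (p : R) : 'cV[R]_2 := cos p *: e1 R + sin p *: e2 R.
Definition dcirc (p : R) : 'cV[R]_2 := - sin p *: e1 R + cos p *: e2 R.

Lemma e12_coord (a b : R) : (a *: e1 R + b *: e2 R) 0 0 = a /\ (a *: e1 R + b *: e2 R) 1 0 = b.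
Proof. by split; rewrite !mxE/= ?mulr1 ?mulr0 ?addr0 ?add0r. Qed.

(** What z^N leaves over in $G - [\partial_\theta + \omega^\star \partial_\phi] z = 0$ at [ls]. *)
Definition nf_residual t p e : 'cV[R]_n := G F C (nf_point (cos p) (sin p) t e) ls t e
  - nf_point_dt (cos p) (sin p) t e - os *: nf_point_dx (cos p) (sin p) (- sin p) (cos p) t e.

Lemma T2_poly (a b c : R) : T2 (fun e => a + e * b + e ^+ 2 * c).
Proof.
apply: T2D; first (apply: T2D; first exact: T2_cst).
  by apply: T2M; [exact: T2_id|exact: T2_cst].
rewrite (_ : (fun e => _) = fun e : R => e * e * c); last by apply/funext => e; rewrite expr2.
by apply: T2M; [apply: T2M; exact: T2_id|exact: T2_cst].
Qed.

Lemma nf_linear_hat p i : (cE C ls *m col_mx (circ p) 0) (lshift m i) 0 = os * dcirc p i 0.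
Proof.
rewrite E_ls /Estar mul_block_col !mul0mx mulmx0 !addr0 col_mxEu mxE !big_ord_recl big_ord0 addr0.
have -> : lift 0 0 = 1 :> 'I_2 by apply/val_inj.
have [h1 h2] := e12_coord (cos p) (sin p); have [h3 h4] := e12_coord (- sin p) (cos p).
by case: (ord2 i) => ->; rewrite /circ /dcirc h1 h2 ?h3 ?h4 !mxE/=; ring.
Qed.

Lemma nf_linear_tilde p i : (cE C ls *m col_mx (circ p) 0) (rshift 2 i) 0 = 0.
Proof. by rewrite E_ls /Estar mul_block_col !mul0mx mulmx0 !addr0 col_mxEd mxE. Qed.

Section fixed_angles.
Variables t p : R.
Let y := circ p.
Let d := dcirc p.
Let Jh e := jac (fun x => hhat N x t ls) (e *: y).
Let g e := Ghat_dag F C N y 0 ls t e.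

Let y0 : y 0 0 = cos p. Proof. exact: (e12_coord _ _).1. Qed.
Let y1 : y 1 0 = sin p. Proof. exact: (e12_coord _ _).2. Qed.
Let d0 : d 0 0 = - sin p. Proof. exact: (e12_coord _ _).1. Qed.
Let d1 : d 1 0 = cos p. Proof. exact: (e12_coord _ _).2. Qed.

Lemma nf_point0 : nf_point (cos p) (sin p) t 0 = col_mx y 0.
Proof. by rewrite /nf_point expr0n/= !scale0r !addr0. Qed.

Lemma nf_point_dt0 : nf_point_dt (cos p) (sin p) t 0 = 0.
Proof. by rewrite /nf_point_dt; move: (hq _ _ _ _ _) (hc _ _ _ _ _ _) => a b;
  rewrite expr0n/= !scale0r addr0. Qed.

(** The polynomials start at degree two, so their Jacobian at e y is O(e). *)
Lemma Jh_form i j : exists u w, forall e, Jh e i j = e * (u + e * w).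
Proof.
have E e : Jh e i j = (Jh e *m (delta_mx j 0 : 'cV[R]_2)) i 0 by move: (Jh e) => M;
  rewrite -colE mxE.
have h e : Jh e i j = _ := etrans (E e) (jac_hhat y t e _ i).
by eexists; eexists => e; rewrite h mulrDr [e * (e * _)]mulrA -expr2.
Qed.

Lemma T2_Jh i j : T2 (fun e => Jh e i j).
Proof.
have [u [w h]] := Jh_form i j.
by have := T2_poly 0 u w; congr T2; apply/funext => e; rewrite h; ring.
Qed.

Lemma Jh0 i j : Jh 0 i j = 0.
Proof.
have -> : Jh 0 i j = (Jh 0 *m (delta_mx j 0 : 'cV[R]_2)) i 0 by move: (Jh 0) => M;
  rewrite -colE mxE.
by rewrite jac_hhat expr0n/= !mul0r addr0.
Qed.

Lemma T2_G_nf i : T2 (fun e => G F C (nf_point (cos p) (sin p) t e) ls t e i 0).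
Proof. exact: (T2_G F_smooth U_open U_ls smooth_v smooth_P floquet t). Qed.

Lemma T2_nf_dt i : T2 (fun e => nf_point_dt (cos p) (sin p) t e i 0).
Proof.
rewrite (_ : (fun e => _) = fun e => 0 + e * (hq (cos p) (sin p) (derive1 (nfA 0) t)
  (derive1 (nfA 2) t) (derive1 (nfB 2) t)) i 0
  + e ^+ 2 * (hc (cos p) (sin p) (derive1 (nfA 1) t) (derive1 (nfB 1) t) (derive1 (nfA 3) t)
    (derive1 (nfB 3) t)) i 0); first exact: T2_poly.
apply/funext => e; rewrite add0r.
by have -> (a b : 'cV[R]_n) : (e *: a + e ^+ 2 *: b) i 0 = e * a i 0 + e ^+ 2 * b i 0
  by rewrite !mxE.
Qed.

Let Jt e := jac (fun x => htilde N x t ls) (e *: y).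
Let b e := usubmx (G F C (nf_point (cos p) (sin p) t e) ls t e) - e^-1 *: derive1 (fun t =>
  hhat N (e *: y) t ls) t.

Let bE e i : b e i 0 = G F C (nf_point (cos p) (sin p) t e) ls t e (lshift m i) 0
  - nf_point_dt (cos p) (sin p) t e (lshift m i) 0.
Proof.
have -> (u w : 'cV[R]_2) : (u - w) i 0 = u i 0 - w i 0 by rewrite !mxE.
by rewrite der_hhat_t y0 y1 mxE.
Qed.

Let gE e : g e = invmx (1%:M + Jh e) *m b e.
Proof. by rewrite /g /Ghat_dag nf_mapE y0 y1. Qed.

Let dxH e i : nf_point_dx (cos p) (sin p) (- sin p) (cos p) t e (lshift m i) 0 =
  ((1%:M + Jh e) *m d) i 0.
Proof. by rewrite -nf_dx_hat y0 y1 d0 d1. Qed.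

Let dxT e i : nf_point_dx (cos p) (sin p) (- sin p) (cos p) t e (rshift 2 i) 0 = (Jt e *m d) i 0.
Proof. by rewrite -nf_dx_tilde y0 y1 d0 d1. Qed.

Let T2_A i j : T2 (fun e => (1%:M + Jh e) i j).
Proof.
by have := T2D (T2_cst ((1%:M : 'M[R]_2) i j)) (T2_Jh i j); congr T2; apply/funext => e;
  rewrite !mxE.
Qed.

Let A0 : 1%:M + Jh 0 = 1%:M.
Proof. by apply/matrixP => i j; rewrite [LHS]mxE Jh0 addr0. Qed.

Let unit_near : \forall e \near (0 : R), 1%:M + Jh e \in unitmx.
Proof. by apply: (T2_invmx T2_A _).1; rewrite A0 unitmx1. Qed.

Let T2_b i : T2 (fun e => b e i 0).
Proof.
by have := T2B (T2_G_nf (lshift m i)) (T2_nf_dt (lshift m i)); congr T2; apply/funext => e;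
  rewrite bE.
Qed.

Let T2_g i : T2 (fun e => g e i 0).
Proof.
have := @T2_sum R _ (index_enum 'I_2) (fun j e => invmx (1%:M + Jh e) i j * b e j 0); move=> h.
have -> : (fun e => g e i 0) = fun e => \sum_j invmx (1%:M + Jh e) i j * b e j 0.
  by apply/funext => e; rewrite gE mxE.
apply: h => j; apply: T2M => //; apply: (T2_invmx T2_A _).2; by rewrite A0 unitmx1.
Qed.

Let g0 i : g 0 i 0 = os * d i 0.
Proof.
rewrite gE A0 invmx1 mul1mx bE nf_point_dt0 mxE subr0 nf_point0.
by rewrite /G eqxx nf_linear_hat.
Qed.

(** The rotation block maps the circle to [os] times its tangent, which is the value at e = 0. The
    normal form conditions say that the first derivative vanishes and that half the second one is
    the cubic normal form, where the factor y1^2 + y2^2 is 1 on the circle. *)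
Lemma Ghat_little_o i : little_o 2 (fun e => g e i 0 - os * d i 0
  - e ^+ 2 * (rot_scale (betaR N ls) (betaI N ls) *m y) i 0).
Proof.
have [f1 hf1] := choice T2_g; have [f2 hf2] := choice hf1.
have [D1 D2] := derive1n_col hf2.
have := nf_quadratic_hat nf U_ls t y; have := nf_cubic_hat nf U_ls t y.
have -> : Ghat_dag_term F C N 2 y 0 ls t = 1`!%:R^-1 *: \col_i f1 i 0 by rewrite -D1.
have -> : Ghat_dag_term F C N 3 y 0 ls t = 2`!%:R^-1 *: \col_i f2 i by rewrite -D2.
move=> /colP/(_ i) h3 /colP/(_ i) h2.
have f10 : f1 i 0 = 0 by move: h2; rewrite !mxE invr1 mul1r.
have f20 : f2 i / 2 = (rot_scale (betaR N ls) (betaI N ls) *m y) i 0.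
  move: h3; rewrite y0 y1 cos2Dsin2 scale1r => <-; rewrite !mxE mulrC.
  by have -> : 2`! = 2%N by [].
exact: little_o_quadratic (hf2 i) (g0 i) f10 f20.
Qed.

(** For small e the hat residual is (I + D h) applied to the transformed field minus [os] times the
    tangent. That vector is e^2 beta y + o(e^2), and D h = O(e) contributes only to o(e^2). *)
Lemma nf_residual_hat_little_o i : little_o 2 (fun e => nf_residual t p e (lshift m i) 0
  - e ^+ 2 * (rot_scale (betaR N ls) (betaI N ls) *m y) i 0).
Proof.
pose be j := (rot_scale (betaR N ls) (betaI N ls) *m y) j 0.
pose o j e := g e j 0 - os * d j 0 - e ^+ 2 * be j.
have ho j : little_o 2 (o j) := Ghat_little_o j.
have hJ : little_o 2 (fun e => \sum_j Jh e i j * (o j e + e ^+ 2 * be j)).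
  apply: little_o_sum => j.
  have [u [w hJ]] := Jh_form i j.
  have cuw : {for 0, continuous (fun e : R => u + e * w)}.
    suff -> : (fun e : R => u + e * w) = (fun e => u + e * w + e ^+ 2 * 0)
      by exact: T2_cont (T2_poly u w 0).
    by apply/funext => e; rewrite mulr0 addr0.
  rewrite (_ : (fun e => _) = fun e => (u + e * w) * (e * o j e + be j * e ^+ 3)); last first.
    by apply/funext => e; rewrite hJ; ring.
  apply: little_o_mul cuw (little_o_add _ _); first exact/little_oW/little_o_scale.
  exact: little_o_mul (cvg_cst _) (little_o_monomial 2).
apply: little_o_near (little_o_add (ho i) hJ).
near=> e.
have ue : 1%:M + Jh e \in unitmx by near: e.
have gb : b e = (1%:M + Jh e) *m g e by rewrite gE mulKVmx.
rewrite /nf_residual.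
have -> (u v w : 'cV[R]_n) : (u - v - os *: w) (lshift m i) 0 = u (lshift m i) 0 - v (lshift m i) 0
  - os * w (lshift m i) 0 by rewrite !mxE.
rewrite -bE dxH gb.
have -> (M : 'M[R]_2) (v w : 'cV[R]_2) : (M *m v) i 0 - os * (M *m w) i 0 =
  (M *m (v - os *: w)) i 0.
  by rewrite mulmxBr -scalemxAr !mxE.
have ED (u w : 'cV[R]_2) : (u + w) i 0 = u i 0 + w i 0 by rewrite mxE.
rewrite mulmxDl mul1mx (ED (g e - os *: d)) [(Jh e *m _) i 0]mxE.
have EB j : (g e - os *: d) j 0 = o j e + e ^+ 2 * be j by rewrite /o !mxE; ring.
have aux (u v w : R) : u + v = u + w + v - w by ring.
under [X in _ = _ + X - _]eq_bigr do rewrite EB.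
by rewrite EB; exact: aux.
Unshelve. all: by end_near. Qed.

Lemma T2_nf_dx i : T2 (fun e => nf_point_dx (cos p) (sin p) (- sin p) (cos p) t e i 0).
Proof.
rewrite (_ : (fun e => _) = fun e => (col_mx (- sin p *: e1 R + cos p *: e2 R) 0 : 'cV[R]_n) i 0
  + e * (dhq (cos p) (sin p) (- sin p) (cos p) (nfA 0 t) (nfA 2 t) (nfB 2 t)) i 0
  + e ^+ 2 * (dhc (cos p) (sin p) (- sin p) (cos p) (nfA 1 t) (nfB 1 t) (nfA 3 t) (nfB 3 t)) i 0);
    first exact: T2_poly.
apply/funext => e.
by have -> (u v w : 'cV[R]_n) : (u + e *: v + e ^+ 2 *: w) i 0 = u i 0 + e * v i 0 + e ^+ 2 * w i 0
  by rewrite !mxE.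
Qed.

(** The tilde residual is the transformed tilde field plus D h~ applied to the transformed hat field
    minus [os] times the tangent. The former is o(e) by the quadratic condition, the latter O(e)
    times O(e^2). *)
Lemma nf_residual_tilde_little_o i : little_o 1 (fun e => nf_residual t p e (rshift 2 i) 0).
Proof.
pose gt e := Gtilde_dag F C N y 0 ls t e.
have Jt_form k j : exists u, forall e, Jt e k j = e * u.
  have E e : Jt e k j = (Jt e *m (delta_mx j 0 : 'cV[R]_2)) k 0 by move: (Jt e) => M;
    rewrite -colE mxE.
  have h e : Jt e k j = _ := etrans (E e) (jac_htilde y t e _ k).
  by eexists => e; rewrite h.
have gtE e k : gt e k 0 = nf_residual t p e (rshift 2 k) 0 - \sum_j Jt e k j * (g e j 0
  - os * d j 0).
  rewrite /gt /Gtilde_dag nf_mapE y0 y1.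
  have -> (u v w : 'cV[R]_m) : (u - v - w) k 0 = u k 0 - v k 0 - w k 0 by rewrite !mxE.
  rewrite der_htilde_t y0 y1 mxE /nf_residual.
  have -> (u v w : 'cV[R]_n) : (u - v - os *: w) (rshift 2 k) 0 =
    u (rshift 2 k) 0 - v (rshift 2 k) 0 - os * w (rshift 2 k) 0 by rewrite !mxE.
  rewrite dxT -/(Jt e) -/(g e).
  have -> : \sum_j Jt e k j * (g e j 0 - os * d j 0) = (Jt e *m g e) k 0 - os * (Jt e *m d) k 0.
    by rewrite !mxE mulr_sumr -sumrB; apply: eq_bigr => j _; ring.
  by move: (G _ _ _ _ _ _ _ _) => ?; ring.
have T2J k j : T2 (fun e => Jt e k j).
  have [u hu] := Jt_form k j.
  by have := T2_poly 0 u 0; congr T2; apply/funext => e; rewrite hu; ring.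
have T2res k : T2 (fun e => nf_residual t p e k 0).
  have := T2B (T2B (T2_G_nf k) (T2_nf_dt k)) (T2Z os (T2_nf_dx k)); congr T2; apply/funext => e.
  rewrite /nf_residual.
  by have -> (u v w : 'cV[R]_n) : (u - v - os *: w) k 0 = u k 0 - v k 0 - os * w k 0
    by rewrite !mxE.
have T2gt k : T2 (fun e => gt e k 0).
  rewrite (_ : (fun e => _) = fun e => nf_residual t p e (rshift 2 k) 0 - \sum_j Jt e k j *
    (g e j 0 - os * d j 0)); last by apply/funext => e.
  apply: T2B => //; apply: T2_sum => j; apply: T2M; first exact: T2J.
  by apply: T2B; [exact: T2_g|exact: T2_cst].
have [f1 hf1] := choice T2gt; have [f2 hf2] := choice hf1.
have [D1 _] := derive1n_col hf2.
have := nf_quadratic_tilde nf U_ls t y.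
have -> : Gtilde_dag_term F C N 2 y 0 ls t = 1`!%:R^-1 *: \col_i f1 i 0 by rewrite -D1.
move=> /colP/(_ i) h2.
have f10 : f1 i 0 = 0 by move: h2; rewrite !mxE invr1 mul1r.
have gt0 : gt 0 i 0 = 0.
  rewrite gtE big1 => [|j _]; last by have [u ->] := Jt_form i j; rewrite !mul0r.
  rewrite subr0 /nf_residual nf_point_dt0 nf_point0 subr0.
  have -> (u v : 'cV[R]_n) : (u - os *: v) (rshift 2 i) 0 =
    u (rshift 2 i) 0 - os * v (rshift 2 i) 0 by rewrite !mxE.
  rewrite /G eqxx nf_linear_tilde dxT mxE big1 ?mulr0 ?subr0// => j _.
  by have [u ->] := Jt_form i j; rewrite !mul0r.
have lo1 : little_o 1 (fun e => gt e i 0).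
  exact: little_o_linear (nbhs_singleton (hf2 i).1) gt0 f10.
rewrite (_ : (fun e => _) = fun e => gt e i 0 + \sum_j Jt e i j * (g e j 0 - os * d j 0));
  last first.
  by apply/funext => e; rewrite gtE subrK.
apply: little_o_add lo1 (little_o_sum _) => j.
have [u hu] := Jt_form i j.
pose be := (rot_scale (betaR N ls) (betaI N ls) *m y) j 0.
rewrite (_ : (fun e => _) = fun e => u * (e * (g e j 0 - os * d j 0 - e ^+ 2 * be))
  + (u * be) * e ^+ 3); last first.
  have aux (e v : R) : e * u * v = u * (e * (v - e ^+ 2 * be)) + (u * be) * e ^+ 3 by ring.
  by apply/funext => e; rewrite hu; exact: aux.
apply: little_o_add.
  apply: little_o_mul (cvg_cst _) _; apply: little_oW; apply: little_oW; apply: little_o_scale.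
  exact: Ghat_little_o.
exact: little_o_mul (cvg_cst _) (little_oW (little_o_monomial 2)).
Qed.

End fixed_angles.
End normal_form_curves.

Section bounded_families.
Variables (R : realType) (T : Type).
Implicit Types (f g : T -> R).

Lemma bfD f g : bounded_family f -> bounded_family g -> bounded_family (fun u => f u + g u).
Proof. by move=> [K hK] [L hL]; exists (K + L) => u; apply: le_trans (ler_normD _ _) _;
  exact: lerD. Qed.

Lemma bfM f g : bounded_family f -> bounded_family g -> bounded_family (fun u => f u * g u).
Proof. by move=> [K hK] [L hL]; exists (K * L) => u; rewrite normrM; exact: ler_pM. Qed.

Lemma bf_cst (c : R) : bounded_family (fun _ : T => c).
Proof. by exists `|c|. Qed.

Lemma bfB f g : bounded_family f -> bounded_family g -> bounded_family (fun u => f u - g u).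
Proof. by move=> [K hK] [L hL]; exists (K + L) => u; apply: le_trans (ler_normB _ _) _;
  exact: lerD. Qed.

Lemma bf_sum k (f : 'I_k -> T -> R) : (forall i, bounded_family (f i)) -> bounded_family (fun u =>
  \sum_i f i u).
Proof.
move=> hf; have [K hK] := choice hf; exists (\sum_i K i) => u.
by apply: le_trans (ler_norm_sum _ _ _) _; apply: ler_sum => i _; exact: hK.
Qed.

Lemma bfN f : bounded_family f -> bounded_family (fun u => - f u).
Proof. by move=> [K hK]; exists K => u; rewrite normrN. Qed.

Lemma bfX k f : bounded_family f -> bounded_family (fun u => f u ^+ k).
Proof. by move=> [K hK]; exists (K ^+ k) => u; rewrite normrX lerXn2r ?nnegrE//;
  exact: le_trans (hK u). Qed.

End bounded_families.

Ltac bf := repeat first [exact: bf_cst | exact: bfX | apply: bfD | apply: bfB | apply: bfM | apply: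
  bfX | apply: bfN | by []].

Section bounded_polynomials.
Variables (R : realType) (T : Type) (q : nat) (x1 x2 d1 d2 : T -> R).
Hypotheses (h1 : bounded_family x1) (h2 : bounded_family x2) (k1 : bounded_family d1)
  (k2 : bounded_family d2).

Lemma bf_hq (a0 a2 b2 : T -> 'cV[R]_q) i : bounded_family (fun u => a0 u i 0) ->
  bounded_family (fun u => a2 u i 0) ->
  bounded_family (fun u => b2 u i 0) -> bounded_family (fun u => hq (x1 u) (x2 u) (a0 u) (a2 u)
    (b2 u) i 0).
Proof.
move=> ? ? ?; rewrite (_ : (fun u => _) = fun u => (x1 u ^+ 2 + x2 u ^+ 2) * a0 u i 0 + (x1 u ^+ 2
  - x2 u ^+ 2) * a2 u i 0 + (2 * x1 u * x2 u) * b2 u i 0); last by apply/funext => u; rewrite !mxE.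
by bf.
Qed.

Lemma bf_dhq (a0 a2 b2 : T -> 'cV[R]_q) i : bounded_family (fun u => a0 u i 0) ->
  bounded_family (fun u => a2 u i 0) ->
  bounded_family (fun u => b2 u i 0) -> bounded_family (fun u => dhq (x1 u) (x2 u) (d1 u) (d2 u)
    (a0 u) (a2 u) (b2 u) i 0).
Proof.
move=> ? ? ?; rewrite (_ : (fun u => _) = fun u => (2 * x1 u * d1 u + 2 * x2 u * d2 u) * a0 u i 0
  + (2 * x1 u * d1 u - 2 * x2 u * d2 u) * a2 u i 0
  + (2 * (x1 u * d2 u + d1 u * x2 u)) * b2 u i 0); last by apply/funext => u; rewrite !mxE.
by bf.
Qed.

Lemma bf_hc (a1 b1 a3 b3 : T -> 'cV[R]_q) i : bounded_family (fun u => a1 u i 0) ->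
  bounded_family (fun u => b1 u i 0) ->
  bounded_family (fun u => a3 u i 0) -> bounded_family (fun u => b3 u i 0) ->
  bounded_family (fun u => hc (x1 u) (x2 u) (a1 u) (b1 u) (a3 u) (b3 u) i 0).
Proof.
move=> ? ? ? ?; rewrite (_ : (fun u => _) = fun u => (x1 u * (x1 u ^+ 2 + x2 u ^+ 2)) * a1 u i 0
  + (x2 u * (x1 u ^+ 2 + x2 u ^+ 2)) * b1 u i 0
  + (x1 u * (x1 u ^+ 2 - 3 * x2 u ^+ 2)) * a3 u i 0 + (x2 u * (3 * x1 u ^+ 2 - x2 u ^+ 2)) * b3 u i
    0); last by apply/funext => u; rewrite !mxE.
by bf.
Qed.

Lemma bf_dhc (a1 b1 a3 b3 : T -> 'cV[R]_q) i : bounded_family (fun u => a1 u i 0) ->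
  bounded_family (fun u => b1 u i 0) ->
  bounded_family (fun u => a3 u i 0) -> bounded_family (fun u => b3 u i 0) ->
  bounded_family (fun u => dhc (x1 u) (x2 u) (d1 u) (d2 u) (a1 u) (b1 u) (a3 u) (b3 u) i 0).
Proof.
move=> ? ? ? ?; rewrite (_ : (fun u => _) = fun u => (3 * x1 u ^+ 2 * d1 u + d1 u * x2 u ^+ 2
  + 2 * x1 u * x2 u * d2 u) * a1 u i 0
  + (2 * x1 u * x2 u * d1 u + d2 u * x1 u ^+ 2 + 3 * x2 u ^+ 2 * d2 u) * b1 u i 0
  + (3 * x1 u ^+ 2 * d1 u - 3 * x2 u ^+ 2 * d1 u - 6 * x1 u * x2 u * d2 u) * a3 u i 0
  + (6 * x1 u * x2 u * d1 u + 3 * x1 u ^+ 2 * d2 u - 3 * x2 u ^+ 2 * d2 u) * b3 u i 0);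
    last by apply/funext => u; rewrite !mxE.
by bf.
Qed.

End bounded_polynomials.

Section opposite_points.
Variables (R : realType) (W : lmodType R).
Implicit Types (x d : R) (a b : W).

Lemma hq_opp (x1 x2 : R) a0 a2 b2 : hq (- x1) (- x2) a0 a2 b2 = hq x1 x2 a0 a2 b2.
Proof. by rewrite /hq; congr (_ *: _ + _ *: _ + _ *: _); ring. Qed.

Lemma hc_opp (x1 x2 : R) a1 b1 a3 b3 : hc (- x1) (- x2) a1 b1 a3 b3 = - hc x1 x2 a1 b1 a3 b3.
Proof. by rewrite /hc -[RHS]scaleN1r !scalerDr !scalerA; congr (_ *: _ + _ *: _ + _ *: _ + _ *: _);
  ring. Qed.

Lemma dhq_opp (x1 x2 d1 d2 : R) a0 a2 b2 : dhq (- x1) (- x2) (- d1) (- d2) a0 a2 b2 =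
  dhq x1 x2 d1 d2 a0 a2 b2.
Proof. by rewrite /dhq; congr (_ *: _ + _ *: _ + _ *: _); ring. Qed.

Lemma dhc_opp (x1 x2 d1 d2 : R) a1 b1 a3 b3 :
  dhc (- x1) (- x2) (- d1) (- d2) a1 b1 a3 b3 = - dhc x1 x2 d1 d2 a1 b1 a3 b3.
Proof. by rewrite /dhc -[RHS]scaleN1r !scalerDr !scalerA;
  congr (_ *: _ + _ *: _ + _ *: _ + _ *: _); ring. Qed.

End opposite_points.

Lemma circ_col_opp (R : realType) (m : nat) (x1 x2 : R) :
  col_mx (- x1 *: e1 R + - x2 *: e2 R) (0 : 'cV[R]_m) = - col_mx (x1 *: e1 R + x2 *: e2 R) 0.
Proof. by rewrite opp_col_mx opprD -!scaleNr oppr0. Qed.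

(** * Uniform size and parity of the normal form residual *)

Section normal_form_residual.
Variables (R : realType) (m : nat) (F : vector_field R m) (ls os : R) (U : set R)
  (C : continuation R m) (N : nf_coeffs R m) (Ets : 'M[R]_m).
Local Notation n := (2 + m)%N.
Hypotheses (F_smooth : smooth_field F) (U_open : open U) (U_ls : U ls)
  (smooth_v : smooth_periodic U (cv C)) (smooth_P : smooth_periodic U (cP C))
  (floquet : forall l, U l -> is_floquet F l (cv C ^~ l) (cP C ^~ l) (cE C l))
  (E_ls : cE C ls = Estar os Ets) (nf : is_normal_form F U C N).
Local Notation nfA := (nfA ls N).
Local Notation nfB := (nfB ls N).
Local Notation zN u e := (nf_point ls N (cos u.2) (sin u.2) u.1 e).
Local Notation rN := (nf_residual F ls os C N).

Let bA k i : (k <= 3)%N -> bounded_family (fun u : R * R => nfA k u.1 i 0).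
Proof. by move=> k3; have [_ _ /(_ i)[K hK] _] := per_nfA U_open U_ls nf k3; exists K => u. Qed.
Let bB k i : (1 <= k <= 3)%N -> bounded_family (fun u : R * R => nfB k u.1 i 0).
Proof. by move=> k3; have [_ _ /(_ i)[K hK] _] := per_nfB U_open U_ls nf k3; exists K => u. Qed.
Let bdA k i : (k <= 3)%N -> bounded_family (fun u : R * R => derive1 (nfA k) u.1 i 0).
Proof. by move=> k3; have [_ _ _ /(_ i)[K hK]] := per_nfA U_open U_ls nf k3; exists K => u. Qed.
Let bdB k i : (1 <= k <= 3)%N -> bounded_family (fun u : R * R => derive1 (nfB k) u.1 i 0).
Proof. by move=> k3; have [_ _ _ /(_ i)[K hK]] := per_nfB U_open U_ls nf k3; exists K => u. Qed.
Let bcos : bounded_family (fun u : R * R => cos u.2).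
Proof. by exists 1 => u; rewrite ler_norml cos_geN1 cos_le1. Qed.
Let bsin : bounded_family (fun u : R * R => sin u.2).
Proof. by exists 1 => u; rewrite ler_norml sin_geN1 sin_le1. Qed.

Lemma bf_circ i (x1 x2 : R * R -> R) : bounded_family x1 -> bounded_family x2 ->
  bounded_family (fun u => (col_mx (x1 u *: e1 R + x2 u *: e2 R) 0 : 'cV[R]_n) i 0).
Proof.
move=> h1 h2; case: (split_ordP i) => k ->.
  rewrite (_ : (fun u => _) = fun u => x1 u * e1 R k 0 + x2 u * e2 R k 0); first by bf.
  by apply/funext => v; rewrite col_mxEu !mxE.
by exists 0 => v; rewrite col_mxEd mxE normr0.
Qed.

Lemma jet_nf_point r N0 i : jet r N0 (fun (u : R * R) e => zN u e i 0).
Proof.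
rewrite (_ : (fun u e => _) = fun (u : R * R) e => (col_mx (cos u.2 *: e1 R + sin u.2 *: e2 R) 0 :
  'cV[R]_n) i 0
  + e * hq (cos u.2) (sin u.2) (nfA 0 u.1) (nfA 2 u.1) (nfB 2 u.1) i 0
  + e ^+ 2 * hc (cos u.2) (sin u.2) (nfA 1 u.1) (nfB 1 u.1) (nfA 3 u.1) (nfB 3 u.1) i 0).
  apply: jet_poly2; [exact: bf_circ|apply: bf_hq => //; [exact: bA|exact: bA|exact: bB]|].
  by apply: bf_hc => //; [exact: bA|exact: bB|exact: bA|exact: bB].
apply/funext => u; apply/funext => e; rewrite /nf_point.
by have -> (a b c : 'cV[R]_n) : (a + e *: b + e ^+ 2 *: c) i 0 = a i 0 + e * b i 0 + e ^+ 2 * c i 0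
  by rewrite !mxE.
Qed.

Lemma jet_nf_dt r N0 i : jet r N0 (fun (u : R * R) e => nf_point_dt ls N (cos u.2) (sin u.2) u.1 e
  i 0).
Proof.
rewrite (_ : (fun u e => _) = fun (u : R * R) e => 0
  + e * hq (cos u.2) (sin u.2) (derive1 (nfA 0) u.1) (derive1 (nfA 2) u.1) (derive1 (nfB 2) u.1) i 0
  + e ^+ 2 * hc (cos u.2) (sin u.2) (derive1 (nfA 1) u.1) (derive1 (nfB 1) u.1) (derive1 (nfA 3)
    u.1) (derive1 (nfB 3) u.1) i 0).
  apply: jet_poly2; [exact: bf_cst|apply: bf_hq => //; [exact: bdA|exact: bdA|exact: bdB]|].
  by apply: bf_hc => //; [exact: bdA|exact: bdB|exact: bdA|exact: bdB].
apply/funext => u; apply/funext => e; rewrite /nf_point_dt.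
by have -> (v w : 'cV[R]_n) : (e *: v + e ^+ 2 *: w) i 0 = 0 + e * v i 0 + e ^+ 2 * w i 0
  by rewrite add0r !mxE.
Qed.

Lemma jet_nf_dx r N0 i : jet r N0 (fun (u : R * R) e => nf_point_dx ls N (cos u.2) (sin u.2)
  (- sin u.2) (cos u.2) u.1 e i 0).
Proof.
have bns : bounded_family (fun u : R * R => - sin u.2) by bf.
rewrite (_ : (fun u e => _) = fun (u : R * R) e => (col_mx (- sin u.2 *: e1 R + cos u.2 *: e2 R) 0
  : 'cV[R]_n) i 0
  + e * dhq (cos u.2) (sin u.2) (- sin u.2) (cos u.2) (nfA 0 u.1) (nfA 2 u.1) (nfB 2 u.1) i 0
  + e ^+ 2 * dhc (cos u.2) (sin u.2) (- sin u.2) (cos u.2) (nfA 1 u.1) (nfB 1 u.1) (nfA 3 u.1)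
    (nfB 3 u.1) i 0).
  apply: jet_poly2; [exact: bf_circ|apply: bf_dhq => //; [exact: bA|exact: bA|exact: bB]|].
  by apply: bf_dhc => //; [exact: bA|exact: bB|exact: bA|exact: bB].
apply/funext => u; apply/funext => e; rewrite /nf_point_dx.
by have -> (a b c : 'cV[R]_n) : (a + e *: b + e ^+ 2 *: c) i 0 = a i 0 + e * b i 0 + e ^+ 2 * c i 0
  by rewrite !mxE.
Qed.

Lemma nf_point_bounded : exists2 K, 0 <= K & forall t p e i, `|e| <=
  1 -> `|nf_point ls N (cos p) (sin p) t e i 0| <= K.
Proof.
have [K hK] := choice (fun i => jet_nf_point 1 0 i).
exists (\sum_i `|K i|); first by rewrite sumr_ge0.
move=> t p e i he; apply: le_trans (hK i (t, p) e he) _; apply: le_trans (ler_norm _) _.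
by rewrite (bigD1 i)//= lerDl sumr_ge0.
Qed.

(** Order four is one more than the leading order three of the hat residual, and the parity argument
    uses that extra order. *)
Lemma jet_G_nf i : jet 1 4 (fun (u : R * R) e => G F C (zN u e) ls u.1 e i 0).
Proof.
have [rho rho0 hrho] := nf_point_bounded.
have [K K0 /nbhs_singleton hK] := G_expansion F_smooth U_open U_ls smooth_v smooth_P floquet i rho0.
pose S (u : R * R) e := (cE C ls *m zN u e) i 0 + e * taylor_coefficient F C i 2 u.1 ls (zN u e)
  + e ^+ 2 * taylor_coefficient F C i 3 u.1 ls (zN u e) + e ^+ 3 * taylor_coefficient F C i 4 u.1
    ls (zN u e).
have jh k : jet 1 4 (fun (u : R * R) e => taylor_coefficient F C i k u.1 ls (zN u e)).
  apply: (@jet_hom R (R * R)%type 1 ls n fst (fun u e => zN u e) k) => //.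
    exact: (hom_taylor_coefficient F_smooth U_open U_ls smooth_v smooth_P floquet).
  by move=> j; exact: jet_nf_point.
have jS : jet 1 4 S.
  apply: jetD; last by apply: jetM => //; exact: jet_expr.
  apply: jetD; last by apply: jetM => //; exact: jet_expr.
  apply: jetD; last by apply: jetM => //; exact: jet_id.
  rewrite (_ : (fun u e => _) = fun u e => \sum_j cE C ls i j * zN u e j 0).
    by apply: jet_sum => j; apply: jetZ; exact: jet_nf_point.
  by apply/funext => u; apply/funext => e; rewrite mxE.
have jR : jet 1 4 (fun u e => G F C (zN u e) ls u.1 e i 0 - S u e).
  apply: (jet_remainder ler01 K0) => u e he; have [->|e0] := eqVneq e 0.
    have aux (a b c d : R) : a + 0 * b + 0 ^+ 2 * c + 0 ^+ 3 * d = a by ring.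
    have -> : S u 0 = (cE C ls *m zN u 0) i 0 := aux _ _ _ _.
    have GE z t : G F C z ls t 0 = cE C ls *m z by rewrite /G eqxx.
    by rewrite GE subrr normr0 expr0n/= mulr0.
  by apply: hK => // j; exact: hrho.
by apply: jet_ext (jetD jR jS) => u e _; rewrite subrK.
Qed.

Lemma jet_residual i : jet 1 4 (fun (u : R * R) e => rN u.1 u.2 e i 0).
Proof.
have := jetD (jetD (jet_G_nf i) (jetZ (-1) (jet_nf_dt 1 4 i))) (jetZ (- os) (jet_nf_dx 1 4 i)).
apply: jet_ext => u e _; rewrite /nf_residual.
have -> (a b c : 'cV[R]_n) : (a - b - os *: c) i 0 = a i 0 - b i 0 - os * c i 0 by rewrite !mxE.
by rewrite mulN1r mulNr.
Qed.

Definition res_hat t p e i : R := rN t p e (lshift m i) 0 - e ^+ 2 * (rot_scale (betaR N ls)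
  (betaI N ls) *m circ p) i 0.

Lemma circ_pi p : circ (p + pi) = - circ p :> 'cV[R]_2.
Proof. by rewrite /circ cosDpi sinDpi !scaleNr opprD. Qed.

Lemma G_opp z t e : G F C (- z) ls t (- e) = - G F C z ls t e.
Proof.
rewrite /G oppr_eq0; case: eqP => _; first by rewrite mulmxN.
by rewrite invrN scaleNr !mulmxN !scaleNr !scalerN !opprK.
Qed.

Lemma residual_pi t p e : rN t (p + pi) e = - rN t p (- e).
Proof.
have e2 : (- e) ^+ 2 = e ^+ 2 by rewrite sqrrN.
have zE : nf_point ls N (- cos p) (- sin p) t e = - nf_point ls N (cos p) (sin p) t (- e).
  rewrite /nf_point circ_col_opp hq_opp hc_opp e2 scaleNr scalerN;
    move: (hq _ _ _ _ _) (hc _ _ _ _ _ _) => u v.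
  by rewrite !opprD opprK.
have dE : nf_point_dt ls N (- cos p) (- sin p) t e = - nf_point_dt ls N (cos p) (sin p) t (- e).
  rewrite /nf_point_dt hq_opp hc_opp e2 scaleNr scalerN; move: (hq _ _ _ _ _) (hc _ _ _ _ _ _) =>
    u v.
  by rewrite opprD opprK.
have xE : nf_point_dx ls N (- cos p) (- sin p) (- - sin p) (- cos p) t e =
  - nf_point_dx ls N (cos p) (sin p) (- sin p) (cos p) t (- e).
  rewrite /nf_point_dx circ_col_opp dhq_opp dhc_opp e2 !scaleNr scalerN;
    move: (dhq _ _ _ _ _ _ _) (dhc _ _ _ _ _ _ _ _) => u v.
  by rewrite !opprD opprK.
rewrite /nf_residual cosDpi sinDpi zE dE xE -[in LHS](opprK e) G_opp !opprK scalerN.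
move: (G _ _ _ _ _ _) (nf_point_dt _ _ _ _ _ _) (os *: _) => u v w.
by rewrite !opprD !opprK.
Qed.

(** A half-turn in phi trades for a change of sign of e ([residual_pi]), so the parity in e of the
    leading term e^3 becomes a parity in phi, and the difference below loses that term. *)
Lemma residual_hat_bound : exists2 K, 0 <= K & forall t (e : R) i, e != 0 -> `|e| <= 1 -> forall p,
  `|res_hat t p e i| <= K * `|e| ^+ 3 /\ `|res_hat t p e i - res_hat t (p + pi) e i| <=
    K * `|e| ^+ 4.
Proof.
have jb i : jet 1 4 (fun (u : R * R) e => res_hat u.1 u.2 e i).
  have bc : bounded_family (fun u : R * R => (rot_scale (betaR N ls) (betaI N ls) *m circ u.2) i 0).
    rewrite (_ : (fun u => _) = fun u : R * R => \sum_j rot_scale (betaR N ls) (betaI N ls) i j *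
      (cos u.2 * e1 R j 0 + sin u.2 * e2 R j 0)).
      by apply: bf_sum => j; bf.
    by apply/funext => u; rewrite mxE; apply: eq_bigr => j _; rewrite /circ !mxE.
  have := jetD (jet_residual (lshift m i)) (jetM (jet_expr (R * R)%type 1 4 2) (jet_cst 1 4
    (bfN bc))).
  by apply: jet_ext => u e _; rewrite mulrN.
have hK i : exists K, 0 <= K /\ forall (u : R * R) (e : R), e != 0 -> `|e| <= 1 ->
    `|res_hat u.1 u.2 e i| <= K * `|e| ^+ 3 /\ `|res_hat u.1 u.2 e i - (-1) ^+ 1 * res_hat u.1 u.2
      (- e) i| <= K * `|e| ^+ 4.
  have [K K0 hK] := jet_leading_parity (k := 1) ler01 ltr01 (fun u =>
    nf_residual_hat_little_o F_smooth U_open U_ls smooth_v smooth_P floquet E_ls nf u.1 u.2 i)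
    (jb i).
  by exists K.
have [K hKi] := choice hK; exists (\sum_i K i); first by apply: sumr_ge0 => i _; exact: (hKi i).1.
move=> t e i e0 he p; have [h1 h2] := (hKi i).2 (t, p) e e0 he.
have hle j : K i * `|e| ^+ j <= (\sum_i K i) * `|e| ^+ j.
  rewrite ler_wpM2r ?exprn_ge0// (bigD1 i)//= lerDl; apply: sumr_ge0 => i' _; exact: (hKi i').1.
split; first exact: le_trans h1 (hle 3%N).
have -> : res_hat t (p + pi) e i = (-1) ^+ 1 * res_hat t p (- e) i.
  rewrite /res_hat residual_pi circ_pi mulmxN sqrrN expr1 mulN1r.
  have -> (a : 'cV[R]_2) : (- a) i 0 = - a i 0 by rewrite !mxE.
  have -> (a : 'cV[R]_n) : (- a) (lshift m i) 0 = - a (lshift m i) 0 by rewrite !mxE.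
  by rewrite mulrN opprK opprB addrC.
exact: le_trans h2 (hle 4%N).
Qed.

(** Here the leading term is e^2, of the opposite parity, so it disappears from the sum and not from
    the difference. *)
Lemma residual_tilde_bound : exists2 K, 0 <= K & forall t (e : R) i, e != 0 -> `|e| <=
  1 -> forall p,
  `|rN t p e (rshift 2 i) 0| <= K * `|e| ^+ 2 /\
  `|rN t p e (rshift 2 i) 0 + rN t (p + pi) e (rshift 2 i) 0| <= K * `|e| ^+ 3.
Proof.
have hK i : exists K, 0 <= K /\ forall (u : R * R) (e : R), e != 0 -> `|e| <= 1 ->
    `|rN u.1 u.2 e (rshift 2 i) 0| <= K * `|e| ^+ 2 /\ `|rN u.1 u.2 e (rshift 2 i) 0
      - (-1) ^+ 0 * rN u.1 u.2 (- e) (rshift 2 i) 0| <= K * `|e| ^+ 3.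
  have [K K0 hK] := jet_leading_parity (k := 0) ler01 ltr01 (fun u => nf_residual_tilde_little_o
    F_smooth U_open U_ls smooth_v smooth_P floquet E_ls nf u.1 u.2 i)
    (jetW (jet_residual (rshift 2 i))).
  by exists K.
have [K hKi] := choice hK; exists (\sum_i K i); first by apply: sumr_ge0 => i _; exact: (hKi i).1.
move=> t e i e0 he p; have [h1 h2] := (hKi i).2 (t, p) e e0 he.
have hle j : K i * `|e| ^+ j <= (\sum_i K i) * `|e| ^+ j.
  rewrite ler_wpM2r ?exprn_ge0// (bigD1 i)//= lerDl; apply: sumr_ge0 => i' _; exact: (hKi i').1.
split; first exact: le_trans h1 (hle 2%N).
have -> : rN t (p + pi) e (rshift 2 i) 0 = - ((-1) ^+ 0 * rN t p (- e) (rshift 2 i) 0).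
  by rewrite residual_pi mxE expr0 mul1r.
exact: le_trans h2 (hle 3%N).
Qed.

End normal_form_residual.

(** * Mode equations for the defect *)

Section trigonometric_series.
Variables (R : realType) (n : nat).
Implicit Types (c : bool -> nat -> 'cV[R]_n) (p t : R).

Definition tseries c p : 'cV[R]_n :=
  \sum_(k < 4) (trig false k p *: c false k + trig true k p *: c true k).

(* d/dp maps the coefficient family c to (b, k) |-> tsign b * k * c (~~ b) k. *)
Definition tsign (b : bool) : R := if b then -1 else 1.

Lemma tseries_entry c p i :
  tseries c p i 0 = \sum_(k < 4) (c false k i 0 * trig false k p + c true k i 0 * trig true k p).
Proof.
rewrite /tseries summxE; apply: eq_bigr => k _.
by rewrite !mxE [X in X + _]mulrC [X in _ + X]mulrC.
Qed.

Lemma fourier_true0 (f : R -> R) : fourier true 0 f = 0.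
Proof.
rewrite /fourier (@period_int_ext _ _ (fun=> 0)); first by rewrite period_int_cst !mulr0.
by move=> x; rewrite /trig mul0r sin0 mulr0.
Qed.

Lemma fourier_tseries c b k i : c true 0%N = 0 -> (k < 4)%N -> fourier b k (fun p =>
  tseries c p i 0) = c b k i 0.
Proof.
move=> c0 k4; rewrite (fourier_ext _ _ (fun p => tseries_entry c p i)).
have [/andP[/eqP-> /eqP->]|hbk] := boolP ((b == true) && (k == 0%N));
  first by rewrite fourier_true0 c0 mxE.
by rewrite (@fourier_poly R 4 (fun b k => c b k i 0))//; case: b hbk.
Qed.

Lemma der_tseries_coef (c : bool -> nat -> R -> 'cV[R]_n) t p (dc : bool -> nat -> 'cV[R]_n) :
  (forall b k, (k < 4)%N -> is_derive t 1 (c b k) (dc b k)) ->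
  is_derive t 1 (fun t => tseries (fun b k => c b k t) p) (tseries dc p).
Proof.
move=> hc; apply: der_mx => i j; rewrite ord1 tseries_entry.
rewrite (_ : (fun y => _) = fun t => \sum_(k < 4) (trig false k p * c false k t i 0 + trig true k p
  * c true k t i 0)); last first.
  by apply/funext => s; rewrite tseries_entry; apply: eq_bigr => k _; ring.
rewrite (_ : \sum_(k < 4) _ = \sum_(k < 4) (trig false k p * dc false k i 0 + trig true k p * dc
  true k i 0)); last first.
  by apply: eq_bigr => k _; ring.
by apply: der_sum => k; apply: derD; apply: derZ; apply: der_entry; exact: hc.
Qed.

Lemma der_tseries c p : is_derive p 1 (tseries c) (tseries (fun b k => (tsign b * k%:R) *: c (~~ b)
  k) p).
Proof.
apply: der_mx => i j; rewrite ord1 tseries_entry.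
rewrite (_ : (fun y => _) = fun p => \sum_(k < 4) (c false k i 0 * trig false k p + c true k i 0 *
  trig true k p)); last first.
  by apply/funext => s; rewrite tseries_entry.
rewrite (_ : \sum_(k < 4) _ = \sum_(k < 4) (c false k i 0 * trig_deriv false k p + c true k i 0 *
  trig_deriv true k p)); last first.
  by apply: eq_bigr => k _; rewrite !mxE /tsign /trig_deriv /trig; ring.
by apply: der_sum => k; apply: derD; apply: derZ; exact: der_trig.
Qed.

Lemma tseries_cont c i : continuous (fun p => tseries c p i 0).
Proof. by move=> p; exact: der_cont (der_entry i 0 (der_tseries c p)). Qed.

Lemma tseriesD c c' p : tseries (fun b k => c b k + c' b k) p = tseries c p + tseries c' p.
Proof. by rewrite /tseries -big_split; apply: eq_bigr => k _; rewrite !scalerDr addrACA. Qed.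

Lemma tseriesZ (s : R) c p : tseries (fun b k => s *: c b k) p = s *: tseries c p.
Proof. by rewrite /tseries scaler_sumr; apply: eq_bigr => k _;
  rewrite scalerDr !scalerA ![_ * s]mulrC. Qed.

Lemma tseriesB c c' p : tseries (fun b k => c b k - c' b k) p = tseries c p - tseries c' p.
Proof.
rewrite -[- tseries c' p]scaleN1r -tseriesZ -tseriesD; congr tseries.
by apply/funext => b; apply/funext => k; rewrite scaleN1r.
Qed.

Lemma tseries_mulmx q (A : 'M[R]_(q, n)) c p : A *m tseries c p =
  \sum_(k < 4) (trig false k p *: (A *m c false k) + trig true k p *: (A *m c true k)).
Proof. by rewrite /tseries mulmx_sumr; apply: eq_bigr => k _; rewrite mulmxDr !scalemxAr. Qed.

Lemma tseries_bound c p (W : R) i : (forall b k, (k < 4)%N -> `|c b k i 0| <= W) ->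
  `|tseries c p i 0| <= 8 * W.
Proof.
move=> hc; rewrite tseries_entry; apply: le_trans (ler_norm_sum _ _ _) _.
apply: le_trans (_ : \sum_(k < 4) (W + W) <= _).
  apply: ler_sum => k _; apply: le_trans (ler_normD _ _) _; apply: lerD; rewrite normrM.
    by apply: le_trans (hc false k _) => //; rewrite ler_piMr// trig_le1.
  by apply: le_trans (hc true k _) => //; rewrite ler_piMr// trig_le1.
by rewrite sumr_const card_ord -mulr_natl; lra.
Qed.

Lemma tseries_pi c p i : tseries c (p + pi) i 0 =
  \sum_(k < 4) (-1) ^+ k * (c false k i 0 * trig false k p + c true k i 0 * trig true k p).
Proof. by rewrite tseries_entry; apply: eq_bigr => k _; rewrite !trig_pi; ring. Qed.

(* Odd modes cancel. *)
Lemma tseries_even_bound c p (W : R) i : (forall b k, (k < 4)%N -> ~~ odd k -> `|c b k i 0| <= W) ->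
  `|tseries c p i 0 + tseries c (p + pi) i 0| <= 8 * W.
Proof.
move=> hc; rewrite tseries_pi tseries_entry -big_split/= !big_ord_recl big_ord0/=.
have hb b k x : (k < 4)%N -> ~~ odd k -> `|c b k i 0 * trig b k x| <= W.
  by move=> k4 ok; rewrite normrM; apply: le_trans (hc b k k4 ok); rewrite ler_piMr// trig_le1.
have h0 := hb false 0%N p isT isT; have h1 := hb true 0%N p isT isT.
have h2 := hb false 2%N p isT isT; have h3 := hb true 2%N p isT isT.
rewrite /bump /=.
have -> : c false 0 i 0 * trig false 0 p + c true 0 i 0 * trig true 0 p
  + (-1) ^+ 0 * (c false 0 i 0 * trig false 0 p + c true 0 i 0 * trig true 0 p)
  + (c false 1 i 0 * trig false 1 p + c true 1 i 0 * trig true 1 p + (-1) ^+ 1 * (c false 1 i 0 *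
    trig false 1 p + c true 1 i 0 * trig true 1 p)
  + (c false 2%N i 0 * trig false 2 p + c true 2%N i 0 * trig true 2 p + (-1) ^+ 2 * (c false 2%N i
    0 * trig false 2 p + c true 2%N i 0 * trig true 2 p)
  + (c false 3%N i 0 * trig false 3 p + c true 3%N i 0 * trig true 3 p + (-1) ^+ 3 * (c false 3%N i
    0 * trig false 3 p + c true 3%N i 0 * trig true 3 p) + 0))) =
  2 * (c false 0 i 0 * trig false 0 p + c true 0 i 0 * trig true 0 p
    + (c false 2%N i 0 * trig false 2 p + c true 2%N i 0 * trig true 2 p)) by ring.
move: h0 h1 h2 h3; rewrite !ler_norml;
  move: (c _ _ _ _ * _) (c _ _ _ _ * _) (c _ _ _ _ * _) (c _ _ _ _ * _) => a b d f; lra.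
Qed.

(** The phi-derivative exchanges the cosine and sine coefficients of one mode, so each mode
    decouples. The hypothesis on H involves only its Fourier coefficients in the modes 0 to 3, which
    lets H be the untruncated field. *)
Lemma mode_ode (c : bool -> nat -> R -> 'cV[R]_n) (om : R) (H : R -> R -> 'I_n -> R) :
  (forall b k (t : R), (k < 4)%N -> is_derive t 1 (c b k) (derive1 (c b k) t)) ->
    (forall t, c true 0%N t = 0) ->
  (forall t b k i, (k < 4)%N -> fourier b k (fun p => H t p i) = fourier b k (fun p =>
     (derive1 (fun t => tseries (fun b k => c b k t) p) t + om *: derive1 (tseries (fun b k =>
       c b k t)) p) i 0)) ->
  forall b k (t : R) i, (k < 4)%N -> is_derive t 1 (fun t => c b k t i 0)
    (fourier b k (fun p => H t p i) - om * (tsign b * k%:R * c (~~ b) k t i 0)).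
Proof.
move=> dc c0 Heq b k t i k4.
apply: is_derive_eq (der_entry i 0 (dc b k t k4)) _.
have d0 : derive1 (c true 0%N) t = 0.
  have -> : c true 0%N = fun=> 0 by apply/funext.
  by rewrite derive1E derive_cst.
rewrite Heq// (@fourier_ext _ _ _ _ (fun p => tseries (fun b k => derive1 (c b k) t
  + om *: ((tsign b * k%:R) *: c (~~ b) k t)) p i 0)); last first.
  move=> p; rewrite tseriesD tseriesZ (der1E (der_tseries_coef p (fun b k => dc b k t))).
  by rewrite (der1E (der_tseries _ p)).
rewrite fourier_tseries//; last by rewrite d0 mulr0 scale0r scaler0 addr0.
by rewrite !mxE addrK.
Qed.

End trigonometric_series.

(** * Non-resonance and the inversion of the hat equations, mode by mode *)

Section mode_inversion.
Variables (R : realType) (os : R).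
Hypotheses (os_gt0 : 0 < os) (os_lt : os < 2^-1) (os3 : os != 3^-1) (os4 : os != 4^-1).

Lemma cos_2pi_neq1 (x : R) : 0 < x < 1 -> cos (2 * pi * x) != 1.
Proof.
move=> /andP[x0 x1]; have pi0 := pi_gt0 R.
have s0 : 0 < sin (pi * x) by apply: sin_gt0_pi; rewrite mulr_gt0//= gtr_pMr.
have -> : 2 * pi * x = (pi * x) *+ 2 by rewrite -mulr_natl; ring.
rewrite cos_mulr2n; apply/eqP => h.
have := cos2Dsin2 (pi * x); have : 0 < sin (pi * x) ^+ 2 by rewrite exprn_gt0.
move: h; rewrite -mulr_natl; lra.
Qed.

Lemma cos_2pi_shift (x : R) : cos (2 * pi * x) = cos (2 * pi * (x - 1)).
Proof.
have -> : 2 * pi * x = 2 * pi * (x - 1) + pi *+ 2 by rewrite -mulr_natl; ring.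
exact: cosD2pi.
Qed.

(** j goes up to 4 because mode 3 also rotates with frequency 4 [os]. As j [os] lies strictly
    between 0 and 2, only the value 1 has to be excluded: by [os] < 1/2 for j = 1, 2 and by the
    absence of strong resonance for j = 3, 4. *)
Lemma nonresonant (j : nat) : (1 <= j <= 4)%N -> cos (2 * pi * (j%:R * os)) != 1.
Proof.
have os2 : 2 * os < 1 by rewrite -ltr_pdivlMl// mulr1.
have os0 : 0 < os := os_gt0.
case: j => [//|[|[|[|[|//]]]]] _.
- by rewrite mulrA mulr1; apply: cos_2pi_neq1; rewrite os_gt0; lra.
- by apply: cos_2pi_neq1; lra.
- have [h|h|h] := ltgtP (3 * os) 1; first by apply: cos_2pi_neq1; lra.
    by rewrite cos_2pi_shift; apply: cos_2pi_neq1; lra.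
  by case/eqP: os3; rewrite -(mulKf (_ : 3 != 0 :> R) os) ?h ?mulr1.
- have [h|h|h] := ltgtP (4 * os) 1; first by apply: cos_2pi_neq1; lra.
    by rewrite cos_2pi_shift; apply: cos_2pi_neq1; lra.
  by case/eqP: os4; rewrite -(mulKf (_ : 4 != 0 :> R) os) ?h ?mulr1.
Qed.

Lemma cos_2piN (x : R) : cos (2 * pi * - x) = cos (2 * pi * x).
Proof. by rewrite mulrN cosN. Qed.

(* The combinations a1 + b2, a2 - b1 rotate with frequency (k - 1) os and
   a1 - b2, a2 + b1 with frequency (k + 1) os; only the former can resonate, for k = 1,
   where the drift (pR, pI) and the normalization take over. *)
Lemma mode_hat_bound (k : nat) : (k <= 3)%N -> exists2 K : R, 0 <= K &
  forall (a1 a2 b1 b2 f1 f2 g1 g2 : R -> R) (pR pI M : R),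
  (forall t, a1 (t + 2 * pi) = a1 t) -> (forall t, a2 (t + 2 * pi) = a2 t) ->
  (forall t, b1 (t + 2 * pi) = b1 t) -> (forall t, b2 (t + 2 * pi) = b2 t) ->
  (forall t : R, is_derive t 1 a1 (- os * a2 t - os * k%:R * b1 t + (k == 1%N)%:R * pR + f1 t)) ->
  (forall t : R, is_derive t 1 a2 (os * a1 t - os * k%:R * b2 t + (k == 1%N)%:R * pI + f2 t)) ->
  (forall t : R, is_derive t 1 b1 (- os * b2 t + os * k%:R * a1 t - (k == 1%N)%:R * pI + g1 t)) ->
  (forall t : R, is_derive t 1 b2 (os * b1 t + os * k%:R * a2 t + (k == 1%N)%:R * pR + g2 t)) ->
  (k = 1%N -> period_int (fun t => a1 t + b2 t) = 0 /\ period_int (fun t => a2 t - b1 t) = 0) ->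
  (forall t, `|f1 t| <= M) -> (forall t, `|f2 t| <= M) -> (forall t, `|g1 t| <= M) ->
    (forall t, `|g2 t| <= M) ->
  (forall t, [/\ `|a1 t| <= K * M, `|a2 t| <= K * M, `|b1 t| <= K * M & `|b2 t| <= K * M]) /\
  (k = 1%N -> `|pR| <= K * M /\ `|pI| <= K * M).
Proof.
move=> k3.
have n2 : cos (2 * pi * (k.+1%:R * os)) != 1 by apply: nonresonant.
have [K2 K20 hK2] := rotation_ode_bound n2.
have hUV : forall (a1 a2 b1 b2 f1 f2 g1 g2 : R -> R) (pR pI M : R),
  (forall t, a1 (t + 2 * pi) = a1 t) -> (forall t, a2 (t + 2 * pi) = a2 t) ->
  (forall t, b1 (t + 2 * pi) = b1 t) -> (forall t, b2 (t + 2 * pi) = b2 t) ->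
  (forall t : R, is_derive t 1 a1 (- os * a2 t - os * k%:R * b1 t + (k == 1%N)%:R * pR + f1 t)) ->
  (forall t : R, is_derive t 1 a2 (os * a1 t - os * k%:R * b2 t + (k == 1%N)%:R * pI + f2 t)) ->
  (forall t : R, is_derive t 1 b1 (- os * b2 t + os * k%:R * a1 t - (k == 1%N)%:R * pI + g1 t)) ->
  (forall t : R, is_derive t 1 b2 (os * b1 t + os * k%:R * a2 t + (k == 1%N)%:R * pR + g2 t)) ->
  (forall t, `|f1 t| <= M) -> (forall t, `|f2 t| <= M) -> (forall t, `|g1 t| <= M) ->
    (forall t, `|g2 t| <= M) ->
  forall t, `|a1 t - b2 t| <= K2 * (2 * M) /\ `|a2 t + b1 t| <= K2 * (2 * M).
  move=> a1 a2 b1 b2 f1 f2 g1 g2 pR pI M pa1 pa2 pb1 pb2 da1 da2 db1 db2 hf1 hf2 hg1 hg2.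
  apply: (hK2 (fun t => a1 t - b2 t) (fun t => a2 t + b1 t) (fun t => f1 t - g2 t) (fun t =>
    f2 t + g1 t)) => t.
  - by rewrite pa1 pb2.
  - by rewrite pa2 pb1.
  - by apply: is_derive_eq (derB (da1 t) (db2 t)) _; rewrite -natr1; ring.
  - by apply: is_derive_eq (derD (da2 t) (db1 t)) _; rewrite -natr1; ring.
  - by apply: le_trans (ler_normB _ _) _; have := hf1 t; have := hg2 t; lra.
  - by apply: le_trans (ler_normD _ _) _; have := hf2 t; have := hg1 t; lra.
have half (s u d v K M : R) : `|s| <= K * M -> `|u| <= K2 * (2 * M) -> `|d| <= K * M -> `|v| <=
  K2 * (2 * M) ->
   0 <= K -> 0 <= M -> [/\ `|(s + u) / 2| <= (K + K2) * M, `|(d + v) / 2| <=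
     (K + K2) * M, `|(v - d) / 2| <= (K + K2) * M & `|(s - u) / 2| <= (K + K2) * M].
  move=> hs hu hd hv K0 M0; have KM : 0 <= K * M by rewrite mulr_ge0.
  by split; move: hs hu hd hv; rewrite !ler_norml; lra.
have [k1|k1] : (k = 1%N) \/ (k != 1%N) by have [?|?] := eqVneq k 1%N; [left|right].
  (* The drift bound and the forcing give 4 M for the derivative of the resonant combinations, hence
     16 pi M for these combinations by their zero mean. The summand 1 covers the drifts
     themselves. *)
  exists (16 * pi + K2 + 1); first by rewrite !addr_ge0// mulr_ge0// pi_ge0.
  move=> a1 a2 b1 b2 f1 f2 g1 g2 pR pI M pa1 pa2 pb1 pb2 da1 da2 db1 db2 hm hf1 hf2 hg1 hg2.
  have UV := hUV _ _ _ _ _ _ _ _ _ _ _ pa1 pa2 pb1 pb2 da1 da2 db1 db2 hf1 hf2 hg1 hg2.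
  have M0 : 0 <= M := le_trans (normr_ge0 _) (hf1 0).
  have dS (t : R) : is_derive t 1 (fun t => a1 t + b2 t) (2 * pR + (f1 t + g2 t)).
    by apply: is_derive_eq (derD (da1 t) (db2 t)) _; rewrite k1 eqxx /=; ring.
  have dD (t : R) : is_derive t 1 (fun t => a2 t - b1 t) (2 * pI + (f2 t - g1 t)).
    by apply: is_derive_eq (derB (da2 t) (db1 t)) _; rewrite k1 eqxx /=; ring.
  have fS t : `|f1 t + g2 t| <= 2 * M by apply: le_trans (ler_normD _ _) _; have := hf1 t;
    have := hg2 t; lra.
  have fD t : `|f2 t - g1 t| <= 2 * M by apply: le_trans (ler_normB _ _) _; have := hf2 t;
    have := hg1 t; lra.
  have pS t : a1 (t + 2 * pi) + b2 (t + 2 * pi) = a1 t + b2 t by rewrite pa1 pb2.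
  have pD t : a2 (t + 2 * pi) - b1 (t + 2 * pi) = a2 t - b1 t by rewrite pa2 pb1.
  have hR := periodic_drift_bound pS dS fS; have hI := periodic_drift_bound pD dD fD.
  have [mS mD] := hm k1.
  have bS := @periodic_zero_mean_bound R (fun t => a1 t + b2 t) _ (4 * M) pS dS _ mS.
  have bD := @periodic_zero_mean_bound R (fun t => a2 t - b1 t) _ (4 * M) pD dD _ mD.
  have {}bS := bS (fun t => ltac:(apply: le_trans (ler_normD _ _) _; have := fS t; lra)).
  have {}bD := bD (fun t => ltac:(apply: le_trans (ler_normD _ _) _; have := fD t; lra)).
  have pi0 := pi_ge0 R.
  split=> [t|_].
    have [u1 u2] := UV t; have := bS t; have := bD t; rewrite !mulrA => h2 h1.
    have [||||||] := half (a1 t + b2 t) (a1 t - b2 t) (a2 t - b1 t) (a2 t + b1 t) (16 * pi) M => //.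
    - by apply: le_trans h1 _; have -> : 4 * pi * 4 * M = 16 * pi * M by ring.
    - by apply: le_trans h2 _; have -> : 4 * pi * 4 * M = 16 * pi * M by ring.
    - by rewrite mulr_ge0.
    - move=> q1 q2 q3 q4.
      have e1 : a1 t = (a1 t + b2 t + (a1 t - b2 t)) / 2 by field.
      have e2 : a2 t = (a2 t - b1 t + (a2 t + b1 t)) / 2 by field.
      have e3 : b1 t = (a2 t + b1 t - (a2 t - b1 t)) / 2 by field.
      have e4 : b2 t = (a1 t + b2 t - (a1 t - b2 t)) / 2 by field.
      have le1 (x : R) : `|x| <= (16 * pi + K2) * M -> `|x| <= (16 * pi + K2 + 1) * M.
        by move=> h; apply: le_trans h _; rewrite ler_wpM2r// lerDl.
      by split; [rewrite e1|rewrite e2|rewrite e3|rewrite e4]; exact: le1.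
  have leM : M <= (16 * pi + K2 + 1) * M.
    by rewrite -[leLHS]mul1r ler_wpM2r// lerDr addr_ge0// mulr_ge0.
  have n2R : `|2| = 2 :> R by rewrite ger0_norm.
  move: hR hI; rewrite !normrM n2R => hR hI.
  by split; apply: le_trans leM; lra.
(* For k = 0 the frequency is - [os], and the cosine is even. *)
have n1 : cos (2 * pi * ((k%:R - 1) * os)) != 1.
  case: k k3 k1 {n2 hK2 hUV} => [|[//|k]] k3 _.
    by rewrite sub0r mulN1r cos_2piN -[os]mul1r; exact: (@nonresonant 1).
  rewrite (_ : k.+2%:R - 1 = k.+1%:R :> R); last by rewrite -natr1 addrK.
  by apply: nonresonant; rewrite /= ltnW// ltnW.
have [K1 K10 hK1] := rotation_ode_bound n1.
exists (K1 * 2 + K2); first by rewrite addr_ge0// mulr_ge0.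
move=> a1 a2 b1 b2 f1 f2 g1 g2 pR pI M pa1 pa2 pb1 pb2 da1 da2 db1 db2 hm hf1 hf2 hg1 hg2.
have UV := hUV _ _ _ _ _ _ _ _ _ _ _ pa1 pa2 pb1 pb2 da1 da2 db1 db2 hf1 hf2 hg1 hg2.
have M0 : 0 <= M := le_trans (normr_ge0 _) (hf1 0).
have SD := hK1 (fun t => a2 t - b1 t) (fun t => a1 t + b2 t) (fun t => f2 t - g1 t) (fun t =>
  f1 t + g2 t) (2 * M).
split=> [t|/eqP]; last by rewrite (negbTE k1).
have [||||||h1 h2] := SD _ _ _ _ _ _ t.
- by move=> s; rewrite pa2 pb1.
- by move=> s; rewrite pa1 pb2.
- by move=> s; apply: is_derive_eq (derB (da2 s) (db1 s)) _; rewrite (negbTE k1) /=; ring.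
- by move=> s; apply: is_derive_eq (derD (da1 s) (db2 s)) _; rewrite (negbTE k1) /=; ring.
- by move=> s; apply: le_trans (ler_normB _ _) _; have := hf2 s; have := hg1 s; lra.
- by move=> s; apply: le_trans (ler_normD _ _) _; have := hf1 s; have := hg2 s; lra.
have [u1 u2] := UV t.
have [||||||] := half (a1 t + b2 t) (a1 t - b2 t) (a2 t - b1 t) (a2 t + b1 t) (K1 * 2) M => //.
- by rewrite -mulrA.
- by rewrite -mulrA.
- by rewrite mulr_ge0.
- move=> q1 q2 q3 q4.
  have e1 : a1 t = (a1 t + b2 t + (a1 t - b2 t)) / 2 by field.
  have e2 : a2 t = (a2 t - b1 t + (a2 t + b1 t)) / 2 by field.
  have e3 : b1 t = (a2 t + b1 t - (a2 t - b1 t)) / 2 by field.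
  have e4 : b2 t = (a1 t + b2 t - (a1 t - b2 t)) / 2 by field.
  by split; [rewrite e1|rewrite e2|rewrite e3|rewrite e4].
Qed.

End mode_inversion.

(** * The equations satisfied by the modes of z^F, of z^N and of the defect *)

Section mode_equations.
Variables (R : realType) (m : nat) (F : vector_field R m) (ls os : R) (U : set R)
  (C : continuation R m) (N : nf_coeffs R m) (X : fourier_family R m).
Local Notation n := (2 + m)%N.
Hypotheses (F_smooth : smooth_field F) (U_open : open U) (U_ls : U ls) (nf : is_normal_form F U C
  N).

Definition ycoef (b : bool) (k : nat) : 'cV[R]_n :=
  if k == 1%N then if b then col_mx (e2 R) 0 else col_mx (e1 R) 0 else 0.

Definition Fcoef b k t e : 'cV[R]_n :=
  if b then if k == 0%N then 0 else bF X k t e else aF X k t e.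

Definition nfcoef b k t : 'cV[R]_n :=
  if b then if k == 0%N then 0 else nfB ls N k t else nfA ls N k t.

(** Even modes arise from the quadratic terms, with weight e, and the correction in odd modes from
    the cubic terms, with weight e^2. *)
Definition nfscale (k : nat) (e : R) : R := if odd k then e ^+ 2 else e.

Definition defect b k t e : 'cV[R]_n := Fcoef b k t e - nfscale k e *: nfcoef b k t.

Lemma tseries_ycoef p : tseries ycoef p = col_mx (circ p) 0.
Proof.
rewrite /tseries !big_ord_recl big_ord0 /bump /ycoef /= !scaler0 !addr0 !add0r /trig !mul1r.
by rewrite !scale_col_mx add_col_mx !scaler0 addr0.
Qed.

Lemma tseries4 (c : bool -> nat -> 'cV[R]_n) p : tseries c p =
  (trig false 0 p *: c false 0%N + trig true 0 p *: c true 0%N) + ((trig false 1 p *: c false 1%N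
    + trig true 1 p *: c true 1%N)
  + ((trig false 2 p *: c false 2%N + trig true 2 p *: c true 2%N) + (trig false 3 p *: c false 3%N
    + trig true 3 p *: c true 3%N))).
Proof. by rewrite /tseries !big_ord_recl big_ord0 addr0. Qed.

Lemma tseries_zF t p e : zF X t p e = tseries (fun b k => ycoef b k + Fcoef b k t e) p.
Proof.
rewrite tseriesD tseries_ycoef /zF; congr (_ + _).
rewrite tseries4 /phi_series big_ltn// big_ltn// big_ltn// big_geq// /trig /Fcoef /= !mul0r cos0
  scale1r !scaler0 !addr0.
by [].
Qed.

(** Double and triple angle formulas; they show that z^N has no mode above 3. *)
Lemma nf_pointE t p e : nf_point ls N (cos p) (sin p) t e =
  tseries (fun b k => ycoef b k + nfscale k e *: nfcoef b k t) p.
Proof.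
rewrite tseriesD tseries_ycoef /nf_point -addrA; congr (_ + _).
rewrite tseries4 /nfscale /nfcoef /trig /= !mul0r cos0 scale1r !scaler0 addr0 !mul1r /hq /hc.
have c2 : cos (2 * p) = cos p ^+ 2 - sin p ^+ 2 by rewrite mulr_natl cos_mulr2n;
  have := cos2Dsin2 p; rewrite -mulr_natl => h; lra.
have s2 : sin (2 * p) = 2 * cos p * sin p by rewrite mulr_natl sin_mulr2n -mulr_natl; ring.
have c1 := cos2Dsin2 p.
have c3 : cos (3 * p) = cos p * (cos p ^+ 2 - 3 * sin p ^+ 2).
  have -> : 3 * p = 2 * p + p by ring.
  by rewrite cosD c2 s2; ring.
have s3 : sin (3 * p) = sin p * (3 * cos p ^+ 2 - sin p ^+ 2).
  have -> : 3 * p = 2 * p + p by ring.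
  by rewrite sinD c2 s2; ring.
rewrite c2 s2 c3 s3 c1 scale1r !mulr1.
move: (nfA ls N 0 t) (nfA ls N 1 t) (nfA ls N 2 t) (nfA ls N 3 t) (nfB ls N 1 t) (nfB ls N 2 t)
  (nfB ls N 3 t) => a0 a1 a2 a3 b1 b2 b3.
by apply/colP => i; rewrite !mxE; ring.
Qed.

Lemma per_nfcoef b k : (k < 4)%N -> per_curve (nfcoef b k).
Proof.
move=> k4; case: b; rewrite /nfcoef; last exact: (per_nfA U_open U_ls nf).
by case: k k4 => [|k] k4 /=; [exact: per_curve0|exact: (per_nfB U_open U_ls nf)].
Qed.

Lemma cont_G l t e (z dz : R -> 'cV[R]_n) i : (forall p : R, is_derive p 1 z (dz p)) ->
  continuous (fun p => G F C (z p) l t e i 0).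
Proof.
move=> hz; have [->|e0] := eqVneq e 0.
  rewrite (_ : (fun p => _) = fun p => \sum_j cE C l i j * z p j 0); last first.
    by apply/funext => p; rewrite /G eqxx mxE.
  by apply: cont_sum => j; apply: contZ => p; exact: der_cont (der_entry j 0 (hz p)).
pose K j := F (cv C t l) t l j 0.
rewrite (_ : (fun p => _) = fun p => \sum_j (e^-1 * invmx (cP C t l) i j) *
   (component F j (cv C t l + e *: (cP C t l *m z p), t, l)
     + (- K j + - e * \sum_k (derive1 (cP C ^~ l) t) j k * z p k 0))); last first.
  apply/funext => p; rewrite /G (negbTE e0) mxE mxE mulr_sumr; apply: eq_bigr => j _.
  rewrite mulrA; congr (_ * _); rewrite /component /K /=.
  have -> (a b c : 'cV[R]_n) : (a - b - e *: c) j 0 = a j 0 + (- b j 0 + - e * c j 0)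
    by rewrite !mxE addrA mulNr.
  by rewrite [(derive1 _ _ *m _) j 0]mxE.
apply: cont_sum => j; apply: contZ; apply: contD; last first.
  apply: contD; first exact: cst_continuous.
  by apply: contZ; apply: cont_sum => k; apply: contZ => p; exact: der_cont (der_entry k 0 (hz p)).
move=> p; have hs := component_smper F_smooth j.
have hm (k : 'I_n) : is_derive p 1 (fun p => (cP C t l *m z p) k 0) ((cP C t l *m dz p) k 0).
  rewrite (_ : (fun p => _) = fun p => \sum_q cP C t l k q * z p q 0); last by apply/funext => q;
    rewrite mxE.
  by rewrite mxE; apply: der_sum => q; apply: derZ; exact: der_entry.
have [h1 _] : is_derive p 1 (fun p => cv C t l + e *: (cP C t l *m z p)) (e *: (cP C t l *m dz p)).
  apply: der_mx => a b; rewrite ord1.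
  rewrite (_ : (fun y => _) = fun y => cv C t l a 0 + e * (cP C t l *m z y) a 0);
    last by apply/funext => y; rewrite mxE [X in _ + X]mxE.
  by rewrite mxE; apply: is_derive_eq (derD (der_cst (cv C t l a 0) p 1) (derZ e (hm a))) _;
    rewrite add0r.
have c1 : {for p, continuous (fun p => cv C t l + e *: (cP C t l *m z p))}
  by apply/differentiable_continuous/derivable1_diffP.
apply: (@continuous_comp _ _ _ (fun p => (cv C t l + e *: (cP C t l *m z p), t, l)) (component F
  j)); last exact: smper_cont.
exact: (cvg_pair (cvg_pair c1 (cvg_cst _)) (cvg_cst _)).
Qed.

Lemma phi_trunc_entry (f : R -> R -> 'cV[R]_n) t p i : phi_trunc 3 f t p i 0 =
  \sum_(j < 4) (fourier false j (fun x => f t x i 0) * trig false j p + fourier true j (fun x =>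
    f t x i 0) * trig true j p).
Proof.
rewrite /phi_trunc /phi_series big_ltn// big_ltn// big_ltn// big_geq// !big_ord_recl big_ord0 /bump
  /= fourier_true0.
rewrite /fourier /trig /= !mxE !mul0r cos0 mulr1;
  move: (period_int _) (period_int _) (period_int _) (period_int _)
  (period_int _) (period_int _) (period_int _) (cos _) (cos _) (cos _) (sin _) (sin _) (sin _) =>
    *; ring.
Qed.

Lemma ode_F e : fourier_solution F C X e -> forall b k (t : R) i, (k < 4)%N ->
  is_derive t 1 (fun t => (ycoef b k + Fcoef b k t e) i 0)
    (fourier b k (fun p => G F C (zF X t p e) (lambdaF X e) t e i 0)
     - omegaF X e * (tsign R b * k%:R * (ycoef (~~ b) k + Fcoef (~~ b) k t e) i 0)).
Proof.
move=> sol; pose c b k t := ycoef b k + Fcoef b k t e.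
have dF b k (t : R) : (k < 4)%N -> derivable (Fcoef b k ^~ e) t 1.
  move=> k4; rewrite /Fcoef; case: b; last exact: (four_a sol k4 t).1.
  by case: k k4 => [|k] k4 /=; [exact: derivable_cst|exact: (@four_b _ _ _ _ _ _ sol k.+1 k4 t).1].
have dc b k (t : R) : (k < 4)%N -> is_derive t 1 (c b k) (derive1 (c b k) t).
  move=> k4; rewrite derive1E; apply: derivableP.
  by apply: derivableD; [exact: derivable_cst|exact: dF].
apply: (@mode_ode R n c (omegaF X e) (fun t p i => G F C (zF X t p e) (lambdaF X e) t e i 0)) => //.
  by move=> t; rewrite /c /ycoef /Fcoef /= addr0.
move=> t b k i k4.
have [/andP[/eqP-> /eqP->]|hbk] := boolP ((b == true) && (k == 0%N));
  first by rewrite !fourier_true0.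
(* The truncation has the same Fourier coefficients as [G] in the modes 0 to 3. *)
rewrite -[LHS](@fourier_poly R 4 (fun b j => fourier b j (fun x => G F C (zF X t x e) (lambdaF X e)
  t e i 0)))//; last by case: b hbk.
apply: fourier_ext => p;
  rewrite -(phi_trunc_entry (fun t p => G F C (zF X t p e) (lambdaF X e) t e)).
have := four_eq sol t p; rewrite -addrA -opprD => /subr0_eq ->.
have -> : (fun t => zF X t p e) = fun t => tseries (fun b k => c b k t) p by apply/funext => s;
  exact: tseries_zF.
by have -> : (fun p => zF X t p e) = tseries (fun b k => c b k t) by apply/funext => s;
  exact: tseries_zF.
Qed.

Lemma ode_N e b k (t : R) i : (k < 4)%N ->
  is_derive t 1 (fun t => (ycoef b k + nfscale k e *: nfcoef b k t) i 0)
    (fourier b k (fun p => (G F C (nf_point ls N (cos p) (sin p) t e) ls t e - nf_residual F ls os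
      C N t p e) i 0)
     - os * (tsign R b * k%:R * (ycoef (~~ b) k + nfscale k e *: nfcoef (~~ b) k t) i 0)).
Proof.
pose c b k t := ycoef b k + nfscale k e *: nfcoef b k t.
have dc b' k' (s : R) : (k' < 4)%N -> is_derive s 1 (c b' k') (derive1 (c b' k') s).
  move=> k4; rewrite derive1E; apply: derivableP.
  apply: derivableD; first exact: derivable_cst.
  by apply: derivableZ; have [h _ _ _] := per_nfcoef b' k4; have [] := h s.
move: b k t i; apply: (@mode_ode R n c os (fun t p i => (G F C (nf_point ls N (cos p) (sin p) t e)
  ls t e - nf_residual F ls os C N t p e) i 0)) => //.
  by move=> t; rewrite /c /ycoef /nfcoef /= scaler0 addr0.
move=> t b k i k4; apply: fourier_ext => p; congr (_ i 0).
have Et : (fun t => tseries (fun b k => c b k t) p) = fun t => nf_point ls N (cos p) (sin p) t e.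
  by apply/funext => s; rewrite nf_pointE.
have Ep : tseries (fun b k => c b k t) = fun p => nf_point ls N (cos p) (sin p) t e.
  by apply/funext => s; rewrite nf_pointE.
rewrite Et Ep (der1E (der_nf_point_t U_open U_ls nf (cos p) (sin p) t e)).
rewrite (der1E (der_nf_point_x ls N t e (is_derive_cos p) (is_derive_sin p))).
rewrite /nf_residual; move: (G _ _ _ _ _ _) (nf_point_dt _ _ _ _ _ _) (os *: _) => x y z.
by rewrite -addrA -opprD opprB addrC subrK.
Qed.

Lemma zF_der t e (p : R) : is_derive p 1 (fun p => zF X t p e) (tseries (fun b k =>
  (tsign R b * k%:R) *: (ycoef (~~ b) k + Fcoef (~~ b) k t e)) p).
Proof.
have -> : (fun p => zF X t p e) = tseries (fun b k => ycoef b k + Fcoef b k t e) by apply/funext =>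
  s; exact: tseries_zF.
exact: der_tseries.
Qed.

Lemma zN_der t e (p : R) : is_derive p 1 (fun p => nf_point ls N (cos p) (sin p) t e)
  (tseries (fun b k => (tsign R b * k%:R) *: (ycoef (~~ b) k + nfscale k e *: nfcoef (~~ b) k t))
    p).
Proof.
have -> : (fun p => nf_point ls N (cos p) (sin p) t e) =
  tseries (fun b k => ycoef b k + nfscale k e *: nfcoef b k t).
  by apply/funext => s; exact: nf_pointE.
exact: der_tseries.
Qed.

Lemma fourier_mulmx_tseries q (A : 'M[R]_(q, n)) (c : bool -> nat -> 'cV[R]_n) b k i : c true 0%N =
  0 -> (k < 4)%N ->
  fourier b k (fun p => (A *m tseries c p) i 0) = (A *m c b k) i 0.
Proof.
move=> c0 k4; rewrite (@fourier_ext _ _ _ _ (fun p => tseries (fun b k => A *m c b k) p i 0));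
  last first.
  by move=> p; rewrite tseries_mulmx.
by rewrite fourier_tseries// c0 mulmx0.
Qed.

Definition Gnl z l t e i : R := G F C z l t e i 0 - (cE C l *m z) i 0.

Definition beta_mx : 'M[R]_n := block_mx (rot_scale (betaR N ls) (betaI N ls)) 0 0 0.

(** The difference of the nonlinear parts plus the residual freed from e^2 beta y; this last term is
    accounted for in [mode_drift]. *)
Definition mode_source t p e i : R := Gnl (zF X t p e) (lambdaF X e) t e i
  - Gnl (nf_point ls N (cos p) (sin p) t e) ls t e i
  + (nf_residual F ls os C N t p e i 0 - e ^+ 2 * (beta_mx *m col_mx (circ p) 0) i 0).

(** The action of the detuning on $a^\star$ is left to [mode_drift], so that here the detuning meets
    only the coefficients of $z^F - a^\star$, which are small. *)
Definition mode_forcing b k t e i : R :=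
  ((cE C (lambdaF X e) - cE C ls) *m Fcoef b k t e) i 0 - (omegaF X e - os) * (tsign R b * k%:R *
    Fcoef (~~ b) k t e i 0)
  + fourier b k (fun p => mode_source t p e i).

(* The forcing of the critical mode k = 1 by the detuning. *)
Definition mode_drift b k e i : R :=
  ((cE C (lambdaF X e) - cE C ls + e ^+ 2 *: beta_mx) *m ycoef b k) i 0 - (omegaF X e - os) *
    (tsign R b * k%:R * ycoef (~~ b) k i 0).

Lemma residual_cont t e i : continuous (fun p => nf_residual F ls os C N t p e i 0).
Proof.
pose c b k t := ycoef b k + nfscale k e *: nfcoef b k t.
have dc b' k' (s : R) : (k' < 4)%N -> is_derive s 1 (c b' k') (derive1 (c b' k') s).
  move=> k4; rewrite derive1E; apply: derivableP.
  apply: derivableD; first exact: derivable_cst.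
  by apply: derivableZ; have [h _ _ _] := per_nfcoef b' k4; have [] := h s.
rewrite (_ : (fun p => _) = fun p => G F C (nf_point ls N (cos p) (sin p) t e) ls t e i 0
  + (-1 * tseries (fun b k => derive1 (c b k) t) p i 0 + - os * tseries (fun b k =>
    (tsign R b * k%:R) *: c (~~ b) k t) p i 0)).
  apply: contD; first exact: cont_G (zN_der t e).
  by apply: contD; apply: contZ; exact: tseries_cont.
apply/funext => p; rewrite /nf_residual.
have -> (x y z : 'cV[R]_n) : (x - y - os *: z) i 0 = x i 0 + (-1 * y i 0 + - os * z i 0)
  by rewrite !mxE; ring.
have Et : (fun t => tseries (fun b k => c b k t) p) = fun t => nf_point ls N (cos p) (sin p) t e.
  by apply/funext => s; rewrite nf_pointE.
have E1 : nf_point_dt ls N (cos p) (sin p) t e = tseries (fun b k => derive1 (c b k) t) p.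
  by rewrite -(der1E (der_nf_point_t U_open U_ls nf (cos p) (sin p) t e)) -Et; apply: der1E;
    apply: der_tseries_coef.
have E2 : nf_point_dx ls N (cos p) (sin p) (- sin p) (cos p) t e =
  tseries (fun b k => (tsign R b * k%:R) *: c (~~ b) k t) p.
  rewrite -(der1E (der_nf_point_x ls N t e (is_derive_cos p) (is_derive_sin p))).
  by apply: der1E; exact: zN_der.
by rewrite E1 E2.
Qed.

Lemma mode_source_cont t e i : continuous (fun p => mode_source t p e i).
Proof.
have cM (A : 'M[R]_n) (z dz : R -> 'cV[R]_n) : (forall p : R, is_derive p 1 z (dz p)) ->
  continuous (fun p => (A *m z p) i 0).
  move=> hz; rewrite (_ : (fun p => _) = fun p => \sum_j A i j * z p j 0);
    last by apply/funext => p; rewrite mxE.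
  by apply: cont_sum => j; apply: contZ => p; exact: der_cont (der_entry j 0 (hz p)).
have cN l z dz : (forall p : R, is_derive p 1 z (dz p)) -> continuous (fun p => Gnl (z p) l t e i).
  move=> hz; rewrite (_ : (fun p => _) = fun p => G F C (z p) l t e i 0 + -1 * (cE C l *m z p) i
    0); last first.
    by apply/funext => p; rewrite mulN1r.
  by apply: contD; [exact: cont_G hz|apply: contZ; exact: cM hz].
rewrite (_ : (fun p => _) = fun p => Gnl (zF X t p e) (lambdaF X e) t e i
  + (-1 * Gnl (nf_point ls N (cos p) (sin p) t e) ls t e i
  + (nf_residual F ls os C N t p e i 0 + - e ^+ 2 * (beta_mx *m tseries ycoef p) i 0))); last first.
  by apply/funext => p; rewrite /mode_source tseries_ycoef; ring.
apply: contD; first exact: cN (zF_der t e).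
apply: contD; first by apply: contZ; exact: cN (zN_der t e).
apply: contD; first exact: residual_cont.
by apply: contZ; exact: cM (der_tseries _).
Qed.

(** Difference of the mode equations of z^F and z^N. The linear operator at ([ls], [os]) acts on the
    defect, and the detuning on the coefficients of z^F, split as those of $a^\star$ and the
    rest. *)
Lemma ode_defect e : fourier_solution F C X e -> forall b k (t : R) i, (k < 4)%N ->
  is_derive t 1 (fun t => defect b k t e i 0)
    ((cE C ls *m defect b k t e) i 0 - os * (tsign R b * k%:R * defect (~~ b) k t e i 0)
     + mode_drift b k e i + mode_forcing b k t e i).
Proof.
move=> sol b k t i k4.
have h := derB (ode_F sol b t i k4) (ode_N e b t i k4).
have -> : (fun t => defect b k t e i 0) = fun y => (ycoef b k + Fcoef b k y e) i 0 - (ycoef b k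
  + nfscale k e *: nfcoef b k y) i 0.
  by apply/funext => y; rewrite /defect !mxE; ring.
apply: is_derive_eq h _.
pose zf p := zF X t p e; pose zn p := nf_point ls N (cos p) (sin p) t e; pose l := lambdaF X e.
have E1 : fourier b k (fun p => G F C (zf p) l t e i 0) - fourier b k (fun p =>
  (G F C (zn p) ls t e - nf_residual F ls os C N t p e) i 0) =
  (cE C l *m (ycoef b k + Fcoef b k t e)) i 0 - (cE C ls *m (ycoef b k + nfscale k e *: nfcoef b k
    t)) i 0
  + fourier b k (fun p => mode_source t p e i) + e ^+ 2 * (beta_mx *m ycoef b k) i 0.
  have cM (A : 'M[R]_n) c : continuous (fun p => (A *m tseries c p) i 0).
    rewrite (_ : (fun p => _) = fun p => tseries (fun b k => A *m c b k) p i 0);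
      first exact: tseries_cont.
    by apply/funext => p; rewrite tseries_mulmx.
  have c00 e' : (fun b k => ycoef b k + nfscale k e' *: nfcoef b k t) true 0%N =
    0 by rewrite /ycoef /nfcoef /= scaler0 addr0.
  have c01 : (fun b k => ycoef b k + Fcoef b k t e) true 0%N = 0 by rewrite /ycoef /Fcoef /= addr0.
  have cl := cM (cE C l) (fun b k => ycoef b k + Fcoef b k t e).
  have cs := cM (cE C ls) (fun b k => ycoef b k + nfscale k e *: nfcoef b k t).
  have cb := cM beta_mx ycoef.
  have E : (fun p => G F C (zf p) l t e i 0) =
    fun p => (G F C (zn p) ls t e - nf_residual F ls os C N t p e) i 0 +
     (mode_source t p e i + ((cE C l *m tseries (fun b k => ycoef b k + Fcoef b k t e) p) i 0
       + (-1 * (cE C ls *m tseries (fun b k => ycoef b k + nfscale k e *: nfcoef b k t) p) i 0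
       + e ^+ 2 * (beta_mx *m tseries ycoef p) i 0))).
    apply/funext => p; rewrite /mode_source /Gnl tseries_ycoef -tseries_zF -nf_pointE.
    have -> (a c : 'cV[R]_n) : (a - c) i 0 = a i 0 - c i 0 by rewrite !mxE.
    move: (G _ _ (zF _ _ _ _) _ _ _ i 0) (G _ _ (nf_point _ _ _ _ _ _) _ _ _ i 0)
      ((_ *m zF _ _ _ _) i 0) ((_ *m nf_point _ _ _ _ _ _) i 0)
      (nf_residual _ _ _ _ _ _ _ _ i 0) ((beta_mx *m _) i 0) => x1 x2 x3 x4 x5 x6; ring.
  have csrc : continuous (fun p => mode_source t p e i) by exact: mode_source_cont.
  rewrite E fourierD; last 2 first.
  - rewrite (_ : (fun p => _) = fun p => G F C (zn p) ls t e i 0 + -1 * nf_residual F ls os C N t p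
    e i 0); last first.
      apply/funext => p; have -> (a c : 'cV[R]_n) : (a - c) i 0 = a i 0 - c i 0 by rewrite !mxE.
      by rewrite mulN1r.
    by apply: contD; [exact: cont_G (zN_der t e)|apply: contZ; exact: residual_cont].
  - by apply: contD => //; apply: contD => //; apply: contD; exact: contZ.
  rewrite addrC addKr fourierD//; last by apply: contD => //; apply: contD; exact: contZ.
  set S := fourier b k (fun x => mode_source t x e i).
  rewrite fourierD; [|exact: cl|by apply: contD; exact: contZ].
  rewrite fourierD; [|exact: contZ|exact: contZ].
  rewrite !fourierZ// !fourier_mulmx_tseries//.
  by move: S ((_ *m _) i 0) ((_ *m _) i 0) ((_ *m _) i 0) => S y1 y2 y3; ring.
have aux (x1 x2 z a c : R) : x1 - x2 = z -> x1 - a - (x2 - c) = z - a + c by move=> <-; ring.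
apply: etrans (aux _ _ _ _ _ E1) _; rewrite /mode_drift /mode_forcing -/l /defect.
have ED (a c : 'cV[R]_n) j : (a + c) j 0 = a j 0 + c j 0 by rewrite mxE.
have EN (a : 'cV[R]_n) j : (- a) j 0 = - a j 0 by rewrite !mxE.
have EZ (x : R) (c : 'cV[R]_n) j : (x *: c) j 0 = x * c j 0 by rewrite mxE.
rewrite !mulmxDr !mulmxDl !mulNmx !mulmxN -!scalemxAl -!scalemxAr !ED !EN !EZ.
move: (fourier _ _ _) (tsign _ _) (ycoef _ _ i 0) (Fcoef (~~ b) _ _ _ i 0) (nfcoef (~~ b) _ _ i 0)
  ((_ *m Fcoef _ _ _ _) i 0) ((_ *m Fcoef _ _ _ _) i 0)
  ((_ *m ycoef _ _) i 0) ((_ *m ycoef _ _) i 0) ((_ *m ycoef _ _) i 0) ((_ *m nfcoef _ _ _) i 0) =>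
    *; ring.
Qed.

End mode_equations.

(** * Means over theta *)

Section normalization.
Variables (R : realType) (n : nat).

Definition mean_coef (c : bool -> nat -> R -> 'cV[R]_n) b k : 'cV[R]_n :=
  \col_i period_int (fun t => c b k t i 0).

Lemma period_int_sum k (f : 'I_k -> R -> R) : (forall i, continuous (f i)) ->
  period_int (fun t => \sum_i f i t) = \sum_i period_int (f i).
Proof.
elim: k f => [|k IH] f cf.
  by rewrite big_ord0 (@period_int_ext _ _ (fun=> 0)) ?period_int_cst ?mulr0// => x;
    rewrite big_ord0.
rewrite big_ord_recl -IH// -period_intD//; last exact: cont_sum.
by apply: period_int_ext => x; rewrite big_ord_recl.
Qed.

Lemma period_int_tseries (c : bool -> nat -> R -> 'cV[R]_n) p i :
  (forall b k, (k < 4)%N -> continuous (fun t => c b k t i 0)) ->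
  period_int (fun t => tseries (fun b k => c b k t) p i 0) = tseries (mean_coef c) p i 0.
Proof.
move=> cc; rewrite (@period_int_ext _ _ (fun t => \sum_(k < 4) (trig false k p * c false k t i 0
  + trig true k p * c true k t i 0))); last first.
  by move=> t; rewrite tseries_entry; apply: eq_bigr => k _; ring.
rewrite period_int_sum => [|k]; last by apply: contD; apply: contZ; exact: cc.
rewrite tseries_entry; apply: eq_bigr => k _.
rewrite period_intD; [|by apply: contZ; exact: cc|by apply: contZ; exact: cc].
by rewrite !period_intZ; [rewrite !mxE; ring|exact: cc|exact: cc].
Qed.

End normalization.

(** * Defect and drifts in terms of the forcing *)

Section linear_estimates.
Variables (R : realType) (m : nat) (F : vector_field R m) (ls os : R) (U : set R)
  (C : continuation R m) (N : nf_coeffs R m) (X : fourier_family R m) (Ets : 'M[R]_m).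
Local Notation n := (2 + m)%N.
Hypotheses (F_smooth : smooth_field F) (U_open : open U) (U_ls : U ls) (nf : is_normal_form F U C N)
  (E_ls : cE C ls = Estar os Ets).
Local Notation defect := (defect ls N X).

Lemma Fcoef_der e b k (t : R) i : fourier_solution F C X e -> (k < 4)%N ->
  derivable (fun t => Fcoef X b k t e i 0) t 1 /\ Fcoef X b k (t + 2 * pi) e = Fcoef X b k t e.
Proof.
move=> sol k4; have h : derivable (Fcoef X b k ^~ e) t 1 /\ Fcoef X b k (t + 2 * pi) e =
  Fcoef X b k t e.
  rewrite /Fcoef; case: b; last exact: (four_a sol k4 t).
  by case: k k4 => [|k] k4 /=; [split=> //;
    exact: derivable_cst|exact: (@four_b _ _ _ _ _ _ sol k.+1 k4 t)].
split; last exact: h.2.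
exact: (derivable_mxP _ _ _).1 h.1 i 0.
Qed.

Lemma defect_periodic e b k t : fourier_solution F C X e -> (k < 4)%N -> defect b k (t + 2 * pi) e
  = defect b k t e.
Proof.
move=> sol k4; rewrite /defect; have [_ -> _ _] := per_nfcoef U_open U_ls nf b k4.
by rewrite (Fcoef_der b t (lshift m 0) sol k4).2.
Qed.

Lemma Fcoef_cont e b k i : fourier_solution F C X e -> (k < 4)%N -> continuous (fun t =>
  Fcoef X b k t e i 0).
Proof.
by move=> sol k4 t; apply/differentiable_continuous/derivable1_diffP;
  exact: (Fcoef_der b t i sol k4).1.
Qed.

Lemma nfcoef_cont b k i : (k < 4)%N -> continuous (fun t => nfcoef ls N b k t i 0).
Proof.
move=> k4 t; have [h _ _ _] := per_nfcoef U_open U_ls nf b k4.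
exact: der_cont (der_entry i 0 (h t)).
Qed.

Lemma dot_hat (u v : 'cV[R]_n) (x y : R) : v = col_mx (x *: e1 R + y *: e2 R) 0 ->
  dot u v = u (lshift m 0) 0 * x + u (lshift m 1) 0 * y.
Proof.
move=> ->; rewrite /dot big_split_ord/= [X in _ + X]big1 ?addr0; last by move=> i _;
  rewrite col_mxEd mxE mulr0.
have [h1 h2] := e12_coord x y.
rewrite !big_ord_recl big_ord0 addr0 !col_mxEu.
have l01 : lift ord0 ord0 = 1 :> 'I_2 by exact/val_inj.
by rewrite l01 h1 h2.
Qed.

(** $a^\star$ alone already gives gamma its prescribed value, so the contribution of the remaining
    mode 1 coefficients vanishes. These are the two combinations that resonate. *)
Lemma Fcoef_mean e : fourier_solution F C X e ->
  period_int (fun t => Fcoef X false 1 t e (lshift m 0) 0) + period_int (fun t =>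
    Fcoef X true 1 t e (lshift m 1) 0) = 0 /\
  period_int (fun t => Fcoef X false 1 t e (lshift m 1) 0) - period_int (fun t =>
    Fcoef X true 1 t e (lshift m 0) 0) = 0.
Proof.
move=> sol; pose c b k t := ycoef R m b k + Fcoef X b k t e.
have cc b k i : (k < 4)%N -> continuous (fun t => c b k t i 0).
  move=> k4; rewrite (_ : (fun t => _) = fun t => ycoef R m b k i 0 + Fcoef X b k t e i 0);
    last by apply/funext => t; rewrite mxE.
  by apply: contD; [exact: cst_continuous|exact: Fcoef_cont].
have c0 : mean_coef c true 0%N = 0.
  apply/colP => i; rewrite !mxE (@period_int_ext _ _ (fun=> 0)) ?period_int_cst ?mulr0// => t.
  by rewrite /c /ycoef /Fcoef /= !mxE addr0.
have pi0 : pi != 0 :> R by rewrite lt0r_neq0// pi_gt0.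
have pF (b : bool) i : period_int (fun p => tseries (mean_coef c) p i 0 * trig b 1 p) =
  pi * mean_coef c b 1%N i 0.
  by rewrite -(fourier_tseries b i c0 (isT : 1 < 4)%N) /fourier mulVKf.
have cz i (p : R) : continuous (fun t => tseries (fun b k => c b k t) p i 0).
  rewrite (_ : (fun t => _) = fun t => \sum_(k < 4) (trig false k p * c false k t i 0
    + trig true k p * c true k t i 0)).
    by apply: cont_sum => k; apply: contD; apply: contZ; exact: cc.
  by apply/funext => t; rewrite tseries_entry; apply: eq_bigr => k _; ring.
have inner (x y : R -> R) (v : R -> 'cV[R]_n) : (forall p, v p =
  col_mx (x p *: e1 R + y p *: e2 R) 0) ->
    ip2 (fun t p => zF X t p e) (fun _ p => v p) = (2 * pi) ^- 2 *
      period_int (fun p => tseries (mean_coef c) p (lshift m 0) 0 * x p + tseries (mean_coef c) p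
        (lshift m 1) 0 * y p).
  move=> vE; rewrite /ip2; congr (_ * _); apply: period_int_ext => p.
  rewrite (@period_int_ext _ _ (fun t => x p * tseries (fun b k => c b k t) p (lshift m 0) 0
    + y p * tseries (fun b k => c b k t) p (lshift m 1) 0)).
    rewrite period_intD; [|by apply: contZ; exact: cz|by apply: contZ; exact: cz].
    rewrite !period_intZ; [|exact: cz|exact: cz].
    by rewrite !period_int_tseries; [ring|move=> b k; exact: cc|move=> b k; exact: cc].
  by move=> t; rewrite (dot_hat _ (vE p)) tseries_zF -/(c _ _ _) ![_ * x p]mulrC ![_ * y p]mulrC.
have trig1 (b : bool) (p : R) : trig b 1 p = if b then sin p else cos p by rewrite /trig mul1r.
have ct i (b : bool) : continuous (fun p => tseries (mean_coef c) p i 0 * trig b 1 p).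
  by move=> p; apply: continuousM; [exact: tseries_cont|exact: trig_cont].
have ca : ip2 (fun t p => zF X t p e) (fun _ p => astar m p) =
  (2 * pi) ^- 2 * (pi * (mean_coef c false 1%N (lshift m 0) 0 + mean_coef c true 1%N (lshift m 1)
  0)).
  rewrite (inner cos sin)//; congr (_ * _).
  rewrite (@period_int_ext _ _ (fun p => tseries (mean_coef c) p (lshift m 0) 0 * trig false 1 p
    + tseries (mean_coef c) p (lshift m 1) 0 * trig true 1 p)).
    by rewrite period_intD// !pF mulrDr.
  by move=> p; rewrite !trig1.
have cd : ip2 (fun t p => zF X t p e) (fun _ p => dastar m p) =
  (2 * pi) ^- 2 * (pi * (mean_coef c false 1%N (lshift m 1) 0 - mean_coef c true 1%N (lshift m 0)
  0)).
  rewrite (inner (fun p => - sin p) cos)//; congr (_ * _).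
  rewrite (@period_int_ext _ _ (fun p => tseries (mean_coef c) p (lshift m 1) 0 * trig false 1 p
    + -1 * (tseries (mean_coef c) p (lshift m 0) 0 * trig true 1 p))).
    rewrite period_intD//; last exact: contZ.
    by rewrite period_intZ// !pF; ring.
  by move=> p; rewrite !trig1; ring.
have := four_gamma sol; rewrite /gamma ca cd => h.
have [h1 h2] := e12_coord ((2 * pi) ^- 2 * (pi * (mean_coef c false 1%N (lshift m 0) 0
  + mean_coef c true 1%N (lshift m 1) 0)))
  ((2 * pi) ^- 2 * (pi * (mean_coef c false 1%N (lshift m 1) 0 - mean_coef c true 1%N (lshift m 0)
    0))).
rewrite h in h1 h2.
have mE b i : mean_coef c b 1%N i 0 = 2 * pi * ycoef R m b 1 i 0 + period_int (fun t =>
  Fcoef X b 1 t e i 0).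
  rewrite mxE -period_int_cst -period_intD; [|exact: cst_continuous|exact: Fcoef_cont].
  by apply: period_int_ext => t; rewrite mxE.
have y00 : ycoef R m false 1 (lshift m 0) 0 = 1 by rewrite /ycoef /= col_mxEu mxE.
have y01 : ycoef R m false 1 (lshift m 1) 0 = 0 by rewrite /ycoef /= col_mxEu mxE.
have y10 : ycoef R m true 1 (lshift m 0) 0 = 0 by rewrite /ycoef /= col_mxEu mxE.
have y11 : ycoef R m true 1 (lshift m 1) 0 = 1 by rewrite /ycoef /= col_mxEu mxE.
rewrite !mE y00 y11 mxE/= in h1; rewrite !mE y01 y10 mxE/= in h2.
have pi4 : (4 * pi)^-1 != 0 :> R by rewrite invr_neq0// mulf_neq0.
have aux1 (a b : R) : 1 = (2 * pi) ^- 2 * (pi * (2 * pi * 1 + a + (2 * pi * 1 + b))) -> a + b = 0.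
  have -> : (2 * pi) ^- 2 * (pi * (2 * pi * 1 + a + (2 * pi * 1 + b))) = 1 + (4 * pi)^-1 * (a + b).
    by move: (pi : R) pi0 => x x0; field.
  by move=> /esym/eqP; rewrite -subr_eq0 addrAC subrr add0r mulf_eq0 (negbTE pi4) => /eqP.
have aux2 (a b : R) : 0 = (2 * pi) ^- 2 * (pi * (2 * pi * 0 + a - (2 * pi * 0 + b))) -> a - b = 0.
  have -> : (2 * pi) ^- 2 * (pi * (2 * pi * 0 + a - (2 * pi * 0 + b))) = (4 * pi)^-1 * (a - b).
    by move: (pi : R) pi0 => x x0; field.
  by move=> /esym/eqP; rewrite mulf_eq0 (negbTE pi4) => /eqP.
by split; [exact: aux1|exact: aux2].
Qed.

(** The constraints on the normal form transformation concern the same combinations as [Fcoef_mean],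
    so the defect inherits both. *)
Lemma nfcoef_mean :
  period_int (fun t => nfcoef ls N false 1 t (lshift m 0) 0) + period_int (fun t =>
    nfcoef ls N true 1 t (lshift m 1) 0) = 0 /\
  period_int (fun t => nfcoef ls N false 1 t (lshift m 1) 0) - period_int (fun t =>
    nfcoef ls N true 1 t (lshift m 0) 0) = 0.
Proof.
have pi2 : (2 * pi)^-1 != 0 :> R by rewrite invr_neq0// mulf_neq0// lt0r_neq0// pi_gt0.
have d1 (u : 'cV[R]_2) : dot u (e1 R) = u 0 0.
  by rewrite /dot !big_ord_recl big_ord0 !mxE /= mulr1 mulr0 !addr0.
have d2 (u : 'cV[R]_2) : dot u (e2 R) = u 1 0.
  rewrite /dot !big_ord_recl big_ord0 !mxE /= mulr1 mulr0 !addr0 add0r.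
  by have -> : lift ord0 ord0 = 1 :> 'I_2 by exact/val_inj.
have := nf_norm1 nf U_ls; have := nf_norm2 nf U_ls; rewrite /ip1.
have pe (f g : R -> R) : f =1 g -> period_int f = period_int g by exact: period_int_ext.
rewrite (pe (fun t => dot (ah N 1 t ls) (e2 R)) (fun t => nfcoef ls N false 1 t (lshift m 1) 0));
  last by move=> t; rewrite d2 /nfcoef /nfA col_mxEu.
rewrite (pe (fun t => dot (bh N 1 t ls) (e1 R)) (fun t => nfcoef ls N true 1 t (lshift m 0) 0));
  last by move=> t; rewrite d1 /nfcoef /nfB /= col_mxEu.
rewrite (pe (fun t => dot (ah N 1 t ls) (e1 R)) (fun t => nfcoef ls N false 1 t (lshift m 0) 0));
  last by move=> t; rewrite d1 /nfcoef /nfA col_mxEu.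
rewrite (pe (fun t => dot (bh N 1 t ls) (e2 R)) (fun t => nfcoef ls N true 1 t (lshift m 1) 0));
  last by move=> t; rewrite d2 /nfcoef /nfB /= col_mxEu.
rewrite -mulrBr -mulrDr => /eqP h2 /eqP h1; move: h1 h2.
by rewrite !(mulrI_eq0 _ (mulfI pi2)) => /eqP-> /eqP->.
Qed.

Lemma defect_mean e : fourier_solution F C X e ->
  period_int (fun t => defect false 1 t e (lshift m 0) 0 + defect true 1 t e (lshift m 1) 0) = 0 /\
  period_int (fun t => defect false 1 t e (lshift m 1) 0 - defect true 1 t e (lshift m 0) 0) = 0.
Proof.
move=> sol; have [f1 f2] := Fcoef_mean sol; have [n1 n2] := nfcoef_mean.
have cd b i : continuous (fun t => defect b 1 t e i 0).
  rewrite (_ : (fun t => _) = fun t => Fcoef X b 1 t e i 0 + - e ^+ 2 * nfcoef ls N b 1 t i 0).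
    by apply: contD; [exact: Fcoef_cont|apply: contZ; exact: nfcoef_cont].
  by apply/funext => t; rewrite /defect /nfscale /= !mxE mulNr.
have pd b i : period_int (fun t => defect b 1 t e i 0) = period_int (fun t => Fcoef X b 1 t e i 0)
  - e ^+ 2 * period_int (fun t => nfcoef ls N b 1 t i 0).
  rewrite (@period_int_ext _ _ (fun t => Fcoef X b 1 t e i 0 + - e ^+ 2 * nfcoef ls N b 1 t i 0));
    last first.
    by move=> t; rewrite /defect /nfscale /= !mxE mulNr.
  rewrite period_intD; [|exact: Fcoef_cont|by apply: contZ; exact: nfcoef_cont].
  by rewrite period_intZ ?mulNr//; exact: nfcoef_cont.
split.
  by rewrite period_intD// !pd addrACA f1 -opprD -mulrDr n1 mulr0 subrr.
rewrite (@period_int_ext _ _ (fun t => defect false 1 t e (lshift m 1) 0 + -1 * defect true 1 t e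
  (lshift m 0) 0)); last first.
  by move=> t; rewrite mulN1r.
rewrite period_intD//; last exact: contZ.
rewrite period_intZ// !pd.
have -> : forall a b c d : R, a - e ^+ 2 * b + -1 * (c - e ^+ 2 * d) = (a - c) - e ^+ 2 * (b - d)
  by move=> *; ring.
by rewrite f2 n2 mulr0 subrr.
Qed.

Definition drift_R e : R := alphaR C (lambdaF X e) + e ^+ 2 * betaR N ls.
Definition drift_I e : R := alphaI C (lambdaF X e) - omegaF X e + e ^+ 2 * betaI N ls.

Lemma E_lsE : [/\ alphaR C ls = 0, alphaI C ls = os & cEt C ls = Ets].
Proof.
have := E_ls; rewrite /cE /Estar => /eq_block_mx[h _ _ ->]; split=> //.
  by have /matrixP/(_ 0 0) := h; rewrite !mxE.
by have /matrixP/(_ 1 0) := h; rewrite !mxE.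
Qed.

Lemma cE_hat l c i : (cE C l *m c : 'cV[R]_n) (lshift m i) 0 =
  (rot_scale (alphaR C l) (alphaI C l) *m usubmx c) i 0.
Proof. by rewrite -{1}[c]vsubmxK /cE mul_block_col !mul0mx addr0 add0r col_mxEu. Qed.

Lemma cE_tilde l c i : (cE C l *m c : 'cV[R]_n) (rshift 2 i) 0 = (cEt C l *m dsubmx c) i 0.
Proof. by rewrite -{1}[c]vsubmxK /cE mul_block_col !mul0mx addr0 add0r col_mxEd. Qed.

Lemma rot_scale0 (a b : R) (c : 'cV[R]_2) : (rot_scale a b *m c) 0 0 = a * c 0 0 - b * c 1 0.
Proof.
have l01 : lift ord0 ord0 = 1 :> 'I_2 by exact/val_inj.
by rewrite mxE !big_ord_recl big_ord0 !mxE /= addr0 l01 mulNr.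
Qed.

Lemma rot_scale1 (a b : R) (c : 'cV[R]_2) : (rot_scale a b *m c) 1 0 = b * c 0 0 + a * c 1 0.
Proof.
have l01 : lift ord0 ord0 = 1 :> 'I_2 by exact/val_inj.
by rewrite mxE !big_ord_recl big_ord0 !mxE /= addr0 l01.
Qed.

Lemma drift_mx l e (c : 'cV[R]_n) i : ((cE C l - cE C ls + e ^+ 2 *: beta_mx ls N) *m c) i 0 =
  (cE C l *m c) i 0 - (cE C ls *m c) i 0 + e ^+ 2 * (beta_mx ls N *m c) i 0.
Proof. by rewrite mulmxDl mulmxBl -scalemxAl !mxE. Qed.

Lemma beta_hat (c : 'cV[R]_n) i : (beta_mx ls N *m c) (lshift m i) 0 =
  (rot_scale (betaR N ls) (betaI N ls) *m usubmx c) i 0.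
Proof. by rewrite -{1}[c]vsubmxK /beta_mx mul_block_col !mul0mx !addr0 col_mxEu. Qed.

Lemma beta_tilde (c : 'cV[R]_n) i : (beta_mx ls N *m c) (rshift 2 i) 0 = 0.
Proof. by rewrite -{1}[c]vsubmxK /beta_mx mul_block_col !mul0mx !addr0 col_mxEd mxE. Qed.

Lemma mode_driftE e k : [/\ mode_drift ls os C N X false k e (lshift m 0) =
  (k == 1%N)%:R * drift_R e,
  mode_drift ls os C N X false k e (lshift m 1) = (k == 1%N)%:R * drift_I e,
  mode_drift ls os C N X true k e (lshift m 0) = - ((k == 1%N)%:R * drift_I e) &
  mode_drift ls os C N X true k e (lshift m 1) = (k == 1%N)%:R * drift_R e].
Proof.
have [aR aI _] := E_lsE; rewrite /mode_drift /ycoef /drift_R /drift_I.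
have [->|k1] := eqVneq k 1%N; last first.
  by rewrite !mulmx0 /= !mxE !mulr0 !mul0r !subrr oppr0.
rewrite !drift_mx !cE_hat !beta_hat !col_mxKu !rot_scale0 !rot_scale1 !col_mxEu !mxE aR aI /tsign
  /=.
split; ring.
Qed.

Lemma mode_drift_tilde e b k i : mode_drift ls os C N X b k e (rshift 2 i) = 0.
Proof.
rewrite /mode_drift drift_mx !cE_tilde beta_tilde.
have hd b' : dsubmx (ycoef R m b' k) = 0 by rewrite /ycoef; case: (k == 1%N); case: b';
  rewrite ?col_mxKd ?linear0.
have hy b' : ycoef R m b' k (rshift 2 i) 0 = 0 by have /colP/(_ i) := hd b'; rewrite !mxE.
by rewrite hd !mulmx0 hy mxE !mulr0 subrr addr0 subrr.
Qed.

(** M refers to the forcing of a single mode k. Even and odd modes can therefore be estimated at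
    different orders, and the drifts depend on mode 1 alone. *)
Lemma defect_hat_bound : 0 < os -> os < 2^-1 -> os != 3^-1 -> os != 4^-1 -> exists2 K : R, 0 <= K &
  forall e k M, fourier_solution F C X e -> (k < 4)%N ->
  (forall b t i, `|mode_forcing F ls os C N X b k t e (lshift m i)| <= M) ->
  (forall b t i, `|defect b k t e (lshift m i) 0| <= K * M) /\ (k = 1%N -> `|drift_R e| <=
    K * M /\ `|drift_I e| <= K * M).
Proof.
move=> os0 os12 os3 os4.
have [K hK] := choice (fun k : 'I_4 => let: ex_intro2 K K0 h := mode_hat_bound os0 os12 os3 os4
  (ltn_ord k : (k <= 3)%N) in
  ex_intro (fun K => 0 <= K /\ _) K (conj K0 h)).
exists (\sum_k K k); first by apply: sumr_ge0 => k _; exact: (hK k).1.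
move=> e k M sol k4 hM.
have M0 : 0 <= M := le_trans (normr_ge0 _) (hM false 0 0).
have leK : K (Ordinal k4) * M <= (\sum_k K k) * M.
  by rewrite ler_wpM2r// (bigD1 (Ordinal k4))//= lerDl sumr_ge0// => k' _; exact: (hK k').1.
have [aR aI _] := E_lsE.
have ode b (t : R) i := ode_defect os F_smooth U_open U_ls nf sol b t (lshift m i) k4.
have dsh b t j : usubmx (defect b k t e) j 0 = defect b k t e (lshift m j) 0 by rewrite mxE.
have [D1 D2 D3 D4] := mode_driftE e k.
have per b i t : defect b k (t + 2 * pi) e (lshift m i) 0 = defect b k t e (lshift m i) 0
  by rewrite defect_periodic.
have [|||||h1 h2] := (hK (Ordinal k4)).2 (fun t => defect false k t e (lshift m 0) 0) (fun t =>
  defect false k t e (lshift m 1) 0)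
  (fun t => defect true k t e (lshift m 0) 0) (fun t => defect true k t e (lshift m 1) 0)
  (fun t => mode_forcing F ls os C N X false k t e (lshift m 0)) (fun t =>
    mode_forcing F ls os C N X false k t e (lshift m 1))
  (fun t => mode_forcing F ls os C N X true k t e (lshift m 0)) (fun t =>
    mode_forcing F ls os C N X true k t e (lshift m 1))
  (drift_R e) (drift_I e) M (per false 0) (per false 1) (per true 0) (per true 1) _ _ _ _ _
    (fun t => hM false t 0) (fun t => hM false t 1)
  (fun t => hM true t 0) (fun t => hM true t 1).
- move=> t; apply: is_derive_eq (ode false t 0) _.
  by rewrite cE_hat rot_scale0 !dsh aR aI D1 /tsign /=; ring.
- move=> t; apply: is_derive_eq (ode false t 1) _.
  by rewrite cE_hat rot_scale1 !dsh aR aI D2 /tsign /=; ring.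
- move=> t; apply: is_derive_eq (ode true t 0) _.
  by rewrite cE_hat rot_scale0 !dsh aR aI D3 /tsign /=; ring.
- move=> t; apply: is_derive_eq (ode true t 1) _.
  by rewrite cE_hat rot_scale1 !dsh aR aI D4 /tsign /=; ring.
- by move=> /= k1; rewrite k1; exact: defect_mean.
split=> [b t i|k1]; last by have [q1 q2] := h2 k1; split; apply: le_trans leK.
by have [q1 q2 q3 q4] := h1 t; apply: le_trans leK; case: b; case: (ord2 i) => ->.
Qed.

(** No drift acts on the tilde components. The cosine and sine coefficients of mode k form the
    hyperbolic system coupled with frequency k [os]. *)
Lemma defect_tilde_bound : (forall mu, complex_eigenvalue Ets mu -> complex.Re mu != 0) ->
  exists2 K : R, 0 <= K &
  forall e k M, fourier_solution F C X e -> (k < 4)%N ->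
  (forall b t i, `|mode_forcing F ls os C N X b k t e (rshift 2 i)| <= M) ->
  forall b t i, `|defect b k t e (rshift 2 i) 0| <= K * M.
Proof.
move=> hyp.
have [K hK] := choice (fun k : 'I_4 => let: ex_intro2 K K0 h := hyperbolic_system_bound (k%:R * os)
  hyp in ex_intro (fun K => 0 <= K /\ _) K (conj K0 h)).
exists (\sum_k K k); first by apply: sumr_ge0 => k _; exact: (hK k).1.
move=> e k M sol k4 hM b t i.
have M0 : 0 <= M := le_trans (normr_ge0 _) (hM b t i).
have leK : K (Ordinal k4) * M <= (\sum_k K k) * M.
  by rewrite ler_wpM2r// (bigD1 (Ordinal k4))//= lerDl sumr_ge0// => k' _; exact: (hK k').1.
have [_ _ eT] := E_lsE.
have ode b' (s : R) j := ode_defect os F_smooth U_open U_ls nf sol b' s (rshift 2 j) k4.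
have dE b' j : (fun s => dsubmx (defect b' k s e) j 0) = fun s => defect b' k s e (rshift 2 j) 0
  by apply/funext => s; rewrite mxE.
have [||||||h1 h2] := (hK (Ordinal k4)).2 (fun s => dsubmx (defect false k s e)) (fun s =>
  dsubmx (defect true k s e))
  (fun s => \col_j mode_forcing F ls os C N X false k s e (rshift 2 j)) (fun s =>
    \col_j mode_forcing F ls os C N X true k s e (rshift 2 j)) M _ _ _ _ _ _ t i.
- by move=> s; rewrite defect_periodic.
- by move=> s; rewrite defect_periodic.
- move=> s j; rewrite dE; apply: is_derive_eq (ode false s j) _.
  rewrite cE_tilde mode_drift_tilde eT.
  have -> (x y z : 'cV[R]_m) : (x - (k%:R * os) *: y + z) j 0 = x j 0 - k%:R * os * y j 0 + z j 0
    by rewrite !mxE.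
  by rewrite [dsubmx (defect true _ _ _) j 0]mxE [(\col_j _) j 0]mxE /tsign /=; ring.
- move=> s j; rewrite dE; apply: is_derive_eq (ode true s j) _.
  rewrite cE_tilde mode_drift_tilde eT.
  have -> (x y z : 'cV[R]_m) : (x + (k%:R * os) *: y + z) j 0 = x j 0 + k%:R * os * y j 0 + z j 0
    by rewrite !mxE.
  by rewrite [dsubmx (defect false _ _ _) j 0]mxE [(\col_j _) j 0]mxE /tsign /=; ring.
- by move=> s j; rewrite mxE.
- by move=> s j; rewrite mxE.
rewrite mxE in h1; rewrite mxE in h2.
by apply: le_trans leK; case: b.
Qed.

End linear_estimates.

(** * Bounds for the forcing and bootstrap *)

Section smooth_functions_of_the_parameter.
Variables (R : realType) (U : set R) (ls : R).
Hypotheses (U_open : open U) (U_ls : U ls).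

Lemma near_segment (P : R -> Prop) : (\forall l \near ls, P l) ->
  \forall l \near ls, forall x, Num.min ls l <= x <= Num.max ls l -> P x.
Proof.
move=> /nbhs_ballP[d /= d0 hd]; apply: filterS (near_dist ls (_ : 0 < d / 2));
  last by rewrite divr_gt0.
move=> l hl x hx; apply: hd; rewrite /ball/= distrC.
apply: le_lt_trans (_ : d / 2 < d); last by rewrite ltr_pdivrMr//; lra.
apply: le_trans hl; move: hx => /andP[]; have [h|h] := lerP ls l => h1 h2.
  by rewrite !ger0_norm ?subr_ge0//; lra.
by rewrite !ler0_norm ?subr_le0//; lra.
Qed.

Lemma C1_lipschitz (f : R -> R) : Ck_on 1 U f -> exists2 K, 0 <= K & \forall l \near ls, `|f l
  - f ls| <= K * `|l - ls|.
Proof.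
move=> [h1 h2]; exists (`|'D_1 f ls| + 1); first by rewrite addr_ge0.
have nU : \forall l \near ls, U l by exact: open_nbhs_nbhs.
have nD : \forall l \near ls, `|'D_1 f l| <= `|'D_1 f ls| + 1.
  have /cvgrPdist_le/(_ 1 ltr01) := h2 1 ls U_ls; apply: filterS => l hl.
  have -> : 'D_1 f l = 'D_1 f ls - ('D_1 f ls - 'D_1 f l) by ring.
  by apply: le_trans (ler_normB _ _) _; rewrite lerD2l.
apply: filterS2 (near_segment nU) (near_segment nD) => l hU hD.
apply: (@der_bound R f (fun x => 'D_1 f x)) => x hx; last exact: hD.
by apply: derivableP; apply: diff_derivable; apply: h1; exact: hU.
Qed.

Lemma C2_taylor (f : R -> R) : Ck_on 2 U f -> exists2 K, 0 <= K &
  \forall l \near ls, `|f l - f ls - derive1 f ls * (l - ls)| <= K * `|l - ls| ^+ 2.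
Proof.
move=> [h1 h2]; have [K K0 hK] := C1_lipschitz (h2 1); exists K => //.
have nU : \forall l \near ls, U l by exact: open_nbhs_nbhs.
apply: filterS2 (near_segment nU) (near_segment hK) => l hU hD.
have -> : f l - f ls - derive1 f ls * (l - ls) =
  (f l - derive1 f ls * l) - (f ls - derive1 f ls * ls) by ring.
rewrite expr2 mulrA.
apply: (@der_bound R (fun x => f x - derive1 f ls * x) (fun x => 'D_1 f x - derive1 f ls)) => x hx.
  apply: is_derive_eq (derB _ (derZ (derive1 f ls) (der_id x))) _; last by rewrite mulr1.
  by apply: derivableP; apply: diff_derivable; apply: h1; exact: hU.
rewrite derive1E; apply: le_trans (hD x hx) _; rewrite ler_wpM2l//.
move: hx => /andP[]; have [h|h] := lerP ls l => x1 x2.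
  by rewrite !ger0_norm ?subr_ge0//; lra.
by rewrite !ler0_norm ?subr_le0//; lra.
Qed.

End smooth_functions_of_the_parameter.

Section parity_of_quadratic_forms.
Variables (R : realType) (ls : R) (n : nat).

Lemma hom2_monomials (q : R -> R -> 'cV[R]_n -> R) : hom ls 2 q -> exists c : 'I_n * 'I_n -> R ->
  R -> R,
  (forall jk, lipb ls (c jk)) /\ forall t l x, q t l x = \sum_jk x jk.1 0 * x jk.2 0 * c jk t l.
Proof.
move=> [q1 [h1 qE]]; have [q2 h2] := choice h1.
have h3 (jk : 'I_n * 'I_n) : exists c, lipb ls c /\ forall t l x, q2 jk.1 jk.2 t l x =
  c t l by exact: (h2 jk.1).1.
have [c hc] := choice h3; exists c; split=> [jk|t l x]; first exact: (hc jk).1.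
rewrite qE (eq_bigr (fun j => \sum_k x j 0 * x k 0 * c (j, k) t l)); first by rewrite pair_bigA;
  apply: eq_bigr => -[j k] _.
by move=> j _; rewrite (h2 j).2 mulr_sumr; apply: eq_bigr => k _; rewrite (hc (j, k)).2 mulrA.
Qed.

(* A quadratic form is even, so its values at u and u' differ little when u' is close to -u. *)
Lemma hom2_parity q (rho : R) : hom ls 2 q -> 0 <= rho -> exists2 K, 0 <= K &
  \forall l \near ls, forall t (u u' v v' : 'cV[R]_n) (d1 d2 d3 : R),
  (forall j, `|u j 0| <= rho) -> (forall j, `|u' j 0| <= rho) -> (forall j, `|v j 0| <= rho) ->
    (forall j, `|v' j 0| <= rho) ->
  (forall j, `|v j 0 + v' j 0| <= d1) -> (forall j, `|u j 0 - v j 0| <= d2) ->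
  (forall j, `|u j 0 + u' j 0 - (v j 0 + v' j 0)| <= d3) -> 0 <= d1 -> 0 <= d2 -> 0 <= d3 ->
  `|(q t l u - q t ls v) - (q t l u' - q t ls v')| <= K * (d3 + d1 * d2 + `|l - ls| * d1).
Proof.
move=> /hom2_monomials[c [hc qE]] rho0.
have [Kc hKc] := choice (fun jk => let: ex_intro2 K K0 h := lipb_pos (hc jk) in ex_intro (fun K =>
  0 <= K /\ _) K (conj K0 h)).
exists (\sum_jk Kc jk * (6 * rho + 2)).
  by apply: sumr_ge0 => jk _; rewrite mulr_ge0 ?addr_ge0 ?mulr_ge0//; exact: (hKc jk).1.
have hall := near_fin (fun jk => (hKc jk).2).
apply: filterS hall => l hall t u u' v v' d1 d2 d3 hu hu' hv hv' h1 h2 h3 d10 d20 d30.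
have -> : q t l u - q t ls v - (q t l u' - q t ls v') = \sum_jk
  ((u jk.1 0 * u jk.2 0 - u' jk.1 0 * u' jk.2 0) * c jk t l - (v jk.1 0 * v jk.2 0 - v' jk.1 0 * v'
    jk.2 0) * c jk t ls).
  by rewrite !qE -!sumrB; apply: eq_bigr => jk _; ring.
apply: le_trans (ler_norm_sum _ _ _) _; rewrite mulr_suml; apply: ler_sum => -[j k] _ /=.
have [c1 c2] := hall (j, k) t; have K0 := (hKc (j, k)).1.
pose s i := u i 0 + u' i 0; pose r i := v i 0 + v' i 0.
(* With s = u + u' one has u_j u_k - u'_j u'_k = s_j u_k + u_j s_k - s_j s_k. [Dv] is this
   expression for v and r = v + v', and [DD] is the difference between the two expressions, arranged
   so that each product contains a small factor. *)
pose Dv := r j * v k 0 + v j 0 * r k - r j * r k.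
pose DD := (s j - r j) * u k 0 + r j * (u k 0 - v k 0) + (u j 0 * (s k - r k) + (u j 0 - v j 0) * r
  k)
  - ((s j - r j) * s k + r j * (s k - r k)).
have -> : (u j 0 * u k 0 - u' j 0 * u' k 0) * c (j, k) t l - (v j 0 * v k 0 - v' j 0 * v' k 0) * c
  (j, k) t ls =
  DD * c (j, k) t l + Dv * (c (j, k) t l - c (j, k) t ls) by rewrite /DD /Dv /s /r; ring.
have hs i : `|s i| <= 2 * rho by apply: le_trans (ler_normD _ _) _; have := hu i; have := hu' i;
  lra.
have nM (a b A B : R) : `|a| <= A -> `|b| <= B -> `|a * b| <= A * B by move=> ha hb;
  rewrite normrM; exact: ler_pM.
have bDv : `|Dv| <= 4 * rho * d1.
  have q1 := nM _ _ _ _ (h1 j) (hv k); have q2 := nM _ _ _ _ (hv j) (h1 k).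
  have hr : `|r k| <= 2 * rho by apply: le_trans (ler_normD _ _) _; have := hv k; have := hv' k;
    lra.
  have q3 := nM _ _ _ _ (h1 j) hr.
  apply: le_trans (ler_normB _ _) _; have := ler_normD (r j * v k 0) (v j 0 * r k);
    rewrite -/(r j) -/(r k) in q1 q2 q3; lra.
have bDD : `|DD| <= 6 * rho * d3 + 2 * (d1 * d2).
  have q1 := nM _ _ _ _ (h3 j) (hu k); have q2 := nM _ _ _ _ (h1 j) (h2 k);
    have q3 := nM _ _ _ _ (hu j) (h3 k).
  have q4 := nM _ _ _ _ (h2 j) (h1 k); have q5 := nM _ _ _ _ (h3 j) (hs k).
  have hr : `|r j| <= 2 * rho by apply: le_trans (ler_normD _ _) _; have := hv j; have := hv' j;
    lra.
  have q6 := nM _ _ _ _ hr (h3 k).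
  rewrite -/(s j) -/(s k) -/(r j) -/(r k) in q1 q2 q3 q4 q5 q6.
  apply: le_trans (ler_normB _ _) _.
  have n1 := ler_normD ((s j - r j) * u k 0 + r j * (u k 0 - v k 0)) (u j 0 * (s k - r k)
    + (u j 0 - v j 0) * r k).
  have n2 := ler_normD ((s j - r j) * u k 0) (r j * (u k 0 - v k 0)).
  have n3 := ler_normD (u j 0 * (s k - r k)) ((u j 0 - v j 0) * r k).
  have n4 := ler_normD ((s j - r j) * s k) (r j * (s k - r k)).
  lra.
apply: le_trans (ler_normD _ _) _.
have p1 := nM _ _ _ _ bDD c1; have p2 := nM _ _ _ _ bDv c2.
apply: le_trans (lerD p1 p2) _.
have -> : Kc (j, k) * (6 * rho + 2) * (d3 + d1 * d2 + `|l - ls| * d1) =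
  Kc (j, k) * ((6 * rho + 2) * (d3 + d1 * d2 + `|l - ls| * d1)) by rewrite mulrA.
have -> : (6 * rho * d3 + 2 * (d1 * d2)) * Kc (j, k) + 4 * rho * d1 * (Kc (j, k) * `|l - ls|) =
  Kc (j, k) * (6 * rho * d3 + 2 * (d1 * d2) + 4 * rho * (`|l - ls| * d1)) by ring.
rewrite ler_wpM2l//.
have m1 : 0 <= d1 * d2 by rewrite mulr_ge0.
have m2 : 0 <= `|l - ls| * d1 by rewrite mulr_ge0.
have m3 : 0 <= rho * (d1 * d2) by rewrite mulr_ge0.
have m4 : 0 <= rho * (`|l - ls| * d1) by rewrite mulr_ge0.
have m5 : 0 <= rho * d3 by rewrite mulr_ge0.
move: (`|l - ls| * d1) (d1 * d2) m1 m2 m3 m4 m5 => y x *; lra.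
Qed.

End parity_of_quadratic_forms.

(** The arithmetic of [nonlinear_gap_bound]: a2, a3, a4 stand for the differences of the forms of
    degree 2, 3, 4 and D for the bound common to them. *)
Lemma cubic_bound (R : realType) (g a2 a3 a4 e D K K2 K3 K4 : R) : 0 <= D -> `|e| <= 1 -> 0 <=
  K -> 0 <= K2 -> 0 <= K3 -> 0 <= K4 ->
  `|g - (e * a2 + e ^+ 2 * a3 + e ^+ 3 * a4)| <= K * `|e| ^+ 4 -> `|a2| <= K2 * D -> `|a3| <=
    K3 * D -> `|a4| <= K4 * D ->
  `|g| <= (K + K2 + K3 + K4) * (`|e| * D + `|e| ^+ 4).
Proof.
move=> D0 he K0 K20 K30 K40 lg l2 l3 l4.
have -> : g = (g - (e * a2 + e ^+ 2 * a3 + e ^+ 3 * a4)) + (e * a2 + e ^+ 2 * a3 + e ^+ 3 * a4)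
  by ring.
apply: le_trans (ler_normD _ _) _.
have E1 : `|e * a2| <= `|e| * (K2 * D) by rewrite normrM ler_wpM2l.
have E2 : `|e ^+ 2 * a3| <= `|e| * (K3 * D).
  by rewrite normrM normrX; apply: ler_pM => //; rewrite expr2 ler_piMl.
have E3 : `|e ^+ 3 * a4| <= `|e| * (K4 * D).
  rewrite normrM normrX; apply: ler_pM => //.
  by rewrite exprS ler_piMr// exprn_ile1.
have E4 := ler_normD (e * a2 + e ^+ 2 * a3) (e ^+ 3 * a4);
  have E5 := ler_normD (e * a2) (e ^+ 2 * a3).
have D1 : 0 <= `|e| * D by rewrite mulr_ge0.
have e4 : 0 <= `|e| ^+ 4 by rewrite exprn_ge0.
have m1 : 0 <= K * (`|e| * D) by rewrite mulr_ge0.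
have m2 : 0 <= (K2 + K3 + K4) * `|e| ^+ 4 by rewrite mulr_ge0// !addr_ge0.
move: (`|e| ^+ 4) e4 m2 lg => x4 e4 m2 lg; lra.
Qed.

(** Finitely many constants are summed into one. The predicate H carries hypotheses on the parameter
    that involve e, such as a bound on the defect, so the neighbourhood of 0 is chosen before the
    parameter. *)
Lemma uniform_constant (R : realType) (I : finType) (T : Type) (B : T -> R -> R) (f : I -> T ->
  R -> R) (H : T -> R -> Prop) :
  (forall i, exists2 K, 0 <= K & \forall e \near (0 : R)^', forall u, H u e -> `|f i u e| <=
    K * B u e) ->
  (forall u e, H u e -> 0 <= B u e) ->
  exists2 K, 0 <= K & \forall e \near (0 : R)^', forall i u, H u e -> `|f i u e| <= K * B u e.
Proof.
move=> h B0; have [K hK] := choice (fun i => let: ex_intro2 K K0 h := h i in ex_intro (fun K =>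
  0 <= K /\ _) K (conj K0 h)).
exists (\sum_i K i); first by apply: sumr_ge0 => i _; exact: (hK i).1.
have hall : \forall e \near (0 : R)^', forall i, forall u, H u e -> `|f i u e| <= K i * B u e.
  by apply: filter_forall => i; exact: (hK i).2.
apply: filterS hall => e hall i u hu; apply: le_trans (hall i u hu) _.
by rewrite ler_wpM2r ?B0// (bigD1 i)//= lerDl; apply: sumr_ge0 => j _; exact: (hK j).1.
Qed.

(** * Size of the linear forcing and of the difference of the nonlinear terms *)

Section forcing_bounds.
Variables (R : realType) (m : nat) (F : vector_field R m) (ls os : R)
    (vs : R -> 'cV[R]_(2 + m)) (Ps : R -> 'M[R]_(2 + m)) (Ets : 'M[R]_m)
    (U : set R) (C : continuation R m) (N : nf_coeffs R m)
    (X : fourier_family R m).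
Local Notation n := (2 + m)%N.
Hypotheses (F_smooth : smooth_field F)
    (U_open : open U) (U_ls : U ls)
    (cont : is_continuation F ls os vs Ps Ets U C)
    (nf : is_normal_form F U C N)
    (approx : is_fourier_approx F ls os C X).
Local Notation defect := (defect ls N X).
Local Notation l := (lambdaF X).
Local Notation dl e := (`|lambdaF X e - ls|).
Local Notation dom e := (`|omegaF X e - os|).

Let smooth_v := cont_smooth_v cont.
Let smooth_P := cont_smooth_P cont.
Let floquet := cont_floquet cont.
Let E_ls := cont_E0 cont.

Lemma near_sol : \forall e \near (0 : R)^', fourier_solution F C X e.
Proof. by apply: cvg_within; exact: approx_solution approx. Qed.

Lemma near_lambda (P : R -> Prop) : (\forall x \near ls, P x) -> \forall e \near (0 : R)^', P (l e).
Proof. by move=> h; apply: cvg_within; exact: (approx_lambda approx h). Qed.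

Lemma near_punctured (r : R) : 0 < r -> \forall e \near (0 : R)^', e != 0 /\ `|e| <= r.
Proof.
move=> r0; near=> e; split; near: e; first exact: nbhs_dnbhs_neq.
exact: dnbhs0_le.
Unshelve. all: by end_near. Qed.

(** The sole consequence drawn from the convergence of z^F to $a^\star$: Fourier coefficients are at
    most twice the sup norm. *)
Lemma Fcoef_small (r : R) : 0 < r -> \forall e \near (0 : R)^', forall b k t i, (k < 4)%N ->
  `|Fcoef X b k t e i 0| <= r.
Proof.
move=> r0; have r2 : 0 < r / 2 by rewrite divr_gt0.
have h : \forall e \near (0 : R)^', forall t p, `|zF X t p e - astar m p| < r / 2
  by apply: cvg_within; exact: (approx_z approx r2).
apply: filterS h => e h b k t i k4.
have E p : tseries (fun b k => Fcoef X b k t e) p = zF X t p e - astar m p.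
  by rewrite tseries_zF tseriesD tseries_ycoef /circ -/(astar m p) addrAC subrr add0r.
have c0 : Fcoef X true 0 t e = 0 by [].
rewrite -(@fourier_tseries R n (fun b k => Fcoef X b k t e) b k i c0 k4).
have -> : r = 2 * (r / 2) by field.
apply: fourier_bound; first exact: tseries_cont.
move=> p; rewrite E; apply: le_trans (ltW (h t p)).
rewrite [leRHS]/Num.norm/= mx_normrE.
exact: (@le_bigmax _ _ _ _ (fun ij : 'I_n * 'I_1 => `|(zF X t p e - astar m p) ij.1 ij.2|) (i, 0)).
Qed.

Lemma cE_lipschitz : exists2 K, 0 <= K & \forall e \near (0 : R)^', forall i j,
  `|(cE C (l e) - cE C ls) i j| <= K * dl e.
Proof.
have hT i j : Ck_on 1 U (fun x => cEt C x i j) by apply: C1_entry => //;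
  exact: (cont_smooth_Et cont 1%N).
have [K1 K10 h1] := C1_lipschitz U_open U_ls (cont_smooth_aR cont 1%N).
have [K2 K20 h2] := C1_lipschitz U_open U_ls (cont_smooth_aI cont 1%N).
have [K3 hK3] := choice (fun ij : 'I_m * 'I_m => let: ex_intro2 K K0 h :=
  C1_lipschitz U_open U_ls (hT ij.1 ij.2) in ex_intro (fun K => 0 <= K /\ _) K (conj K0 h)).
have K30 ij : 0 <= K3 ij := (hK3 ij).1.
have S0 : 0 <= \sum_ij K3 ij by rewrite sumr_ge0.
exists (K1 + K2 + \sum_ij K3 ij); first by rewrite !addr_ge0.
have h3 := near_fin (fun ij => (hK3 ij).2).
apply: (near_lambda (P := fun x => forall i j, `|(cE C x - cE C ls) i j| <=
  (K1 + K2 + \sum_ij K3 ij) * `|x - ls|)).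
apply: filterS3 h1 h2 h3 => x h1 h2 h3 i j.
have d0 := normr_ge0 (x - ls).
have le1 (y : R) k : `|y| <= k * `|x - ls| -> 0 <= k -> k <= K1 + K2 + \sum_ij K3 ij -> `|y| <=
  (K1 + K2 + \sum_ij K3 ij) * `|x - ls|.
  by move=> hy k0 hk; apply: le_trans hy _; rewrite ler_wpM2r.
have B (A A' : 'M[R]_2) (D D' : 'M[R]_m) : block_mx A 0 0 D - block_mx A' 0 0 D' =
  block_mx (A - A') 0 0 (D - D').
  by rewrite opp_block_mx add_block_mx !subr0.
rewrite /cE B; case: (split_ordP i) => i' ->; case: (split_ordP j) => j' ->.
- rewrite block_mxEul !mxE; case: (i' == j').
    by apply: (le1 _ K1) => //; lra.
  case: (i' == 0).
    by apply: (le1 _ K2) => //; [rewrite opprK addrC distrC|lra].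
  by apply: (le1 _ K2) => //; lra.
- by rewrite block_mxEur mxE normr0 mulr_ge0// !addr_ge0.
- by rewrite block_mxEdl mxE normr0 mulr_ge0// !addr_ge0.
- rewrite block_mxEdr; apply: (le1 _ (K3 (i', j'))) => //; first by have := h3 (i', j');
  rewrite !mxE.
  apply: le_trans (_ : \sum_ij K3 ij <= _); last by lra.
  by rewrite (bigD1 (i', j'))//= lerDl sumr_ge0.
Qed.

Definition detuning e := dl e + dom e.

Lemma detuning_ge0 e : 0 <= detuning e. Proof. by rewrite addr_ge0. Qed.

Definition linear_forcing b k t e i : R :=
  ((cE C (l e) - cE C ls) *m Fcoef X b k t e) i 0 - (omegaF X e - os) * (tsign R b * k%:R * Fcoef X
    (~~ b) k t e i 0).

(** A product of two small quantities. Phi is left free because it improves in each round: an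
    arbitrary constant, then O(e), then O(e^2) for the odd modes. *)
Lemma linear_forcing_bound : exists2 K, 0 <= K & \forall e \near (0 : R)^', forall b k t (Phi : R)
  i, (k < 4)%N ->
  (forall b j, `|Fcoef X b k t e j 0| <= Phi) -> `|linear_forcing b k t e i| <=
    K * (detuning e * Phi).
Proof.
have [K K0 hK] := cE_lipschitz; exists (n%:R * K + 3); first by rewrite addr_ge0// mulr_ge0.
apply: filterS hK => e hK b k t Phi i k4 hPhi.
have Phi0 : 0 <= Phi := le_trans (normr_ge0 _) (hPhi b i).
have dl0 : 0 <= dl e by []. have dom0 : 0 <= dom e by [].
apply: le_trans (ler_normB _ _) _; rewrite [leRHS]mulrDl; apply: lerD.
  rewrite mxE; apply: le_trans (ler_norm_sum _ _ _) _.
  apply: le_trans (_ : \sum_(j < n) K * detuning e * Phi <= _).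
    apply: ler_sum => j _; rewrite normrM; apply: ler_pM => //.
    by apply: le_trans (hK i j) _; rewrite ler_wpM2l// /detuning lerDl.
  by rewrite sumr_const card_ord -[leLHS]mulr_natl !mulrA lexx.
rewrite !normrM.
have -> : `|tsign R b| = 1 by rewrite /tsign; case: b; rewrite ?normrN normr1.
rewrite mul1r (ger0_norm (ler0n _ k)).
apply: le_trans (_ : dom e * (3 * Phi) <= _).
  rewrite ler_wpM2l//; apply: ler_pM => //; by rewrite ler_nat.
rewrite mulrCA; rewrite ler_wpM2l// ler_wpM2r// /detuning; lra.
Qed.

Definition nonlinear_gap t p e i : R :=
  Gnl F C (zF X t p e) (l e) t e i - Gnl F C (nf_point ls N (cos p) (sin p) t e) ls t e i.

Lemma ycoef_le1 b k i : `|ycoef R m b k i 0| <= 1.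
Proof.
have h01 (q : bool) : `|q%:R| <= 1 :> R by case: q; rewrite ?normr1 ?normr0.
rewrite /ycoef; case: (k == 1%N); last by rewrite mxE normr0.
case: b; case: (split_ordP i) => j ->; rewrite ?col_mxEu ?col_mxEd mxE ?normr0//.
Qed.

Lemma zF_bounded : exists2 rho, 0 <= rho & \forall e \near (0 : R)^', forall t p i,
  `|zF X t p e i 0| <= rho /\ `|nf_point ls N (cos p) (sin p) t e i 0| <= rho.
Proof.
have [K K0 hK] := nf_point_bounded U_open U_ls nf; exists (K + 16); first by rewrite addr_ge0.
apply: filterS2 (near_punctured ltr01) (Fcoef_small ltr01) => e [e0 he] hF t p i; split; last first.
  by apply: le_trans (hK t p e i he) _; rewrite lerDl.
rewrite tseries_zF; apply: le_trans (tseries_bound (W := 2) (i := i) p _) _; last first.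
  have -> : 8 * 2 = 16 :> R by ring.
  by rewrite lerDr.
move=> b k k4; rewrite mxE; apply: le_trans (ler_normD _ _) _.
have -> : 2 = 1 + 1 :> R by ring.
by apply: lerD; [exact: ycoef_le1|exact: hF].
Qed.

Lemma zF_sub t p e : zF X t p e - nf_point ls N (cos p) (sin p) t e =
  tseries (fun b k => defect b k t e) p.
Proof.
rewrite tseries_zF nf_pointE -tseriesB; congr tseries.
by apply/funext => b; apply/funext => k; rewrite opprD addrACA subrr add0r.
Qed.

Let q i k := taylor_coefficient F C i k.

Let hom_q i k : hom ls k (q i k).
Proof. exact: (hom_taylor_coefficient F_smooth U_open U_ls smooth_v smooth_P floquet). Qed.

(** The linear parts are removed in [Gnl], so only forms of degree 2 to 4 remain; the expansion of
    [G] is used at [l e] for z^F and at [ls] for z^N. *)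
Lemma gap_expansion i : exists2 K, 0 <= K & \forall e \near (0 : R)^', forall t p,
  `|nonlinear_gap t p e i - (e * (q i 2 t (l e) (zF X t p e) - q i 2 t ls (nf_point ls N (cos p)
    (sin p) t e))
    + e ^+ 2 * (q i 3 t (l e) (zF X t p e) - q i 3 t ls (nf_point ls N (cos p) (sin p) t e))
    + e ^+ 3 * (q i 4 t (l e) (zF X t p e) - q i 4 t ls (nf_point ls N (cos p) (sin p) t e)))| <=
      K * `|e| ^+ 4.
Proof.
have [rho rho0 hrho] := zF_bounded.
have [K K0 hK] := G_expansion F_smooth U_open U_ls smooth_v smooth_P floquet i rho0.
exists (K + K); first by rewrite addr_ge0.
have hK0 := nbhs_singleton hK.
apply: filterS3 hrho (near_lambda hK) (near_punctured ltr01) => e hb hKl [e0 he] t p.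
have h1 := hKl t (zF X t p e) e (fun j => (hb t p j).1) e0 he.
have h2 := hK0 t (nf_point ls N (cos p) (sin p) t e) e (fun j => (hb t p j).2) e0 he.
rewrite /nonlinear_gap /Gnl mulrDl.
apply: le_trans (lerD h1 h2); apply: le_trans (ler_normB _ _); rewrite le_eqVlt; apply/orP; left;
  apply/eqP; congr `|_|.
rewrite /q; move: (taylor_coefficient _ _ _ 2 _ _ _) (taylor_coefficient _ _ _ 2 _ _ _)
  (taylor_coefficient _ _ _ 3 _ _ _)
  (taylor_coefficient _ _ _ 3 _ _ _) (taylor_coefficient _ _ _ 4 _ _ _) (taylor_coefficient _ _ _ 4
    _ _ _)
  (G _ _ _ _ _ _ i 0) (G _ _ _ _ _ _ i 0) ((_ *m _) i 0) ((_ *m _) i 0) => *; ring.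
Qed.

Let defect_le (W : R) t e := forall b k j, (k < 4)%N -> `|defect b k t e j 0| <= W.

Lemma form_gap i k : exists2 K, 0 <= K & \forall e \near (0 : R)^', forall t p W, defect_le W t e ->
  `|q i k t (l e) (zF X t p e) - q i k t ls (nf_point ls N (cos p) (sin p) t e)| <= K * (W + dl e).
Proof.
have [rho rho0 hrho] := zF_bounded.
have [K K0 hK] := hom_bounds (hom_q i k) rho0.
exists (K * 8); first by rewrite mulr_ge0.
apply: filterS2 hrho (near_lambda hK) => e hb hKl t p W hW.
have W0 : 0 <= W := le_trans (normr_ge0 _) (hW false 0%N (lshift m 0) isT).
have hd j : `|zF X t p e j 0 - nf_point ls N (cos p) (sin p) t e j 0| <= 8 * W.
  have -> : zF X t p e j 0 - nf_point ls N (cos p) (sin p) t e j 0 =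
    (zF X t p e - nf_point ls N (cos p) (sin p) t e) j 0 by rewrite !mxE.
  by rewrite zF_sub; apply: tseries_bound => b k' k4; exact: hW.
have W8 : 0 <= 8 * W by rewrite mulr_ge0.
have [_ h1 _] := hKl t (zF X t p e) (nf_point ls N (cos p) (sin p) t e) (8 * W) (fun j =>
  (hb t p j).1) (fun j => (hb t p j).2) hd W8.
have [_ _ h2] := hKl t (nf_point ls N (cos p) (sin p) t e) (nf_point ls N (cos p) (sin p) t e) 0
  (fun j => (hb t p j).2) (fun j => (hb t p j).2)
  (fun j => ltac:(by rewrite subrr normr0)) (lexx 0).
set z := zF X t p e in h1 *; set y := nf_point ls N (cos p) (sin p) t e in h1 h2 *.
have -> : q i k t (l e) z - q i k t ls y = (q i k t (l e) z - q i k t (l e) y) + (q i k t (l e) y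
  - q i k t ls y) by ring.
apply: le_trans (ler_normD _ _) _; apply: le_trans (lerD h1 h2) _.
have : 0 <= K * dl e by rewrite mulr_ge0.
move: (dl e) => D hD; have : 0 <= K * W by rewrite mulr_ge0.
lra.
Qed.

(** u packs t, p and a bound W of the defect at t. Each form differs by O(W + |l - ls|) and carries
    a factor e at least. *)
Lemma nonlinear_gap_bound : exists2 K, 0 <= K & \forall e \near (0 : R)^',
  forall i (u : R * R * R), defect_le u.2 u.1.1 e ->
  `|nonlinear_gap u.1.1 u.1.2 e i| <= K * (`|e| * (u.2 + dl e) + `|e| ^+ 4).
Proof.
apply: (@uniform_constant R 'I_n (R * R * R)%type (fun u e => `|e| * (u.2 + dl e) + `|e| ^+ 4)
  (fun i u e => nonlinear_gap u.1.1 u.1.2 e i)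
  (fun u e => defect_le u.2 u.1.1 e)); last first.
  move=> u e hu; have W0 : 0 <= u.2 := le_trans (normr_ge0 _) (hu false 0%N (lshift m 0) isT).
  by rewrite addr_ge0 ?mulr_ge0 ?addr_ge0.
move=> i; have [K K0 hK] := gap_expansion i; have [K2 K20 h2] := form_gap i 2.
have [K3 K30 h3] := form_gap i 3; have [K4 K40 h4] := form_gap i 4.
exists (K + K2 + K3 + K4); first by rewrite !addr_ge0.
have FF : Filter (nbhs (0 : R)^') by exact: dnbhs_filter.
have h34 := @filterI _ _ FF _ _ h3 h4; have hK2 := @filterI _ _ FF _ _ hK h2.
apply: filterS3 hK2 h34 (near_punctured ltr01) => e [{}hK {}h2] [{}h3 {}h4] [e0 he] [[t p] W] /= hW.
have W0 : 0 <= W := le_trans (normr_ge0 _) (hW false 0%N (lshift m 0) isT).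
have X0 : 0 <= W + dl e by rewrite addr_ge0.
exact: cubic_bound X0 he K0 K20 K30 K40 (hK t p) (h2 t p W hW) (h3 t p W hW) (h4 t p W hW).
Qed.

End forcing_bounds.

(** The arithmetic of [gap_parity]: B is the improved bound for the parity difference of the
    quadratic terms, and D the bound for the terms of degree 3 and 4, for which no parity is
    used. *)
Lemma odd_cubic_bound (R : realType) (g g' a2 a2' a3 a3' a4 a4' e D B K K2 K3 K4 : R) : 0 <=
  D -> `|e| <= 1 -> 0 <= K3 -> 0 <= K4 ->
  `|g - (e * a2 + e ^+ 2 * a3 + e ^+ 3 * a4)| <= K * `|e| ^+ 4 -> `|g' - (e * a2' + e ^+ 2 * a3'
    + e ^+ 3 * a4')| <= K * `|e| ^+ 4 ->
  `|a2 - a2'| <= K2 * B -> `|a3| <= K3 * D -> `|a3'| <= K3 * D -> `|a4| <= K4 * D -> `|a4'| <=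
    K4 * D ->
  `|g - g'| <= 2 * K * `|e| ^+ 4 + K2 * (`|e| * B) + 2 * (K3 + K4) * (`|e| ^+ 2 * D).
Proof.
move=> D0 he K30 K40 lg lg' l2 l3 l3' l4 l4'.
have nM (a b A B' : R) : `|a| <= A -> `|b| <= B' -> `|a * b| <= A * B' by move=> ha hb;
  rewrite normrM; exact: ler_pM.
have h3 : `|a3 - a3'| <= 2 * (K3 * D) by apply: le_trans (ler_normB _ _) _; lra.
have h4 : `|a4 - a4'| <= 2 * (K4 * D) by apply: le_trans (ler_normB _ _) _; lra.
have E2 := nM _ _ _ _ (lexx `|e|) l2.
have E3 : `|e ^+ 2 * (a3 - a3')| <= `|e| ^+ 2 * (2 * (K3 * D)) by apply: nM => //; rewrite normrX.
have E4 : `|e ^+ 3 * (a4 - a4')| <= `|e| ^+ 2 * (2 * (K4 * D)).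
  by apply: nM => //; rewrite normrX exprSr ler_piMr// exprn_ge0.
have -> : g - g' = (g - (e * a2 + e ^+ 2 * a3 + e ^+ 3 * a4)) - (g' - (e * a2' + e ^+ 2 * a3'
  + e ^+ 3 * a4'))
  + (e * (a2 - a2') + e ^+ 2 * (a3 - a3') + e ^+ 3 * (a4 - a4')) by ring.
apply: le_trans (ler_normD _ _) _.
have E5 := ler_normB (g - (e * a2 + e ^+ 2 * a3 + e ^+ 3 * a4)) (g' - (e * a2' + e ^+ 2 * a3'
  + e ^+ 3 * a4')).
have E6 := ler_normD (e * (a2 - a2') + e ^+ 2 * (a3 - a3')) (e ^+ 3 * (a4 - a4')).
have E7 := ler_normD (e * (a2 - a2')) (e ^+ 2 * (a3 - a3')).
lra.
Qed.

Section source_bounds.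
Variables (R : realType) (m : nat) (F : vector_field R m) (ls os : R)
    (vs : R -> 'cV[R]_(2 + m)) (Ps : R -> 'M[R]_(2 + m)) (Ets : 'M[R]_m)
    (U : set R) (C : continuation R m) (N : nf_coeffs R m)
    (X : fourier_family R m).
Local Notation n := (2 + m)%N.
Hypotheses (F_smooth : smooth_field F)
    (U_open : open U) (U_ls : U ls)
    (cont : is_continuation F ls os vs Ps Ets U C)
    (nf : is_normal_form F U C N)
    (approx : is_fourier_approx F ls os C X).
Local Notation defect := (defect ls N X).
Local Notation l := (lambdaF X).
Local Notation dl e := (`|lambdaF X e - ls|).
Local Notation gap := (nonlinear_gap F ls C N X).
Local Notation zN t p e := (nf_point ls N (cos p) (sin p) t e).

Let smooth_v := cont_smooth_v cont.
Let smooth_P := cont_smooth_P cont.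
Let floquet := cont_floquet cont.
Let E_ls := cont_E0 cont.

Lemma nfcoef_bounded : exists2 K, 0 <= K & forall b k t i, (k < 4)%N -> `|nfcoef ls N b k t i 0| <=
  K.
Proof.
have h (x : bool * 'I_4 * 'I_n) : exists K : R, 0 <= K /\ forall t, `|nfcoef ls N x.1.1 x.1.2 t x.2
  0| <= K.
  have [_ _ h _] := per_nfcoef U_open U_ls nf x.1.1 (ltn_ord x.1.2); have [K hK] := h x.2.
  by exists K; split=> //; exact: le_trans (normr_ge0 _) (hK 0).
have [K hK] := choice h; exists (\sum_x K x); first by apply: sumr_ge0 => x _; exact: (hK x).1.
move=> b k t i k4; apply: le_trans ((hK (b, Ordinal k4, i)).2 t) _.
by rewrite (bigD1 (b, Ordinal k4, i))//= lerDl; apply: sumr_ge0 => x _; exact: (hK x).1.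
Qed.

(** Under a half-turn the odd modes cancel, $a^\star$ among them, and the even ones carry a factor
    e. *)
Lemma zN_even_bound : exists2 K, 0 <= K & forall t p (e : R) j, `|zN t p e j 0 + zN t (p + pi) e j
  0| <= K * `|e|.
Proof.
have [K K0 hK] := nfcoef_bounded; exists (8 * K); first by rewrite mulr_ge0.
move=> t p e j; rewrite !nf_pointE -mulrA; apply: tseries_even_bound => b k k4 ok.
rewrite /nfscale (negbTE ok) !mxE mulrC.
have -> : ycoef R m b k j 0 = 0 by rewrite /ycoef; case: eqP ok => [->//|_ _]; rewrite mxE.
by rewrite add0r normrM mulrC [leRHS]mulrC; rewrite ler_wpM2l//; exact: hK.
Qed.

Let defect_le (W : R) t e := forall b k j, (k < 4)%N -> `|defect b k t e j 0| <= W.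
Let even_defect_le (W : R) t e := forall b k j, (k < 4)%N -> ~~ odd k -> `|defect b k t e j 0| <= W.

Let q i k := taylor_coefficient F C i k.

(** [hom2_parity] with z^F and z^N at p and p + pi: the half-turn sum of z^N is O(e), z^F - z^N is
    O(W), and the half-turn sum of the latter is O(We), since only even modes survive in it. *)
Lemma quadratic_gap_parity i : exists2 K, 0 <= K & \forall e \near (0 : R)^', forall t p W We,
  defect_le W t e -> even_defect_le We t e ->
  `|(q i 2 t (l e) (zF X t p e) - q i 2 t ls (zN t p e)) - (q i 2 t (l e) (zF X t (p + pi) e)
    - q i 2 t ls (zN t (p + pi) e))|
    <= K * (We + `|e| * (W + dl e)).
Proof.
have [rho rho0 hrho] := zF_bounded U_open U_ls nf approx.
have hq2 : hom ls 2 (q i 2) by exact: (hom_taylor_coefficient F_smooth U_open U_ls smooth_v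
  smooth_P floquet).
have [K K0 hK] := hom2_parity hq2 rho0; have [Kz Kz0 hKz] := zN_even_bound.
exists (K * (8 + 8 * Kz)); first by rewrite mulr_ge0// addr_ge0// mulr_ge0.
apply: filterS2 hrho (near_lambda approx hK) => e hb hKl t p W We hW hWe.
have W0 : 0 <= W := le_trans (normr_ge0 _) (hW false 0%N (lshift m 0) isT).
have We0 : 0 <= We := le_trans (normr_ge0 _) (hWe false 0%N (lshift m 0) isT isT).
have sub p' j : zF X t p' e j 0 - zN t p' e j 0 = tseries (fun b k => defect b k t e) p' j 0.
  by rewrite -zF_sub !mxE.
have hd j : `|zF X t p e j 0 - zN t p e j 0| <= 8 * W by rewrite sub;
  apply: tseries_bound => b k k4; exact: hW.
have hs j : `|zF X t p e j 0 + zF X t (p + pi) e j 0 - (zN t p e j 0 + zN t (p + pi) e j 0)| <=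
  8 * We.
  rewrite opprD addrACA !sub; apply: tseries_even_bound => b k k4 ok; exact: hWe.
have W8 : 0 <= 8 * W by rewrite mulr_ge0.
have We8 : 0 <= 8 * We by rewrite mulr_ge0.
have Ke : 0 <= Kz * `|e| by rewrite mulr_ge0.
apply: le_trans (hKl t _ _ _ _ _ _ _ (fun j => (hb t p j).1) (fun j => (hb t (p + pi) j).1)
  (fun j => (hb t p j).2) (fun j => (hb t (p + pi) j).2)
  (hKz t p e) hd hs Ke W8 We8) _.
rewrite -[leRHS]mulrA ler_wpM2l//.
have D0 : 0 <= dl e by []; have e0 : 0 <= `|e| by [].
move: (dl e) (`|e|) D0 e0 => D x D0 x0.
have m1 : 0 <= Kz * We by rewrite mulr_ge0. have m2 : 0 <=
  x * W by rewrite mulr_ge0. have m3 : 0 <= x * D by rewrite mulr_ge0.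
have m4 : 0 <= Kz * (x * D) by rewrite mulr_ge0. have m5 : 0 <= Kz * (x * W) by rewrite mulr_ge0.
lra.
Qed.

(** u packs t, p, W and the bound We for the even modes. The quadratic terms gain from the parity;
    those of degree 3 and 4 already carry e^2. *)
Lemma gap_parity : exists2 K, 0 <= K & \forall e \near (0 : R)^', forall i (u : R * R * R * R),
  defect_le u.1.2 u.1.1.1 e /\ even_defect_le u.2 u.1.1.1 e ->
  `|gap u.1.1.1 u.1.1.2 e i - gap u.1.1.1 (u.1.1.2 + pi) e i| <=
    K * (`|e| * u.2 + `|e| ^+ 2 * (u.1.2 + dl e) + `|e| ^+ 4).
Proof.
apply: (@uniform_constant R 'I_n (R * R * R * R)%type (fun u e => `|e| * u.2 + `|e| ^+ 2 * (u.1.2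
  + dl e) + `|e| ^+ 4)
  (fun i u e => gap u.1.1.1 u.1.1.2 e i - gap u.1.1.1 (u.1.1.2 + pi) e i) (fun u e =>
    defect_le u.1.2 u.1.1.1 e /\ even_defect_le u.2 u.1.1.1 e)); last first.
  move=> u e [hu hu']; have W0 : 0 <= u.1.2 := le_trans (normr_ge0 _) (hu false 0%N (lshift m 0)
    isT).
  have W0' : 0 <= u.2 := le_trans (normr_ge0 _) (hu' false 0%N (lshift m 0) isT isT).
  by rewrite !addr_ge0 ?mulr_ge0 ?addr_ge0.
move=> i; have [K K0 hK] := gap_expansion F_smooth U_open U_ls cont nf approx i;
  have [K2 K20 h2] := quadratic_gap_parity i.
have [K3 K30 h3] := form_gap F_smooth U_open U_ls cont nf approx i 3;
  have [K4 K40 h4] := form_gap F_smooth U_open U_ls cont nf approx i 4.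
exists (2 * K + K2 + 2 * (K3 + K4)); first by rewrite !addr_ge0 ?mulr_ge0 ?addr_ge0.
have FF : Filter (nbhs (0 : R)^') by exact: dnbhs_filter.
have h34 := @filterI _ _ FF _ _ h3 h4; have hK2 := @filterI _ _ FF _ _ hK h2.
apply: filterS3 hK2 h34 (near_punctured ltr01) => e [{}hK {}h2] [{}h3 {}h4] [e0 he] [[[t p] W] We]
  /= [hW hWe].
have W0 : 0 <= W := le_trans (normr_ge0 _) (hW false 0%N (lshift m 0) isT).
have We0 : 0 <= We := le_trans (normr_ge0 _) (hWe false 0%N (lshift m 0) isT isT).
have X0 : 0 <= W + dl e by rewrite addr_ge0.
apply: le_trans (odd_cubic_bound X0 he K30 K40 (hK t p) (hK t (p + pi)) (h2 t p W We hW hWe)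
  (h3 t p W hW) (h3 t (p + pi) W hW) (h4 t p W hW) (h4 t (p + pi) W hW)) _.
move: (W + dl e) X0 => D X0.
have e1 : 0 <= `|e| by [].
have m1 : 0 <= `|e| * We by rewrite mulr_ge0. have m2 : 0 <= `|e| ^+ 2 * D by rewrite mulr_ge0.
have m3 : 0 <= `|e| ^+ 4 by rewrite exprn_ge0.
have -> : `|e| * (We + `|e| * D) = `|e| * We + `|e| ^+ 2 * D by ring.
move: (`|e| * We) (`|e| ^+ 2 * D) (`|e| ^+ 4) m1 m2 m3 => x y z x0 y0 z0; nra.
Qed.

Local Notation source := (mode_source F ls os C N X).

Lemma source_hat t p e i : source t p e (lshift m i) = gap t p e (lshift m i) + res_hat F ls os C N
  t p e i.
Proof. by rewrite /mode_source beta_hat col_mxKu. Qed.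

Lemma source_tilde t p e i : source t p e (rshift 2 i) = gap t p e (rshift 2 i) + nf_residual F ls
  os C N t p e (rshift 2 i) 0.
Proof. by rewrite /mode_source beta_tilde mulr0 subr0. Qed.

Lemma tseries_2pi c p : tseries c (p + 2 * pi) = tseries c p :> 'cV[R]_n.
Proof. by apply: eq_bigr => k _; rewrite !trig_2pi. Qed.

Lemma source_2pi t p e i : source t (p + 2 * pi) e i = source t p e i.
Proof.
have pp : p + 2 * pi = p + pi + pi by rewrite mulr_natl mulr2n addrA.
rewrite /mode_source !nf_pointE !tseries_zF !tseries_2pi -!tseries_ycoef tseries_2pi.
by rewrite pp !residual_pi !opprK.
Qed.

End source_bounds.

Section mode_forcing_bounds.
Variables (R : realType) (m : nat) (F : vector_field R m) (ls os : R)
    (vs : R -> 'cV[R]_(2 + m)) (Ps : R -> 'M[R]_(2 + m)) (Ets : 'M[R]_m)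
    (U : set R) (C : continuation R m) (N : nf_coeffs R m)
    (X : fourier_family R m).
Local Notation n := (2 + m)%N.
Hypotheses (F_smooth : smooth_field F)
    (U_open : open U) (U_ls : U ls)
    (cont : is_continuation F ls os vs Ps Ets U C)
    (nf : is_normal_form F U C N)
    (approx : is_fourier_approx F ls os C X).
Local Notation defect := (defect ls N X).
Local Notation gap := (nonlinear_gap F ls C N X).
Local Notation source := (mode_source F ls os C N X).
Local Notation forcing := (mode_forcing F ls os C N X).
Local Notation A e := (detuning ls os X e).

Let smooth_v := cont_smooth_v cont.
Let smooth_P := cont_smooth_P cont.
Let floquet := cont_floquet cont.
Let E_ls := cont_E0 cont.

Definition defect_le (W e : R) := forall b k t i, (k < 4)%N -> `|defect b k t e i 0| <= W.
Definition even_defect_le (W e : R) := forall b k t i, (k < 4)%N -> ~~ odd k ->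
  `|defect b k t e i 0| <= W.

Lemma defect_le_ge0 W e : defect_le W e -> 0 <= W.
Proof. by move=> h; exact: le_trans (normr_ge0 _) (h false 0%N 0 (lshift m 0) isT). Qed.

Lemma even_defect_le_ge0 W e : even_defect_le W e -> 0 <= W.
Proof. by move=> h; exact: le_trans (normr_ge0 _) (h false 0%N 0 (lshift m 0) isT isT). Qed.

Let detuning_dl e : `|lambdaF X e - ls| <= A e. Proof. by rewrite /detuning lerDl. Qed.

Let gap_le : exists2 K, 0 <= K & \forall e \near (0 : R)^', forall W t p i, defect_le W e ->
  `|gap t p e i| <= K * (`|e| * (W + A e) + `|e| ^+ 4).
Proof.
have [K K0 hK] := nonlinear_gap_bound F_smooth U_open U_ls cont nf approx; exists K => //.
apply: filterS hK => e hK W t p i hW.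
apply: le_trans (hK i (t, p, W) (fun b k j => hW b k t j)) _;
  rewrite ler_wpM2l// lerD2r ler_wpM2l// lerD2l.
exact: detuning_dl.
Qed.

Let gap_parity_le : exists2 K, 0 <= K & \forall e \near (0 : R)^', forall W We t p i,
  defect_le W e -> even_defect_le We e ->
  `|gap t p e i - gap t (p + pi) e i| <= K * (`|e| * We + `|e| ^+ 2 * (W + A e) + `|e| ^+ 4).
Proof.
have [K K0 hK] := gap_parity F_smooth U_open U_ls cont nf approx; exists K => //.
apply: filterS hK => e hK W We t p i hW hWe.
apply: le_trans (hK i (t, p, W, We) (conj (fun b k j => hW b k t j) (fun b k j => hWe b k t j))) _.
rewrite ler_wpM2l// lerD2r lerD2l ler_wpM2l ?exprn_ge0// lerD2l; exact: detuning_dl.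
Qed.

Let fourier_source b k t e i M : (forall p, `|source t p e i| <= M) -> `|fourier b k (fun p =>
  source t p e i)| <= 2 * M.
Proof. move=> hM; apply: fourier_bound => //;
  exact: (mode_source_cont F_smooth U_open U_ls nf). Qed.

Let fourier_source_parity b k t e i M : (forall p, `|source t p e i + (-1) ^+ k * source t (p + pi)
  e i| <= M) ->
  `|fourier b k (fun p => source t p e i)| <= M.
Proof.
move=> hM; apply: fourier_parity_bound => //;
  first exact: (mode_source_cont F_smooth U_open U_ls nf).
move=> p; exact: source_2pi.
Qed.

(** The first two estimates use sizes only. The last two use the half-turn: in even modes the e^2 of
    the tilde residual drops out, and in odd modes the e^3 of the hat residual does, while the
    quadratic interaction is reduced to the even part We of the defect and to terms of order e^2. *)
Lemma forcing_bound : exists2 K, 0 <= K & \forall e \near (0 : R)^', forall W We Phi k t b,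
  (k < 4)%N ->
  defect_le W e -> even_defect_le We e -> (forall b j, `|Fcoef X b k t e j 0| <= Phi) ->
  [/\ forall i, `|forcing b k t e (lshift m i)| <= K * (A e * Phi + `|e| * (W + A e) + `|e| ^+ 3),
      forall i, `|forcing b k t e (rshift 2 i)| <= K * (A e * Phi + `|e| * (W + A e) + `|e| ^+ 2),
      ~~ odd k -> forall i, `|forcing b k t e (rshift 2 i)| <=
        K * (A e * Phi + `|e| * (W + A e) + `|e| ^+ 3) &
      odd k -> forall i, `|forcing b k t e (lshift m i)| <=
        K * (A e * Phi + (`|e| * We + `|e| ^+ 2 * (W + A e)) + `|e| ^+ 4)].
Proof.
have [K1 K10 h1] := linear_forcing_bound U_open U_ls cont approx.
have [K2 K20 h2] := gap_le; have [K3 K30 h3] := gap_parity_le.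
have [K4 K40 h4] := residual_hat_bound F_smooth U_open U_ls smooth_v smooth_P floquet E_ls nf.
have [K5 K50 h5] := residual_tilde_bound F_smooth U_open U_ls smooth_v smooth_P floquet E_ls nf.
pose K6 := 2 * (K2 + K3 + K4 + K5); exists (K1 + K6);
  first by rewrite addr_ge0// mulr_ge0// !addr_ge0.
have FF : Filter (nbhs (0 : R)^') by exact: dnbhs_filter.
have h12 := @filterI _ _ FF _ _ h1 h2.
apply: filterS3 h12 h3 (near_punctured ltr01) => e [{}h1 {}h2] {}h3 [e0 he] W We Phi k t b k4 hW
  hWe hPhi.
have W0 := defect_le_ge0 hW; have We0 := even_defect_le_ge0 hWe; have A0 := detuning_ge0 ls os X e.
have Phi0 : 0 <= Phi := le_trans (normr_ge0 _) (hPhi b (lshift m 0)).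
have x0 : 0 <= `|e| by [].
have x3 : `|e| ^+ 4 <= `|e| ^+ 3 by rewrite exprSr ler_piMr// exprn_ge0.
have x2 : `|e| ^+ 3 <= `|e| ^+ 2 by rewrite exprSr ler_piMr// exprn_ge0.
have x30 : 0 <= `|e| ^+ 3 by rewrite exprn_ge0.
have x40 : 0 <= `|e| ^+ 4 by rewrite exprn_ge0.
have B0 : 0 <= `|e| * (W + A e) by rewrite mulr_ge0// addr_ge0.
have B0' : 0 <= `|e| * We + `|e| ^+ 2 * (W + A e) by rewrite addr_ge0// mulr_ge0 ?exprn_ge0//
  addr_ge0.
have K0 i (Y : R) : 0 <= Y -> `|fourier b k (fun p => source t p e i)| <=
  K6 * Y -> `|forcing b k t e i| <= (K1 + K6) * (A e * Phi + Y).
  move=> Y0 hY; apply: le_trans (ler_normD _ _) _; have hl := h1 b k t Phi i k4 hPhi.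
  rewrite /linear_forcing in hl; apply: le_trans (lerD hl hY) _.
  have m1 : 0 <= K1 * Y by rewrite mulr_ge0.
  have m2 : 0 <= K6 * (A e * Phi) by rewrite mulr_ge0 ?mulr_ge0// !addr_ge0.
  move: (A e * Phi) m2 => y; clearbody K6; lra.
have comb (x y kx ky Y X1 X2 : R) : `|x| <= kx * X1 -> `|y| <= ky * X2 -> 0 <= kx -> 0 <=
  ky -> X1 <= Y -> X2 <= Y -> `|x + y| <= (kx + ky) * Y.
  move=> hx hy kx0 ky0 l1 l2; apply: le_trans (ler_normD _ _) _; rewrite mulrDl; apply: lerD.
    by apply: le_trans hx _; rewrite ler_wpM2l.
  by apply: le_trans hy _; rewrite ler_wpM2l.
split.
- move=> i; rewrite -addrA; apply: K0; first by rewrite addr_ge0.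
  have hs p : `|source t p e (lshift m i)| <= (K2 + K4) * (`|e| * (W + A e) + `|e| ^+ 3).
    rewrite source_hat; have [q1 _] := h4 t e i e0 he p; apply: comb (h2 W t p _ hW) q1 _ _ _ _ =>
      //; [by rewrite lerD2l|by rewrite lerDr].
  apply: le_trans (fourier_source b k hs) _; rewrite mulrA ler_wpM2r ?addr_ge0// ler_wpM2l//; lra.
- move=> i; rewrite -addrA; apply: K0; first by rewrite addr_ge0 ?exprn_ge0.
  have hs p : `|source t p e (rshift 2 i)| <= (K2 + K5) * (`|e| * (W + A e) + `|e| ^+ 2).
    rewrite source_tilde; have [q1 _] := h5 t e i e0 he p;
      apply: comb (h2 W t p _ hW) q1 _ _ _ _ => //; [by rewrite lerD2l;
      exact: le_trans x2|by rewrite lerDr].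
  apply: le_trans (fourier_source b k hs) _;
    rewrite mulrA ler_wpM2r ?addr_ge0 ?exprn_ge0// ler_wpM2l//; lra.
- move=> ek i; rewrite -addrA; apply: K0; first by rewrite addr_ge0.
  apply: fourier_source_parity => p; rewrite -signr_odd (negbTE ek) mul1r !source_tilde addrACA.
  have [_ q1] := h5 t e i e0 he p.
  have l2 := comb _ _ _ _ (`|e| * (W + A e) + `|e| ^+ 3) _ _ (h2 W t p (rshift 2 i) hW) (h2 W t (p
    + pi) (rshift 2 i) hW) K20 K20.
  have := comb _ _ _ _ (`|e| * (W + A e) + `|e| ^+ 3) _ _ (l2 _ _) q1.
  rewrite !lerD2l lerDr => /(_ x3 x3 _ K50 (lexx _) B0) h; apply: le_trans (h _) _;
    first by rewrite addr_ge0.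
  rewrite ler_wpM2r ?addr_ge0// /K6; lra.
- move=> ok i; rewrite -addrA; apply: K0; first by rewrite addr_ge0.
  apply: fourier_source_parity => p; rewrite -signr_odd ok mulN1r !source_hat opprD addrACA.
  have [_ q1] := h4 t e i e0 he p.
  have := comb _ _ _ _ (`|e| * We + `|e| ^+ 2 * (W + A e) + `|e| ^+ 4) _ _ (h3 W We t p
    (lshift m i) hW hWe) q1 K30 K40 (lexx _).
  rewrite lerDr => /(_ B0') h; apply: le_trans h _.
  by apply: ler_wpM2r; [rewrite addr_ge0|rewrite /K6; lra].
Qed.

End mode_forcing_bounds.

(** Q stands for defect plus drifts, A for the detuning, x for |e| and r for the smallness of the
    coefficients. Inserting the bound for A in that for Q gives Q the coefficient L r (2 KA + 1) on
    the right, at most 1/2. *)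
Lemma absorption (R : realType) (Q A x r L KA : R) : 0 <= Q -> 0 <= A -> 0 <= x -> x <= r -> r <=
  1 -> 0 <= L -> 0 <= KA ->
  A <= KA * (Q + x ^+ 2) -> Q <= L * (A * r + x * (Q + A) + x ^+ 2) -> L * r * (2 * KA + 1) <=
    2^-1 ->
  Q <= 2 * L * (2 * KA + 1) * x ^+ 2.
Proof.
move=> Q0 A0 x0 xr r1 L0 KA0 hA hQ hr.
have r0 : 0 <= r := le_trans x0 xr.
have y0 : 0 <= x ^+ 2 by rewrite exprn_ge0.
move: (x ^+ 2) hA hQ y0 => y hA hQ y0.
have B1 : A * r <= KA * (Q + y) * r by rewrite ler_wpM2r.
have B2 : x * (Q + A) <= r * (Q + KA * (Q + y)) by apply: ler_pM => //;
  [rewrite addr_ge0|rewrite lerD2l].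
have B3 : L * (A * r + x * (Q + A) + y) <= L * (r * (2 * KA + 1) * Q + 2 * KA * y + y).
  rewrite ler_wpM2l// lerD2r; apply: le_trans (lerD B1 B2) _.
  have : r * (KA * y) <= KA * y by rewrite ler_piMl// mulr_ge0.
  have -> : KA * (Q + y) * r + r * (Q + KA * (Q + y)) = r * (2 * KA + 1) * Q + 2 * (r * (KA * y))
    by ring.
  move: (r * (KA * y)) => z; lra.
have B4 : L * r * (2 * KA + 1) * Q <= 2^-1 * Q by rewrite ler_wpM2r.
have B5 : L * (r * (2 * KA + 1) * Q + 2 * KA * y + y) = L * r * (2 * KA + 1) * Q + L * (2 * KA + 1)
  * y by ring.
have -> : 2 * L * (2 * KA + 1) * y = 2 * (L * (2 * KA + 1) * y) by ring.
lra.
Qed.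

(** * Absorption and successive improvement of the order in epsilon *)

Section bootstrap.
Variables (R : realType) (m : nat) (F : vector_field R m) (ls os : R)
    (vs : R -> 'cV[R]_(2 + m)) (Ps : R -> 'M[R]_(2 + m)) (Ets : 'M[R]_m)
    (U : set R) (C : continuation R m) (N : nf_coeffs R m)
    (X : fourier_family R m).
Local Notation n := (2 + m)%N.
Hypotheses (F_smooth : smooth_field F)
    (U_open : open U) (U_ls : U ls)
    (cont : is_continuation F ls os vs Ps Ets U C)
    (transversality : derive1 (alphaR C) ls != 0)
    (nf : is_normal_form F U C N)
    (approx : is_fourier_approx F ls os C X)
    (os_gt0 : 0 < os) (os_lt : os < 2^-1) (os3 : os != 3^-1) (os4 : os != 4^-1)
    (hyperbolic : forall mu, complex_eigenvalue Ets mu -> complex.Re mu != 0).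
Local Notation defect := (defect ls N X).
Local Notation forcing := (mode_forcing F ls os C N X).
Local Notation A e := (detuning ls os X e).
Local Notation l := (lambdaF X).
Local Notation dl e := (`|lambdaF X e - ls|).
Local Notation dR e := (drift_R ls C N X e).
Local Notation dI e := (drift_I ls C N X e).
Local Notation defect_le := (defect_le ls N X).
Local Notation even_defect_le := (even_defect_le ls N X).

Let E_ls := cont_E0 cont.

Lemma near_lambda_dist (r : R) : 0 < r -> \forall e \near (0 : R)^', dl e <= r.
Proof. by move=> r0; exact: (near_lambda approx (near_dist ls r0)). Qed.

(** alpha_R at [l e] is the drift minus e^2 beta_R and also its linear part up to a quadratic
    remainder. As the slope is not 0, this controls [l e - ls]; the imaginary drift then controls
    the frequency. *)
Lemma detuning_bound : exists2 K, 0 <= K & \forall e \near (0 : R)^', A e <=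
  K * (`|dR e| + `|dI e| + `|e| ^+ 2).
Proof.
have [aR aI _] := E_lsE E_ls.
have [K1 K10 h1] := C2_taylor U_open U_ls (cont_smooth_aR cont 2).
have [K2 K20 h2] := C1_lipschitz U_open U_ls (cont_smooth_aI cont 1).
set a := derive1 (alphaR C) ls; have a0 : 0 < `|a| by rewrite normr_gt0.
(* Makes the quadratic remainder at most half of the linear term; the 1 added to K1 keeps the
   denominator positive. *)
pose r := `|a| / (2 * (K1 + 1)); have r0 : 0 < r by rewrite divr_gt0// mulr_gt0// ltr_wpDl.
pose L := 2 / `|a| * (1 + `|betaR N ls|); have L0 : 0 <= L by rewrite mulr_ge0 ?divr_ge0 ?addr_ge0.
exists (L * (1 + K2) + 1 + `|betaI N ls|); first by rewrite !addr_ge0 ?mulr_ge0 ?addr_ge0.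
apply: filterS3 (near_lambda approx h1) (near_lambda approx h2) (near_lambda_dist r0) =>
  e {}h1 {}h2 hr.
rewrite aR subr0 in h1; rewrite aI in h2.
have x0 : 0 <= `|e| ^+ 2 by rewrite exprn_ge0.
have xE : `|e| ^+ 2 = `|e ^+ 2| by rewrite normrX.
have D0 : 0 <= dl e by [].
have B1 : `|a| * dl e <= `|dR e| + `|e| ^+ 2 * `|betaR N ls| + K1 * dl e ^+ 2.
  rewrite -normrM.
  have -> : a * (l e - ls) = dR e - e ^+ 2 * betaR N ls - (alphaR C (l e) - a * (l e - ls))
    by rewrite /drift_R; ring.
  by apply: le_trans (ler_normB _ _) _; apply: lerD => //; apply: le_trans (ler_normB _ _) _;
    rewrite normrM xE.
have B2 : K1 * dl e ^+ 2 <= `|a| / 2 * dl e.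
  rewrite expr2 mulrA ler_wpM2r//; apply: le_trans (_ : K1 * r <= _); first by rewrite ler_wpM2l.
  rewrite /r mulrA ler_pdivrMr ?mulr_gt0 ?ltr_wpDl//; nra.
have B3 : dl e <= L * (`|dR e| + `|e| ^+ 2).
  apply: le_trans (_ : 2 / `|a| * (`|dR e| + `|e| ^+ 2 * `|betaR N ls|) <= _).
    rewrite mulrAC ler_pdivlMr//; move: (K1 * dl e ^+ 2) B1 B2 => z B1 B2; lra.
  rewrite /L -[leRHS]mulrA ler_wpM2l ?divr_ge0//.
  have y0 : 0 <= `|dR e| * `|betaR N ls| by rewrite mulr_ge0.
  have -> : (1 + `|betaR N ls|) * (`|dR e| + `|e| ^+ 2) = `|dR e| + `|e| ^+ 2 * `|betaR N ls|
    + (`|dR e| * `|betaR N ls| + `|e| ^+ 2) by ring.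
  by rewrite lerDl addr_ge0.
have B4 : `|omegaF X e - os| <= K2 * dl e + `|dI e| + `|e| ^+ 2 * `|betaI N ls|.
  have -> : omegaF X e - os = (alphaI C (l e) - os) - dI e + e ^+ 2 * betaI N ls
    by rewrite /drift_I; ring.
  apply: le_trans (ler_normD _ _) _; rewrite normrM -xE lerD2r; apply: le_trans (ler_normB _ _) _;
    exact: lerD.
rewrite /detuning.
have c0 : 0 <= `|dR e| by []. have d0 : 0 <= `|dI e| by [].
have B5 : K2 * dl e <= K2 * (L * (`|dR e| + `|e| ^+ 2)) by rewrite ler_wpM2l.
move: (`|dR e|) (`|dI e|) (`|e| ^+ 2) (dl e) (`|omegaF X e - os|) (`|betaI N ls|)
  (normr_ge0 (betaI N ls)) x0 D0 B3 B4 B5 c0 d0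
  => u v y d w b b0 y0 D0' B3 B4 B5 u0 v0.
have -> : (L * (1 + K2) + 1 + b) * (u + v + y) = L * (u + y) + K2 * (L * (u + y))
  + (L * v + K2 * (L * v)) + (u + v + y) + (b * u + b * v + y * b) by ring.
have p1 : 0 <= L * v by rewrite mulr_ge0. have p2 : 0 <= K2 * (L * v) by rewrite mulr_ge0.
have p3 : 0 <= b * u by rewrite mulr_ge0. have p4 : 0 <= b * v by rewrite mulr_ge0.
lra.
Qed.

(** The supremum over theta, modes and entries, finite by continuity and periodicity. Being the
    least bound, it can be estimated by the forcing, which in turn depends on it. *)
Lemma least_defect e : fourier_solution F C X e -> exists2 W, defect_le W e & forall M,
  defect_le M e -> W <= M.
Proof.
move=> sol.
pose S := [set x : R | exists b k t i, (k < 4)%N /\ x = `|defect b k t e i 0|].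
have S0 : S !=set0 by exists `|defect false 0%N 0 e (lshift m 0) 0|, false, 0%N, 0, (lshift m 0).
have hb (x : bool * 'I_4 * 'I_n) : exists K : R, 0 <= K /\ forall t, `|defect x.1.1 x.1.2 t e x.2
  0| <= K.
  have [||K K0 hK] := @periodic_continuous_bounded R (fun t => defect x.1.1 x.1.2 t e x.2 0);
    last by exists K.
    by move=> t; rewrite (defect_periodic U_open U_ls nf _ _ sol)//; exact: ltn_ord.
  rewrite (_ : (fun t => _) = fun t => Fcoef X x.1.1 x.1.2 t e x.2 0 + - nfscale x.1.2 e * nfcoef
    ls N x.1.1 x.1.2 t x.2 0); last first.
    by apply/funext => t; rewrite /defect !mxE mulNr.
  apply: contD; first exact: (Fcoef_cont sol (ltn_ord _)).
  by apply: contZ; exact: (nfcoef_cont U_open U_ls nf (ltn_ord _)).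
have [K hK] := choice hb.
have Sub : has_ubound S.
  exists (\sum_x K x) => x [b [k [t [i [k4 ->]]]]]; apply: le_trans ((hK (b, Ordinal k4, i)).2 t) _.
  by rewrite (bigD1 (b, Ordinal k4, i))//= lerDl; apply: sumr_ge0 => y _; exact: (hK y).1.
exists (sup S).
  by move=> b k t i k4; apply: ub_le_sup => //; exists b, k, t, i.
by move=> M hM; apply: ge_sup => // x [b [k [t [i [k4 ->]]]]]; exact: hM.
Qed.

Lemma defect_le_split W e : (forall b k t i, (k < 4)%N -> `|defect b k t e (lshift m i) 0| <= W) ->
  (forall b k t i, (k < 4)%N -> `|defect b k t e (rshift 2 i) 0| <= W) -> defect_le W e.
Proof. by move=> h1 h2 b k t i k4; case: (split_ordP i) => j ->; [exact: h1|exact: h2]. Qed.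

Lemma order_two : exists2 K, 0 <= K & \forall e \near (0 : R)^', defect_le (K * `|e| ^+ 2) e /\
  [/\ `|dR e| <= K * `|e| ^+ 2, `|dI e| <= K * `|e| ^+ 2 & A e <= K * `|e| ^+ 2].
Proof.
have [KA KA0 hA] := detuning_bound.
have [KF KF0 hF] := forcing_bound F_smooth U_open U_ls cont nf approx.
have [KH KH0 hH] := defect_hat_bound X F_smooth U_open U_ls nf E_ls os_gt0 os_lt os3 os4.
have [KT KT0 hT] := defect_tilde_bound X F_smooth U_open U_ls nf E_ls hyperbolic.
(* The defect and the two drifts are each at most (KH + KT) M, hence the 3. The radius r, which also
   bounds the coefficients of z^F, is chosen to meet the hypothesis of [absorption]. *)
pose L := 3 * ((KH + KT) * KF); have L0 : 0 <= L by rewrite mulr_ge0// mulr_ge0// addr_ge0.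
pose r := (2 * (L + 1) * (2 * KA + 1))^-1.
have KA1 : 1 <= 2 * KA + 1 by lra.
have r0 : 0 < r by rewrite invr_gt0 mulr_gt0 ?mulr_gt0//; lra.
have rr : L * r * (2 * KA + 1) <= 2^-1.
  rewrite /r invfM invfM; have Q0 : 2 * KA + 1 != 0 by apply: lt0r_neq0; lra.
  have -> : L * (2^-1 / (L + 1) / (2 * KA + 1)) * (2 * KA + 1) = 2^-1 * (L / (L + 1)).
    field; apply/andP; split=> //; apply: lt0r_neq0; lra.
  rewrite ler_piMr// ler_pdivrMr; lra.
have r1 : r <= 1 by rewrite invf_le1; nra.
pose B := 2 * L * (2 * KA + 1); have B0 : 0 <= B by rewrite mulr_ge0 ?mulr_ge0//; lra.
exists (B + KA * (B + 1)); first by rewrite addr_ge0// mulr_ge0// addr_ge0.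
have FF : Filter (nbhs (0 : R)^') by exact: dnbhs_filter.
have hAF := @filterI _ _ FF _ _ hA hF;
  have hS := @filterI _ _ FF _ _ (near_sol approx) (Fcoef_small approx r0).
apply: filterS3 hAF hS (near_punctured r0) => e [{}hA {}hF] [sol hr] [e0 he].
have [W hW lub] := least_defect sol.
have W0 := defect_le_ge0 hW; have A0 := detuning_ge0 ls os X e.
have hWe : even_defect_le W e by move=> b k t i k4 _; exact: hW.
have x0 : 0 <= `|e| by [].
have y0 : 0 <= `|e| ^+ 2 by rewrite exprn_ge0.
have x2 : `|e| ^+ 3 <= `|e| ^+ 2 by rewrite exprSr ler_piMr// (le_trans he).
pose M := KF * (A e * r + `|e| * (W + A e) + `|e| ^+ 2).
have MH k : (k < 4)%N -> forall b t i, `|forcing b k t e (lshift m i)| <= M.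
  move=> k4 b t i; have [h _ _ _] := hF W W r k t b k4 hW hWe (fun b j => hr b k t j k4).
  by apply: le_trans (h i) _; rewrite ler_wpM2l// lerD2l.
have MT k : (k < 4)%N -> forall b t i, `|forcing b k t e (rshift 2 i)| <= M.
  by move=> k4 b t i; have [_ h _ _] := hF W W r k t b k4 hW hWe (fun b j => hr b k t j k4);
    exact: h.
have M0 : 0 <= M := le_trans (normr_ge0 _) (MH 0%N isT false 0 0).
have leH : KH * M <= (KH + KT) * M by rewrite ler_wpM2r// lerDl.
have leT : KT * M <= (KH + KT) * M by rewrite ler_wpM2r// lerDr.
(* M contains W; the inequality closes by minimality of W. *)
have hWM : W <= (KH + KT) * M.
  apply: lub; apply: defect_le_split => b k t i k4.
    by have [h _] := hH e k M sol k4 (MH k k4); exact: le_trans (h b t i) leH.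
  exact: le_trans (hT e k M sol k4 (MT k k4) b t i) leT.
have [_ /(_ erefl)[hR hI]] := hH e 1%N M sol isT (MH 1%N isT).
have hR' := le_trans hR leH; have hI' := le_trans hI leH.
pose Q := W + `|dR e| + `|dI e|.
have Q0 : 0 <= Q by rewrite !addr_ge0.
have c0 : 0 <= `|dR e| by []. have d0 : 0 <= `|dI e| by [].
have hAQ : A e <= KA * (Q + `|e| ^+ 2).
  by apply: le_trans hA _; rewrite ler_wpM2l// lerD2r /Q; lra.
have hQ : Q <= L * (A e * r + `|e| * (Q + A e) + `|e| ^+ 2).
  apply: le_trans (_ : 3 * ((KH + KT) * M) <= _); first by rewrite /Q; lra.
  rewrite /L /M -!mulrA ler_wpM2l// ler_wpM2l ?addr_ge0// ler_wpM2l//.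
  by rewrite lerD2r lerD2l ler_wpM2l// lerD2r /Q -addrA lerDl addr_ge0.
have hB := absorption Q0 A0 x0 he r1 L0 KA0 hAQ hQ rr; rewrite -/B in hB.
have E (x : R) : x <= B * `|e| ^+ 2 -> x <= (B + KA * (B + 1)) * `|e| ^+ 2.
  by move=> h; apply: le_trans h _; rewrite ler_wpM2r// lerDl mulr_ge0// addr_ge0.
split.
  move=> b k t i k4; apply: E; apply: le_trans (hW b k t i k4) _; apply: le_trans hB; rewrite /Q;
    lra.
split.
- by apply: E; apply: le_trans hB; rewrite /Q; lra.
- by apply: E; apply: le_trans hB; rewrite /Q; lra.
- apply: le_trans hAQ _; rewrite [leRHS]mulrDl; apply: le_trans (_ : KA * (B + 1) * `|e| ^+ 2 <= _).
    by rewrite -mulrA ler_wpM2l// [leRHS]mulrDl mul1r lerD2r.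
  by rewrite lerDr mulr_ge0.
Qed.

(** With detuning and defect O(e^2) and coefficients of z^F of size O(e), every term of the forcing
    is O(e^3), except the tilde residual in odd modes. That exception limits the gain to the hat
    components and the even modes. *)
Lemma order_three : exists2 K, 0 <= K & \forall e \near (0 : R)^',
  [/\ even_defect_le (K * `|e| ^+ 3) e,
  forall b k t i, (k < 4)%N -> `|defect b k t e (lshift m i) 0| <= K * `|e| ^+ 3,
  `|dR e| <= K * `|e| ^+ 3 & `|dI e| <= K * `|e| ^+ 3].
Proof.
have [K2 K20 h2] := order_two; have [Kn Kn0 hn] := nfcoef_bounded U_open U_ls nf.
have [KF KF0 hF] := forcing_bound F_smooth U_open U_ls cont nf approx.
have [KH KH0 hH] := defect_hat_bound X F_smooth U_open U_ls nf E_ls os_gt0 os_lt os3 os4.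
have [KT KT0 hT] := defect_tilde_bound X F_smooth U_open U_ls nf E_ls hyperbolic.
pose L := KF * (K2 * (K2 + Kn) + 2 * K2 + 1); exists ((KH + KT) * L).
  by rewrite mulr_ge0 ?addr_ge0// mulr_ge0// addr_ge0// addr_ge0 ?mulr_ge0// addr_ge0.
have FF : Filter (nbhs (0 : R)^') by exact: dnbhs_filter.
have h2F := @filterI _ _ FF _ _ h2 hF.
apply: filterS3 h2F (near_sol approx) (near_punctured ltr01) => e [[hW [hR hI hA]] {}hF] sol
  [e0 he].
have x0 : 0 <= `|e| by []. have y0 : 0 <= `|e| ^+ 2 by rewrite exprn_ge0.
have hPhi b k t i : (k < 4)%N -> `|Fcoef X b k t e i 0| <= (K2 + Kn) * `|e|.
  move=> k4; have -> : Fcoef X b k t e i 0 = defect b k t e i 0 + nfscale k e * nfcoef ls N b k t i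
    0 by rewrite /defect !mxE; ring.
  apply: le_trans (ler_normD _ _) _; rewrite [leRHS]mulrDl; apply: lerD.
    apply: le_trans (hW b k t i k4) _; rewrite ler_wpM2l// expr2 ler_piMl//.
  rewrite normrM mulrC ler_pM//; first exact: hn.
  rewrite /nfscale; case: (odd k) => //; rewrite normrX expr2 ler_piMl//.
pose M := L * `|e| ^+ 3.
have ME : KF * (A e * ((K2 + Kn) * `|e|) + `|e| * (K2 * `|e| ^+ 2 + A e) + `|e| ^+ 3) <= M.
  rewrite /M /L -mulrA ler_wpM2l//.
  have -> : (K2 * (K2 + Kn) + 2 * K2 + 1) * `|e| ^+ 3 = K2 * `|e| ^+ 2 * ((K2 + Kn) * `|e|)
    + `|e| * (K2 * `|e| ^+ 2 + K2 * `|e| ^+ 2) + `|e| ^+ 3 by ring.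
  rewrite lerD2r; apply: lerD; first by rewrite ler_wpM2r// mulr_ge0// addr_ge0.
  by rewrite ler_wpM2l// lerD2l.
have hWe : even_defect_le (K2 * `|e| ^+ 2) e by move=> b k t i k4 _; exact: hW.
have hFk b k t (k4 : (k < 4)%N) := hF _ _ _ k t b k4 hW hWe (fun b j => hPhi b k t j k4).
have MH k : (k < 4)%N -> forall b t i, `|forcing b k t e (lshift m i)| <= M.
  by move=> k4 b t i; have [h _ _ _] := hFk b k t k4; exact: le_trans (h i) ME.
have M0 : 0 <= M := le_trans (normr_ge0 _) (MH 0%N isT false 0 0).
have leH : KH * M <= (KH + KT) * M by rewrite ler_wpM2r// lerDl.
have leT : KT * M <= (KH + KT) * M by rewrite ler_wpM2r// lerDr.
have hhat b k t i : (k < 4)%N -> `|defect b k t e (lshift m i) 0| <= (KH + KT) * L * `|e| ^+ 3.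
  by move=> k4; rewrite -mulrA; have [h _] := hH e k M sol k4 (MH k k4);
    exact: le_trans (h b t i) leH.
have [_ /(_ erefl)[hR' hI']] := hH e 1%N M sol isT (MH 1%N isT).
split=> //; last 2 first.
- by rewrite -mulrA; exact: le_trans leH.
- by rewrite -mulrA; exact: le_trans leH.
move=> b k t i k4 ek; case: (split_ordP i) => j ->; first exact: hhat.
rewrite -mulrA; apply: le_trans leT; apply: (hT e k M sol k4) => {}b {}t {}j.
by have [_ _ h _] := hFk b k t k4; exact: le_trans (h ek j) ME.
Qed.

(** In odd modes the coefficients of z^F are O(e^2), so the detuning contributes O(e^4). The even
    part of the defect is O(e^3) and enters with a factor e; the rest enters with e^2. *)
Lemma order_four : exists2 K, 0 <= K & \forall e \near (0 : R)^', [/\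
  forall b k t i, (k < 4)%N -> odd k -> `|defect b k t e (lshift m i) 0| <= K * `|e| ^+ 4,
  `|dR e| <= K * `|e| ^+ 4 & `|dI e| <= K * `|e| ^+ 4].
Proof.
have [K2 K20 h2] := order_two; have [K3 K30 h3] := order_three;
  have [Kn Kn0 hn] := nfcoef_bounded U_open U_ls nf.
have [KF KF0 hF] := forcing_bound F_smooth U_open U_ls cont nf approx.
have [KH KH0 hH] := defect_hat_bound X F_smooth U_open U_ls nf E_ls os_gt0 os_lt os3 os4.
pose L := KF * (K2 * (K2 + Kn) + (K3 + 2 * K2) + 1); exists (KH * L).
  by rewrite mulr_ge0// mulr_ge0// !addr_ge0 ?mulr_ge0// addr_ge0.
have FF : Filter (nbhs (0 : R)^') by exact: dnbhs_filter.
have h2F := @filterI _ _ FF _ _ h2 hF.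
apply: filterS3 h2F (near_sol approx) h3 => e [[hW [_ _ hA]] {}hF] sol [hWe _ _ _].
have x0 : 0 <= `|e| by []. have y0 : 0 <= `|e| ^+ 2 by rewrite exprn_ge0.
have hPhi b k t i : (k < 4)%N -> odd k -> `|Fcoef X b k t e i 0| <= (K2 + Kn) * `|e| ^+ 2.
  move=> k4 ok; have -> : Fcoef X b k t e i 0 = defect b k t e i 0 + e ^+ 2 * nfcoef ls N b k t i 0
    by rewrite /defect /nfscale ok !mxE; ring.
  apply: le_trans (ler_normD _ _) _; rewrite [leRHS]mulrDl; apply: lerD; first exact: hW.
  by rewrite normrM normrX mulrC ler_wpM2r//; exact: hn.
pose M := L * `|e| ^+ 4.
have MH k : (k < 4)%N -> odd k -> forall b t i, `|forcing b k t e (lshift m i)| <= M.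
  move=> k4 ok b t i; have [_ _ _ /(_ ok i) h] := hF _ _ _ k t b k4 hW hWe (fun b j =>
    hPhi b k t j k4 ok).
  apply: le_trans h _; rewrite /M /L -[leRHS]mulrA ler_wpM2l//.
  have -> : (K2 * (K2 + Kn) + (K3 + 2 * K2) + 1) * `|e| ^+ 4 =
    K2 * `|e| ^+ 2 * ((K2 + Kn) * `|e| ^+ 2) + (`|e| * (K3 * `|e| ^+ 3) + `|e| ^+ 2 * (K2 * `|e| ^+
      2 + K2 * `|e| ^+ 2)) + `|e| ^+ 4 by ring.
  rewrite lerD2r; apply: lerD; first by rewrite ler_wpM2r// mulr_ge0// addr_ge0.
  by rewrite lerD2l ler_wpM2l// lerD2l.
have [_ /(_ erefl)[hR hI]] := hH e 1%N M sol isT (MH 1%N isT isT).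
have -> : KH * L * `|e| ^+ 4 = KH * M := esym (mulrA _ _ _).
split=> // b k t i k4 ok.
by have [h _] := hH e k M sol k4 (MH k k4 ok).
Qed.

End bootstrap.

Lemma entries_le (R : realType) (q : nat) (c : 'cV[R]_q) (M : R) : 0 <= M -> (forall i, `|c i 0| <=
  M) -> `|c| <= M.
Proof.
move=> M0 hM; rewrite [leLHS]/Num.norm/= mx_normrE; apply: (big_ind (fun x => x <= M)) => //.
  by move=> x y hx hy; rewrite ge_max hx.
by move=> [i j] _ /=; rewrite (ord1 j).
Qed.

(* (1, i) is a left eigenvector of the rotation block. *)
Lemma Estar_eigenvalue (R : realType) (m : nat) (os : R) (Ets : 'M[R]_m) : complex_eigenvalue
  (Estar os Ets) (Complex 0 os).
Proof.
apply/eigenvalueP; exists (row_mx (\row_j if j == 0 then 1 else Complex 0 1) 0); last first.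
  apply/eqP => /rowP/(_ (lshift m 0)); rewrite row_mxEl !mxE /= => /eqP; by rewrite oner_eq0.
rewrite /Estar map_block_mx mul_row_block !map_mx0 !mul0mx !mulmx0 !addr0 scale_row_mx scaler0;
  congr row_mx.
have l01 : lift ord0 ord0 = 1 :> 'I_2 by exact/val_inj.
apply/rowP => j; rewrite !mxE !big_ord_recl big_ord0 !mxE /= addr0 l01.
case: (ord2 j) => -> /=; apply/eqP; rewrite eq_complex /=; apply/andP; split; apply/eqP; ring.
Qed.

Lemma bigO_sqr (R : realType) (f : R -> R) (K : R) : (\forall e \near (0 : R)^', `|f e| <=
  K * e ^+ 2) ->
  f =O_ ((0 : R)^') (fun e => e ^+ 2).
Proof.
move=> h; apply/eqO_exP; exists (`|K| + 1); first by rewrite ltr_wpDl.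
apply: filterS h => e h; apply: le_trans h _;
  rewrite [`|e ^+ 2|]ger0_norm ?sqr_ge0// ler_wpM2r ?sqr_ge0//.
by apply: le_trans (ler_norm K) _; rewrite lerDl.
Qed.

(** * From the bounds on defect and drifts to the stated expansions *)

Section conclusion.
Variables (R : realType) (m : nat) (F : vector_field R m) (ls os : R)
    (vs : R -> 'cV[R]_(2 + m)) (Ps : R -> 'M[R]_(2 + m)) (Ets : 'M[R]_m)
    (U : set R) (C : continuation R m) (N : nf_coeffs R m)
    (X : fourier_family R m).
Hypotheses (F_smooth : smooth_field F)
    (U_open : open U) (U_ls : U ls)
    (cont : is_continuation F ls os vs Ps Ets U C)
    (transversality : derive1 (alphaR C) ls != 0)
    (nf : is_normal_form F U C N)
    (approx : is_fourier_approx F ls os C X)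
    (os_gt0 : 0 < os) (os_lt : os < 2^-1) (os3 : os != 3^-1) (os4 : os != 4^-1)
    (hyperbolic : forall mu, complex_eigenvalue Ets mu -> complex.Re mu != 0).
Local Notation defect := (defect ls N X).

(** Serves both Lyapunov coefficients: beta is 0 for the real part and the frequency quotient for
    the imaginary part. After division by e^2 the drift is O(e^2), and so is the Taylor remainder of
    alpha, because [l e - ls] is O(e^2). *)
Lemma drift_quotient (alpha beta dr : R -> R) (b : R) : Ck_on 2 U alpha ->
  (forall e, e != 0 -> dr e = alpha (lambdaF X e) - alpha ls + e ^+ 2 * b - beta e * e ^+ 2) ->
  (exists2 K, 0 <= K & \forall e \near (0 : R)^', `|dr e| <= K * `|e| ^+ 4) ->
  (fun e => b - (beta e - derive1 alpha ls * ((lambdaF X e - ls) / e ^+ 2))) =O_ ((0 : R)^')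
    (fun e => e ^+ 2).
Proof.
move=> hal drE [K K0 hK]; have [K1 K10 h1] := C2_taylor U_open U_ls hal.
have [K2 K20 h2] := order_two F_smooth U_open U_ls cont transversality nf approx os_gt0 os_lt os3
  os4 hyperbolic.
apply: (@bigO_sqr _ _ (K + K1 * K2 ^+ 2)).
have FF : Filter (nbhs (0 : R)^') by exact: dnbhs_filter.
have h12 := @filterI _ _ FF _ _ (near_lambda approx h1) h2.
apply: filterS3 h12 hK (near_punctured (@ltr01 R)) => e [{}h1 [_ [_ _ {}h2]]] {}hK [e0 _].
have -> : b - (beta e - derive1 alpha ls * ((lambdaF X e - ls) / e ^+ 2)) =
   (dr e - (alpha (lambdaF X e) - alpha ls - derive1 alpha ls * (lambdaF X e - ls))) / e ^+ 2.
  by rewrite drE//; field.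
rewrite normrM normfV normrX ler_pdivrMr ?exprn_gt0 ?normr_gt0//.
have -> : (K + K1 * K2 ^+ 2) * e ^+ 2 * `|e| ^+ 2 = K * `|e| ^+ 4 + K1 * (K2 * `|e| ^+ 2) ^+ 2.
  by rewrite -(real_normK (num_real e)); ring.
apply: le_trans (ler_normB _ _) _; apply: lerD => //; apply: le_trans h1 _;
  rewrite ler_wpM2l// ler_pXn2r ?nnegrE ?mulr_ge0 ?exprn_ge0//.
by apply: le_trans h2; rewrite /detuning lerDl.
Qed.

(** The error is the defect divided by its weight: O(e^3) over e here, O(e^4) over e^2 for the odd
    modes. *)
Lemma coefficient_even b k : (k < 4)%N -> ~~ odd k ->
  eq_O2 (fun t => usubmx (nfcoef ls N b k t)) (fun t e => e^-1 *: usubmx (Fcoef X b k t e)) /\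
  eq_O2 (fun t => dsubmx (nfcoef ls N b k t)) (fun t e => e^-1 *: dsubmx (Fcoef X b k t e)).
Proof.
move=> k4 ek.
have [K K0 h] := order_three F_smooth U_open U_ls cont transversality nf approx os_gt0 os_lt os3
  os4 hyperbolic.
have key e t i : e != 0 -> even_defect_le ls N X (K * `|e| ^+ 3) e -> `|nfcoef ls N b k t i 0
  - e^-1 * Fcoef X b k t e i 0| <= K * e ^+ 2.
  move=> e0 hK; have -> : nfcoef ls N b k t i 0 - e^-1 * Fcoef X b k t e i 0 =
    - (defect b k t e i 0 / e).
    by rewrite /defect /nfscale (negbTE ek) !mxE; field.
  rewrite normrN normrM normfV ler_pdivrMr ?normr_gt0// -(real_normK (num_real e)) -mulrA -exprSr;
    exact: hK.
split; exists K; apply: filterS2 h (near_punctured (@ltr01 R)) => e [hK _ _ _] [e0 _] t.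
  by apply: entries_le => [|i]; [rewrite mulr_ge0 ?sqr_ge0|rewrite !mxE; exact: key].
by apply: entries_le => [|i]; [rewrite mulr_ge0 ?sqr_ge0|rewrite !mxE; exact: key].
Qed.

Lemma coefficient_odd b k : (k < 4)%N -> odd k ->
  eq_O2 (fun t => usubmx (nfcoef ls N b k t)) (fun t e => e ^- 2 *: usubmx (Fcoef X b k t e)).
Proof.
move=> k4 ok.
have [K K0 h] := order_four F_smooth U_open U_ls cont transversality nf approx os_gt0 os_lt os3 os4
  hyperbolic.
exists K; apply: filterS2 h (near_punctured (@ltr01 R)) => e [hK _ _] [e0 _] t.
apply: entries_le => [|i]; first by rewrite mulr_ge0 ?sqr_ge0.
have -> : (usubmx (nfcoef ls N b k t) - e ^- 2 *: usubmx (Fcoef X b k t e)) i 0 =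
  - (defect b k t e (lshift m i) 0 / e ^+ 2).
  by rewrite /defect /nfscale ok !mxE; field.
rewrite normrN normrM normfV normrX ler_pdivrMr ?exprn_gt0 ?normr_gt0//.
have -> : K * e ^+ 2 * `|e| ^+ 2 = K * `|e| ^+ 4 by rewrite -(real_normK (num_real e)); ring.
exact: hK.
Qed.

End conclusion.

Theorem theorem4p3 (R : realType) (m : nat) (F : vector_field R m) (ls os : R)
    (vs : R -> 'cV[R]_(2 + m)) (Ps : R -> 'M[R]_(2 + m)) (Ets : 'M[R]_m)
    (U : set R) (C : continuation R m) (N : nf_coeffs R m)
    (X : fourier_family R m)
    (F_smooth : smooth_field F)
    (NS : NS_point F ls os vs Ps Ets)
    (U_open : open U) (U_ls : U ls)
    (cont : is_continuation F ls os vs Ps Ets U C)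
    (transversality : derive1 (alphaR C) ls != 0)
    (normal_form : is_normal_form F U C N)
    (approx : is_fourier_approx F ls os C X) :
  let dl := fun e : R => (lambdaF X e - ls) / e ^+ 2 in
  let dw := fun e : R => (omegaF X e - os) / e ^+ 2 in
  ((fun e => betaR N ls - (- derive1 (alphaR C) ls * dl e))
     =O_ ((0 : R)^') (fun e => e ^+ 2)) /\
  ((fun e => betaI N ls - (dw e - derive1 (alphaI C) ls * dl e))
     =O_ ((0 : R)^') (fun e => e ^+ 2)) /\
  (forall k, (k \in [:: 0; 2])%N ->
     eq_O2 (ah N k ^~ ls) (fun t e => e^-1 *: usubmx (aF X k t e)) /\
     eq_O2 (at_ N k ^~ ls) (fun t e => e^-1 *: dsubmx (aF X k t e))) /\
  (forall k, k = 2%N ->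
     eq_O2 (bh N k ^~ ls) (fun t e => e^-1 *: usubmx (bF X k t e)) /\
     eq_O2 (bt N k ^~ ls) (fun t e => e^-1 *: dsubmx (bF X k t e))) /\
  (forall k, (k \in [:: 1; 3])%N ->
     eq_O2 (ah N k ^~ ls) (fun t e => e ^- 2 *: usubmx (aF X k t e)) /\
     eq_O2 (bh N k ^~ ls) (fun t e => e ^- 2 *: usubmx (bF X k t e))).
Proof.
move=> dl dw.
have os0 := NS_omega_gt0 NS; have [os3 os4] := NS_no_resonance NS.
(* The eigenvalue i [os] of the Floquet matrix turns the range of the exponents into [os] < 1/2. *)
have /andP[_ os2] := NS_exponents NS (Estar_eigenvalue os Ets).
have hyp := NS_hyperbolic NS.
have [aR aI _] := E_lsE (cont_E0 cont).
have even b k := @coefficient_even R m F ls os vs Ps Ets U C N X F_smooth U_open U_ls cont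
  transversality normal_form approx os0 os2 os3 os4 hyp b k.
have odd_ b k := @coefficient_odd R m F ls os vs Ps Ets U C N X F_smooth U_open U_ls cont
  transversality normal_form approx os0 os2 os3 os4 hyp b k.
have [K K0 hK] := order_four F_smooth U_open U_ls cont transversality normal_form approx os0 os2
  os3 os4 hyp.
have quotient := drift_quotient F_smooth U_open U_ls cont transversality normal_form approx os0 os2
  os3 os4 hyp.
split.
  have h := quotient (alphaR C) (fun=> 0) (drift_R ls C N X) (betaR N ls) (cont_smooth_aR cont 2).
  rewrite (_ : (fun e => _) = fun e => betaR N ls - (0 - derive1 (alphaR C) ls * ((lambdaF X e
    - ls) / e ^+ 2))); last first.
    by apply/funext => e; rewrite sub0r mulNr.
  apply: h; first by move=> e _; rewrite /drift_R aR mul0r !subr0.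
  by exists K => //; apply: filterS hK => e [].
split.
  apply: (quotient (alphaI C) dw (drift_I ls C N X) (betaI N ls) (cont_smooth_aI cont 2));
    last first.
    by exists K => //; apply: filterS hK => e [].
  by move=> e e0; rewrite /drift_I /dw aI; field.
have hU (c1 : R -> 'cV[R]_2) (c2 : R -> 'cV[R]_m) : (fun t => usubmx (col_mx (c1 t) (c2 t))) = c1.
  by apply/funext => t; rewrite col_mxKu.
have hD (c1 : R -> 'cV[R]_2) (c2 : R -> 'cV[R]_m) : (fun t => dsubmx (col_mx (c1 t) (c2 t))) = c2.
  by apply/funext => t; rewrite col_mxKd.
split; [|split].
- by move=> k; rewrite !inE => /orP[] /eqP ->;
  [have := even false 0%N isT isT|have := even false 2%N isT isT]; rewrite /nfcoef hU hD.
- by move=> k ->; have := even true 2%N isT isT; rewrite /nfcoef hU hD.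
- move=> k; rewrite !inE => /orP[] /eqP ->.
    by have := odd_ false 1%N isT isT; have := odd_ true 1%N isT isT; rewrite /nfcoef !hU.
  by have := odd_ false 3%N isT isT; have := odd_ true 3%N isT isT; rewrite /nfcoef !hU.
Qed.
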